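(* Let $d\ge 1$, $a\in(0,2]$, $b\in(0,2]$, $r\ge 0$, $\theta>0$, $\nu>0$, and suppose that the fundamental solution $G$ satisfies one of the following (Assumption G): either $G$ is nonnegative and $b\in(0,2)$; or $a=b=2$ and $r=0$. If the stochastic fractional diffusion equation (SFDE, see context) admits, on some finite time interval, a square-integrable mild Stratonovich solution with the expansion $$u(t,x)=\sum_{n=0}^\infty\theta^{n/2}S_n\bigl(g_n(\cdot,t,x)\bigr),$$ then necessarily Dalang's condition holds: $$\int_{\mathbb{R}^d}\frac{1}{1+|\xi|^a}\,\mu(\mathrm{d}\xi)<\infty .$$
   Context: **Noise.** $\dot W$ is a centered Gaussian noise on $\mathbb{R}^d$ (time-independent) with $\mathbb{E}[\dot W(x)\dot W(y)]=\gamma(x-y)$, where $\gamma$ is a nonnegative and nonnegative-definite function with $\gamma(x)=\int_{\mathbb{R}^d}e^{\iota\xi\cdot x}\mu(\mathrm{d}\xi)$ for its spectral measure $\mu$ (in the sense of distributions if $\mu$ is infinite; $\iota$ is the imaginary unit). $\mathcal{H}$ is the completion of the smooth compactly supported functions under $\langle f,g\rangle_{\mathcal H}=\int\int f(x)\gamma(x-y)g(y)\,\mathrm{d}x\mathrm{d}y$, and $\{W(f):f\in\mathcal{H}\}$ is the isonormal Gaussian process with $\mathbb{E}[W(f)W(g)]=\langle f,g\rangle_{\mathcal H}$, formally $W(f)=\int f(y)\dot W(y)\,\mathrm{d}y$. **Equation (SFDE).** For $t>0$, $x\in\mathbb{R}^d$, $$\Bigl(\partial^b+\tfrac{\nu}{2}(-\Delta)^{a/2}\Bigr)u(t,x)=I^r\bigl[\sqrt\theta\,u(t,x)\dot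 W(x)\bigr],$$ with $u(0,\cdot)=1$ if $b\in(0,1]$, and $u(0,\cdot)=1$, $\partial_tu(0,\cdot)=0$ if $b\in(1,2]$. Here $\partial^b$ is the Caputo derivative of order $b$ in time, $(-\Delta)^{a/2}$ is the fractional Laplacian, $I^rf(t)=\frac1{\Gamma(r)}\int_0^tf(s)(t-s)^{r-1}\mathrm{d}s$ for $r>0$, and $I^0$ is the identity. **Fundamental solution.** $G(t,\cdot)$, $t>0$, is characterized by $$\int_{\mathbb{R}^d}e^{-\iota x\cdot\xi}G(t,x)\,\mathrm{d}x=t^{b+r-1}E_{b,b+r}\bigl(-\tfrac12\nu t^b|\xi|^a\bigr),\qquad E_{\varrho_1,\varrho_2}(z)=\sum_{k\ge0}\frac{z^k}{\Gamma(\varrho_1k+\varrho_2)}.$$ Integrals against $G$ are understood in the sense of measures/distributions when $G(t,\cdot)$ is not a function. **Stratonovich integrals.** Let $p_\varepsilon(x)=(2\pi\varepsilon)^{-d/2}e^{-|x|^2/(2\varepsilon)}$ and $\dot W_\varepsilon(x)=\int\dot W(y)p_\varepsilon(x-y)\,\mathrm{d}y=W(p_\varepsilon(x-\cdot))$. For a random field $\Psi$ with $\mathbb{E}|\int\Psi(x)\dot W_\varepsilon(x)\mathrm{d}x|^2<\infty$ for all $\varepsilon>0$, $\int\Psi(x)W(\mathrm{d}x):=\lim_{\varepsilon\to0^+}\int\Psi(x)\dot W_\varepsilon(x)\mathrm{d}x$ whenever the limit exists in $\mathcal{L}^2(\Omega)$. For $f:(\mathbb{R}^d)^n\to\mathbb{R}$,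 the $n$-multiple Stratonovich integral is $S_n(f)=\lim_{\varepsilon_1,\dots,\varepsilon_n\to0}\int f(x_1,\dots,x_n)\prod_{k=1}^n\dot W_{\varepsilon_k}(x_k)\,\mathrm{d}x_1\cdots\mathrm{d}x_n$, whenever the limit exists in $\mathcal{L}^2(\Omega)$. **Kernels.** $S_0(g_0)=1$ and, for $n\ge1$, $g_n(x_1,\dots,x_n,t,x)=\int_{0<s_1<\cdots<s_n<t}\prod_{k=1}^nG(s_k-s_{k-1},x_k-x_{k-1})\,\mathrm{d}\mathbf s$ with $x_0=x$, $s_0=0$. **Mild Stratonovich solution.** A random field $u(t,x)$ such that $\int_0^tG(t-s,x-y)u(s,y)\mathrm{d}s$ is well-defined and Stratonovich integrable (in $y$) and $u(t,x)=1+\sqrt\theta\int_{\mathbb{R}^d}\bigl[\int_0^tG(t-s,x-y)u(s,y)\,\mathrm{d}s\bigr]W(\mathrm{d}y)$. It is square-integrable if $\mathbb{E}|u(t,x)|^2<\infty$. *)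

(* Defs.v *)
From HB Require Import structures.
From mathcomp Require Import all_boot all_order all_algebra.
From mathcomp Require Import all_classical all_reals all_analysis.

Set Implicit Arguments.
Unset Strict Implicit.
Unset Printing Implicit Defensive.

Import Order.TTheory GRing.Theory Num.Theory.
Import numFieldNormedType.Exports.

Local Open Scope classical_set_scope.
Local Open Scope ring_scope.

Section pushforward_sigma_finite.
Context d1 d2 (T1 : measurableType d1) (T2 : measurableType d2) (R : realType).
Variables (m : {sigma_finite_measure set T1 -> \bar R}) (f : T1 -> T2)
  (g : T2 -> T1).
Hypotheses (mf : measurable_fun setT f) (mg : measurable_fun setT g).
Hypothesis fK : cancel f g.

Definition push : set T2 -> \bar R := pushforward m f.

Let push0 : push set0 = 0%E.
Proof. by rewrite /push /pushforward preimage_set0 measure0. Qed.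

Let push_ge0 A : (0 <= push A)%E.
Proof. exact: measure_ge0. Qed.

Let push_sigma_additive : semi_sigma_additive push.
Proof.
move=> F mF tF mUF; rewrite /push /pushforward preimage_bigcup.
apply: measure_semi_sigma_additive.
- by move=> n; rewrite -[X in measurable X]setTI; exact: mf.
- apply/trivIsetP => /= i j _ _ ij; rewrite -preimage_setI.
  by move/trivIsetP : tF => /(_ _ _ _ _ ij) ->//; rewrite preimage_set0.
- by rewrite -preimage_bigcup -[X in measurable X]setTI; exact: mf.
Qed.

HB.instance Definition _ :=
  isMeasure.Build _ _ _ push push0 push_ge0 push_sigma_additive.

Let push_sigma_finite : sigma_finite setT push.
Proof.
have [F FT Foo] := sigma_finiteT m.
exists (fun i => g @^-1` F i) => [|i].
  by rewrite -preimage_bigcup -FT preimage_setT.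
have [mF Fi] := Foo i; split.
  by rewrite -[X in measurable X]setTI; exact: mg.
rewrite /push /pushforward -comp_preimage.
by rewrite (_ : g \o f = id) //; apply/funext => x /=; rewrite fK.
Qed.

HB.instance Definition _ :=
  Measure_isSigmaFinite.Build _ _ _ push push_sigma_finite.

Definition push_measure : {sigma_finite_measure set T2 -> \bar R} := push.

End pushforward_sigma_finite.

Section product_sigma_finite.
Context d1 d2 (T1 : measurableType d1) (T2 : measurableType d2) (R : realType).
Variables (m1 : {sigma_finite_measure set T1 -> \bar R})
  (m2 : {sigma_finite_measure set T2 -> \bar R}).

Definition prod_fun : set (T1 * T2) -> \bar R := (m1 \x m2)%E.

HB.instance Definition _ := Measure.copy prod_fun (m1 \x m2)%E.

Let prod_sigma_finite : sigma_finite setT prod_fun.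
Proof.
have /sigma_finiteP[F [TF ndF Foo]] := sigma_finiteT m1.
have /sigma_finiteP[G [TG ndG Goo]] := sigma_finiteT m2.
exists (fun n => F n `*` G n).
  rewrite -setXTT TF TG predeqE => -[x y]; split.
    move=> [/= [n _ Fnx] [k _ Gky]]; exists (maxn n k) => //; split.
    - by move: x Fnx; exact/subsetPset/ndF/leq_maxl.
    - by move: y Gky; exact/subsetPset/ndG/leq_maxr.
  by move=> [n _ []/= ? ?]; split; exists n.
move=> k; have [? ?] := Foo k; have [? ?] := Goo k.
split; first exact: measurableX.
by rewrite /prod_fun product_measure1E// lte_mul_pinfty// ge0_fin_numE.
Qed.

HB.instance Definition _ :=
  Measure_isSigmaFinite.Build _ _ _ prod_fun prod_sigma_finite.

Definition prod_measure :
  {sigma_finite_measure set (T1 * T2)%type -> \bar R} := prod_fun.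

End product_sigma_finite.

Section tuple_measure.
Context d (T : measurableType d) (R : realType).
Variable m : {sigma_finite_measure set T -> \bar R}.

Let consp n (p : T * n.-tuple T) : n.+1.-tuple T := [tuple of p.1 :: p.2].
Let unconsp n (t : n.+1.-tuple T) : T * n.-tuple T :=
  (thead t, [tuple of behead t]).

Let measurable_consp n : measurable_fun setT (@consp n).
Proof. exact: measurable_cons. Qed.

Let measurable_unconsp n : measurable_fun setT (@unconsp n).
Proof.
apply: measurable_fun_pair; last exact: measurable_behead.
exact: measurable_tnth.
Qed.

Let conspK n : cancel (@consp n) (@unconsp n).
Proof. by move=> [x t]; congr pair; apply/val_inj. Qed.

(* The n-fold product measure m ^ n; a Dirac mass for n = 0.                  *)
Fixpoint tuple_measure (n : nat) :
    {sigma_finite_measure set (n.-tuple T) -> \bar R} :=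
  match n with
  | 0 => dirac ([tuple] : 0.-tuple T)
  | n'.+1 => push_measure (prod_measure m (tuple_measure n'))
      (@measurable_consp n') (@measurable_unconsp n') (@conspK n')
  end.

End tuple_measure.

(* The Borel sigma-algebra of row vectors, generated by the coordinates.      *)
Definition row_display : measure_display -> measure_display.
Proof. exact. Qed.

Section measurable_row.
Context {d} {T : sigmaRingType d} (n : nat).

Let coors : 'I_n -> 'rV[T]_n -> T := fun i x => x ord0 i.

Let row_set0 : g_sigma_preimage coors set0.
Proof. exact: sigma_algebra0. Qed.

Let row_setC A : g_sigma_preimage coors A -> g_sigma_preimage coors (~` A).
Proof. exact: sigma_algebraC. Qed.

Let row_bigcup (F : _^nat) : (forall i, g_sigma_preimage coors (F i)) ->
  g_sigma_preimage coors (\bigcup_i (F i)).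
Proof. exact: sigma_algebra_bigcup. Qed.

HB.instance Definition _ := @isMeasurable.Build (row_display d)
  'rV[T]_n (g_sigma_preimage coors) row_set0 row_setC row_bigcup.

End measurable_row.

Section lebesgue_row.
Context (R : realType) (n : nat).

Let row_of (t : n.-tuple R) : 'rV[R]_n := \row_i tnth t i.
Let of_row (x : 'rV[R]_n) : n.-tuple R := [tuple x ord0 i | i < n].

Let measurable_row_of : measurable_fun setT row_of.
Proof.
have H (A : set 'rV[R]_n) :
    g_sigma_preimage (fun i (x : 'rV[R]_n) => x ord0 i) A ->
    measurable (row_of @^-1` A).
  move=> mA.
  have : preimage_set_system [set: n.-tuple R] row_of
      (g_sigma_preimage (fun i (x : 'rV[R]_n) => x ord0 i)) (row_of @^-1` A).
    by exists A => //; rewrite setTI.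
  rewrite -g_sigma_preimage_comp.
  rewrite (_ : (fun i => _) = (fun i t => tnth t i)) //.
  by apply/funext => i; apply/funext => t; rewrite /= /row_of mxE.
by move=> _ A mA; rewrite setTI; exact: H.
Qed.

Let measurable_of_row : measurable_fun setT of_row.
Proof.
apply/measurable_fun_tnthP => i.
rewrite (_ : _ \o _ = fun x : 'rV[R]_n => x ord0 i); last first.
  by apply/funext => x /=; rewrite tnth_mktuple.
move=> _ Y mY; rewrite setTI; apply: sub_sigma_algebra => /=.
rewrite -bigcup_seq/=; exists i => /=; first by rewrite mem_index_enum.
by exists Y => //; rewrite setTI.
Qed.

Let row_ofK : cancel row_of of_row.
Proof. by move=> t; apply: eq_from_tnth => i; rewrite tnth_mktuple mxE. Qed.

Definition leb : {sigma_finite_measure set 'rV[R]_n -> \bar R} :=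
  push_measure (tuple_measure lebesgue_measure n)
    measurable_row_of measurable_of_row row_ofK.

End lebesgue_row.
Arguments leb {R n}.

Section euclidean.
Context {R : realType} {d : nat}.
Implicit Types (x y xi : 'rV[R]_d).

Definition dot x y : R := \sum_(i < d) x ord0 i * y ord0 i.

(* The Euclidean norm; the norm of the normed module ['rV_d] is the sup norm. *)
Definition enorm x : R := Num.sqrt (dot x x).

(* The heat kernel, with variance eps in each coordinate.                     *)
Definition heat (eps : R) x : R :=
  (2 * pi * eps) `^ (- (d%:R / 2)) * expR (- (dot x x / (2 * eps))).

End euclidean.

Section test_functions.
Context {R : realType} {d : nat}.
Implicit Types f phi : 'rV[R]_d -> R.

Definition partials (l : seq 'I_d) f : 'rV[R]_d -> R :=
  foldr (fun i g => fun x => 'D_(delta_mx ord0 i : 'rV[R]_d) g x) f l.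

Definition smooth f := forall (l : seq 'I_d) x, differentiable (partials l f) x.

Definition test_fun f :=
  smooth f /\ exists M : R, forall x, M < enorm x -> f x = 0.

Definition schwartz phi :=
  smooth phi /\ forall (k : nat) (l : seq 'I_d), exists C : R,
    forall x, (1 + enorm x) ^+ k * `|partials l phi x| <= C.

(* S'(R^d): linear forms on S(R^d) dominated by one of its seminorms. Only    *)
(* the values of T on Schwartz functions are meaningful.                      *)
Definition tempered_distribution (T : ('rV[R]_d -> R) -> R) :=
  [/\ forall (c : R) f g, schwartz f -> schwartz g ->
        T (fun x => c * f x + g x) = c * T f + T g
    & exists (C : R) (k : nat), forall phi (M : R), schwartz phi ->
        (forall (l : seq 'I_d) x, (size l <= k)%N ->
          (1 + enorm x) ^+ k * `|partials l phi x| <= M) ->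
        `|T phi| <= C * M].

(* Real and (up to sign) imaginary parts of the Fourier transform             *)
(* x |-> \int e^{- i x . xi} phi(xi) dxi of a real function.                  *)
Definition ft_cos phi (x : 'rV[R]_d) : R :=
  \int[leb]_xi (cos (dot x xi) * phi xi).
Definition ft_sin phi (x : 'rV[R]_d) : R :=
  \int[leb]_xi (sin (dot x xi) * phi xi).

(* The Fourier transform of the real tempered distribution T is the real      *)
(* function m: T(phi^) = \int m phi, with phi^ = ft_cos phi - i ft_sin phi.   *)
Definition has_fourier_transform (T : ('rV[R]_d -> R) -> R)
    (m : 'rV[R]_d -> R) :=
  forall phi, schwartz phi ->
    T (ft_cos phi) = \int[leb]_xi (m xi * phi xi) /\ T (ft_sin phi) = 0.

End test_functions.

Section covariance.
Context {R : realType} {d : nat}.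
Variables (gamma : 'rV[R]_d -> R) (mu : {measure set 'rV[R]_d -> \bar R}).
Implicit Types f g : 'rV[R]_d -> R.

Definition tempered_measure :=
  exists k : nat,
    (\int[mu]_xi (((1 + enorm xi) ^+ k)^-1)%:E < +oo)%E.

(* gamma(x) = \int e^{i xi . x} mu(dxi), pointwise if mu is finite and always *)
(* in the sense of tempered distributions.                                    *)
Definition spectral_measure :=
  [/\ tempered_measure,
      (mu setT < +oo)%E -> forall x,
        gamma x = \int[mu]_xi cos (dot xi x) /\
        \int[mu]_xi sin (dot xi x) = 0
    & forall phi, schwartz phi ->
        [/\ leb.-integrable setT (EFin \o (fun x => gamma x * phi x)),
            \int[leb]_x (gamma x * phi x) = \int[mu]_xi ft_cos phi xi
          & \int[mu]_xi ft_sin phi xi = 0]].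

Definition cov f g : R :=
  \int[leb]_x \int[leb]_y (f x * gamma (x - y) * g y).

Definition noise_covariance :=
  [/\ measurable_fun setT gamma,
      forall x, 0 <= gamma x,
      forall f, test_fun f -> 0 <= cov f f
    & spectral_measure].

(* (H, iota) is the completion of C_c^oo(R^d) for the inner product cov.      *)
Definition is_completion (H : completeNormedModType R)
    (iota : ('rV[R]_d -> R) -> H) :=
  [/\ forall (c : R) f g, test_fun f -> test_fun g ->
        iota (fun x => c * f x + g x) = c *: iota f + iota g,
      forall f, test_fun f -> `|iota f| ^+ 2 = cov f f
    & forall (h : H) (e : R), 0 < e ->
        exists2 f, test_fun f & `|h - iota f| < e].

(* The element h of H is (the class of) the function f.                       *)
Definition represents (H : completeNormedModType R)
    (iota : ('rV[R]_d -> R) -> H) (f : 'rV[R]_d -> R) (h : H) :=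
  measurable_fun setT f /\
  exists phi : nat -> 'rV[R]_d -> R,
    [/\ forall n, test_fun (phi n),
        (\int[leb]_x \int[leb]_y
           (`|phi n x - f x| * gamma (x - y) * `|phi n y - f y|)%:E)%E
          @[n --> \oo] --> 0%E
      & iota (phi n) @[n --> \oo] --> h].

End covariance.

(* The inner product of a Hilbert space, by polarization.                     *)
Definition hdot (R : realType) (H : normedModType R) (h k : H) : R :=
  (`|h + k| ^+ 2 - `|h - k| ^+ 2) / 4.

Section noise.
Context {R : realType} {d : nat} {dO : measure_display}
  {Omega : measurableType dO}.
Variable P : probability Omega R.

(* A possibly degenerate centered Gaussian variable; the degenerate case is   *)
(* apart because [normal_prob 0 0] is not a Dirac mass.                       *)
Definition centered_gaussian (X : Omega -> R) :=
  measurable_fun setT X /\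
  ({ae P, forall w, X w = 0} \/
   exists2 s : R, s != 0 & forall A : set R, measurable A ->
     P (X @^-1` A) = normal_prob 0 s A).

Definition isonormal (H : completeNormedModType R) (W : H -> Omega -> R) :=
  (forall (n : nat) (c : 'I_n -> R) (h : 'I_n -> H),
     centered_gaussian (fun w => \sum_(i < n) c i * W (h i) w)) /\
  (forall h k : H, ('E_P[fun w => (W h w * W k w)%R] = (hdot h k)%:E)%E).

(* A jointly measurable version of the mollified noise                        *)
(* dW eps x = W (p_eps (x - .)), p_eps being the heat kernel.                 *)
Definition mollified_noise (gamma : 'rV[R]_d -> R)
    (H : completeNormedModType R) (iota : ('rV[R]_d -> R) -> H)
    (W : H -> Omega -> R) (dW : R -> 'rV[R]_d -> Omega -> R) :=
  forall eps : R, 0 < eps ->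
    measurable_fun setT (fun z : 'rV[R]_d * Omega => dW eps z.1 z.2) /\
    forall x, exists2 h : H, represents gamma iota (fun y => heat eps (x - y)) h
      & {ae P, forall w, dW eps x w = W h w}.

End noise.

Section fundamental_solution.
Context {R : realType} {d : nat}.
Variables a b r nu : R.

(* Euler's Gamma function, meaningful for x > 0 only.                         *)
Definition Gamma (x : R) : R :=
  \int[lebesgue_measure]_(t in `]0, +oo[) (t `^ (x - 1) * expR (- t)).

Definition mittag_leffler (rho1 rho2 z : R) : R :=
  limn (series (fun k : nat => z ^+ k / Gamma (rho1 * k%:R + rho2))).

Definition symbol (t : R) (xi : 'rV[R]_d) : R :=
  t `^ (b + r - 1) *
  mittag_leffler b (b + r) (- (nu / 2 * t `^ b * enorm xi `^ a)).

Variable G : R -> ('rV[R]_d -> R) -> R.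

Definition fundamental_solution :=
  forall t : R, 0 < t ->
    tempered_distribution (G t) /\ has_fourier_transform (G t) (symbol t).

Definition nonnegative_solution :=
  forall (t : R) (phi : 'rV[R]_d -> R), 0 < t -> schwartz phi ->
    (forall x, 0 <= phi x) -> 0 <= G t phi.

Definition assumption_G :=
  (nonnegative_solution /\ b < 2) \/ [/\ a = 2, b = 2 & r = 0].

(* The smooth function G(t, .) * p_del, which tends to G(t, .) as del -> 0+.  *)
Definition Gmol (del t : R) (x : 'rV[R]_d) : R :=
  G t (fun y => heat del (x - y)).

(* 0 < s_1 < ... < s_n < t *)
Definition simplex (n : nat) (t : R) : set (n.-tuple R) :=
  [set s : n.-tuple R | path <%R 0 (rcons s t)].

(* The kernel g_n(x_1, ..., x_n, t, x), with G replaced by [Gmol del].        *)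
Definition kernel_mol (n : nat) (t : R) (x : 'rV[R]_d) (del : R)
    (xs : n.-tuple 'rV[R]_d) : R :=
  \int[tuple_measure lebesgue_measure n]_(s in @simplex n t)
    \prod_(k < n)
      Gmol del (nth 0 (0 :: s) k.+1 - nth 0 (0 :: s) k)
        (nth x (x :: xs) k.+1 - nth x (x :: xs) k).

End fundamental_solution.

(* Since G(t, .) may be a measure or a distribution, so may the integrands f  *)
(* of Stratonovich integrals. Such an f is represented by functions [f del],  *)
(* del > 0, in which G is replaced by G * p_del, and the integral of f        *)
(* against the mollified noise is the limit in L^2(Omega), as del -> 0+, of   *)
(* those of [f del]. A function f is the case where [f del] is constant.      *)
Section stratonovich.
Context {R : realType} {d : nat} {dO : measure_display}
  {Omega : measurableType dO}.
Variables (P : probability Omega R) (dW : R -> 'rV[R]_d -> Omega -> R).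

Definition in_L2 (X : Omega -> R) :=
  measurable_fun setT X /\ (\int[P]_w (X w ^+ 2)%:E < +oo)%E.

Definition cvg_L2 (I : Type) (F : set_system I) (X : I -> Omega -> R)
    (Y : Omega -> R) :=
  [/\ in_L2 Y, \forall i \near F, in_L2 (X i)
    & (\int[P]_w ((X i w - Y w) ^+ 2)%:E)%E @[i --> F] --> 0%E].

(* Z = \int Psi(y) W(dy), for a random field Psi                              *)
Definition stratonovich_integral (Psi : R -> 'rV[R]_d -> Omega -> R)
    (Z : Omega -> R) :=
  exists I : R -> Omega -> R,
    (forall eps : R, 0 < eps ->
      (forall del : R, 0 < del -> {ae P, forall w,
         leb.-integrable setT (fun y => (Psi del y w * dW eps y w)%:E)}) /\
      cvg_L2 0^'+
        (fun del w => \int[leb]_y (Psi del y w * dW eps y w)) (I eps)) /\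
    cvg_L2 0^'+ I Z.

(* Z = S_n(f), for a deterministic f; here (eps_1, ..., eps_n) tends to 0 in  *)
(* the open positive orthant.                                                 *)
Definition multiple_stratonovich_integral (n : nat)
    (f : R -> n.-tuple 'rV[R]_d -> R) (Z : Omega -> R) :=
  exists I : 'rV[R]_n -> Omega -> R,
    (forall eps : 'rV[R]_n, (forall k, 0 < eps ord0 k) ->
      (forall del : R, 0 < del -> {ae P, forall w,
         (tuple_measure leb n).-integrable setT (fun xs =>
           (f del xs * \prod_(k < n) dW (eps ord0 k) (tnth xs k) w)%:E)}) /\
      cvg_L2 0^'+
        (fun del w => \int[tuple_measure leb n]_xs
           (f del xs * \prod_(k < n) dW (eps ord0 k) (tnth xs k) w))
        (I eps)) /\
    cvg_L2 (within [set eps : 'rV[R]_n | forall k, 0 < eps ord0 k]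
              (nbhs (0 : 'rV[R]_n))) I Z.

Variables (G : R -> ('rV[R]_d -> R) -> R) (theta : R).

(* The field y |-> \int_0^t G(t - s, x - y) u(s, y) ds                        *)
Definition duhamel (u : R -> 'rV[R]_d -> Omega -> R) (t : R) (x : 'rV[R]_d)
    (del : R) (y : 'rV[R]_d) (w : Omega) : R :=
  \int[lebesgue_measure]_(s in `]0, t[) (Gmol G del (t - s) (x - y) * u s y w).

Definition duhamel_well_defined (u : R -> 'rV[R]_d -> Omega -> R) (t : R)
    (x : 'rV[R]_d) :=
  forall del : R, 0 < del -> {ae P, forall w, {ae leb, forall y : 'rV[R]_d,
    (@lebesgue_measure R).-integrable `]0, t[
      (fun s => (Gmol G del (t - s) (x - y) * u s y w)%:E)}}.

Definition mild_stratonovich_solution (T : R)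
    (u : R -> 'rV[R]_d -> Omega -> R) :=
  forall (t : R) (x : 'rV[R]_d), 0 < t <= T ->
    duhamel_well_defined u t x /\
    exists2 Z : Omega -> R, stratonovich_integral (duhamel u t x) Z
      & {ae P, forall w, u t x w = 1 + Num.sqrt theta * Z w}.

Definition square_integrable_field (T : R)
    (u : R -> 'rV[R]_d -> Omega -> R) :=
  forall (t : R) (x : 'rV[R]_d), 0 < t <= T -> in_L2 (u t x).

Definition has_stratonovich_expansion (T : R)
    (u : R -> 'rV[R]_d -> Omega -> R) :=
  forall (t : R) (x : 'rV[R]_d), 0 < t <= T ->
    exists S : nat -> Omega -> R,
      [/\ forall w, S 0%N w = 1,
          forall n : nat, (0 < n)%N ->
            multiple_stratonovich_integral (@kernel_mol R d G n t x) (S n)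
        & cvg_L2 \oo
            (fun N w => \sum_(0 <= n < N) theta `^ (n%:R / 2) * S n w)
            (u t x)].

End stratonovich.

Definition dalang_condition (R : realType) (d : nat) (a : R)
    (mu : {measure set 'rV[R]_d -> \bar R}) :=
  (\int[mu]_xi ((1 + enorm xi `^ a)^-1)%:E < +oo)%E.

(* Main.v *)
(* The second term of the expansion is enough. Writing m(t, xi) for the Fourier transform
   of G(t, .), the mean of S_2(g_2(., T, 0)) is the limit, as eps -> 0, of
     \int e^{-eps |eta|^2} F(eta) mu(d eta),
     F(eta) = \int_{0 < s_1 < s_2 < T} m(s_1, 0) m(s_2 - s_1, eta) ds_1 ds_2
            = T^{2 (b + r)} E_{b, 2 (b + r) + 1}(- nu/2 T^b |eta|^a).
   F is bounded, and F(eta) >= c |eta|^{-a} for large |eta|, so that Fatou's lemma gives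
   Dalang's condition.

   The bound |m(t, xi)| <= 2 m(t, 0) comes from the positivity of t^{b-1} E_{b,b}(-z t^b)
   if b <= 1 and from an energy identity if 1 < b <= 2; it controls the increments of the
   fractional integrals of m in time, hence the asymptotics of F.

   The mean of the mollified double integral may be computed under the integral sign as
   soon as its kernel f is integrable. This follows from the almost sure integrability of
   f(x_1, x_2) dW(x_1) dW(x_2), because |dW(x_1) dW(x_2)| is bounded below with probability
   at least 3/4, uniformly in x_1 and x_2. Gaussian cut-offs in space then make Fubini's
   theorem available on the Fourier side. *)

Require Import Defs.
From HB Require Import structures.
From mathcomp Require Import all_boot all_order all_algebra.
From mathcomp Require Import all_classical all_reals all_analysis.
From mathcomp Require Import measurable_realfun.
From mathcomp Require Import ring lra.

Set Implicit Arguments.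
Unset Strict Implicit.
Unset Printing Implicit Defensive.

Import Order.TTheory GRing.Theory Num.Theory.
Import numFieldNormedType.Exports.

Local Open Scope classical_set_scope.
Local Open Scope ring_scope.

(** * Integration *)

(** Convergence in L^2 entails convergence of means, and the mean of a product of two mollified
    noises is a function of x_1 - x_2 alone; the first increment is therefore integrated against a
    constant, which explains the frequency 0 in F. The obstacle is space: Fourier inversion yields a
    mollified G that is bounded, but without any decay, so that the integrability of the kernel has
    to be extracted from the noise itself. The noise must then be nondegenerate; the case of a
    vanishing variance, which forces mu = 0, is set apart. Time is handled by two identities for
    [EE b z beta], the function t^(beta - 1) E_{b,beta}(- z t^b): convolution with the fractional
    kernel [kk p] raises beta by p, and [EE b z beta] equals [kk beta] minus z times
    [EE b z (beta + b)]. All bounds uniform in z follow from these and from positivity, without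
    asymptotic expansions. F may be negative at low frequencies, so Fatou's lemma is applied at high
    frequencies only; the low ones are integrable because mu is tempered. *)

Section integrals.
Context d (T : measurableType d) (R : realType).
Implicit Types (m : {measure set T -> \bar R}) (f g : T -> R).

Definition L1 m f := m.-integrable setT (EFin \o f).

Lemma L1_measurable m f : L1 m f -> measurable_fun setT f.
Proof. by move=> /integrableP[/measurable_EFinP]. Qed.

Lemma L1P m f : measurable_fun setT f ->
  L1 m f <-> (\int[m]_x (`|f x|)%:E < +oo)%E.
Proof.
move=> mf; split=> [/integrableP[_]//|h].
by apply/integrableP; split => //; exact/measurable_EFinP.
Qed.

Lemma L1_le m f g : measurable_fun setT f -> (forall x, `|f x| <= g x) ->
  L1 m g -> L1 m f.
Proof.
move=> mf fg; apply: le_integrable => //; first exact/measurable_EFinP.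
by move=> x _ /=; rewrite lee_fin (le_trans (fg x))// ler_norm.
Qed.

Lemma L1_norm m f : L1 m f -> L1 m (fun x => `|f x|).
Proof. by move=> /integrable_norm. Qed.

Lemma L1D m f g : L1 m f -> L1 m g -> L1 m (fun x => f x + g x).
Proof.
move=> hf hg; rewrite /L1.
by have := integrableD measurableT hf hg; apply: eq_integrable.
Qed.

Lemma L1B m f g : L1 m f -> L1 m g -> L1 m (fun x => f x - g x).
Proof.
move=> hf hg; rewrite /L1.
by have := integrableB measurableT hf hg; apply: eq_integrable.
Qed.

Lemma L1Z m f (c : R) : L1 m f -> L1 m (fun x => c * f x).
Proof.
move=> hf; rewrite /L1.
by have := integrableZl measurableT c hf; apply: eq_integrable.
Qed.

Lemma L1Zr m f (c : R) : L1 m f -> L1 m (fun x => f x * c).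
Proof. by move=> /(L1Z c); apply: eq_integrable => // x _ /=; rewrite mulrC. Qed.

Lemma eq_RI m f g : f =1 g -> \int[m]_x f x = \int[m]_x g x.
Proof. by move=> fg; apply: eq_Rintegral => x _. Qed.

Lemma RID m f g : L1 m f -> L1 m g ->
  \int[m]_x (f x + g x) = \int[m]_x f x + \int[m]_x g x.
Proof. exact: RintegralD. Qed.

Lemma RIB m f g : L1 m f -> L1 m g ->
  \int[m]_x (f x - g x) = \int[m]_x f x - \int[m]_x g x.
Proof. exact: RintegralB. Qed.

Lemma RIZ m f (c : R) : L1 m f ->
  \int[m]_x (c * f x) = c * \int[m]_x f x.
Proof. exact: RintegralZl. Qed.

Lemma RIZr m f (c : R) : L1 m f ->
  \int[m]_x (f x * c) = \int[m]_x f x * c.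
Proof. exact: RintegralZr. Qed.

Lemma le_RI m f g : L1 m f -> L1 m g -> (forall x, f x <= g x) ->
  \int[m]_x f x <= \int[m]_x g x.
Proof. by move=> hf hg fg; apply: le_Rintegral. Qed.

Lemma RI_ge0 m f : (forall x, 0 <= f x) -> 0 <= \int[m]_x f x.
Proof. by move=> h; apply: Rintegral_ge0. Qed.

Lemma norm_RI m f : L1 m f -> `|\int[m]_x f x| <= \int[m]_x `|f x|.
Proof. exact: le_normr_Rintegral. Qed.

Lemma RI_EFin m f : L1 m f -> (\int[m]_x f x)%:E = (\int[m]_x (f x)%:E)%E.
Proof. by move=> h; rewrite /Rintegral fineK//; exact: integrable_fin_num. Qed.

Lemma norm_RI_le m f g : measurable_fun setT f -> (forall x, `|f x| <= g x) ->
  L1 m g -> `|\int[m]_x f x| <= \int[m]_x g x.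
Proof.
move=> mf fg hg; have hf := L1_le mf fg hg.
by rewrite (le_trans (norm_RI hf))// le_RI//; exact: L1_norm.
Qed.

(** Convergence and domination are asked everywhere, as all the majorants below are explicit; the
    limit inherits measurability from the sequence. *)
Lemma RI_dct m (f_ : nat -> T -> R) f g :
  (forall n, measurable_fun setT (f_ n)) ->
  (forall x, f_ ^~ x @ \oo --> f x) ->
  (forall n x, `|f_ n x| <= g x) -> L1 m g ->
  L1 m f /\ \int[m]_x f_ n x @[n --> \oo] --> \int[m]_x f x.
Proof.
move=> mf_ cf fg hg.
have mf : measurable_fun setT f.
  by apply: (measurable_fun_cvg (h := f_)) => // x _; exact: cf.
have [||||h1 _ h2] := @dominated_convergence _ _ _ m _ measurableT
    (fun n x => (f_ n x)%:E) (EFin \o f) (EFin \o g) _ _ _ hg.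
- by move=> n; exact/measurable_EFinP.
- exact/measurable_EFinP.
- by apply: aeW => x _ /=; apply: cvg_EFin; [exact: nearW|exact: cf].
- by apply: aeW => x n _ /=; rewrite lee_fin.
split=> //.
by apply: fine_cvg; rewrite RI_EFin.
Qed.

End integrals.

(** * Measure-preserving maps and change of variables *)

Section preserve.
Context {R : realType}.

Definition mpres d1 d2 (T1 : measurableType d1) (T2 : measurableType d2)
  (m1 : {measure set T1 -> \bar R}) (m2 : {measure set T2 -> \bar R})
  (phi : T1 -> T2) :=
  measurable_fun setT phi /\
  forall A, measurable A -> m1 (phi @^-1` A) = m2 A.

Section one.
Context d1 d2 (T1 : measurableType d1) (T2 : measurableType d2).
Variables (m1 : {measure set T1 -> \bar R}) (m2 : {measure set T2 -> \bar R}).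
Variables (phi : T1 -> T2) (h : mpres m1 m2 phi).

Lemma mpres_ge0_integral (f : T2 -> \bar R) : measurable_fun setT f ->
  (forall y, 0 <= f y)%E -> (\int[m2]_y f y = \int[m1]_x f (phi x))%E.
Proof.
move=> mf f0; have [mphi e] := h.
have := @ge0_integral_pushforward _ _ _ _ R phi mphi m1 setT f measurableT mf.
rewrite preimage_setT => <-; last by move=> y _.
by apply: eq_measure_integral => A mA _; rewrite /= /pushforward e.
Qed.

(** Positive and negative parts are transported separately, so that the identity also covers
    integrals that take a default value. *)
Lemma mpres_integral (f : T2 -> \bar R) : measurable_fun setT f ->
  (\int[m2]_y f y = \int[m1]_x f (phi x))%E.
Proof.
move=> mf; rewrite integralE [RHS]integralE.
rewrite mpres_ge0_integral; [|exact: measurable_funepos|by []].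
rewrite [X in (_ - X)%E]mpres_ge0_integral; [|exact: measurable_funeneg|by []].
by rewrite (funepos_comp f phi : (fun x => f (phi x))^\+%E = _)
  (funeneg_comp f phi : (fun x => f (phi x))^\-%E = _).
Qed.

Lemma mpres_RI (f : T2 -> R) : measurable_fun setT f ->
  \int[m2]_y f y = \int[m1]_x f (phi x).
Proof.
by move=> mf; rewrite /Rintegral mpres_integral//; exact/measurable_EFinP.
Qed.

Lemma mpres_L1 (f : T2 -> R) : measurable_fun setT f ->
  L1 m2 f <-> L1 m1 (f \o phi).
Proof.
move=> mf; have [mphi _] := h.
rewrite L1P// L1P; last exact: measurableT_comp.
by rewrite mpres_ge0_integral//; apply/measurable_EFinP/measurableT_comp.
Qed.

End one.

Lemma mpres_comp d1 d2 d3 (T1 : measurableType d1) (T2 : measurableType d2)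
    (T3 : measurableType d3) (m1 : {measure set T1 -> \bar R})
    (m2 : {measure set T2 -> \bar R}) (m3 : {measure set T3 -> \bar R})
    (phi : T1 -> T2) (psi : T2 -> T3) :
  mpres m1 m2 phi -> mpres m2 m3 psi -> mpres m1 m3 (psi \o phi).
Proof.
move=> [mp ep] [mq eq]; split; first exact: measurableT_comp.
move=> A mA; rewrite comp_preimage ep ?eq//.
by rewrite -[X in measurable X]setTI; exact: mq.
Qed.

Lemma mpres_prod d1 d2 d3 d4 (T1 : measurableType d1) (T2 : measurableType d2)
    (T3 : measurableType d3) (T4 : measurableType d4)
    (m1 : {sigma_finite_measure set T1 -> \bar R})
    (m2 : {sigma_finite_measure set T2 -> \bar R})
    (m3 : {sigma_finite_measure set T3 -> \bar R})
    (m4 : {sigma_finite_measure set T4 -> \bar R})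
    (phi : T1 -> T3) (psi : T2 -> T4) :
  mpres m1 m3 phi -> mpres m2 m4 psi ->
  mpres (m1 \x m2)%E (m3 \x m4)%E (fun p => (phi p.1, psi p.2)).
Proof.
move=> hp hq; have [mp ep] := hp; have [mq eq] := hq.
split; first by apply: measurable_fun_pair; exact: measurableT_comp.
move=> A mA; rewrite /= /product_measure1 (mpres_ge0_integral hp)//; last exact: measurable_fun_xsection.
apply: eq_integral => x _ /=.
rewrite -eq; last exact: measurable_xsection.
congr (m2 _); apply/seteqP; split=> y; rewrite /= /xsection/= ?inE//.
Qed.

End preserve.

(** * Fubini's theorem for real-valued integrals *)

Section fubini_real.
Context d1 d2 (T1 : measurableType d1) (T2 : measurableType d2) (R : realType).
Variables (m1 : {sigma_finite_measure set T1 -> \bar R})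
  (m2 : {sigma_finite_measure set T2 -> \bar R}).
Implicit Types f : T1 * T2 -> R.

(** Up to [fine], the integral is a difference of two Tonelli functions, which are measurable
    whether or not the sections are integrable. *)
Lemma measurable_RI f : measurable_fun setT f ->
  measurable_fun setT (fun x => \int[m2]_y f (x, y)).
Proof.
move=> mf; rewrite /Rintegral.
apply: (measurableT_comp (f := fine)) => //.
pose g := EFin \o f.
have mg : measurable_fun setT g by exact/measurable_EFinP.
rewrite (_ : (fun x => _) = (fun x => \int[m2]_y g^\+%E (x, y) -
    \int[m2]_y g^\-%E (x, y)))%E; last first.
  apply/funext => x; rewrite (integralE m2 setT (fun y => (f (x, y))%:E)).
  by rewrite (funepos_comp g (pair x) : (fun y => (f (x, y))%:E)^\+%E = _)
    (funeneg_comp g (pair x) : (fun y => (f (x, y))%:E)^\-%E = _).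
apply: emeasurable_funB; apply: measurable_fun_fubini_tonelli_F => //.
  exact: measurable_funepos.
exact: measurable_funeneg.
Qed.

(** The inner integrals are finite for almost every [x] only; on the exceptional null set [fine]
    returns a default value, which the outer integral ignores. *)
Lemma RI_prod12 f : L1 (m1 \x m2)%E f ->
  \int[(m1 \x m2)%E]_z f z = \int[m1]_x \int[m2]_y f (x, y).
Proof.
move=> hf; rewrite {1}/Rintegral -integral12_prod_meas1//; congr fine.
apply: ae_eq_integral => //.
- exact: measurable_fubini_F hf.
- by apply/measurable_EFinP/measurable_RI; exact: L1_measurable hf.
have := ae_integrable1 hf; apply: filterS => x hx _.
by rewrite /fubini_F RI_EFin.
Qed.

Lemma RI_prod21 f : L1 (m1 \x m2)%E f ->
  \int[(m1 \x m2)%E]_z f z = \int[m2]_y \int[m1]_x f (x, y).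
Proof.
move=> hf; rewrite {1}/Rintegral -integral21_prod_meas1//; congr fine.
have mf := L1_measurable hf.
have ms : measurable_fun setT (fun y => \int[m1]_x f (x, y)).
  rewrite /Rintegral; apply: (measurableT_comp (f := fine)) => //.
  pose g := EFin \o f.
  have mg : measurable_fun setT g by exact/measurable_EFinP.
  rewrite (_ : (fun x => _) = (fun y => \int[m1]_x g^\+%E (x, y) -
      \int[m1]_x g^\-%E (x, y)))%E; last first.
    apply/funext => y; rewrite (integralE m1 setT (fun x => (f (x, y))%:E)).
  by rewrite (funepos_comp g (pair^~ y) : (fun x => (f (x, y))%:E)^\+%E = _)
    (funeneg_comp g (pair^~ y) : (fun x => (f (x, y))%:E)^\-%E = _).
  apply: emeasurable_funB; apply: measurable_fun_fubini_tonelli_G => //.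
    exact: measurable_funepos.
  exact: measurable_funeneg.
apply: ae_eq_integral => //.
- exact: measurable_fubini_G hf.
- exact/measurable_EFinP.
have := ae_integrable2 hf; apply: filterS => x hx _.
by rewrite /fubini_G RI_EFin.
Qed.

Lemma RI_fubini f : L1 (m1 \x m2)%E f ->
  \int[m1]_x \int[m2]_y f (x, y) = \int[m2]_y \int[m1]_x f (x, y).
Proof. by move=> hf; rewrite -RI_prod12// RI_prod21. Qed.

Lemma L1_prod12 f : L1 (m1 \x m2)%E f -> L1 m1 (fun x => \int[m2]_y f (x, y)).
Proof.
move=> hf; have := integrable_fubini_F hf.
move=> /integrableP[mF hF]; apply/integrableP; split.
  by apply/measurable_EFinP/measurable_RI; exact: L1_measurable hf.
apply: le_lt_trans hF; apply: ge0_le_integral => //.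
- apply: measurableT_comp => //.
  by apply/measurable_EFinP/measurable_RI; exact: L1_measurable hf.
- exact: measurableT_comp.
move=> x _; rewrite /= /Rintegral /fubini_F.
set I := (\int[m2]_y _)%E.
(* [fine] sends infinite values to 0, so it can only decrease the modulus. *)
case: I => [r| |] //=; rewrite ?lexx ?normr0 ?leey//.
Qed.

(** Tonelli's criterion with an explicit majorant [G] for the L^1 norms of the sections; below, [G]
    is usually again made of fractional or heat kernels. *)
Lemma L1_prod_iter f (G : T1 -> R) : measurable_fun setT f ->
  (forall x, L1 m2 (fun y => f (x, y))) ->
  (forall x, \int[m2]_y `|f (x, y)| <= G x) -> L1 m1 G ->
  L1 (m1 \x m2)%E f.
Proof.
move=> mf h1 hG h2.
have mf' : measurable_fun setT (EFin \o f) by exact/measurable_EFinP.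
apply/(integrable12ltyP m1 m2 mf') => /=.
move/integrableP : (h2) => [mG]; apply: le_lt_trans.
apply: ge0_le_integral => //=.
- by move=> x _; apply: integral_ge0.
- apply: (measurable_fun_fubini_tonelli_F (fun z => (`|f z|)%:E)) => //.
  by apply/measurable_EFinP/measurableT_comp.
- by apply/measurable_EFinP/measurableT_comp => //; exact/measurable_EFinP.
move=> x _; rewrite -RI_EFin; last exact: L1_norm.
by rewrite lee_fin (le_trans (hG x))// ler_norm.
Qed.

Lemma L1_prod_le f (g : T1 -> R) (h : T2 -> R) : measurable_fun setT f ->
  (forall x y, `|f (x, y)| <= g x * h y) -> L1 m1 g -> L1 m2 h ->
  L1 (m1 \x m2)%E f.
Proof.
move=> mf fgh hg hh.
have hx x : L1 m2 (fun y => f (x, y)).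
  apply: L1_le (fgh x) _; last exact: L1Z.
  exact: measurableT_comp.
apply: (L1_prod_iter (G := fun x => g x * \int[m2]_y h y)) => //.
  move=> x; rewrite -RIZ//; apply: le_RI => //; first exact: L1_norm.
  exact: L1Z.
exact: L1Zr.
Qed.

End fubini_real.

(** * Lebesgue measure *)

Section lebesgue_affine.
Context {R : realType}.

(* Lebesgue measure on [R] itself: the carrier of [lebesgue_measure] is the
   type alias [measurableTypeR R], whose display is not the default one. *)
Let mid1 : @measurable_fun _ _ (measurableTypeR R) R setT idfun.
Proof. by move=> _ A mA; rewrite setTI. Qed.

Let mid2 : @measurable_fun _ _ R (measurableTypeR R) setT idfun.
Proof. by move=> _ A mA; rewrite setTI. Qed.

Let idK : @cancel R R idfun idfun.
Proof. by []. Qed.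

Definition lam : {sigma_finite_measure set R -> \bar R} :=
  push_measure (@lebesgue_measure R) mid1 mid2 idK.

Lemma mpres_lamV : mpres lam (@lebesgue_measure R) idfun.
Proof. by split. Qed.

Lemma integral_lam (f : R -> \bar R) : measurable_fun setT f ->
  (\int[lebesgue_measure]_x f x = \int[lam]_x f x)%E.
Proof. exact: (mpres_integral mpres_lamV). Qed.

Lemma RI_lam (f : R -> R) : measurable_fun setT f ->
  \int[lebesgue_measure]_x f x = \int[lam]_x f x.
Proof. exact: (mpres_RI mpres_lamV). Qed.

Lemma L1_lam (f : R -> R) : L1 (@lebesgue_measure R) f -> L1 lam f.
Proof.
move=> h; have mf : @measurable_fun _ _ R R setT f := L1_measurable h.
exact: (mpres_L1 mpres_lamV mf).1 h.
Qed.

Lemma lam_itv (a b : R) (x y : bool) : a <= b ->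
  lam [set` Interval (BSide x a) (BSide y b)] = (b - a)%:E.
Proof.
move=> ab; have := @lebesgue_measure_itv R (Interval (BSide x a) (BSide y b)).
rewrite /lam /= /push /pushforward preimage_id => ->.
rewrite /= lte_fin; case: ltP => [//|ba]; have -> : a = b by apply/le_anti; rewrite ab.
by rewrite subrr.
Qed.

Lemma lam_unique (m : {measure set R -> \bar R}) :
  (forall a b, a < b -> m `]a, b]%classic = (b - a)%:E) ->
  forall A, measurable A -> lam A = m A.
Proof.
move=> h A mA.
(* [m] is repackaged as a measure on the alias type, where the uniqueness of Lebesgue measure is
   stated. *)
have m0 : m set0 = 0%E by exact: measure0.
have mge A0 : (0 <= m A0)%E by exact: measure_ge0.
have msa : @semi_sigma_additive _ (measurableTypeR R) R m.
  exact: measure_semi_sigma_additive.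
pose mm := isMeasure.Build _ (measurableTypeR R) R (m : set (measurableTypeR R) -> \bar R) m0 mge msa.
pose p : {measure set (measurableTypeR R) -> \bar R} := HB.pack (m : set (measurableTypeR R) -> \bar R) mm.
apply: (@lebesgue_measure_unique R p _ A mA).
move=> X /ocitvP[->|[[a b] /= ab ->]]; first by rewrite !measure0.
by rewrite [RHS]h// -(lam_itv false false (ltW ab)).
Qed.

Lemma mpres_lamP (phi : R -> R) : measurable_fun setT phi ->
  (forall a b, a < b -> lam (phi @^-1` `]a, b]) = (b - a)%:E) ->
  mpres lam lam phi.
Proof.
move=> mphi h; split=> // A mA; apply/esym.
pose p : {measure set R -> \bar R} := pushforward lam phi.
exact: (lam_unique (m := p mphi)).
Qed.

Lemma lam_translation (c : R) : mpres lam lam (fun x => c + x).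
Proof.
apply: mpres_lamP; first exact: measurable_funD.
move=> a b ab; rewrite (_ : _ @^-1` _ = `]a - c, b - c]%classic).
  by rewrite lam_itv ?lerB// ?ltW//; congr EFin; ring.
apply/seteqP; split=> x; rewrite /= !in_itv/= => /andP[h1 h2]; apply/andP; split; lra.
Qed.

Lemma lam_reflection (c : R) : mpres lam lam (fun x => c - x).
Proof.
apply: mpres_lamP; first exact: measurable_funB.
move=> a b ab; rewrite (_ : _ @^-1` _ = `[c - b, c - a[%classic).
  by rewrite lam_itv ?lerB// ?ltW//; congr EFin; ring.
apply/seteqP; split=> x; rewrite /= !in_itv/= => /andP[h1 h2]; apply/andP; split; lra.
Qed.

Lemma lam_scaling (c : R) (c0 : 0 < c) (f : R -> \bar R) :
  measurable_fun setT f -> (forall x, 0 <= f x)%E ->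
  (\int[lam]_x f (c * x)%R = (c^-1)%:E * \int[lam]_x f x)%E.
Proof.
move=> mf f0.
have c1 : 0 <= c^-1 by rewrite invr_ge0 ltW.
have mphi : measurable_fun setT (fun x : R => c * x) by exact: measurable_funM.
have h : mpres lam (mscale (NngNum c1) lam) (fun x : R => c * x).
  split=> // A mA.
  have mpsi : measurable_fun setT (fun x : R => c^-1 * x) by exact: measurable_funM.
  have fK : cancel (fun x : R => c * x) (fun x : R => c^-1 * x).
    by move=> x; rewrite mulKf// gt_eqF.
  (* [c] times the image measure gives []a, b]] its length, hence is Lebesgue measure. *)
  pose m2 : {measure set R -> \bar R} :=
    mscale (NngNum (ltW c0)) (push_measure lam mphi mpsi fK).
  rewrite [RHS](_ : _ = ((c^-1)%:E * lam A)%E)// (lam_unique (m := m2))//.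
    by rewrite /m2 /mscale /= muleA -EFinM mulVf ?gt_eqF// mul1e.
  move=> a b ab.
  rewrite [LHS](_ : _ = (c%:E * lam ((fun x : R => c * x)%R @^-1` `]a, b]))%E)//.
  rewrite (_ : _ @^-1` _ = `]a / c, b / c]%classic).
    have abc : a / c <= b / c by rewrite ler_pM2r ?invr_gt0 ?ltW.
    rewrite lam_itv//.
    by rewrite -EFinM; congr EFin; field; rewrite gt_eqF.
  apply/seteqP; split=> x; rewrite /= !in_itv/= => /andP[h1 h2];
    move: h1 h2; rewrite ltr_pdivrMr// ler_pdivlMr// mulrC => -> //.
rewrite -(mpres_ge0_integral h)// ge0_integral_mscale//.
Qed.

End lebesgue_affine.
Arguments lam {R}.

(** * Product measures on tuples *)

Section tuples.
Context d (T : measurableType d) (R : realType).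
Variable m : {sigma_finite_measure set T -> \bar R}.

Lemma mpres_cons n : mpres (m \x tuple_measure m n)%E (tuple_measure m n.+1)
  (fun p : T * n.-tuple T => [tuple of p.1 :: p.2]).
Proof. by split; [exact: measurable_cons|move=> A mA]. Qed.

Lemma mpres_tuple1 : mpres m (tuple_measure m 1) (fun x => [tuple x]).
Proof.
have h : mpres m (m \x tuple_measure m 0)%E (fun x => (x, [tuple])).
  split; first by apply: measurable_fun_pair.
  move=> A mA; rewrite /= /product_measure1/=.
  rewrite (eq_integral (fun x => (\1_((fun x => (x, [tuple])) @^-1` A) x)%:E)).
    rewrite integral_indic ?setIT//.
    rewrite -[X in measurable X]setTI.
    have := measurable_fun_pair (@measurable_id _ T setT) (@measurable_cst _ _ T _ setT ([tuple] : 0.-tuple T)).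
    by apply.
  move=> x _; rewrite /= diracE indicE; congr (_ %:R%:E).
  by rewrite mem_xsection; congr nat_of_bool; apply/idP/idP; rewrite !inE.
by have := mpres_comp h (mpres_cons 0).
Qed.

Lemma mpres_id : mpres m m id.
Proof. by split. Qed.

Lemma mpres_tuple2 : mpres (m \x m)%E (tuple_measure m 2)
  (fun p => [tuple p.1; p.2]).
Proof. exact: (mpres_comp (mpres_prod mpres_id mpres_tuple1) (mpres_cons 1)). Qed.

End tuples.

Section tuples_map.
Context d (T : measurableType d) (R : realType).
Variable m : {sigma_finite_measure set T -> \bar R}.

(** The maps are indexed by [nat] rather than ['I_n] so that the induction can pass to the shifted
    family [fun i => phi i.+1]. *)
Lemma mpres_tuple d' (T' : measurableType d')
    (m' : {sigma_finite_measure set T' -> \bar R}) n (phi : nat -> T -> T') :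
  (forall i, mpres m m' (phi i)) ->
  mpres (tuple_measure m n) (tuple_measure m' n)
    (fun t => [tuple phi i (tnth t i) | i < n]).
Proof.
elim: n phi => [|n IH] phi hphi.
  split.
    by apply/measurable_fun_tnthP => -[].
    have e (u v : 0.-tuple T') : u = v by rewrite (tuple0 u) (tuple0 v).
  move=> A mA; rewrite /= !diracE; congr (_%:R%:E).
  by rewrite (e [tuple] [tuple phi i (tnth ([tuple] : 0.-tuple T) i) | i < 0]); congr nat_of_bool; apply/idP/idP; rewrite !inE.
have h1 := mpres_prod (hphi 0) (IH (fun i => phi i.+1) (fun i => hphi i.+1)).
have h2 := mpres_comp h1 (mpres_cons m' n).
split.
  apply/measurable_fun_tnthP => i.
  rewrite (_ : _ \o _ = phi i \o (@tnth _ _ ^~ i)).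
    by apply: measurableT_comp; [exact: (hphi i).1|exact: measurable_tnth].
  by apply/funext => t /=; rewrite tnth_mktuple.
move=> A mA.
have [_ e1] := mpres_cons m n; rewrite -e1; last first.
  rewrite -[X in measurable X]setTI.
  suff : measurable_fun setT (fun t : n.+1.-tuple T => [tuple phi i (tnth t i) | i < n.+1]).
    by apply.
  apply/measurable_fun_tnthP => i.
  rewrite (_ : _ \o _ = phi i \o (@tnth _ _ ^~ i)).
    by apply: measurableT_comp; [exact: (hphi i).1|exact: measurable_tnth].
  by apply/funext => t /=; rewrite tnth_mktuple.
rewrite -h2.2//; congr (_ _); apply/seteqP; split=> -[x t] /=.
  have -> : [tuple phi i (tnth [tuple of x :: t] i) | i < n.+1] =
    [tuple of phi 0 x :: [tuple phi i.+1 (tnth t i) | i < n]]; last by [].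
  apply/eq_from_tnth => i; rewrite tnth_mktuple.
  case: (unliftP ord0 i) => [j ->|->]; last by rewrite !tnth0.
  by rewrite !tnthS tnth_mktuple.
have -> : [tuple phi i (tnth [tuple of x :: t] i) | i < n.+1] =
  [tuple of phi 0 x :: [tuple phi i.+1 (tnth t i) | i < n]]; last by [].
apply/eq_from_tnth => i; rewrite tnth_mktuple.
case: (unliftP ord0 i) => [j ->|->]; last by rewrite !tnth0.
by rewrite !tnthS tnth_mktuple.
Qed.

End tuples_map.

(** * Lebesgue measure on row vectors *)

Section rows.
Context {R : realType} {n : nat}.
Implicit Types c : 'rV[R]_n.

Definition rowt (t : n.-tuple R) : 'rV[R]_n := \row_i tnth t i.

Lemma measurable_coord (i : 'I_n) : measurable_fun setT (fun x : 'rV[R]_n => x ord0 i).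
Proof.
move=> _ Y mY; rewrite setTI; apply: sub_sigma_algebra => /=.
rewrite -bigcup_seq/=; exists i => /=; first by rewrite mem_index_enum.
by exists Y => //; rewrite setTI.
Qed.

Lemma measurable_rowP d (T : measurableType d) (f : T -> 'rV[R]_n) :
  (forall i : 'I_n, measurable_fun setT (fun x : T => f x ord0 i)) ->
  measurable_fun setT f.
Proof.
move=> h; have h2 : measurable_fun setT (fun x => [tuple f x ord0 i | i < n]).
  apply/measurable_fun_tnthP => i.
  by rewrite (_ : _ \o _ = fun x => f x ord0 i)//; apply/funext => x /=; rewrite tnth_mktuple.
have h3 : measurable_fun setT rowt.
  have H (A : set 'rV[R]_n) :
    g_sigma_preimage (fun i (x : 'rV[R]_n) => x ord0 i) A ->
    measurable (rowt @^-1` A).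
    move=> mA.
    have : preimage_set_system [set: n.-tuple R] rowt
        (g_sigma_preimage (fun i (x : 'rV[R]_n) => x ord0 i)) (rowt @^-1` A).
      by exists A => //; rewrite setTI.
    rewrite -g_sigma_preimage_comp.
    rewrite (_ : (fun i => _) = (fun i t => tnth t i)) //.
    by apply/funext => i; apply/funext => t; rewrite /= /rowt mxE.
  by move=> _ A mA; rewrite setTI; exact: H.
rewrite (_ : f = rowt \o (fun x => [tuple f x ord0 i | i < n])).
  exact: measurableT_comp.
by apply/funext => x; apply/rowP => i; rewrite /= /rowt mxE tnth_mktuple.
Qed.

Lemma mpres_rowt :
  mpres (tuple_measure lam n) (leb : {measure set 'rV[R]_n -> \bar R}) rowt.
Proof.
suff h : mpres (tuple_measure (@lebesgue_measure R) n)
    (leb : {measure set 'rV[R]_n -> \bar R}) rowt.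
  have := mpres_comp (mpres_tuple n (fun=> mpres_lamV)) h.
  rewrite (_ : _ \o _ = rowt)//; apply/funext => t /=; congr rowt.
  by apply: eq_from_tnth => i; rewrite tnth_mktuple.
split; last by move=> A mA.
apply: measurable_rowP => i; rewrite (_ : (fun x => _) = @tnth _ _ ^~ i).
  exact: measurable_tnth.
by apply/funext => t; rewrite /rowt mxE.
Qed.

Lemma mpres_leb_coord (phi : nat -> R -> R) :
  (forall i, mpres lam lam (phi i)) ->
  mpres (leb : {measure set 'rV[R]_n -> \bar R}) (leb : {measure set 'rV[R]_n -> \bar R})
    (fun x => \row_i phi i (x ord0 i)).
Proof.
move=> hphi.
have mp : measurable_fun setT (fun x : 'rV[R]_n => \row_i phi i (x ord0 i) : 'rV[R]_n).
  apply: measurable_rowP => i; under eq_fun do rewrite mxE.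
  by apply: measurableT_comp; [exact: (hphi i).1|exact: measurable_coord].
split=> // A mA.
have h := mpres_comp (mpres_tuple n hphi) mpres_rowt.
have [_ e] := mpres_rowt; rewrite -e; last first.
  by rewrite -[X in measurable X]setTI; exact: mp.
rewrite -h.2//; congr (_ _); apply/seteqP; split=> t /=.
  rewrite (_ : \row_i _ = rowt [tuple phi i (tnth t i)  | i < n])//.
  by apply/rowP => i; rewrite !mxE tnth_mktuple.
rewrite (_ : rowt [tuple phi i (tnth t i)  | i < n] = \row_i phi i (rowt t ord0 i))//.
by apply/rowP => i; rewrite !mxE tnth_mktuple.
Qed.

Lemma leb_translation c : mpres (leb : {measure set 'rV[R]_n -> \bar R}) leb (fun x => c + x).
Proof.
(* [mpres_leb_coord] takes a family indexed by [nat]; the value 0 beyond [n] is never read. *)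
pose phi (i : nat) (x : R) := (if insub i is Some j then c ord0 j else 0) + x.
rewrite [X in mpres _ _ X](_ : _ = fun x : 'rV[R]_n => \row_i phi i (x ord0 i)).
  by apply: mpres_leb_coord => i; exact: lam_translation.
by apply/funext => x; apply/rowP => i; rewrite !mxE /phi valK.
Qed.

Lemma leb_reflection c : mpres (leb : {measure set 'rV[R]_n -> \bar R}) leb (fun x => c - x).
Proof.
pose phi (i : nat) (x : R) := (if insub i is Some j then c ord0 j else 0) - x.
rewrite [X in mpres _ _ X](_ : _ = fun x : 'rV[R]_n => \row_i phi i (x ord0 i)).
  by apply: mpres_leb_coord => i; exact: lam_reflection.
by apply/funext => x; apply/rowP => i; rewrite !mxE /phi valK.
Qed.

End rows.

(** * Gaussian functions and their Fourier transforms *)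

#[local] Opaque powR expR cos sin.

Section gauss1.
Context {R : realType}.

Implicit Types e x xi al : R.

(** Normalized like [heat], which is thus the product of its values at the coordinates; [gauss1E] is
    the link with the normal law. *)
Definition gauss1 e x := (2 * pi * e) `^ (- (1 / 2)) * expR (- (x * x / (2 * e))).

Lemma gauss1E e : 0 < e -> gauss1 e = normal_pdf 0 (Num.sqrt e).
Proof.
move=> e0; apply/funext => x; rewrite /gauss1 normal_pdfE ?gt_eqF ?sqrtr_gt0//.
rewrite /normal_peak /normal_fun sqr_sqrtr ?ltW// subr0.
have p0 : 0 < 2 * pi * e by rewrite !mulr_gt0// pi_gt0.
congr (_ * _).
  rewrite (_ : e * pi *+ 2 = 2 * pi * e); last by rewrite -mulr_natl; ring.
  rewrite powRN -powR12_sqrt; last exact: ltW.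
  by congr (_ `^ _)^-1; rewrite mul1r.
by congr expR; rewrite -(mulr_natl e) expr2 mulNr.
Qed.

Lemma gauss1_ge0 e x : 0 <= gauss1 e x.
Proof. by rewrite mulr_ge0 ?powR_ge0 ?expR_ge0. Qed.

Lemma L1_gauss1 e : 0 < e -> L1 lam (gauss1 e).
Proof. by move=> e0; apply: L1_lam; rewrite gauss1E//; exact: integrable_normal_pdf. Qed.

Lemma RI_gauss1 e : 0 < e -> \int[lam]_x gauss1 e x = 1.
Proof.
move=> e0; rewrite -RI_lam; last exact: L1_measurable (L1_gauss1 e0).
by rewrite gauss1E// /Rintegral integral_normal_pdf.
Qed.

Lemma gauss1N e x : gauss1 e (- x) = gauss1 e x.
Proof. by rewrite /gauss1 mulrNN. Qed.

Lemma is_derive_gauss1 e x : is_derive x 1 (gauss1 e) (- (x / e) * gauss1 e x).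
Proof.
pose h : R -> R := fun x => - (x * x / (2 * e)).
have dh : is_derive x 1 h (- (x / e)).
  rewrite (_ : h = (- (2 * e)^-1) \*: (id * id)); last first.
    by apply/funext => y; rewrite /h /= /GRing.scale /= !fctE mulrC mulNr.
  apply: is_derive_eq; rewrite /GRing.scale/= !mulr1 invfM.
  have -> : x + x = 2 * x by rewrite mulrDl mul1r.
  by rewrite mulNr mulrACA mulVf// mul1r mulrC.
have -> : gauss1 e = (2 * pi * e) `^ (- (1 / 2)) \*: (expR \o h) by [].
apply: is_derive_eq.
transitivity (- (x / e) * ((2 * pi * e) `^ (- (1 / 2)) * expR (h x))) => //.
by rewrite /GRing.scale /=; ring.
Qed.

Lemma continuous_gauss1 e : continuous (gauss1 e).
Proof.
move=> x; apply: differentiable_continuous; apply/derivable1_diffP.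
by have [] := is_derive_gauss1 e x.
Qed.

(** Doubling the variance spares half of the exponent; the spare factor absorbs polynomials in
    [x]. *)
Lemma gauss1_split e x : 0 < e ->
  gauss1 e x = Num.sqrt 2 * (gauss1 (2 * e) x * expR (- (x * x / (4 * e)))).
Proof.
move=> e0; rewrite /gauss1.
have p0 : 0 < 2 * pi * e by rewrite !mulr_gt0// pi_gt0.
have -> : 2 * pi * (2 * e) = 2 * (2 * pi * e) by ring.
rewrite (_ : - (1 / 2) = - 2^-1); last by rewrite mul1r.
rewrite (@powRM _ 2 (2 * pi * e))//; last exact: ltW.
rewrite !powRN (@powR12_sqrt _ 2)//.
have -> : expR (- (x * x / (2 * e))) =
    expR (- (x * x / (2 * (2 * e)))) * expR (- (x * x / (4 * e))).
  by rewrite -expRD; congr expR; field; rewrite gt_eqF.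
set q := (_ * _ * _) `^ _; set s2 := Num.sqrt 2.
have q0 : q != 0 by rewrite gt_eqF// powR_gt0.
have s0 : s2 != 0 by rewrite gt_eqF// sqrtr_gt0.
by field; rewrite q0.
Qed.

Lemma L1_xgauss1 e : 0 < e -> L1 lam (fun x => `|x| * gauss1 e x).
Proof.
move=> e0; have e20 : 0 < 2 * e by rewrite mulr_gt0.
apply: (L1_le (g := fun x => (Num.sqrt 2 * (1 + 4 * e)) * gauss1 (2 * e) x)).
- apply: measurable_funM; first exact: normr_measurable.
  exact: L1_measurable (L1_gauss1 e0).
- move=> x; rewrite normrM normr_id (ger0_norm (gauss1_ge0 _ _)) (gauss1_split _ e0).
  rewrite (_ : `|x| * _ = (Num.sqrt 2 * (`|x| * expR (- (x * x / (4 * e))))) * gauss1 (2 * e) x); last by ring.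
  rewrite ler_wpM2r ?gauss1_ge0// ler_wpM2l ?sqrtr_ge0//.
  rewrite expRN ler_pdivrMr ?expR_gt0//.
  have h1 : 1 + x * x / (4 * e) <= expR (x * x / (4 * e)).
    by have := @expR_ge1Dxn R (x * x / (4 * e)) 0; rewrite expr1 factS fact0 muln1 divr1; apply; rewrite divr_ge0 -?expr2 ?sqr_ge0// mulr_ge0// ltW.
  (* The product is at least [1 + x * x], hence at least the modulus of [x]; this is where
     [1 + 4 * e] comes from. *)
  apply: (@le_trans _ _ ((1 + 4 * e) * (1 + x * x / (4 * e)))); last first.
    by rewrite ler_wpM2l// addr_ge0// mulr_ge0// ltW.
  have -> : (1 + 4 * e) * (1 + x * x / (4 * e)) = 1 + 4 * e + x * x / (4 * e) + x * x.
    by field; rewrite gt_eqF.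
  have h2 : 0 <= x * x / (4 * e) by rewrite divr_ge0 -?expr2 ?sqr_ge0// mulr_ge0// ltW.
  have h3 : x * x = `|x| * `|x| by rewrite -normrM ger0_norm// -expr2 sqr_ge0.
  have h4 := normr_ge0 x; nra.
- by apply: L1Z; exact: L1_gauss1.
Qed.

(** The fundamental theorem of calculus on growing symmetric intervals, with dominated convergence;
    it will stand for an integration by parts over the whole line. *)
Lemma RI_derive_eq0 (h h' : R -> R) : (forall x, is_derive x 1 h (h' x)) ->
  continuous h' -> L1 lam h' ->
  h n%:R @[n --> \oo] --> 0 -> h (- n%:R) @[n --> \oo] --> 0 ->
  \int[lam]_x h' x = 0.
Proof.
move=> dh ch' ih' hp hm.
have mh := L1_measurable ih'.
(* The bounds are [n.+1] so that the interval is never reduced to a point. *)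
pose f_ (n : nat) := h' \_ `[- n.+1%:R, n.+1%:R].
have [|||_ c1] := @RI_dct _ _ R lam f_ h' (fun x => `|h' x|) _ _ _ (L1_norm ih').
- by move=> n; apply/measurable_restrict => //; exact: measurable_funTS.
- move=> x; apply: cvg_near_cst; near=> n.
  rewrite /f_ patchE mem_set//= in_itv/= -ler_norml.
  apply: (@le_trans _ _ n%:R); last by rewrite ler_nat.
  near: n; exact: nbhs_infty_ger.
- by move=> n x; rewrite /f_ patchE; case: ifP => // _; rewrite normr0.
have c2 : \int[lam]_x f_ n x @[n --> \oo] --> 0 - 0.
  have -> : (fun n => \int[lam]_x f_ n x) = (fun n => h n.+1%:R - h (- n.+1%:R)).
    apply/funext => n.
    have dd : derivable_oo_LRcontinuous h (- n.+1%:R) n.+1%:R.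
      have ch : continuous h.
        move=> x; apply: differentiable_continuous; apply/derivable1_diffP.
        by have [] := dh x.
      split.
      - by move=> x _; have [] := dh x.
      - exact/cvg_at_right_filter/ch.
      - exact/cvg_at_left_filter/ch.
    rewrite -RI_lam; last exact/measurable_restrict/measurable_funTS.
    rewrite -Rintegral_mkcond /Rintegral.
    rewrite (continuous_FTC2 _ _ dd) ?EFinB//=.
    - by rewrite -subr_gt0 opprK -mulr2n pmulrn_lgt0.
    - exact: continuous_subspaceT.
    - by move=> x _; rewrite derive1E; have [_ ->] := dh x.
  by apply: cvgB; [rewrite (cvg_shiftS (fun n : nat => h n%:R))|rewrite (cvg_shiftS (fun n : nat => h (- n%:R)))].
by have /= := cvg_unique _ c1 c2; rewrite subr0; apply; exact: Rhausdorff.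
Unshelve. all: end_near. Qed.

Lemma expR_natN_cvg0 (c : R) : 0 < c -> expR (- (c * n%:R)) @[n --> \oo] --> 0.
Proof.
move=> c0.
have h : (fun n : nat => (expR (- c)) ^+ n) @ \oo --> (0 : R).
  by apply: cvg_expr; rewrite ger0_norm ?expR_ge0// expR_lt1 oppr_lt0.
by under eq_fun do rewrite -mulNr expRM_natr.
Qed.

Lemma gauss1_cvg0 e (s : R) : 0 < e -> (s == 1) || (s == -1) ->
  gauss1 e (s * n%:R) @[n --> \oo] --> 0.
Proof.
move=> e0 s1.
have ss : s * s = 1 by case/orP : s1 => /eqP ->; rewrite ?mulrNN mulr1.
pose c := (2 * e)^-1.
have c0 : 0 < c by rewrite invr_gt0 mulr_gt0.
have : (2 * pi * e) `^ (- (1 / 2)) * expR (- (c * n%:R)) @[n --> \oo] -->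
    (2 * pi * e) `^ (- (1 / 2)) * 0.
  by apply: cvgM; [exact: cvg_cst|exact: expR_natN_cvg0].
rewrite mulr0 => lim0; apply: squeeze_cvgr lim0; last exact: cvg_cst.
near=> n; rewrite gauss1_ge0/= /gauss1 ler_wpM2l ?powR_ge0// ler_expR lerN2.
rewrite mulrACA ss mul1r mulrC ler_wpM2r ?(ltW c0)// ler_peMl//.
by near: n; exact: nbhs_infty_ger.
Unshelve. all: end_near. Qed.

Lemma L1_trig_gauss1 e (g : R -> R) : 0 < e -> continuous g ->
  (forall x, `|g x| <= 1) -> L1 lam (fun x => g x * gauss1 e x).
Proof.
move=> e0 cg g1; apply: (L1_le _ _ (L1_gauss1 e0)).
  apply: measurable_funM; last exact: L1_measurable (L1_gauss1 e0).
  exact: continuous_measurable_fun.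
by move=> x; rewrite normrM (ger0_norm (gauss1_ge0 _ _)) ler_piMl ?gauss1_ge0.
Qed.

Lemma continuous_cosM xi al : continuous (fun x : R => cos (al + xi * x)).
Proof.
move=> x; apply: (@continuous_comp _ _ _ (fun x => al + xi * x) cos); last exact: continuous_cos.
by apply: continuousD; [exact: cst_continuous|apply: continuousM; [exact: cst_continuous|exact: cvg_id]].
Qed.

Lemma continuous_sinM xi al : continuous (fun x : R => sin (al + xi * x)).
Proof.
move=> x; apply: (@continuous_comp _ _ _ (fun x => al + xi * x) sin); last exact: continuous_sin.
by apply: continuousD; [exact: cst_continuous|apply: continuousM; [exact: cst_continuous|exact: cvg_id]].
Qed.

(** Differentiation under the integral brings down [- x] and a sine; as [x] times the Gaussian is
    [- e] times its derivative, an integration by parts turns this into [- (e * xi)] times the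
    transform. *)
Lemma is_derive_gauss1_fourier e xi : 0 < e ->
  is_derive xi 1 (fun xi => \int[lam]_x (cos (0 + xi * x) * gauss1 e x))
    (- (e * xi) * \int[lam]_x (cos (0 + xi * x) * gauss1 e x)).
Proof.
move=> e0; pose f xi x := cos (0 + xi * x) * gauss1 e x.
have df (y : R) x : is_derive y 1 (f^~ x) (- x * sin (0 + y * x) * gauss1 e x).
  have d1 : is_derive y 1 (fun y : R => 0 + y * x) x.
    rewrite (_ : (fun y => _) = (x \*: (id : R -> R))); last first.
      by apply/funext => z; rewrite add0r mulrC.
    by apply: is_derive_eq; rewrite /GRing.scale/= mulr1.
  rewrite (_ : f^~ x = gauss1 e x \*: (cos \o (fun y => 0 + y * x))); last first.
    by apply/funext => z; rewrite /f mulrC.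
  by apply: is_derive_eq; rewrite /GRing.scale/=; ring.
have intf y : L1 lam (f y).
  apply: L1_trig_gauss1 => //; first exact: continuous_cosM.
  by move=> x; rewrite cos_max.
have d1f y x : partial1of2 f y x = - x * sin (0 + y * x) * gauss1 e x.
  by rewrite partial1of2E; have [_ ->] := df y x.
have Ixi : `]xi - 1, xi + 1[%classic xi by rewrite /= in_itv/=; apply/andP; split; lra.
have h1 y x : `]xi - 1, xi + 1[%classic y -> setT x -> derivable (f^~ x) y 1.
  by move=> _ _; have [] := df y x.
have h2 y x : `]xi - 1, xi + 1[%classic y -> setT x ->
    `|partial1of2 f y x| <= `|x| * gauss1 e x.
  move=> _ _; rewrite d1f 2!normrM normrN (ger0_norm (gauss1_ge0 e x)).
  by rewrite ler_wpM2r ?gauss1_ge0// ler_piMr// sin_max.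
have h0 x : 0 <= `|x| * gauss1 e x by rewrite mulr_ge0// gauss1_ge0.
have d := @derivable_under_integral R _ _ lam f setT measurableT xi _ _ Ixi (fun y _ => intf y) h1 _ h0 (L1_xgauss1 e0) h2.
have v := @differentiation_under_integral R _ _ lam f setT measurableT xi _ _ Ixi (fun y _ => intf y) h1 _ h0 (L1_xgauss1 e0) h2.
apply: DeriveDef; first exact: d.
rewrite -derive1E v.
under eq_Rintegral do rewrite d1f.
pose h x := sin (0 + xi * x) * gauss1 e x.
pose h' x := (xi * (cos (0 + xi * x) * gauss1 e x)) - e^-1 * (x * sin (0 + xi * x) * gauss1 e x).
have is_h (x : R) : is_derive x 1 h (h' x).
  have d1 : is_derive x 1 (fun y : R => 0 + xi * y) xi.
    rewrite (_ : (fun y => _) = (xi \*: (id : R -> R))); last first.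
      by apply/funext => z; rewrite add0r.
    by apply: is_derive_eq; rewrite /GRing.scale/= mulr1.
  have d2 := is_derive_gauss1 e x.
  rewrite (_ : h = (sin \o (fun y => 0 + xi * y)) * gauss1 e); last by [].
  by apply: is_derive_eq; rewrite /GRing.scale/= /h'; ring.
have L2 : L1 lam (fun x => x * sin (0 + xi * x) * gauss1 e x).
  apply: (L1_le _ _ (L1_xgauss1 e0)).
    apply: measurable_funM; last exact: L1_measurable (L1_gauss1 e0).
    by apply: measurable_funM => //; apply: continuous_measurable_fun; exact: continuous_sinM.
  move=> x; rewrite 2!normrM (ger0_norm (gauss1_ge0 _ _)).
  by rewrite ler_wpM2r ?gauss1_ge0// ler_piMr// sin_max.
have Lh' : L1 lam h' by apply: L1B; apply: L1Z => //; exact: intf.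
have ch' : continuous h'.
  move=> x; rewrite /h'; apply: cvgB; apply: cvgM; try exact: cvg_cst.
    by apply: cvgM; [exact: continuous_cosM|exact: continuous_gauss1].
  apply: cvgM; last exact: continuous_gauss1.
  by apply: cvgM; [exact: cvg_id|exact: continuous_sinM].
have lim0 s : (s == 1) || (s == -1) -> h (s * n%:R) @[n --> \oo] --> 0.
  move=> s1; apply: norm_cvg0.
  apply: squeeze_cvgr (gauss1_cvg0 e0 s1); last exact: cvg_cst.
  near=> n; rewrite normr_ge0/= /h normrM (ger0_norm (gauss1_ge0 _ _)).
  by rewrite ler_piMl ?gauss1_ge0// sin_max.
have := RI_derive_eq0 is_h ch' Lh'.
have := lim0 1; rewrite eqxx => /(_ isT); under eq_fun do rewrite mul1r.
move=> l1 /(_ l1).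
have := lim0 (-1); rewrite eqxx orbT => /(_ isT); under eq_fun do rewrite mulN1r.
move=> l2 /(_ l2).
rewrite RIB; [|by apply: L1Z; exact: intf|exact: L1Z].
rewrite RIZ; last exact: intf.
rewrite RIZ// => /eqP; rewrite subr_eq0 => /eqP E.
under eq_RI do rewrite -mulrA mulNr mulrA -mulN1r.
rewrite RIZ// -[X in - (_ * _) * X]/(\int[lam]_x f xi x) mulNr -mulrA E mulrA divff ?gt_eqF// mul1r mulN1r.
by [].
Unshelve. all: end_near. Qed.

(** The transform solves the linear equation of [is_derive_gauss1_fourier], so its product with
    [expR (e / 2 * (y * y))] is constant. The phase [al] will carry the other coordinates, which
    keeps the computation in higher dimension within cosines. *)
Lemma gauss1_fourier e al xi : 0 < e ->
  \int[lam]_x (cos (al + xi * x) * gauss1 e x) =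
  cos al * expR (- (e * (xi * xi) / 2)).
Proof.
move=> e0.
have Lc : L1 lam (fun x => cos (0 + xi * x) * gauss1 e x).
  by apply: L1_trig_gauss1 => //; [exact: continuous_cosM|move=> x; rewrite cos_max].
have Ls : L1 lam (fun x => sin (0 + xi * x) * gauss1 e x).
  by apply: L1_trig_gauss1 => //; [exact: continuous_sinM|move=> x; rewrite sin_max].
(* By reflection the sine integral equals its opposite. *)
have s0 : \int[lam]_x (sin (0 + xi * x) * gauss1 e x) = 0.
  have := mpres_RI (lam_reflection 0) (L1_measurable Ls).
  under [RHS]eq_RI do rewrite sub0r gauss1N add0r mulrN sinN mulNr -mulN1r.
  under [LHS]eq_RI do rewrite add0r.
  under [X in _ -> X = _]eq_RI do rewrite add0r.
  rewrite RIZ; last by move: Ls; apply: eq_integrable => // x _ /=; rewrite add0r.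
  by move=> h; lra.
under eq_RI do rewrite cosD mulrBl -!mulrA.
have E1 : (fun x => cos (xi * x) * gauss1 e x) = (fun x => cos (0 + xi * x) * gauss1 e x).
  by apply/funext => x; rewrite add0r.
have E2 : (fun x => sin (xi * x) * gauss1 e x) = (fun x => sin (0 + xi * x) * gauss1 e x).
  by apply/funext => x; rewrite add0r.
rewrite RIB; [|by apply: L1Z; rewrite E1|by apply: L1Z; rewrite E2].
rewrite !RIZ ?E1 ?E2// s0 mulr0 subr0; congr (_ * _).
pose F y := \int[lam]_x (cos (0 + y * x) * gauss1 e x).
pose E : R -> R := fun y => expR (e / 2 * (y * y)).
have dE (y : R) : is_derive y 1 E (e * y * E y).
  have d1 : is_derive y 1 (fun y : R => e / 2 * (y * y)) (e * y).
    rewrite (_ : (fun y => _) = ((e / 2) \*: (id * id : R -> R))); last by [].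
    by apply: is_derive_eq; rewrite /GRing.scale/= !mulr1; field.
  rewrite (_ : E = expR \o (fun y => e / 2 * (y * y)))//.
  by apply: is_derive_eq; rewrite mulrC.
have dFE (y : R) : is_derive y 1 (F * E) 0.
  have dF := is_derive_gauss1_fourier y e0.
  apply: is_derive_eq; rewrite /GRing.scale/= -/(F y); ring.
have := is_derive_0_is_cst xi 0 dFE.
rewrite !fctE /E !mulr0 expR0 mulr1.
have -> : F 0 = 1.
  rewrite /F -(RI_gauss1 e0); apply: eq_RI => x.
  by rewrite mul0r addr0 cos0 mul1r.
rewrite -/(F xi) expRN => h.
rewrite (_ : e * (xi * xi) / 2 = e / 2 * (xi * xi)); last by field.
by apply: (mulIf (lt0r_neq0 (expR_gt0 (e / 2 * (xi * xi))))); rewrite h mulVf// gt_eqF// expR_gt0.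
Qed.

End gauss1.

(** * The Euclidean inner product and norm *)

Section dot.
Context {R : realType} {d : nat}.
Implicit Types x y z : 'rV[R]_d.

Lemma dotC x y : dot x y = dot y x.
Proof. by apply: eq_bigr => i _; rewrite mulrC. Qed.

Lemma dotDl x y z : dot (x + y) z = dot x z + dot y z.
Proof. by rewrite /dot -big_split; apply: eq_bigr => i _; rewrite mxE mulrDl. Qed.

Lemma dotDr x y z : dot z (x + y) = dot z x + dot z y.
Proof. by rewrite dotC dotDl !(dotC z). Qed.

Lemma dotNl x y : dot (- x) y = - dot x y.
Proof. by rewrite /dot -sumrN; apply: eq_bigr => i _; rewrite mxE mulNr. Qed.

Lemma dotNr x y : dot x (- y) = - dot x y.
Proof. by rewrite dotC dotNl dotC. Qed.

Lemma dotBl x y z : dot (x - y) z = dot x z - dot y z.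
Proof. by rewrite dotDl dotNl. Qed.

Lemma dotBr x y z : dot z (x - y) = dot z x - dot z y.
Proof. by rewrite dotDr dotNr. Qed.

Lemma dot0l x : dot 0 x = 0.
Proof. by rewrite /dot big1// => i _; rewrite mxE mul0r. Qed.

Lemma dot0r x : dot x 0 = 0.
Proof. by rewrite dotC dot0l. Qed.

Lemma dot_ge0 x : 0 <= dot x x.
Proof. by apply: sumr_ge0 => i _; rewrite -expr2 sqr_ge0. Qed.

Lemma dotNN x : dot (- x) (- x) = dot x x.
Proof. by rewrite dotNl dotNr opprK. Qed.

Lemma dotD_le x y : dot (x + y) (x + y) <= 2 * dot x x + 2 * dot y y.
Proof.
have := dot_ge0 (x - y).
by rewrite !(dotDl, dotDr, dotNl, dotNr) (dotC y x); lra.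
Qed.

Lemma enorm_ge0 x : 0 <= enorm x. Proof. exact: sqrtr_ge0. Qed.

Lemma enorm_sqr x : enorm x * enorm x = dot x x.
Proof. by rewrite -expr2 sqr_sqrtr// dot_ge0. Qed.

Lemma enormN x : enorm (- x) = enorm x.
Proof. by rewrite /enorm dotNN. Qed.

Lemma coord_sqr_le x (i : 'I_d) : x ord0 i * x ord0 i <= dot x x.
Proof.
rewrite /dot (bigD1 i)//= lerDl sumr_ge0// => j _.
by rewrite -expr2 sqr_ge0.
Qed.

Lemma coord_le_enorm x (i : 'I_d) : `|x ord0 i| <= enorm x.
Proof.
rewrite -(@ler_pXn2r _ 2)// ?nnegrE ?enorm_ge0//.
by rewrite -normrX ger0_norm ?sqr_ge0// !expr2 enorm_sqr coord_sqr_le.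
Qed.

Lemma norm_dot_le x y : `|dot x y| <= enorm x * enorm y.
Proof.
have cs : dot x y * dot x y <= dot x x * dot y y.
  have [y0|y0] := eqVneq (dot y y) 0.
    suff -> : dot x y = 0 by rewrite !mul0r mulr_ge0// dot_ge0.
    have : (forall i : 'I_d, y ord0 i = 0).
      move=> i; apply/eqP; rewrite -sqrf_eq0 expr2; apply/eqP/le_anti.
      by rewrite -{1}y0 coord_sqr_le/= -expr2 sqr_ge0.
    by move=> h; rewrite /dot big1// => i _; rewrite h mulr0.
  have yy : 0 < dot y y by rewrite lt0r y0 dot_ge0.
  (* Cauchy-Schwarz: expand this square and divide by [dot y y]. *)
  have := dot_ge0 (dot y y *: x - dot x y *: y).
  have dZl (c : R) u v : dot (c *: u) v = c * dot u v.
    by rewrite /dot mulr_sumr; apply: eq_bigr => i _; rewrite mxE mulrA.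
  rewrite !(dotDl, dotDr, dotNl, dotNr, dZl) !(dotC _ (_ *: _)) !dZl (dotC y x).
  set p := dot x y; set q := dot x x; set s := dot y y in yy *.
  move=> h; have {h} : 0 <= s * (q * s - p * p) by nra.
  by rewrite pmulr_rge0// subr_ge0.
rewrite -(@ler_pXn2r _ 2)// ?nnegrE ?mulr_ge0 ?enorm_ge0//.
by rewrite -normrX ger0_norm ?sqr_ge0// !expr2 mulrACA !enorm_sqr.
Qed.

Lemma enormD_le x y : enorm (x + y) <= enorm x + enorm y.
Proof.
rewrite -(@ler_pXn2r _ 2)// ?nnegrE ?addr_ge0 ?enorm_ge0//.
rewrite !expr2 enorm_sqr !(dotDl, dotDr) (dotC y x) mulrDl !mulrDr !enorm_sqr.
have := norm_dot_le x y; have := ler_norm (dot x y); nra.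
Qed.

Lemma measurable_dot d' (T : measurableType d') (f g : T -> 'rV[R]_d) :
  measurable_fun setT f -> measurable_fun setT g ->
  measurable_fun setT (fun t => dot (f t) (g t)).
Proof.
move=> mf mg; rewrite /dot; apply: measurable_sum => i.
by apply: measurable_funM; exact: (measurableT_comp (measurable_coord i)).
Qed.

Lemma measurable_enorm : measurable_fun setT (@enorm R d).
Proof.
apply: (@measurableT_comp _ _ _ _ _ _ (Num.sqrt : R -> R) _ (fun x : 'rV[R]_d => dot x x)).
  by apply: continuous_measurable_fun; exact: sqrt_continuous.
exact: measurable_dot.
Qed.

Lemma measurable_rowD d' (T : measurableType d') (f g : T -> 'rV[R]_d) :
  measurable_fun setT f -> measurable_fun setT g ->
  measurable_fun setT (fun t => f t + g t).
Proof.
move=> mf mg; apply: measurable_rowP => i; under eq_fun do rewrite mxE.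
by apply: measurable_funD; exact: (measurableT_comp (measurable_coord i)).
Qed.

Lemma measurable_rowN d' (T : measurableType d') (f : T -> 'rV[R]_d) :
  measurable_fun setT f -> measurable_fun setT (fun t => - f t).
Proof.
move=> mf; apply: measurable_rowP => i; under eq_fun do rewrite mxE.
by apply: measurableT_comp => //; exact: (measurableT_comp (measurable_coord i)).
Qed.

Lemma measurable_rowB d' (T : measurableType d') (f g : T -> 'rV[R]_d) :
  measurable_fun setT f -> measurable_fun setT g ->
  measurable_fun setT (fun t => f t - g t).
Proof. by move=> mf mg; apply: measurable_rowD => //; exact: measurable_rowN. Qed.

End dot.

(** * The heat kernel and its Fourier transform *)

Section heat.
Context {R : realType}.
Implicit Types e : R.

Lemma measurable_gauss1 e : measurable_fun setT (gauss1 e).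
Proof. by apply: continuous_measurable_fun; exact: continuous_gauss1. Qed.

Lemma L1_tuple_gauss1 e n : 0 < e ->
  L1 (tuple_measure lam n) (fun t => \prod_(i < n) gauss1 e (tnth t i)).
Proof.
move=> e0.
have mp k : measurable_fun setT (fun t : k.-tuple R => \prod_(i < k) gauss1 e (tnth t i)).
  apply: measurable_prod => i _; apply: measurableT_comp; first exact: measurable_gauss1.
  exact: measurable_tnth.
elim: n => [|n IH].
  apply/L1P; first exact: mp.
  under eq_integral do rewrite big_ord0 normr1.
  by rewrite integral_cst//= diracT mul1e ltry.
apply/(mpres_L1 (mpres_cons lam n)) => //.
  exact: mp.
apply: (L1_prod_le (g := gauss1 e) (h := fun t : n.-tuple R => \prod_(i < n) gauss1 e (tnth t i))) => //.
- by apply: measurableT_comp; [exact: mp|exact: (mpres_cons lam n).1].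
- move=> x t /=; rewrite big_ord_recl tnth0 ger0_norm.
    by rewrite le_eqVlt; apply/orP; left; apply/eqP; congr (_ * _); apply: eq_bigr => i _; rewrite tnthS.
  rewrite mulr_ge0 ?gauss1_ge0// prodr_ge0// => i _; exact: gauss1_ge0.
- exact: L1_gauss1.
Qed.

Lemma tuple_gauss1_fourier e n (xi : nat -> R) (al : R) : 0 < e ->
  \int[tuple_measure lam n]_t (cos (al + \sum_(i < n) xi i * tnth t i) *
      \prod_(i < n) gauss1 e (tnth t i)) =
  cos al * expR (- (e * (\sum_(i < n) xi i * xi i) / 2)).
Proof.
move=> e0.
have mp k (z : nat -> R) b : measurable_fun setT (fun t : k.-tuple R =>
    cos (b + \sum_(i < k) z i * tnth t i) * \prod_(i < k) gauss1 e (tnth t i)).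
  apply: measurable_funM.
    apply: (measurableT_comp (f := cos)).
      by apply: continuous_measurable_fun; exact: continuous_cos.
    apply: measurable_funD => //; apply: measurable_sum => i.
    by apply: measurable_funM => //; exact: measurable_tnth.
  exact: L1_measurable (L1_tuple_gauss1 k e0).
have Lp k (z : nat -> R) b : L1 (tuple_measure lam k) (fun t : k.-tuple R =>
    cos (b + \sum_(i < k) z i * tnth t i) * \prod_(i < k) gauss1 e (tnth t i)).
  apply: (L1_le _ _ (L1_tuple_gauss1 k e0)); first exact: mp.
  move=> t; have p0 : 0 <= \prod_(i < k) gauss1 e (tnth t i).
    by rewrite prodr_ge0// => i _; exact: gauss1_ge0.
  by rewrite normrM (ger0_norm p0) ler_piMl// cos_max.
elim: n xi al => [|n IH] xi al.
  rewrite /Rintegral; under eq_integral do rewrite !big_ord0 mulr1 addr0.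
  rewrite integral_cst// [X in (_ * X)%E](_ : _ = 1%E); last exact: diracT.
  by rewrite mule1 !big_ord0 mulr0 mul0r oppr0 expR0 mulr1.
rewrite (mpres_RI (mpres_cons lam n)); last exact: mp.
have L := (mpres_L1 (mpres_cons lam n) (mp n.+1 xi al)).1 (Lp n.+1 xi al).
rewrite (RI_prod12 L) /=.
(* The induction hypothesis is taken with phase [al + xi 0 * x]: for the remaining coordinates, the
   first one is a mere phase. *)
transitivity (\int[lam]_x (cos (al + xi 0%N * x) * gauss1 e x *
    expR (- (e * (\sum_(i < n) xi i.+1 * xi i.+1) / 2)))).
  apply: eq_RI => x.
  have := IH (fun i => xi i.+1) (al + xi 0%N * x).
  move=> IHx; rewrite mulrAC -IHx -RIZr; last exact: (Lp n (fun i => xi i.+1)).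
  apply: eq_RI => t; rewrite !big_ord_recl/= tnth0 addrA.
  under eq_bigr do rewrite tnthS.
  under [X in _ * (_ * X) = _]eq_bigr do rewrite tnthS.
  rewrite -[RHS]mulrA [X in _ = _ * X]mulrC; congr (cos (_ + _) * _).
rewrite RIZr ?gauss1_fourier//; last first.
  apply: L1_trig_gauss1 => //; first exact: continuous_cosM.
  by move=> x; rewrite cos_max.
rewrite -[LHS]mulrA -expRD big_ord_recl/=; congr (_ * expR _).
  by rewrite mulrDr mulrDl opprD.
Qed.

Context {d : nat}.
Implicit Types x y xi : 'rV[R]_d.

Lemma heatE e x : 0 < e -> heat e x = \prod_(i < d) gauss1 e (x ord0 i).
Proof.
move=> e0; rewrite /heat /gauss1 big_split/= prodr_const card_ord -expR_sum; congr (_ * _).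
  rewrite -powR_mulrn ?powR_ge0// -powRrM; congr (_ `^ _).
  by rewrite mulNr; congr (- _); rewrite mulrC mul1r.
congr expR; rewrite /dot mulr_suml -sumrN.
by apply: eq_bigr.
Qed.

Lemma heat_ge0 e x : 0 <= heat e x.
Proof. by rewrite mulr_ge0 ?powR_ge0 ?expR_ge0. Qed.

Lemma norm_cosM_le (t g : R) : 0 <= g -> `|cos t * g| <= g.
Proof. by move=> g0; rewrite normrM (ger0_norm g0) ler_piMl// cos_max. Qed.

Lemma heatN e x : heat e (- x) = heat e x.
Proof. by rewrite /heat dotNN. Qed.

Lemma measurable_heat e : measurable_fun setT (@heat R d e).
Proof.
apply: measurable_funM => //; apply: measurableT_comp => //; apply: measurableT_comp => //.
by apply: measurable_funM => //; exact: measurable_dot.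
Qed.

Lemma L1_heat e : 0 < e -> L1 leb (@heat R d e).
Proof.
move=> e0; apply/(mpres_L1 mpres_rowt); first exact: measurable_heat.
have := L1_tuple_gauss1 d e0; apply: eq_integrable => // t _ /=.
by rewrite heatE//; under [in RHS]eq_bigr do rewrite mxE.
Qed.

(** The Fourier transform of [heat e], used both as a convergence factor in frequency and as a
    cut-off in space. *)
Definition ghat e xi : R := expR (- (e * dot xi xi / 2)).

Lemma ghat_ge0 e xi : 0 <= ghat e xi. Proof. exact: expR_ge0. Qed.

Lemma ghat0 e : ghat e 0 = 1.
Proof. by rewrite /ghat dot0l mulr0 mul0r oppr0 expR0. Qed.

Lemma heat_fourier e xi al : 0 < e ->
  \int[leb]_x (cos (al + dot xi x) * heat e x) = cos al * ghat e xi.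
Proof.
rewrite /ghat => e0; rewrite (mpres_RI mpres_rowt); last first.
  apply: measurable_funM; last exact: measurable_heat.
  apply: (measurableT_comp (f := cos)).
    by apply: continuous_measurable_fun; exact: continuous_cos.
  by apply: measurable_funD => //; exact: measurable_dot.
pose z (i : nat) : R := if insub i is Some j then xi ord0 j else 0.
have zE (i : 'I_d) : z i = xi ord0 i by rewrite /z valK.
have := tuple_gauss1_fourier d z al e0.
under [X in _ = _ * expR (- (_ * X / _)) -> _]eq_bigr do rewrite zE.
rewrite -/(dot xi xi) => <-; apply: eq_RI => t.
rewrite heatE// /dot; congr (cos (al + _) * _).
  by apply: eq_bigr => i _; rewrite zE mxE.
by apply: eq_bigr => i _; rewrite mxE.
Qed.

Lemma RI_heat e : 0 < e -> \int[leb]_x @heat R d e x = 1.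
Proof.
move=> e0; have := heat_fourier 0 0 e0.
rewrite ghat0 cos0 mulr1 => <-.
by apply: eq_RI => x; rewrite dot0l addr0 cos0 mul1r.
Qed.

Lemma measurable_cosdot d' (T : measurableType d') (al : T -> R) (f g : T -> 'rV[R]_d) :
  measurable_fun setT al -> measurable_fun setT f -> measurable_fun setT g ->
  measurable_fun setT (fun t => cos (al t + dot (f t) (g t))).
Proof.
move=> ma mf mg; apply: (measurableT_comp (f := cos)).
  by apply: continuous_measurable_fun; exact: continuous_cos.
by apply: measurable_funD => //; exact: measurable_dot.
Qed.

Lemma ghat_le1 e xi : 0 <= e -> ghat e xi <= 1.
Proof. by move=> e0; rewrite expR_le1 oppr_le0 divr_ge0// mulr_ge0// dot_ge0. Qed.

Lemma ghatD e e' xi : ghat (e + e') xi = ghat e xi * ghat e' xi.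
Proof. by rewrite /ghat -expRD; congr expR; ring. Qed.

Lemma ghatN e xi : ghat e (- xi) = ghat e xi.
Proof. by rewrite /ghat dotNN. Qed.

Lemma ghatE e xi : 0 < e ->
  ghat e xi = (2 * pi / e) `^ (d%:R / 2) * heat e^-1 xi.
Proof.
move=> e0; rewrite /heat mulrA -powRD; last by rewrite addrN eqxx/= mulf_neq0// ?invr_neq0 ?gt_eqF// mulr_gt0// pi_gt0.
rewrite addrN powRr0 mul1r /ghat; congr expR; rewrite invfM invrK.
by congr (- _); ring.
Qed.

Lemma measurable_ghat e : measurable_fun setT (@ghat e).
Proof.
apply: measurableT_comp => //; apply: measurableT_comp => //.
by apply: measurable_funM => //; apply: measurable_funM => //; exact: measurable_dot.
Qed.

Lemma L1_ghat e : 0 < e -> L1 leb (ghat e).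
Proof.
move=> e0; have e1 : 0 < e^-1 by rewrite invr_gt0.
have := L1Z ((2 * pi / e) `^ (d%:R / 2)) (L1_heat e1).
by apply: eq_integrable => // x _ /=; rewrite -ghatE.
Qed.

(** By [ghatE] a Gaussian in frequency is a multiple of the heat kernel of inverse variance, so
    inversion is again [heat_fourier]. *)
Lemma heat_inversion e x al : 0 < e ->
  \int[leb]_xi (cos (al + dot x xi) * ghat e xi) =
  (2 * pi) `^ d%:R * (cos al * heat e x).
Proof.
move=> e0; have e1 : 0 < e^-1 by rewrite invr_gt0.
under eq_RI do rewrite (ghatE _ e0) mulrCA.
rewrite RIZ; last first.
  apply: (L1_le _ _ (L1_heat e1)).
    by apply: measurable_funM; [exact: measurable_cosdot|exact: measurable_heat].
  by move=> y; apply: norm_cosM_le; exact: heat_ge0.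
rewrite heat_fourier// mulrCA [RHS]mulrCA; congr (_ * _); rewrite /ghat.
have p0 : 0 < 2 * pi :> R by rewrite mulr_gt0// pi_gt0.
rewrite /heat mulrA; congr (_ * expR _); last by rewrite invfM mulrC; congr (- _); ring.
rewrite (@powRM _ (2 * pi) e) ?ltW// mulrA -powRD; last by rewrite (gt_eqF p0) implybT.
rewrite (@powRM _ (2 * pi) e^-1) ?ltW//.
rewrite -(powR_inv1 (ltW e0)) -powRrM mulN1r; congr (_ `^ _ * _).
by field.
Qed.

Lemma L1_heatB e x : 0 < e -> L1 leb (fun y => heat e (x - y)).
Proof.
move=> e0; apply/(mpres_L1 (leb_reflection x)).
  apply: (measurableT_comp (f := heat e)); first exact: measurable_heat.
  exact: measurable_rowB.
have := L1_heat e0; apply: eq_integrable => // y _ /=.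
by rewrite opprB addrC subrK.
Qed.

Lemma RI_leb_subl (x : 'rV[R]_d) (f : 'rV[R]_d -> R) : measurable_fun setT f ->
  \int[leb]_y f (x - y) = \int[leb]_y f y.
Proof. by move=> mf; rewrite -(mpres_RI (leb_reflection x)). Qed.

Lemma RI_leb_addl (x : 'rV[R]_d) (f : 'rV[R]_d -> R) : measurable_fun setT f ->
  \int[leb]_y f (x + y) = \int[leb]_y f y.
Proof. by move=> mf; rewrite -(mpres_RI (leb_translation x)). Qed.

Lemma RI_heatB e x : 0 < e -> \int[leb]_y heat e (x - y) = 1.
Proof. by move=> e0; rewrite RI_leb_subl ?RI_heat//; exact: measurable_heat. Qed.

Lemma heat_split e x : 0 < e ->
  heat e x = (Num.sqrt 2) ^+ d * (heat (2 * e) x * expR (- (dot x x / (4 * e)))).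
Proof.
move=> e0; rewrite !heatE ?mulr_gt0//.
rewrite (eq_bigr _ (fun i _ => gauss1_split (x ord0 i) e0)) big_split/= big_split/=.
rewrite prodr_const card_ord; congr (_ * (_ * _)).
rewrite -expR_sum; congr expR; rewrite /dot mulr_suml -sumrN.
by apply: eq_bigr.
Qed.

Lemma heat_le e x : 0 < e -> heat e x <= (2 * pi * e) `^ (- (d%:R / 2)).
Proof.
move=> e0; rewrite /heat ler_piMr ?powR_ge0// expR_le1 oppr_le0 divr_ge0 ?dot_ge0//.
by rewrite mulr_ge0 ?ltW.
Qed.

#[local] Opaque heat ghat.

(** On the Fourier side the transforms multiply, by [ghatD]; [heat a] is written by inversion, and
    the two Gaussians allow Fubini's theorem. *)
Lemma heat_semigroup a b x : 0 < a -> 0 < b ->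
  \int[leb]_y (heat a (x - y) * heat b y) = heat (a + b) x.
Proof.
move=> a0 b0; have ab0 : 0 < a + b by rewrite addr_gt0.
have p0 : 0 < 2 * pi :> R by rewrite mulr_gt0// pi_gt0.
have q0 : (2 * pi) `^ d%:R != 0 :> R by rewrite gt_eqF// powR_gt0.
apply: (mulfI q0) => /=.
have := heat_inversion x 0 ab0; rewrite cos0 mul1r => <-.
have mF : measurable_fun setT (fun p : 'rV[R]_d * 'rV[R]_d =>
    cos (0 + dot (x - p.1) p.2) * ghat a p.2 * heat b p.1).
  apply: measurable_funM; last by apply: measurableT_comp => //; exact: measurable_heat.
  apply: measurable_funM; last by apply: measurableT_comp => //; exact: measurable_ghat.
  by apply: measurable_cosdot => //; exact: measurable_rowB.
have LF : L1 (leb \x leb)%E (fun p : 'rV[R]_d * 'rV[R]_d =>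
    cos (0 + dot (x - p.1) p.2) * ghat a p.2 * heat b p.1).
  apply: (L1_prod_le mF _ (L1_heat b0) (L1_ghat a0)) => u v /=.
  rewrite 2!normrM (ger0_norm (heat_ge0 _ _)) (ger0_norm (ghat_ge0 _ _)) mulrC.
  by rewrite ler_wpM2l ?heat_ge0// ler_piMl ?ghat_ge0// cos_max.
have := RI_fubini LF => /= E.
transitivity (\int[leb]_y \int[leb]_xi (cos (0 + dot (x - y) xi) * ghat a xi * heat b y)).
  rewrite -RIZ; last first.
    apply: (L1_le _ _ (L1Z ((2 * pi * a) `^ (- (d%:R / 2))) (L1_heat b0))).
      apply: measurable_funM; last exact: measurable_heat.
      apply: (measurableT_comp (f := heat a)); first exact: measurable_heat.
      exact: measurable_rowB.
    move=> y; rewrite (ger0_norm (mulr_ge0 (heat_ge0 _ _) (heat_ge0 _ _))).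
    by apply: ler_wpM2r; [exact: heat_ge0|exact: heat_le].
  apply: eq_RI => y; rewrite RIZr.
    by rewrite (heat_inversion (x - y) 0 a0) cos0 (mul1r (heat a (x - y))) mulrA.
  apply: (L1_le _ _ (L1_ghat a0)).
    by apply: measurable_funM; [exact: measurable_cosdot|exact: measurable_ghat].
  by move=> xi; apply: norm_cosM_le; exact: ghat_ge0.
rewrite E; apply: eq_RI => xi.
transitivity (ghat a xi * \int[leb]_y (cos (dot x xi + dot (- xi) y) * heat b y)).
  rewrite -RIZ; last first.
    apply: (L1_le _ _ (L1_heat b0)).
      by apply: measurable_funM; [exact: measurable_cosdot|exact: measurable_heat].
    by move=> y; apply: norm_cosM_le; exact: heat_ge0.
  apply: eq_RI => y; rewrite add0r dotBl dotNl (dotC xi y).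
  by rewrite mulrAC mulrC.
rewrite heat_fourier; last first.
  exact: b0.
rewrite ghatN.
rewrite add0r.
rewrite mulrCA.
rewrite -ghatD.
reflexivity.
Qed.

(** At distance at least [eta] from [z], [heat_split] leaves a kernel of mass 1, a constant, and a
    factor at most [4 * e / (eta * eta)], so this part is of order [e]; inside the ball continuity
    at [z] decides. *)
Lemma heat_approx (e_ : nat -> R) (psi : 'rV[R]_d -> R) (M : R) z :
  (forall n, 0 < e_ n) -> e_ @ \oo --> 0 -> measurable_fun setT psi ->
  (forall y, `|psi y| <= M) ->
  (forall eps, 0 < eps -> exists2 eta, 0 < eta &
     forall y, enorm (z - y) < eta -> `|psi y - psi z| <= eps) ->
  \int[leb]_y (psi y * heat (e_ n) (z - y)) @[n --> \oo] --> psi z.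
Proof.
move=> e0 ecvg mpsi hM hc; apply/cvgrPdist_le => eps eps0.
have [eta eta0 heta] := hc (eps / 2) (divr_gt0 eps0 (ltr0Sn _ 1)).
have M0 : 0 <= M by rewrite (le_trans _ (hM 0)).
pose K := 2 * M * (Num.sqrt 2) ^+ d * 4 / (eta * eta).
have K0 : 0 <= K.
  by rewrite /K divr_ge0 ?mulr_ge0 ?exprn_ge0 ?sqrtr_ge0// ltW.
have [N _ hN] : \forall n \near \oo, K * e_ n <= eps / 2.
  have : K * e_ n @[n --> \oo] --> K * 0 by apply: cvgM; [exact: cvg_cst|].
  rewrite mulr0 => /cvgrPdist_le /(_ (eps / 2)) h.
  have := h (divr_gt0 eps0 (ltr0Sn _ 1)); apply: filterS => n.
  by rewrite sub0r normrN; apply: le_trans; exact: ler_norm.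
near=> n; have {hN} hn : K * e_ n <= eps / 2 by apply: hN; near: n; exists N.
have en := e0 n; have en2 : 0 < 2 * e_ n by rewrite mulr_gt0.
have mh e : measurable_fun setT (fun y => heat e (z - y)).
  by apply: (measurableT_comp (f := heat e)); [exact: measurable_heat|exact: measurable_rowB].
have L : L1 leb (fun y => psi y * heat (e_ n) (z - y)).
  apply: (L1_le _ _ (L1Z M (L1_heatB z en))); first exact: measurable_funM.
  by move=> y; rewrite normrM (ger0_norm (heat_ge0 _ _)) ler_wpM2r ?heat_ge0.
have -> : psi z = \int[leb]_y (psi z * heat (e_ n) (z - y)).
  by rewrite RIZ ?RI_heatB ?mulr1//; exact: L1_heatB.
rewrite -RIB//; last by apply: L1Z; exact: L1_heatB.
apply: (@le_trans _ _ (\int[leb]_y (eps / 2 * heat (e_ n) (z - y) +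
    (K * e_ n) * heat (2 * e_ n) (z - y)))); last first.
  rewrite RID; [|by apply: L1Z; exact: L1_heatB|by apply: L1Z; exact: L1_heatB].
  rewrite RIZ; last exact: L1_heatB.
  rewrite RIZ; last exact: L1_heatB.
  by rewrite !RI_heatB// !mulr1; lra.
apply: norm_RI_le.
- by apply: measurable_funB; apply: measurable_funM.
- move=> y; rewrite -mulrBl normrM (ger0_norm (heat_ge0 _ _)).
  have Ke0 : 0 <= K * e_ n by rewrite mulr_ge0// ltW.
  have [ylt|yge] := ltP (enorm (z - y)) eta.
    apply: ler_wpDr; first by rewrite (mulr_ge0 Ke0)// heat_ge0.
    by rewrite ler_wpM2r ?heat_ge0// distrC heta.
  apply: ler_wpDl; first by rewrite mulr_ge0 ?heat_ge0// divr_ge0// ltW.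
  rewrite (heat_split _ en).
  have h1 : `|psi z - psi y| <= 2 * M.
    rewrite (le_trans (ler_normB _ _))// mulrDl mul1r lerD//.
  have h2 : expR (- (dot (z - y) (z - y) / (4 * e_ n))) <= 4 * e_ n / (eta * eta).
    rewrite expRN invf_ple ?posrE ?expR_gt0//; last first.
      by rewrite divr_gt0 ?mulr_gt0.
    rewrite invf_div; set w := dot _ _ / _.
    have w0 : 0 <= w by rewrite /w divr_ge0 ?dot_ge0// mulr_ge0// ltW.
    have : 1 + w <= expR w.
      by have := @expR_ge1Dxn R w 0 w0; rewrite expr1 factS fact0 muln1 divr1.
    apply: le_trans; apply: ler_wpDl => //; rewrite /w ler_wpM2r//.
      by rewrite invr_ge0 mulr_ge0// ltW.
    by rewrite -enorm_sqr ler_pM// ltW.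
  rewrite /K; set s := (_ ^+ d); have s0 : 0 <= s by rewrite exprn_ge0 ?sqrtr_ge0.
  rewrite (_ : _ * (s * _) = (`|psi z - psi y| * s * expR (- (dot (z - y) (z - y) / (4 * e_ n)))) * heat (2 * e_ n) (z - y)); last by ring.
  rewrite ler_wpM2r ?heat_ge0//.
  rewrite (_ : 2 * M * s * 4 / (eta * eta) * e_ n = 2 * M * s * (4 * e_ n / (eta * eta))); last by ring.
  by rewrite ler_pM ?mulr_ge0 ?expR_ge0// ler_wpM2r.
- by apply: L1D; apply: L1Z; exact: L1_heatB.
Unshelve. all: end_near. Qed.

End heat.
Arguments ghat {R d}.

(** * Gaussian waves are Schwartz functions *)

#[local] Opaque heat ghat gauss1.

Section partial_derivatives.
Context {R : realType} {d : nat}.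
Implicit Types (f g h : 'rV[R]_d -> R) (i j : 'I_d) (x : 'rV[R]_d).

Definition has_partial f i x (df : R) :=
  differentiable f x /\ 'D_(delta_mx ord0 i) f x = df.

Lemma has_partial_coord j i x :
  has_partial (fun y => y ord0 j) i x (i == j)%:R.
Proof.
split; first exact: differentiable_coord.
rewrite deriveE; last exact: differentiable_coord.
have @f : {linear 'rV[R]_d -> R}.
  by exists (fun N : 'rV[R]_d => N ord0 j); do 2![eexists]; do ?[constructor]; rewrite ?mxE// => ? *; rewrite ?mxE//; move=> ?; rewrite !mxE.
rewrite (_ : (fun y : 'rV[R]_d => y ord0 j) = f)// diff_lin; last exact: coord_continuous.
by rewrite /f /= mxE eqxx/= eq_sym.
Qed.

Lemma has_partial_cst (c : R) i x : has_partial (fun=> c) i x 0.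
Proof. by split; [exact: differentiable_cst|exact: derive_cst]. Qed.

Lemma has_partialD f g i x df dg : has_partial f i x df -> has_partial g i x dg ->
  has_partial (fun y => f y + g y) i x (df + dg).
Proof.
move=> [f1 f2] [g1 g2]; split; first exact: differentiableD.
by rewrite -f2 -g2; apply: deriveD; exact: diff_derivable.
Qed.

Lemma has_partialM f g i x df dg : has_partial f i x df -> has_partial g i x dg ->
  has_partial (fun y => f y * g y) i x (f x * dg + g x * df).
Proof.
move=> [f1 f2] [g1 g2]; split; first exact: differentiableM.
by rewrite -f2 -g2; apply: deriveM; exact: diff_derivable.
Qed.

Lemma has_partial_comp (g : R -> R) h i x dg dh : has_partial h i x dh ->
  is_derive (h x) 1 g dg -> has_partial (fun y => g (h y)) i x (dg * dh).
Proof.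
move=> [h1 h2] [g1 g2]; have g3 : differentiable g (h x) by apply/derivable1_diffP.
have gh : differentiable (g \o h) x by exact: differentiable_comp.
split => //; rewrite -/(g \o h) (deriveE _ gh) diff_comp//= -(deriveE _ h1) h2.
have -> : dh = dh *: (1 : R) by rewrite /GRing.scale/= mulr1.
by rewrite linearZ/= -deriveE// g2 /GRing.scale/= mulrC mulr1.
Qed.

Lemma has_partial_sum n (F : 'I_n -> 'rV[R]_d -> R) i x (dF : 'I_n -> R) :
  (forall j : 'I_n, has_partial (F j) i x (dF j)) ->
  has_partial (fun y => \sum_(j < n) F j y) i x (\sum_(j < n) dF j).
Proof.
elim: n F dF => [|n IH] F dF h.
  rewrite big_ord0; under eq_fun do rewrite big_ord0; exact: has_partial_cst.
rewrite big_ord_recl; under eq_fun do rewrite big_ord_recl.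
by apply: has_partialD => //; exact: IH.
Qed.

Definition gwave (c : R) (m k : 'rV[R]_d) (al : R) x :=
  expR (- (c * dot (x - m) (x - m))) * cos (al + dot k x).

Lemma has_partial_gwave c m k al i x : has_partial (gwave c m k al) i x
  ((- 2 * c) * (x ord0 i * gwave c m k al x) +
   ((2 * c * m ord0 i) * gwave c m k al x + k ord0 i * gwave c m k (al + pi / 2) x)).
Proof.
have hc j : has_partial (fun y => (y - m) ord0 j) i x (i == j)%:R.
  under eq_fun do rewrite !mxE.
  by rewrite -[_%:R]addr0; apply: has_partialD; [exact: has_partial_coord|exact: has_partial_cst].
have h1 : has_partial (fun y => dot (y - m) (y - m)) i x (2 * (x - m) ord0 i).
  have := has_partial_sum (fun j => has_partialM (hc j) (hc j)).
  rewrite (bigD1 i)//= big1 ?addr0; last first.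
    by move=> j ji; rewrite eq_sym (negbTE ji) mulr0 addr0.
  by congr has_partial; rewrite eqxx/= !mulr1 mulrDl !mul1r.
have h2 : has_partial (fun y => - (c * dot (y - m) (y - m))) i x (- (c * (2 * (x - m) ord0 i))).
  rewrite -mulNr; under eq_fun do rewrite -mulNr.
  have := has_partialM (has_partial_cst (- c) i x) h1.
  by rewrite mulr0 addr0.
have h3 := has_partial_comp h2 (is_derive_expR _).
have h4 : has_partial (fun y => al + dot k y) i x (k ord0 i).
  rewrite -[X in has_partial _ _ _ X]add0r; apply: has_partialD; first exact: has_partial_cst.
  have := has_partial_sum (fun j => has_partialM (has_partial_cst (k ord0 j) i x) (has_partial_coord j i x)).
  rewrite (bigD1 i)//= big1 ?addr0; last first.
    by move=> j ji; rewrite eq_sym (negbTE ji) !mulr0 addr0.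
  by rewrite eqxx mulr1 mulr0 addr0.
have h5 := has_partial_comp h4 (is_derive_cos _).
have := has_partialM h3 h5; rewrite -/(gwave c m k al).
congr has_partial.
rewrite /gwave addrAC (cosD (al + _)) cos_pihalf sin_pihalf !mxE; ring.
Qed.

(** Large enough to be stable under partial derivatives, small enough for rapid decay: two
    inductions over it give all Schwartz seminorms without a formula for iterated derivatives. *)
Inductive gclass (c : R) (m k : 'rV[R]_d) : ('rV[R]_d -> R) -> Prop :=
| gclass_gwave al : gclass c m k (gwave c m k al)
| gclass0 : gclass c m k (fun=> 0)
| gclassM i f : gclass c m k f -> gclass c m k (fun x => x ord0 i * f x)
| gclassD (a : R) f g : gclass c m k f -> gclass c m k g ->
    gclass c m k (fun x => a * f x + g x).

Lemma gclass_partial c m k f i : gclass c m k f ->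
  exists2 df, gclass c m k df & forall x, has_partial f i x (df x).
Proof.
elim=> [al||j {}f hf [df h1 h2]|a {}f g hf [df h1 h2] hg [dg h3 h4]].
- exists (fun x => (- 2 * c) * (x ord0 i * gwave c m k al x) +
   ((2 * c * m ord0 i) * gwave c m k al x +
    (k ord0 i * gwave c m k (al + pi / 2) x + 0))).
    apply: gclassD; first by apply: gclassM; exact: gclass_gwave.
    apply: gclassD; first exact: gclass_gwave.
    by apply: gclassD; [exact: gclass_gwave|exact: gclass0].
  by move=> x; rewrite addr0; exact: has_partial_gwave.
- by exists (fun=> 0); [exact: gclass0|move=> x; exact: has_partial_cst].
- exists (fun x => 1 * (x ord0 j * df x) + ((i == j)%:R * f x + 0)).
    by apply: gclassD; [exact: gclassM|apply: gclassD => //; exact: gclass0].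
  move=> x; have := has_partialM (has_partial_coord j i x) (h2 x).
  by congr has_partial; ring.
- exists (fun x => a * df x + dg x); first exact: gclassD.
  move=> x; have := has_partialD (has_partialM (has_partial_cst a i x) (h2 x)) (h4 x).
  by congr has_partial; ring.
Qed.

Lemma gclass_partials c m k f (l : seq 'I_d) : gclass c m k f ->
  gclass c m k (partials l f).
Proof.
move=> hf; elim: l => [//|i l IH] /=.
have [df h1 h2] := gclass_partial i IH.
rewrite (_ : (fun x => _) = df)//; apply/funext => x.
by have [_ ->] := h2 x.
Qed.

Lemma poly_expR_bound (c : R) (n : nat) : 0 < c ->
  exists C, forall r, 0 <= r -> (1 + r) ^+ n <= C * expR (c * (r * r)).
Proof.
(* The [n]-th power of [expR (c' * (r * r))] stays below [expR (c * (r * r))]; dividing by [n.+1]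
   also covers [n = 0]. *)
move=> c0; pose c' := c / n.+1%:R; have c'0 : 0 < c' by rewrite divr_gt0.
exists ((2 + c'^-1) ^+ n) => r r0.
have h : 1 + r <= (2 + c'^-1) * expR (c' * (r * r)).
  have w0 : 0 <= c' * (r * r) by rewrite mulr_ge0 ?mulr_ge0// ltW.
  have e : 1 + c' * (r * r) <= expR (c' * (r * r)).
    by have := @expR_ge1Dxn R (c' * (r * r)) 0 w0; rewrite expr1 factS fact0 muln1 divr1.
  have ci : 0 < c'^-1 by rewrite invr_gt0.
  apply: (@le_trans _ _ ((2 + c'^-1) * (1 + c' * (r * r)))); last first.
    by rewrite ler_wpM2l// addr_ge0// ltW.
  have -> : (2 + c'^-1) * (1 + c' * (r * r)) = 2 + c'^-1 + 2 * c' * (r * r) + r * r.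
    by field; rewrite gt_eqF.
  nra.
apply: (@le_trans _ _ (((2 + c'^-1) * expR (c' * (r * r))) ^+ n)).
  by rewrite lerXn2r ?nnegrE ?mulr_ge0 ?expR_ge0 ?addr_ge0 ?invr_ge0// ltW.
rewrite exprMn ler_wpM2l ?exprn_ge0 ?addr_ge0 ?invr_ge0 ?(ltW c'0)//.
rewrite -expRM_natl ler_expR /c'.
rewrite (_ : n%:R * _ = (n%:R / n.+1%:R) * (c * (r * r))); last by field; rewrite nat1r pnatr_eq0.
rewrite ler_piMl ?mulr_ge0// ?(ltW c0)//.
by rewrite ler_pdivrMr// mul1r ler_nat.
Qed.

(** The exponent is generalized in the induction: multiplication by a coordinate is paid for with
    one more power of [1 + enorm x]. *)
Lemma gclass_bound c m k f n : 0 < c -> gclass c m k f ->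
  exists C, forall x, (1 + enorm x) ^+ n * `|f x| <= C.
Proof.
move=> c0 hf; elim: hf n => [al||j {}f hf IH|a {}f g hf IHf hg IHg] n.
- have [C hC] := poly_expR_bound n c0.
  exists ((1 + enorm m) ^+ n * C) => x.
  have h1 : 1 + enorm x <= (1 + enorm m) * (1 + enorm (x - m)).
    have := enormD_le (x - m) m; rewrite subrK.
    have := enorm_ge0 m; have := enorm_ge0 (x - m); nra.
  have h2 : `|gwave c m k al x| <= (expR (c * (enorm (x - m) * enorm (x - m))))^-1.
    rewrite /gwave normrM ger0_norm ?expR_ge0// -expRN enorm_sqr.
    by rewrite ler_piMr ?expR_ge0// cos_max.
  apply: (@le_trans _ _ (((1 + enorm m) * (1 + enorm (x - m))) ^+ n *
      (expR (c * (enorm (x - m) * enorm (x - m))))^-1)).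
    rewrite ler_pM ?exprn_ge0 ?addr_ge0 ?enorm_ge0//.
    by rewrite lerXn2r ?nnegrE ?mulr_ge0 ?addr_ge0 ?enorm_ge0.
  rewrite exprMn -mulrA ler_wpM2l ?exprn_ge0 ?addr_ge0 ?enorm_ge0//.
  by rewrite ler_pdivrMr ?expR_gt0// hC// enorm_ge0.
- by exists 0 => x; rewrite normr0 mulr0.
- have [C hC] := IH n.+1; exists C => x; apply: le_trans (hC x).
  rewrite normrM exprSr -mulrA ler_wpM2l ?exprn_ge0 ?addr_ge0 ?enorm_ge0//.
  rewrite ler_wpM2r// (le_trans (coord_le_enorm x j))//; lra.
- have [C1 h1] := IHf n; have [C2 h2] := IHg n; exists (`|a| * C1 + C2) => x.
  apply: (@le_trans _ _ ((1 + enorm x) ^+ n * (`|a| * `|f x| + `|g x|))).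
    by rewrite ler_wpM2l ?exprn_ge0 ?addr_ge0 ?enorm_ge0// -normrM ler_normD.
  by rewrite mulrDr mulrCA lerD// ler_wpM2l.
Qed.

Lemma gclass_schwartz c m k f : 0 < c -> gclass c m k f -> schwartz f.
Proof.
move=> c0 hf; split.
  move=> l x; have h := gclass_partials l hf.
  (* If [d = 0] there is no direction to differentiate in; the space is one point and functions are
     constant. *)
  have [d0|d0] := posnP d.
    rewrite (_ : partials l f = fun=> partials l f x).
      exact: differentiable_cst.
    apply/funext => y; congr (partials _ _ _).
    by apply/rowP => i; have := ltn_ord i; rewrite {2}d0.
  by have [df _ h2] := gclass_partial (Ordinal d0) h; have [] := h2 x.
by move=> n l; apply: gclass_bound c0 (gclass_partials l hf).
Qed.

Lemma schwartz_gwave c m k al (A : R) : 0 < c ->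
  schwartz (fun x => A * gwave c m k al x).
Proof.
move=> c0; apply: (gclass_schwartz (m := m) (k := k) c0).
under eq_fun do rewrite -[_ * _]addr0.
by apply: gclassD; [exact: gclass_gwave|exact: gclass0].
Qed.

#[local] Transparent heat.

Lemma schwartz_heatB (e : R) (z : 'rV[R]_d) : 0 < e ->
  schwartz (fun y => heat e (z - y)).
Proof.
move=> e0; have c0 : 0 < (2 * e)^-1 by rewrite invr_gt0 mulr_gt0.
rewrite (_ : (fun y => _) =
    fun y => (2 * pi * e) `^ (- (d%:R / 2)) * gwave (2 * e)^-1 z 0 0 y).
  exact: schwartz_gwave.
apply/funext => y; rewrite /heat /gwave dot0l addr0 cos0 mulr1 -dotNN opprB.
by rewrite [_ / (2 * e)]mulrC.
Qed.

#[local] Opaque heat.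

End partial_derivatives.

(** * Fractional integrals and Mittag-Leffler functions *)

Lemma L1_fatou d (T : measurableType d) (R : realType)
    (m : {measure set T -> \bar R}) (f_ : nat -> T -> R) (f : T -> R) (C : R) :
  (forall n, measurable_fun setT (f_ n)) -> (forall n x, 0 <= f_ n x) ->
  (forall x, f_ ^~ x @ \oo --> f x) ->
  (forall n, \int[m]_x (f_ n x)%:E <= C%:E)%E ->
  L1 m f /\ (\int[m]_x (f x)%:E <= C%:E)%E.
Proof.
move=> mf f0 cf hC.
have mlim : measurable_fun setT f.
  by apply: (measurable_fun_cvg (h := f_)) => // x _; exact: cf.
have ff0 x : 0 <= f x.
  rewrite -(cvg_lim _ (cf x))//; apply: limr_ge; first by apply/cvg_ex; exists (f x); exact: cf.
  by apply: nearW => n; exact: f0.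
have le : (\int[m]_x (f x)%:E <= C%:E)%E.
  have := @fatou _ T R m setT measurableT (fun n x => (f_ n x)%:E) _ _.
  have h1 n : measurable_fun setT (fun x => (f_ n x)%:E) by exact/measurable_EFinP.
  have h2 n x : setT x -> (0 <= (f_ n x)%:E)%E by rewrite lee_fin.
  move=> /(_ h1 h2) h.
  have E x : limn_einf (fun n => (f_ n x)%:E) = (f x)%:E.
    have cE : (fun n => (f_ n x)%:E) @ \oo --> (f x)%:E.
      by apply: cvg_EFin; [exact: nearW|exact: cf].
    by rewrite is_cvg_limn_einfE ?(cvg_lim _ cE)//; apply/cvg_ex; exists (f x)%:E.
  apply: (@le_trans _ _ (limn_einf (fun n => \int[m]_x (f_ n x)%:E))%E).
    apply: le_trans h; apply: ge0_le_integral => //.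
    - by move=> x _; rewrite lee_fin.
    - exact/measurable_EFinP.
    - by under eq_fun do rewrite E; exact/measurable_EFinP.
    - by move=> x _; rewrite E.
  rewrite limn_einf_lim; apply: lime_le; first exact: is_cvg_einfs.
  apply: nearW => n; apply: le_trans (hC n).
  by apply: ereal_inf_lbound; exists n => //=.
split=> //; apply/L1P => //.
under eq_integral do rewrite ger0_norm//.
exact: le_lt_trans le (ltry _).
Qed.

(** * Integrability of powers and exponentials *)

Section ftc.
Context {R : realType}.

Lemma restrict_itvE (f : R -> R) (i : interval R) :
  f \_ [set` i] = fun x => if x \in i then f x else 0.
Proof. by apply/funext => x; rewrite patchE mem_setE. Qed.

Lemma integral_box (c a b : R) : a <= b ->
  (\int[lam]_s (if s \in `[a, b] then c else 0)%:E = (c * (b - a))%:E)%E.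
Proof.
move=> ab.
rewrite (eq_integral (((EFin \o cst c) \_ [set` `[a, b]]) : R -> \bar R)).
  rewrite -integral_mkcond (eq_integral (cst c%:E))//.
  rewrite integral_cst; last exact: measurable_itv.
  by rewrite EFinM; congr (_ * _)%E; exact: lam_itv.
by move=> s _; rewrite patchE mem_setE; case: ifP.
Qed.

Lemma L1_box (c a b : R) : a <= b -> 0 <= c ->
  L1 lam (fun s => if s \in `[a, b] then c else 0).
Proof.
move=> ab c0; apply/L1P.
  rewrite -(restrict_itvE (cst c)); apply/(measurable_restrict _ (measurable_itv `[a, b])) => //.
rewrite (eq_integral (fun s => (if s \in `[a, b] then c else 0)%:E)); last first.
  by move=> s _; rewrite ger0_norm//; case: ifP.
by rewrite integral_box// ltry.
Qed.

Lemma FTC_lam (F f : R -> R) (a b : R) : a < b ->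
  (forall x, a <= x <= b -> is_derive x 1 F (f x) /\ {for x, continuous f}) ->
  L1 lam (f \_ `[a, b]) /\ \int[lam]_x (f \_ `[a, b]) x = F b - F a.
Proof.
move=> ab h.
have cF x : a <= x <= b -> {for x, continuous F}.
  move=> /h[[d _] _]; apply: differentiable_continuous.
  exact/derivable1_diffP.
have cf : {within `[a, b], continuous f}.
  by apply: continuous_in_subspaceT => x; rewrite inE/= in_itv/= => /h[].
have dF : derivable_oo_LRcontinuous F a b.
  split.
  - by move=> x; rewrite in_itv/= => /andP[/ltW ax /ltW xb]; have [|[]] := h x; rewrite ?ax.
  - by apply: cvg_at_right_filter; apply: cF; rewrite lexx ltW.
  - by apply: cvg_at_left_filter; apply: cF; rewrite lexx ltW.
have intf : (@lebesgue_measure R).-integrable `[a, b] (EFin \o f).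
  by apply: continuous_compact_integrable => //; exact: segment_compact.
have L : L1 (@lebesgue_measure R) (f \_ `[a, b]).
  rewrite /L1 -restrict_EFin.
  by rewrite -integrable_mkcond//; exact: measurable_itv.
split; first exact: L1_lam.
rewrite -RI_lam; last exact: L1_measurable L.
rewrite -Rintegral_mkcond /Rintegral (continuous_FTC2 ab cf dF)//.
by move=> x; rewrite in_itv/= => /andP[/ltW ax /ltW xb]; have [|[_ e] _] := h x; rewrite ?ax// derive1E.
Qed.

(** For improper integrals of nonnegative functions: on the intervals exhausting [D] the integrals
    are increments of [F], and Fatou's lemma takes the limit. *)
Lemma L1_FTC_bounded (F f : R -> R) (D : set R) (a_ b_ : nat -> R) (C : R) :
  (forall n, a_ n < b_ n) ->
  (forall n x, a_ n <= x <= b_ n -> [/\ is_derive x 1 F (f x),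
    {for x, continuous f} & 0 <= f x]) ->
  (forall n, F (b_ n) - F (a_ n) <= C) ->
  (forall x, D x -> \forall n \near \oo, a_ n <= x <= b_ n) ->
  (forall n x, a_ n <= x <= b_ n -> D x) ->
  L1 lam (f \_ D) /\ (\int[lam]_x ((f \_ D) x)%:E <= C%:E)%E.
Proof.
move=> ab hf hC hD hD2.
have H n := @FTC_lam F f (a_ n) (b_ n) (ab n) (fun x hx => let: And3 h1 h2 _ := hf n x hx in conj h1 h2).
apply: (@L1_fatou _ _ R lam (fun n => f \_ `[a_ n, b_ n])).
- by move=> n; exact: L1_measurable (H n).1.
- move=> n x; rewrite patchE; case: ifPn => //; rewrite inE/= in_itv/= => hx.
  by have [] := hf n x hx.
- move=> x; apply: cvg_near_cst.
  have [Dx|Dx] := pselect (D x).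
    have := hD x Dx; apply: filterS => n hx.
    by rewrite !patchE !mem_set//= in_itv.
  apply: nearW => n; rewrite !patchE memNset ?memNset//= in_itv/=.
  by move=> hx; apply: Dx; exact: hD2 hx.
- by move=> n; rewrite -(RI_EFin (H n).1) (H n).2 lee_fin.
Qed.

Lemma powR_continuous_pos (p x : R) : 0 < x -> {for x, continuous (fun y => y `^ p)}.
Proof.
move=> x0; have [d _] := is_derive1_powR p x0.
by apply: differentiable_continuous; exact/derivable1_diffP.
Qed.

Lemma is_derive_powR_div (p x : R) : p != 0 -> 0 < x ->
  is_derive x 1 (fun y => y `^ p / p) (x `^ (p - 1)).
Proof.
move=> p0 x0; have h := is_derive1_powR p x0.
rewrite (_ : (fun y => _) = p^-1 \*: (fun y => y `^ p)); last first.
  by apply/funext => y /=; rewrite mulrC.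
by apply: is_derive_eq; rewrite /GRing.scale/= mulrA mulVf// mul1r.
Qed.

(** Together with [pw1y], a stock of majorants: powers cut off near 0 and near infinity. *)
Definition pw01 (p s : R) : R := if s \in `]0, 1] then s `^ (p - 1) else 0.

Lemma L1_pw01 p : 0 < p -> L1 lam (pw01 p).
Proof.
move=> p0; rewrite (_ : pw01 p = (fun s => s `^ (p - 1)) \_ `]0, 1]); last first.
  by rewrite restrict_itvE.
have [|||||L _ //] := @L1_FTC_bounded (fun y => y `^ p / p) (fun s => s `^ (p - 1)) `]0, 1]
  (fun n => n.+2%:R^-1) (fun=> 1) p^-1.
- by move=> n; rewrite invf_lt1// ltr1n.
- move=> n x /andP[x0 _]; have xp : 0 < x by apply: lt_le_trans x0; rewrite invr_gt0.
  split; [apply: is_derive_powR_div => //; rewrite gt_eqF//|exact: powR_continuous_pos|exact: powR_ge0].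
- move=> n; rewrite powR1 mul1r gerBl divr_ge0 ?powR_ge0// ltW//.
- move=> x /=; rewrite in_itv/= => /andP[x0 x1]; near=> n; rewrite x1 andbT.
  rewrite invf_ple ?posrE//.
  apply: (@le_trans _ _ n%:R); last by rewrite ler_nat ?(leq_trans (leqnSn n) (leqnSn _)).
  by near: n; exact: nbhs_infty_ger.
- move=> n x /andP[x0 x1]; rewrite /= in_itv/= x1 andbT.
  by apply: lt_le_trans x0; rewrite invr_gt0.
Unshelve. all: end_near. Qed.

Definition pw1y (p s : R) : R := if 1 <= s then s `^ (p - 1) else 0.

Lemma L1_pw1y p : p < 0 -> L1 lam (pw1y p).
Proof.
move=> p0; rewrite (_ : pw1y p = (fun s => s `^ (p - 1)) \_ `[1, +oo[); last first.
  by apply/funext => s; rewrite restrict_itvE in_itv/= andbT.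
have [|||||L _ //] := @L1_FTC_bounded (fun y => y `^ p / p) (fun s => s `^ (p - 1)) `[1, +oo[
  (fun=> 1) (fun n => n.+2%:R) (- p^-1).
- by move=> n; rewrite ltr1n.
- move=> n x /andP[x1 _]; have xp : 0 < x by apply: lt_le_trans x1.
  split; [apply: is_derive_powR_div => //; rewrite lt_eqF//|exact: powR_continuous_pos|exact: powR_ge0].
- move=> n; rewrite powR1 mul1r gerDr.
  by rewrite mulr_ge0_le0 ?powR_ge0// invr_le0 ltW.
- move=> x /=; rewrite in_itv/= andbT => x1; near=> n; rewrite x1/=.
  apply: (@le_trans _ _ n%:R); last by rewrite ler_nat ?(leq_trans (leqnSn n) (leqnSn _)).
  by near: n; exact: nbhs_infty_ger.
- by move=> n x /andP[x0 x1]; rewrite /= in_itv/= x0.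
Unshelve. all: end_near. Qed.

Definition exp0y (c s : R) : R := if 0 <= s then expR (- (c * s)) else 0.

Lemma is_derive_exp_lin (c x : R) : is_derive x 1 (fun s => expR (- (c * s))) (- c * expR (- (c * x))).
Proof.
have d1 : is_derive x 1 (fun s => - (c * s)) (- c).
  rewrite (_ : (fun s => _) = (- c) \*: (id : R -> R)); last first.
    by apply/funext => y /=; rewrite -mulNr.
  by apply: is_derive_eq; rewrite /GRing.scale/= mulr1.
rewrite (_ : (fun s => _) = expR \o (fun s => - (c * s)))//.
by apply: is_derive_eq; rewrite mulrC.
Qed.

Lemma continuous_exp_lin (c : R) : continuous (fun s : R => expR (- (c * s))).
Proof.
move=> x; apply: differentiable_continuous; apply/derivable1_diffP.
by have [] := is_derive_exp_lin c x.
Qed.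

Lemma exp_antideriv (c x : R) : c != 0 ->
  is_derive x 1 (fun s => - c^-1 * expR (- (c * s))) (expR (- (c * x))).
Proof.
move=> c0; have h := is_derive_exp_lin c x.
rewrite (_ : (fun s => _) = (- c^-1) \*: (fun s => expR (- (c * s))))//.
by apply: is_derive_eq; rewrite /GRing.scale/= mulrA mulrNN mulVf// mul1r.
Qed.

Lemma L1_exp0y c : 0 < c -> L1 lam (exp0y c).
Proof.
move=> c0; rewrite (_ : exp0y c = (fun s => expR (- (c * s))) \_ `[0, +oo[); last first.
  by apply/funext => s; rewrite restrict_itvE in_itv/= andbT.
have [|||||L _ //] := @L1_FTC_bounded (fun s => - c^-1 * expR (- (c * s)))
   (fun s => expR (- (c * s))) `[0, +oo[ (fun=> 0) (fun n => n.+1%:R) c^-1.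
- by move=> n.
- move=> n x _; split; [by apply: exp_antideriv; rewrite gt_eqF|exact: continuous_exp_lin|exact: expR_ge0].
- move=> n; rewrite mulr0 oppr0 expR0 mulr1 opprK gerDr.
  by rewrite mulr_le0_ge0 ?expR_ge0// oppr_le0 invr_ge0 ltW.
- move=> x /=; rewrite in_itv/= andbT => x0; near=> n; rewrite x0/=.
  apply: (@le_trans _ _ n%:R); last by rewrite ler_nat ?(leq_trans (leqnSn n) (leqnSn _)).
  by near: n; exact: nbhs_infty_ger.
- by move=> n x /andP[x0 x1]; rewrite /= in_itv/= x0.
Unshelve. all: end_near. Qed.

Lemma RI_exp0y : \int[lam]_x exp0y 1 x = 1.
Proof.
have L := L1_exp0y (@ltr01 R).
pose f_ (n : nat) := (fun s : R => expR (- (1 * s))) \_ `[0, n.+1%:R].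
have H n : L1 lam (f_ n) /\ \int[lam]_x f_ n x = 1 - expR (- n.+1%:R).
  have [|L' ->] := @FTC_lam (fun s => - 1^-1 * expR (- (1 * s))) (fun s => expR (- (1 * s))) 0 n.+1%:R (ltr0Sn _ _).
    move=> x _; split; [by apply: exp_antideriv; rewrite gt_eqF|exact: continuous_exp_lin].
  by split => //; rewrite !mulr0 oppr0 expR0 invr1 mul1r mulr1 opprK mulN1r addrC.
have [|||_ c1] := @RI_dct _ _ R lam f_ (exp0y 1) (exp0y 1) _ _ _ L.
- by move=> n; exact: L1_measurable (H n).1.
- move=> x; apply: cvg_near_cst; near=> n.
  rewrite /f_ /exp0y restrict_itvE in_itv/=; case: (0 <= x) => //=.
  rewrite ifT//; apply: (@le_trans _ _ n%:R); last by rewrite ler_nat.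
  by near: n; exact: nbhs_infty_ger.
- move=> n x; rewrite /f_ /exp0y restrict_itvE in_itv/=; case: (0 <= x) => /=; last by rewrite normr0.
  by case: ifPn => _; rewrite ?normr0 ?ger0_norm ?expR_ge0.
have c2 : \int[lam]_x f_ n x @[n --> \oo] --> (1 - 0 : R).
  under eq_fun do rewrite (H _).2.
  apply: cvgB; first exact: cvg_cst.
  rewrite (cvg_shiftS (fun n : nat => expR (- n%:R : R))).
  have h : (fun n : nat => (expR (- 1)) ^+ n) @ \oo --> (0 : R).
    by apply: cvg_expr; rewrite ger0_norm ?expR_ge0// expR_lt1 oppr_lt0.
  by under eq_fun do rewrite -[_%:R]mul1r -mulNr expRM_natr.
by have := cvg_unique _ c1 c2; rewrite subr0; apply; exact: Rhausdorff.
Unshelve. all: end_near. Qed.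

End ftc.

(** * The Gamma function and the kernels of fractional integration *)

Section gamma.
Context {R : realType}.
Implicit Types p q s t x : R.

Definition gammaf p s : R := if 0 < s then s `^ (p - 1) * expR (- s) else 0.

Lemma measurable_gammaf p : measurable_fun setT (gammaf p).
Proof.
apply: measurable_fun_ifT => //.
  by apply: measurable_fun_ltr.
apply: measurable_funM => //; apply: measurableT_comp => //.
Qed.

Lemma gammaf_ge0 p s : 0 <= gammaf p s.
Proof. by rewrite /gammaf; case: ifP => // _; rewrite mulr_ge0 ?powR_ge0 ?expR_ge0. Qed.

Lemma GammaE p : Gamma p = \int[lam]_s gammaf p s.
Proof.
rewrite /Gamma Rintegral_mkcond RI_lam.
  by apply: eq_RI => s; rewrite restrict_itvE in_itv/= andbT.
apply/(measurable_restrict _ (measurable_itv `]0, +oo[)) => //; apply: measurable_funTS.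
by apply: measurable_funM => //; apply: measurableT_comp.
Qed.

Lemma powR_le_exp p : exists C, forall s, 1 <= s -> s `^ p <= C * expR (s / 2).
Proof.
have [n pn] : exists n : nat, p <= n.+1%:R.
  by exists (Num.truncn `|p|); rewrite (le_trans (ler_norm p))// ltW// truncnS_gt.
exists ((n.+1)`!%:R * 2 ^+ n.+1) => s s1.
have s0 : 0 <= s by rewrite (le_trans _ s1).
have s20 : 0 <= s / 2 by rewrite divr_ge0.
apply: (@le_trans _ _ (s ^+ n.+1)).
  by rewrite -powR_mulrn// ler_powR.
have := expR_ge1Dxn n s20; move/(le_trans (ler_wpDl _ (lexx _))) => /(_ ler01).
rewrite ler_pdivrMr ?ltr0n ?fact_gt0// exprMn exprVn ler_pdivrMr ?exprn_gt0// => h.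
by apply: le_trans h _; rewrite -mulrA mulrC.
Qed.

Lemma L1_gammaf p : 0 < p -> L1 lam (gammaf p).
Proof.
move=> p0; have [C hC] := powR_le_exp (p - 1).
have C0 : 0 <= C.
  have := hC 1 (lexx _); rewrite powR1 => h.
  have : 0 < C * expR (1 / 2) by apply: lt_le_trans h.
  by rewrite pmulr_lgt0 ?expR_gt0// => /ltW.
have h0 : 0 < 2^-1 :> R by rewrite invr_gt0.
apply: (L1_le (g := fun s => pw01 p s + C * exp0y 2^-1 s)).
- exact: measurable_gammaf.
- move=> s; rewrite ger0_norm ?gammaf_ge0// /gammaf /pw01 /exp0y in_itv/=.
  case: ifPn => [s0|s0]/=; last first.
    by rewrite add0r mulr_ge0//; case: ifPn => // _; exact: expR_ge0.
  rewrite (ltW s0); have [s1|s1] := leP s 1.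
    apply: ler_wpDr; first by rewrite mulr_ge0 ?expR_ge0.
    by rewrite ler_piMr ?powR_ge0// expR_le1 oppr_le0 ltW.
  rewrite add0r (_ : - s = - (s / 2) - 2^-1 * s); last by field.
  rewrite expRD mulrA ler_wpM2r ?expR_ge0// expRN ler_pdivrMr ?expR_gt0//.
  exact: hC (ltW s1).
- apply: L1D; first exact: L1_pw01.
  by apply: L1Z; exact: L1_exp0y.
Qed.

(** Only [[M, M + 1]] is kept in the integral, with [s ^ (x - 1) = s ^ x / s]. As [M] is free, Gamma
    outgrows every geometric sequence, which makes the Mittag-Leffler series converge. *)
Lemma Gamma_lower x (M : R) : 1 <= M -> 0 < x ->
  M `^ x * (expR (- (M + 1)) / (M + 1)) <= Gamma x.
Proof.
move=> M1 x0.
have M0 : 0 < M by rewrite (lt_le_trans _ M1).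
have MM0 : 0 < M + 1 by rewrite addr_gt0.
set c := _ * _; have c0 : 0 <= c by rewrite mulr_ge0 ?divr_ge0 ?powR_ge0 ?expR_ge0 ?(ltW MM0).
have le1 : M <= M + 1 by rewrite lerDl.
have Lf := L1_box le1 c0.
have If := integral_box c le1.
rewrite (_ : c * _ = c) in If; last by rewrite [M + 1]addrC addrK mulr1.
rewrite GammaE -lee_fin -If -(RI_EFin Lf) lee_fin.
apply: le_RI => //; first exact: L1_gammaf.
move=> s; case: ifPn => [|_]; last exact: gammaf_ge0.
rewrite in_itv/= => /andP[Ms sM].
have s0 : 0 < s by apply: lt_le_trans Ms; rewrite (lt_le_trans _ M1).
rewrite /c /gammaf s0 mulrCA mulrC; apply: ler_pM.
- by rewrite divr_ge0 ?powR_ge0 ?ltW.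
- exact: expR_ge0.
- rewrite powRB ?(gt_eqF s0) ?implybT// powRr1 ?(ltW s0)//; apply: ler_pM.
  + exact: powR_ge0.
  + by rewrite invr_ge0 ltW.
  + by rewrite ge0_ler_powR ?nnegrE// ltW.
  + by rewrite lef_pV2 ?posrE.
- by rewrite ler_expR lerN2.
Qed.

Lemma Gamma_gt0 p : 0 < p -> 0 < Gamma p.
Proof.
move=> p0.
(* on [1, 2] the integrand is at least [min(1, 2^(p-1)) e^-2] *)
pose c := Num.min 1 (2 `^ (p - 1)) * expR (- 2).
have c0 : 0 < c by rewrite mulr_gt0 ?expR_gt0// lt_min ltr01 powR_gt0.
have le1 : 1 <= 2 :> R by rewrite ler1n.
have Lf := L1_box le1 (ltW c0).
have If := integral_box c le1.
rewrite (_ : c * _ = c) in If; last by rewrite (_ : 2 - 1 = 1 :> R) ?mulr1//; ring.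
apply: lt_le_trans c0 _; rewrite GammaE -lee_fin -If -(RI_EFin Lf) lee_fin.
apply: le_RI => //; first exact: L1_gammaf.
move=> s; case: ifPn => [|_]; last exact: gammaf_ge0.
rewrite in_itv/= => /andP[s1 s2].
have s0 : 0 < s by apply: lt_le_trans s1.
rewrite /gammaf s0 /c; apply: ler_pM; rewrite ?expR_ge0 ?le_min ?ler01 ?powR_ge0 ?ler_expR ?lerN2//.
rewrite ge_min; have [p1|p1] := leP 1 p.
  have e1 : 1 `^ (p - 1) = 1 :> R by rewrite powR1.
  by rewrite -[X in X <= _]e1 ge0_ler_powR ?subr_ge0// nnegrE ltW.
rewrite [X in _ || X](_ : _ = true) ?orbT//.
have sp : 0 < s `^ (1 - p) by rewrite powR_gt0.
rewrite -[p - 1]opprB !powRN lef_pV2 ?posrE ?powR_gt0//.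
by rewrite ge0_ler_powR ?subr_ge0// ?nnegrE ltW.
Qed.

Lemma Gamma1 : Gamma 1 = 1 :> R.
Proof.
have L1g := L1_gammaf (@ltr01 R); have L1e := L1_exp0y (@ltr01 R).
transitivity (\int[lam]_s exp0y (1 : R) s); last exact: RI_exp0y.
rewrite GammaE.
rewrite /Rintegral; congr fine; apply: ae_eq_integral => //.
- by apply/measurable_EFinP; exact: measurable_gammaf.
- by apply/measurable_EFinP; exact: L1_measurable L1e.
(* The two integrands differ at 0 only, where [gammaf] vanishes and [exp0y] is 1. *)
exists [set 0]; split => //.
  by have := @lam_itv R 0 0 true false (lexx _); rewrite subrr set_itv1.
move=> s /=; apply: contra_notP => s0 _; rewrite /gammaf /exp0y subrr powRr0 !mul1r.
have [s1|s1] := ltP 0 s; first by rewrite ltW.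
by rewrite ifF//; apply/negbTE; rewrite -ltNge lt_neqAle s1 andbT; exact/eqP.
Qed.

#[local] Opaque Gamma.

(* [s_+ ^ (p - 1) / Gamma p], the kernel of the fractional integral [I^p]. *)
Definition kk p s : R := if 0 < s then s `^ (p - 1) / Gamma p else 0.

Lemma kk_ge0 p s : 0 < p -> 0 <= kk p s.
Proof.
move=> p0; rewrite /kk; case: ifP => // _.
by rewrite divr_ge0 ?powR_ge0// ltW// Gamma_gt0.
Qed.

Lemma kk_le0 p s : s <= 0 -> kk p s = 0.
Proof. by move=> s0; rewrite /kk ltNge s0. Qed.

Lemma kkE p s : 0 < s -> kk p s = s `^ (p - 1) / Gamma p.
Proof. by rewrite /kk => ->. Qed.

Lemma measurable_kk p : measurable_fun setT (kk p).
Proof.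
apply: measurable_fun_ifT => //.
  by apply: measurable_fun_ltr.
by apply: measurable_funM.
Qed.

Lemma measurable_kkB p t : measurable_fun setT (fun s => kk p (t - s)).
Proof. by apply: measurableT_comp; [exact: measurable_kk|exact: measurable_funB]. Qed.

Lemma integral_exp_kk p : 0 < p -> (\int[lam]_s (expR (- s) * kk p s)%:E = 1)%E.
Proof.
move=> p0; have g0 := Gamma_gt0 p0.
have L : L1 lam (fun s => expR (- s) * kk p s).
  have := L1Z (Gamma p)^-1 (L1_gammaf p0); apply: eq_integrable => // s _ /=.
  by rewrite /gammaf /kk; case: ifP => // _; rewrite ?mulr0//; congr EFin; ring.
rewrite -(RI_EFin L); congr EFin.
transitivity (\int[lam]_s ((Gamma p)^-1 * gammaf p s)).
  by apply: eq_RI => s; rewrite /gammaf /kk; case: ifP => // _; rewrite ?mulr0//; ring.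
by rewrite RIZ ?L1_gammaf// -GammaE mulVf// gt_eqF.
Qed.

Lemma measurable_kk2 p q : measurable_fun setT
  (fun z : R * R => kk p (z.1 - z.2) * kk q z.2).
Proof.
apply: measurable_funM; last by apply: measurableT_comp => //; exact: measurable_kk.
by apply: measurableT_comp; [exact: measurable_kk|exact: measurable_funB].
Qed.

Lemma kk_scale p u s : 0 < u -> kk p (u * s) = u `^ (p - 1) * kk p s.
Proof.
move=> u0; rewrite /kk pmulr_rgt0//; case: ifPn => [s0|_]; last by rewrite mulr0.
by rewrite powRM ?(ltW u0) ?(ltW s0)// mulrA.
Qed.

Lemma ge0_integralZ (c : R) (f : R -> R) : 0 <= c -> (forall s, 0 <= f s) ->
  measurable_fun setT f ->
  (\int[lam]_s (c * f s)%:E = c%:E * \int[lam]_s (f s)%:E)%E.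
Proof.
move=> c0 f0 mf; rewrite -ge0_integralZl//; first exact/measurable_EFinP.
by move=> s _; rewrite lee_fin.
Qed.

Lemma measurable_kk_conv p q u : measurable_fun setT (fun s => kk p (u - s) * kk q s).
Proof. by apply: measurable_funM; [exact: measurable_kkB|exact: measurable_kk]. Qed.

Lemma kk_conv_ge0 p q u s : 0 < p -> 0 < q -> 0 <= kk p (u - s) * kk q s.
Proof. by move=> p0 q0; rewrite mulr_ge0 ?kk_ge0. Qed.

Lemma integral_kk_conv_scale p q u : 0 < p -> 0 < q -> 0 < u ->
  (\int[lam]_s (kk p (u - s) * kk q s)%:E = (u `^ (p + q - 1))%:E *
   \int[lam]_s (kk p (1 - s) * kk q s)%:E)%E.
Proof.
move=> p0 q0 u0.
have m1 : measurable_fun setT (fun s => (kk p (u - s) * kk q s)%:E).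
  by apply/measurable_EFinP; exact: measurable_kk_conv.
have m2 s : (0 <= (kk p (u - s) * kk q s)%:E)%E by rewrite lee_fin kk_conv_ge0.
have E := @lam_scaling R u u0 (fun s => (kk p (u - s) * kk q s)%:E) m1 m2.
transitivity (u%:E * \int[lam]_s (kk p (u - u * s) * kk q (u * s))%:E)%E.
  by rewrite E muleA -EFinM divff ?gt_eqF// mul1e.
clear E; rewrite (eq_integral (fun s => (u `^ (p - 1) * u `^ (q - 1) * (kk p (1 - s) * kk q s))%:E)); last first.
  move=> s _; rewrite -{1}[u]mulr1 -mulrBr !kk_scale//; congr EFin; exact: mulrACA.
rewrite ge0_integralZ; last 3 first.
- by rewrite mulr_ge0 ?powR_ge0.
- by move=> s; exact: kk_conv_ge0.
- exact: measurable_kk_conv.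
rewrite muleA -EFinM; congr (_%:E * _)%E.
rewrite -powRD; last by rewrite (gt_eqF u0) implybT.
rewrite -[X in X * _](powRr1 (ltW u0)) -powRD; last by rewrite (gt_eqF u0) implybT.
by congr (_ `^ _); ring.
Qed.

(** The Laplace transform turns convolutions into products, and that of each [kk] at 1 is 1 by
    [integral_exp_kk]; everything is nonnegative, so Tonelli's theorem applies. *)
Lemma laplace_kk_conv p q : 0 < p -> 0 < q ->
  (\int[lam]_u ((expR (- u))%:E * \int[lam]_s (kk p (u - s) * kk q s)%:E) = 1)%E.
Proof.
move=> p0 q0.
have mF : measurable_fun setT (fun z : R * R => (expR (- z.1) * (kk p (z.1 - z.2) * kk q z.2))%:E).
  apply/measurable_EFinP; apply: measurable_funM; last exact: measurable_kk2.
  by apply: measurableT_comp => //; apply: measurableT_comp.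
have F0 z : (0 <= (expR (- z.1) * (kk p (z.1 - z.2) * kk q z.2))%:E)%E.
  by rewrite lee_fin mulr_ge0 ?expR_ge0 ?kk_conv_ge0.
transitivity (\int[lam]_u \int[lam]_s (expR (- u) * (kk p (u - s) * kk q s))%:E)%E.
  apply: eq_integral => u _; rewrite ge0_integralZ ?expR_ge0//.
    by move=> s; exact: kk_conv_ge0.
  exact: measurable_kk_conv.
transitivity (\int[lam]_s \int[lam]_u (expR (- u) * (kk p (u - s) * kk q s))%:E)%E.
  exact: (@fubini_tonelli _ _ _ _ _ lam lam _ mF F0).
transitivity (\int[lam]_s (expR (- s) * kk q s)%:E)%E; last exact: integral_exp_kk.
apply: eq_integral => s _.
have mE : measurable_fun setT (fun u : R => expR (- u) * kk p u).
  apply: measurable_funM; last exact: measurable_kk.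
  by apply: measurableT_comp.
have mE' : measurable_fun setT (fun u : R => expR (- (u - s)) * kk p (u - s)).
  by apply: (measurableT_comp mE); exact: measurable_funB.
rewrite (eq_integral (fun u : R => ((expR (- s) * kk q s) * (expR (- (u - s)) * kk p (u - s)))%:E)); last first.
  have gen (x y v w : R) : x * y * (v * w) = x * w * (y * v) by ring.
  have Es u : expR (- u) = expR (- s) * expR (- (u - s)) by rewrite -expRD; congr expR; ring.
  by move=> u _; rewrite Es gen.
rewrite ge0_integralZ; last 3 first.
- by rewrite mulr_ge0 ?expR_ge0 ?kk_ge0.
- by move=> u; rewrite mulr_ge0 ?expR_ge0 ?kk_ge0.
- exact: mE'.
rewrite [X in (_ * X)%E](_ : _ = 1%E); first by rewrite mule1.
transitivity (\int[lam]_u (expR (- u) * kk p u)%:E)%E; last exact: integral_exp_kk.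
rewrite [RHS](mpres_ge0_integral (lam_translation (- s))); last 2 first.
- exact/measurable_EFinP.
- by move=> u; rewrite lee_fin mulr_ge0 ?expR_ge0 ?kk_ge0.
by apply: eq_integral => u _; rewrite (addrC (- s) u).
Qed.

(* Both sides are multiples of [t ^ (p + q - 1)] by scaling, and they have the
   same Laplace transform at 1. *)
Lemma integral_kk_conv p q t : 0 < p -> 0 < q ->
  (\int[lam]_s (kk p (t - s) * kk q s)%:E = (kk (p + q) t)%:E)%E.
Proof.
move=> p0 q0; have pq0 : 0 < p + q by rewrite addr_gt0.
pose h u := (\int[lam]_s (kk p (u - s) * kk q s)%:E)%E.
have h0 u : (0 <= h u)%E by apply: integral_ge0 => s _; rewrite lee_fin kk_conv_ge0.
have hle0 u : u <= 0 -> h u = 0%E.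
  move=> u0; rewrite /h integral0_eq// => s _; congr EFin.
  have [s0|s0] := ltP 0 s; last by rewrite (kk_le0 _ s0) mulr0.
  by rewrite kk_le0 ?mul0r// subr_le0 (le_trans u0)// ltW.
have h1 : (h (1 : R)%R * (Gamma (p + q))%:E = 1)%E.
  rewrite -(laplace_kk_conv p0 q0) GammaE (RI_EFin (L1_gammaf pq0)).
  rewrite -ge0_integralZl; last 4 first.
  - exact: measurableT.
  - by apply/measurable_EFinP; exact: measurable_gammaf.
  - by move=> s _; rewrite lee_fin gammaf_ge0.
  - exact: h0.
  apply: eq_integral => u _; rewrite /gammaf; case: ifPn => [u0|].
    rewrite (integral_kk_conv_scale p0 q0 u0) -/(h 1) EFinM [RHS]muleCA muleC -muleA; reflexivity.
  rewrite -leNgt => u0; transitivity (0 : \bar R)%E; first exact: mule0.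
  by rewrite -/(h u) (hle0 _ u0); symmetry; exact: mule0.
have h1f : h (1 : R)%R = ((Gamma (p + q))^-1)%:E.
  have g0 := Gamma_gt0 pq0.
  have := h0 1; case: (h (1 : R)%R) h1 => [r| |]//=.
    move=> + _; rewrite -EFinM => -[] e; congr EFin.
    by rewrite -[LHS](mulfK (lt0r_neq0 g0)) e mul1r.
  by rewrite gt0_mulye// lte_fin.
have [t0|t0] := ltP 0 t; last by rewrite -/(h t) hle0// kk_le0.
by rewrite (integral_kk_conv_scale p0 q0 t0) -/(h 1) h1f -EFinM kkE.
Qed.

Lemma L1_kk_conv p q t : 0 < p -> 0 < q -> L1 lam (fun s => kk p (t - s) * kk q s).
Proof.
move=> p0 q0; apply/L1P.
  by apply: measurable_funM; [exact: measurable_kkB|exact: measurable_kk].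
under eq_integral do rewrite ger0_norm ?mulr_ge0 ?kk_ge0//.
by rewrite integral_kk_conv// ltry.
Qed.

Lemma RI_kk_conv p q t : 0 < p -> 0 < q ->
  \int[lam]_s (kk p (t - s) * kk q s) = kk (p + q) t.
Proof. by move=> p0 q0; rewrite /Rintegral integral_kk_conv. Qed.

End gamma.

#[local] Opaque Gamma.

Lemma norm_lim_le (R : realType) (u : nat -> R) (l C : R) :
  u @ \oo --> l -> (forall n, `|u n| <= C) -> `|l| <= C.
Proof.
move=> /cvg_norm c h; rewrite -(cvg_lim _ c)//.
by apply: limr_le; [apply/cvg_ex; eexists; exact: c|exact: nearW].
Qed.

(** * The Mittag-Leffler series *)

Section mittag.
Context {R : realType}.
Variable b : R.
Hypothesis b0 : 0 < b.
Implicit Types beta p s t x y z : R.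

Definition mlp beta (n : nat) x : R :=
  series (fun k : nat => x ^+ k / Gamma (b * k%:R + beta)) n.

(** Its power of exponent [b] is [2 * (B + 1)]: as [M] in [Gamma_lower], it makes the [k]-th term of
    the series at most [ml_cst B / 2 ^ k] for arguments bounded by [B], uniformly in [beta]. *)
Definition ml_radius (B : R) : R := (2 * (B + 1)) `^ b^-1.
Definition ml_cst (B : R) : R := (ml_radius B + 1) * expR (ml_radius B + 1).

Lemma ml_arg_gt0 beta (k : nat) : 0 < beta -> 0 < b * k%:R + beta.
Proof. by move=> ?; rewrite ltr_wpDl// mulr_ge0// ltW. Qed.

Lemma Gamma_inv_ge0 beta (k : nat) : 0 < beta -> 0 <= (Gamma (b * k%:R + beta))^-1.
Proof. by move=> ?; rewrite invr_ge0 ltW// Gamma_gt0// ml_arg_gt0. Qed.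

Lemma ml_radius_ge1 B : 0 <= B -> 1 <= ml_radius B.
Proof.
move=> B0; have e1 : 1 `^ b^-1 = 1 :> R by rewrite powR1.
rewrite /ml_radius -[X in X <= _]e1 ge0_ler_powR ?nnegrE ?invr_ge0 ?(ltW b0)//; lra.
Qed.

Lemma ml_cst_ge0 B : 0 <= B -> 0 <= ml_cst B.
Proof. by move=> /ml_radius_ge1 h; rewrite mulr_ge0 ?expR_ge0// addr_ge0// (le_trans _ h). Qed.

Lemma ml_coef_le beta (B : R) (k : nat) : 0 < beta -> 0 <= B ->
  B ^+ k / Gamma (b * k%:R + beta) <= ml_cst B * 2^-1 ^+ k.
Proof.
move=> beta0 B0; have M1 := ml_radius_ge1 B0; have M0 : 0 < ml_radius B by rewrite (lt_le_trans _ M1).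
have MM0 : 0 < ml_radius B + 1 by rewrite addr_gt0.
have arg := ml_arg_gt0 k beta0.
have := Gamma_lower M1 arg; set g := Gamma _; set M := ml_radius B in M1 M0 MM0 *.
have g0 : 0 < g by exact: Gamma_gt0.
have Mk : (2 * (B + 1)) ^+ k <= M `^ (b * k%:R + beta).
  apply: (@le_trans _ _ (M `^ (b * k%:R))).
    have B20 : 0 <= 2 * (B + 1) by lra.
    by rewrite powRrM /M /ml_radius -(powRrM _ b^-1 b) mulVf ?gt_eqF// powRr1// powR_mulrn.
  by rewrite ler_powR// lerDl ltW.
rewrite expRN => h.
rewrite ler_pdivrMr// /ml_cst -/M.
have h2 : (2 * (B + 1)) ^+ k <= g * ((M + 1) * expR (M + 1)).
  have E0 : 0 <= (expR (M + 1))^-1 / (M + 1) by rewrite divr_ge0 ?invr_ge0 ?expR_ge0 ?(ltW MM0).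
  have := le_trans (ler_wpM2r E0 Mk) h.
  rewrite -invfM ler_pdivrMr; last by rewrite mulr_gt0 ?expR_gt0.
  by rewrite (mulrC (expR _)).
have Bk : B ^+ k <= (2 * (B + 1)) ^+ k * 2^-1 ^+ k.
  rewrite -exprMn mulrAC divff// mul1r lerXn2r ?nnegrE//; lra.
apply: le_trans Bk _; rewrite mulrAC [X in _ <= X * _]mulrC ler_wpM2r ?exprn_ge0//.
Qed.

Lemma mlp_term_le beta B x (k : nat) : 0 < beta -> 0 <= B -> `|x| <= B ->
  `|x ^+ k / Gamma (b * k%:R + beta)| <= ml_cst B * 2^-1 ^+ k.
Proof.
move=> beta0 B0 xB; apply: le_trans (ml_coef_le k beta0 B0).
rewrite normrM normrX (ger0_norm (Gamma_inv_ge0 k beta0)).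
by rewrite ler_wpM2r ?Gamma_inv_ge0// lerXn2r ?nnegrE.
Qed.

Lemma half_sum_le (n : nat) : \sum_(0 <= k < n) (2^-1 : R) ^+ k <= 2.
Proof.
suff -> : \sum_(0 <= k < n) (2^-1 : R) ^+ k = 2 - 2 * 2^-1 ^+ n.
  by rewrite gerBl mulr_ge0// exprn_ge0.
elim: n => [|n IH]; first by rewrite big_geq// expr0; ring.
by rewrite big_nat_recr//= IH exprS; field.
Qed.

Lemma mlp_le beta B (n : nat) x : 0 < beta -> 0 <= B -> `|x| <= B ->
  `|mlp beta n x| <= ml_cst B * 2.
Proof.
move=> beta0 B0 xB; rewrite /mlp /series /=; apply: le_trans (ler_norm_sum _ _ _) _.
apply: (@le_trans _ _ (\sum_(0 <= k < n) ml_cst B * 2^-1 ^+ k)).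
  by apply: ler_sum => k _; exact: mlp_term_le.
by rewrite -mulr_sumr ler_wpM2l ?ml_cst_ge0// half_sum_le.
Qed.

Lemma mlp_cvg beta x : 0 < beta -> mlp beta ^~ x @ \oo --> mittag_leffler b beta x.
Proof.
move=> beta0; apply: normed_cvg.
apply: (series_le_cvg (v_ := fun k => ml_cst `|x| * 2^-1 ^+ k)).
- by move=> k; exact: normr_ge0.
- by move=> k; rewrite mulr_ge0 ?ml_cst_ge0// exprn_ge0.
- by move=> k; exact: mlp_term_le.
- by apply: is_cvg_geometric_series; rewrite ger0_norm// invf_lt1// ltr1n.
Qed.

Lemma measurable_ml beta : 0 < beta -> measurable_fun setT (mittag_leffler b beta).
Proof.
move=> beta0; apply: (measurable_fun_cvg (h := mlp beta)) => [n|x _]; last exact: mlp_cvg.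
rewrite /mlp /series /=; apply: measurable_sum => k.
apply: measurable_funM => //; exact: measurable_funX.
Qed.

(** Since [x ^ k - y ^ k] is at most [(2 B) ^ k] times the distance of [x] and [y], the partial sums
    at [2 B] bound the Lipschitz constant. *)
Lemma ml_lipschitz beta B : 0 < beta -> 1 <= B -> exists L, forall x y,
  `|x| <= B -> `|y| <= B -> `|mittag_leffler b beta x - mittag_leffler b beta y| <= L * `|x - y|.
Proof.
move=> beta0 B1; have B0 : 0 <= B by rewrite (le_trans _ B1).
have pow x y (k : nat) : `|x| <= B -> `|y| <= B -> `|x ^+ k - y ^+ k| <= (2 * B) ^+ k * `|x - y|.
  move=> xB yB; elim: k => [|k IH]; first by rewrite !expr0 subrr normr0 mul1r.
  rewrite !exprS (_ : _ - _ = x * (x ^+ k - y ^+ k) + (x - y) * y ^+ k); last by ring.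
  apply: le_trans (ler_normD _ _) _; rewrite !normrM normrX.
  have h1 : `|x| * `|x ^+ k - y ^+ k| <= B * ((2 * B) ^+ k * `|x - y|) by exact: ler_pM.
  have h2 : `|x - y| * `|y| ^+ k <= B * ((2 * B) ^+ k * `|x - y|).
    rewrite mulrC mulrA ler_wpM2r//.
    apply: (@le_trans _ _ ((2 * B) ^+ k)); first by rewrite lerXn2r ?nnegrE//; lra.
    by rewrite ler_peMl// exprn_ge0//; lra.
  by apply: le_trans (lerD h1 h2) _; rewrite le_eqVlt; apply/orP; left; apply/eqP; ring.
exists (ml_cst (2 * B) * 2) => x y xB yB.
apply: norm_lim_le (cvgB (@mlp_cvg beta x beta0) (@mlp_cvg beta y beta0)) _ => n.
have B20 : 0 <= 2 * B by lra.
have := @mlp_le beta (2 * B) n (2 * B) beta0 B20; rewrite ger0_norm// => /(_ (lexx _)) h.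
apply: (@le_trans _ _ (mlp beta n (2 * B) * `|x - y|)); last first.
  by rewrite ler_wpM2r// (le_trans (ler_norm _)).
rewrite /mlp /series /= mulr_suml.
rewrite (_ : `|_| = `|\sum_(0 <= k < n) ((x ^+ k - y ^+ k) / Gamma (b * k%:R + beta))|); last first.
  congr (`|_|); transitivity (\sum_(0 <= k < n) (x ^+ k / Gamma (b * k%:R + beta)) -
    \sum_(0 <= k < n) (y ^+ k / Gamma (b * k%:R + beta))); first reflexivity.
  by rewrite -sumrB; apply: eq_bigr => k _; rewrite mulrBl.
apply: le_trans (ler_norm_sum _ _ _) _; apply: ler_sum => k _.
rewrite normrM (ger0_norm (Gamma_inv_ge0 k beta0)) mulrAC ler_wpM2r ?Gamma_inv_ge0//.
exact: pow.
Qed.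

Lemma continuous_ml beta : 0 < beta -> continuous (mittag_leffler b beta).
Proof.
move=> beta0 x; have B1 : 1 <= `|x| + 1 by rewrite lerDr.
have [L hL] := ml_lipschitz beta0 B1.
apply/cvgrPdist_le => e e0; near=> y.
have xy1 : `|x - y| <= 1.
  by near: y; apply: cvgr_dist_le => //; exact: cvg_id.
have xye : `|x - y| <= e / (`|L| + 1).
  by near: y; apply: cvgr_dist_le; [exact: cvg_id|rewrite divr_gt0// ltr_wpDl].
have yB : `|y| <= `|x| + 1.
  rewrite (_ : y = x - (x - y)); last by ring.
  by apply: le_trans (ler_normB _ _) _; rewrite lerD2l.
have xB : `|x| <= `|x| + 1 by rewrite lerDl.
apply: le_trans (hL x y xB yB) _.
apply: (@le_trans _ _ ((`|L| + 1) * `|x - y|)).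
  by rewrite ler_wpM2r// (le_trans (ler_norm L))// lerDl.
by rewrite mulrC -ler_pdivlMr// ltr_wpDl.
Unshelve. all: end_near. Qed.

Lemma ml0 beta : mittag_leffler b beta 0 = (Gamma beta)^-1.
Proof.
rewrite /mittag_leffler; apply: cvg_lim => //.
apply: cvg_near_cst; near=> n.
have n0 : (0 < n)%N by near: n; exact: nbhs_infty_gt.
rewrite -(prednK n0) /series /= big_nat_recl// big1 => [|k _].
  by rewrite expr0 mulr0 add0r addr0 mul1r.
by rewrite expr0n mul0r.
Unshelve. all: end_near. Qed.

End mittag.

(** * Mittag-Leffler functions under fractional integration *)

Section EE.
Context {R : realType}.
Variable b : R.
Hypothesis b0 : 0 < b.
Implicit Types beta p s t x y z : R.

(* The inverse Laplace transform of [l^(b - beta) / (l^b + z)]. *)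
Definition EE z beta s : R :=
  if 0 < s then s `^ (beta - 1) * mittag_leffler b beta (- (z * s `^ b)) else 0.

Definition EEp z beta (n : nat) s : R :=
  if 0 < s then s `^ (beta - 1) * mlp b beta n (- (z * s `^ b)) else 0.

Lemma EE_le0 z beta s : s <= 0 -> EE z beta s = 0.
Proof. by move=> s0; rewrite /EE ltNge s0. Qed.

(** Each term of the series is a multiple of a kernel [kk], so fractional integrals can be computed
    termwise. *)
Lemma EEpS z beta n s : 0 < beta -> EEp z beta n.+1 s = EEp z beta n s + (- z) ^+ n * kk (b * n%:R + beta) s.
Proof.
move=> beta0; rewrite /EEp /kk; case: ifPn => [s0|_]; last by rewrite mulr0 addr0.
rewrite /mlp /series /= big_nat_recr//= mulrDr; congr (_ + _).
have -> : s `^ (b * n%:R + beta - 1) = s `^ (beta - 1) * (s `^ b) ^+ n.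
  rewrite -powR_mulrn ?powR_ge0// -powRrM -powRD; last by rewrite (gt_eqF s0) implybT.
  by congr (_ `^ _); ring.
by rewrite -mulNr exprMn; ring.
Qed.

Lemma EEp0 z beta s : EEp z beta 0 s = 0.
Proof. by rewrite /EEp /mlp /series /= big_geq// mulr0; case: ifP. Qed.

Lemma EEp_recl z beta n s : 0 < beta ->
  EEp z beta n.+1 s = kk beta s - z * EEp z (beta + b) n s.
Proof.
move=> beta0; have bb0 : 0 < beta + b by rewrite addr_gt0.
elim: n => [|n IH].
  by rewrite EEpS// !EEp0 expr0 mul1r !mulr0 !add0r subr0.
rewrite EEpS// IH EEpS// exprS.
have -> : b * n.+1%:R + beta = b * n%:R + (beta + b) by rewrite -addn1 natrD; ring.
by move: (kk (b * n%:R + (beta + b)) s) (kk beta s) (EEp _ _ _ _) => x y w; ring.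
Qed.

Lemma EEp_cvg z beta s : 0 < beta -> EEp z beta ^~ s @ \oo --> EE z beta s.
Proof.
move=> beta0; rewrite /EEp /EE; case: ifPn => [s0|_]; last exact: cvg_cst.
by apply: cvgM; [exact: cvg_cst|exact: mlp_cvg].
Qed.

(** The first term of the series is [kk beta]; the others form [- z] times the series of parameter
    [beta + b]. *)
Lemma EE_rec z beta s : 0 < beta -> EE z beta s = kk beta s - z * EE z (beta + b) s.
Proof.
move=> beta0; have bb0 : 0 < beta + b by rewrite addr_gt0.
have c1 := @EEp_cvg z beta s beta0; rewrite -(cvg_shiftS (fun n => EEp z beta n s)) in c1.
have c2 : (fun n => EEp z beta n.+1 s) @ \oo --> kk beta s - z * EE z (beta + b) s.
  under eq_fun do rewrite EEp_recl//.
  by apply: cvgB; [exact: cvg_cst|apply: cvgM; [exact: cvg_cst|exact: EEp_cvg]].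
by have := cvg_unique _ c1 c2; apply; exact: Rhausdorff.
Qed.

Lemma measurable_EE2 beta d (T : measurableType d) (z s : T -> R) : 0 < beta ->
  measurable_fun setT z -> measurable_fun setT s ->
  measurable_fun setT (fun x : T => EE (z x) beta (s x)).
Proof.
move=> beta0 mz ms; apply: measurable_fun_ifT => //.
  by apply: measurable_fun_ltr.
apply: measurable_funM.
  exact: (measurableT_comp (measurable_powR (beta - 1)) ms).
apply: (measurableT_comp (measurable_ml b0 beta0)); apply: measurableT_comp => //.
by apply: measurable_funM => //; exact: (measurableT_comp (measurable_powR b) ms).
Qed.

Lemma measurable_EE z beta : 0 < beta -> measurable_fun setT (EE z beta).
Proof. by move=> beta0; apply: (@measurable_EE2 beta _ _ (cst z) id beta0). Qed.

Lemma L1_EEp_conv p z beta t n : 0 < p -> 0 < beta ->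
  L1 lam (fun s => kk p (t - s) * EEp z beta n s) /\
  \int[lam]_s (kk p (t - s) * EEp z beta n s) = EEp z (beta + p) n t.
Proof.
move=> p0 beta0; have bp0 : 0 < beta + p by rewrite addr_gt0.
elim: n => [|n [L I]].
  have E : (fun s => kk p (t - s) * EEp z beta 0 s) = cst 0.
    by apply/funext => s; rewrite EEp0 mulr0.
  rewrite E EEp0; split; first exact: integrable0.
  by rewrite /Rintegral integral0_eq.
have a0 := ml_arg_gt0 b0 n beta0.
have E : (fun s => kk p (t - s) * EEp z beta n.+1 s) =
    (fun s => kk p (t - s) * EEp z beta n s +
       (- z) ^+ n * (kk p (t - s) * kk (b * n%:R + beta) s)).
  apply/funext => s; rewrite (EEpS _ _ _ beta0) mulrDr; congr (_ + _).
  exact: mulrCA.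
have L2 := L1Z ((- z) ^+ n) (L1_kk_conv t p0 a0).
rewrite E; split; first exact: L1D.
rewrite RID// I RIZ; last exact: L1_kk_conv.
have e : p + (b * n%:R + beta) = b * n%:R + (beta + p) by clear; ring.
rewrite (RI_kk_conv t p0 a0) (EEpS _ _ _ bp0) e; reflexivity.
Qed.

(** A crude bound, whose constant grows with [z]: it serves to dominate uniformly in [n] and to know
    that suprema are finite. The bound uniform in [z] is [EE_bound]. *)
Lemma EEp_le z beta t n s : 0 < beta -> 0 <= t -> s <= t ->
  `|EEp z beta n s| <= ml_cst b (`|z| * t `^ b) * 2 * Gamma beta * kk beta s.
Proof.
move=> beta0 t0 st; have B0 : 0 <= `|z| * t `^ b by rewrite mulr_ge0 ?powR_ge0.
rewrite /EEp; have [s0|s0] := ltP 0 s; last by rewrite kk_le0// mulr0 normr0.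
rewrite kkE// normrM (ger0_norm (powR_ge0 _ _)).
have -> : ml_cst b (`|z| * t `^ b) * 2 * Gamma beta * (s `^ (beta - 1) / Gamma beta) =
   s `^ (beta - 1) * (ml_cst b (`|z| * t `^ b) * 2) * (Gamma beta / Gamma beta) by ring.
rewrite divff ?gt_eqF ?Gamma_gt0// mulr1 ler_wpM2l ?powR_ge0//.
apply: mlp_le => //; rewrite normrN normrM (ger0_norm (powR_ge0 _ _)) ler_wpM2l//.
by rewrite ge0_ler_powR ?nnegrE// ltW.
Qed.

Lemma EE_le z beta t s : 0 < beta -> 0 <= t -> s <= t ->
  `|EE z beta s| <= ml_cst b (`|z| * t `^ b) * 2 * Gamma beta * kk beta s.
Proof.
move=> beta0 t0 st; apply: norm_lim_le (@EEp_cvg z beta s beta0) _ => n; exact: EEp_le.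
Qed.

(** The semigroup law of fractional integrals, termwise, followed by dominated convergence. *)
Lemma EE_conv p z beta t : 0 < p -> 0 < beta ->
  L1 lam (fun s => kk p (t - s) * EE z beta s) /\
  \int[lam]_s (kk p (t - s) * EE z beta s) = EE z (beta + p) t.
Proof.
move=> p0 beta0; have bp0 : 0 < beta + p by rewrite addr_gt0.
have dom n s : `|kk p (t - s) * EEp z beta n s| <=
    ml_cst b (`|z| * `|t| `^ b) * 2 * Gamma beta * (kk p (t - s) * kk beta s).
  rewrite normrM (ger0_norm (kk_ge0 _ p0)) [X in _ <= X]mulrCA.
  have [ts|ts] := leP (t - s) 0; first by rewrite kk_le0// !mul0r.
  by rewrite ler_wpM2l ?kk_ge0// EEp_le// (le_trans _ (ler_norm t))// ltW// -subr_gt0.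
have [|||L c] := @RI_dct _ _ R lam (fun n s => kk p (t - s) * EEp z beta n s)
  (fun s => kk p (t - s) * EE z beta s) _ _ _ dom.
- by move=> n; exact: L1_measurable (@L1_EEp_conv p z beta t n p0 beta0).1.
- by move=> s; apply: cvgM; [exact: cvg_cst|exact: EEp_cvg].
- by apply: L1Z; exact: L1_kk_conv.
split => //.
have c2 := @EEp_cvg z (beta + p) t bp0.
have E : (fun n => \int[lam]_s (kk p (t - s) * EEp z beta n s)) = EEp z (beta + p) ^~ t.
  by apply/funext => n; exact: (@L1_EEp_conv p z beta t n p0 beta0).2.
by rewrite E in c; have := cvg_unique _ c c2; apply; exact: Rhausdorff.
Qed.

End EE.

(** * Monotonicity and convexity of the fractional kernels *)

Section kk_facts.
Context {R : realType}.
Implicit Types p q s t u x y z : R.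

(** [kk 1] is the Heaviside function; time cut-offs are written with it so that they enter the
    convolution identities. *)
Lemma kk1E s : kk 1 s = if 0 < s then 1 else 0 :> R.
Proof. by rewrite /kk Gamma1 subrr powRr0 invr1 mulr1. Qed.

Lemma kk1_01 (s : R) : 0 <= kk 1 s <= 1.
by rewrite kk1E; case: ifP; rewrite ?lexx ler01.
Qed.

Lemma kk_conv_shift p q t u : 0 < p -> 0 < q ->
  L1 lam (fun s => kk p (t - s) * kk q (s - u)) /\
  \int[lam]_s (kk p (t - s) * kk q (s - u)) = kk (p + q) (t - u).
Proof.
move=> p0 q0.
have mf : measurable_fun setT (fun s : R => kk p (t - s) * kk q (s - u)).
  apply: measurable_funM; first exact: measurable_kkB.
  by apply: measurableT_comp; [exact: measurable_kk|exact: measurable_funB].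
have E : (fun s : R => kk p (t - (u + s)) * kk q (u + s - u)) =
    fun s => kk p ((t - u) - s) * kk q s.
  by apply/funext => s; congr (kk _ _ * kk _ _); ring.
split.
  apply/(mpres_L1 (lam_translation u) mf).
  rewrite (_ : _ \o _ = fun s => kk p ((t - u) - s) * kk q s); first exact: L1_kk_conv.
  exact: E.
rewrite (mpres_RI (lam_translation u) mf) E; exact: RI_kk_conv.
Qed.

Lemma powR_decr p x y : p <= 0 -> 0 < x -> x <= y -> y `^ p <= x `^ p.
Proof.
move=> p0 x0 xy; have y0 : 0 < y by rewrite (lt_le_trans x0).
rewrite -(opprK p) !(powRN _ (- p)) lef_pV2 ?posrE ?powR_gt0//.
by rewrite ge0_ler_powR ?oppr_ge0// nnegrE ltW.
Qed.

Lemma kk_decr p x y : 0 < p <= 1 -> 0 < x -> x <= y -> kk p y <= kk p x.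
Proof.
move=> /andP[p0 p1] x0 xy; have y0 : 0 < y by rewrite (lt_le_trans x0).
rewrite !kkE// ler_wpM2r ?invr_ge0 ?(ltW (Gamma_gt0 p0))// powR_decr// subr_le0//.
Qed.

Lemma kk_incr p x y : 1 <= p -> x <= y -> kk p x <= kk p y.
Proof.
move=> p1 xy; have p0 : 0 < p by rewrite (lt_le_trans _ p1).
have [x0|x0] := ltP 0 x; last by rewrite (kk_le0 _ x0) kk_ge0.
have y0 : 0 < y by rewrite (lt_le_trans x0).
rewrite !kkE// ler_wpM2r ?invr_ge0 ?(ltW (Gamma_gt0 p0))// ge0_ler_powR ?subr_ge0// nnegrE ltW//.
Qed.

(* Log-convexity of [kk p] for [p <= 1]. *)
Lemma kk_ratio p s t t0 : 0 < p <= 1 -> 0 < s -> s < t -> t <= t0 ->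
  kk p t * kk p (t0 - s) <= kk p t0 * kk p (t - s).
Proof.
move=> /andP[p0 p1] s0 st tt0.
have t_gt0 : 0 < t by rewrite (lt_trans s0).
have t0_gt0 : 0 < t0 by rewrite (lt_le_trans t_gt0).
have ts : 0 < t - s by rewrite subr_gt0.
have t0s : 0 < t0 - s by rewrite subr_gt0 (lt_le_trans st).
rewrite !kkE// ![_ / _ * (_ / _)]mulrACA -!powRM ?(ltW t_gt0) ?(ltW t0_gt0) ?(ltW ts) ?(ltW t0s)//.
have g0 := Gamma_gt0 p0.
rewrite ler_wpM2r ?mulr_ge0 ?invr_ge0 ?(ltW g0)//.
apply: powR_decr; rewrite ?subr_le0// ?mulr_gt0//.
rewrite -subr_ge0 (_ : _ - _ = s * (t0 - t)); last by clear; ring.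
by rewrite mulr_ge0 ?(ltW s0)// subr_ge0.
Qed.

Lemma powR_small b x : 0 < b -> 0 < x -> exists2 h, 0 < h & forall y, 0 <= y <= h -> y `^ b <= x.
Proof.
move=> b0 x0; exists (x `^ b^-1); first by rewrite powR_gt0.
move=> y /andP[y0 yh]; apply: (@le_trans _ _ ((x `^ b^-1) `^ b)).
  by rewrite ge0_ler_powR ?nnegrE ?powR_ge0// ltW.
by rewrite -powRrM mulVf ?gt_eqF// powRr1// ltW.
Qed.

End kk_facts.

(** * Positivity for orders at most 1 *)

Section EE_pos.
Context {R : realType}.
Variables b z : R.
Hypotheses (b01 : 0 < b <= 1) (z0 : 0 <= z).

Let b0 : 0 < b. Proof. by case/andP : b01. Qed.

Lemma EE_volterra (t : R) :
  L1 lam (fun s => kk b (t - s) * EE b z b s) /\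
  EE b z b t = kk b t - z * \int[lam]_s (kk b (t - s) * EE b z b s).
Proof.
have [L I] := EE_conv b0 z t b0 b0.
split; first exact: L.
rewrite I; exact: EE_rec.
Qed.

Lemma continuous_EE (beta t : R) : 0 < beta -> 0 < t -> {for t, continuous (EE b z beta)}.
Proof.
move=> beta0 t0.
have c : {for t, continuous (fun s => s `^ (beta - 1) * mittag_leffler b beta (- (z * s `^ b)))}.
  apply: cvgM; first exact: powR_continuous_pos.
  apply: (continuous_comp (f := fun s : R => - (z * s `^ b)) (g := mittag_leffler b beta)); last exact: continuous_ml.
  apply: cvgN; apply: cvgM; [exact: cvg_cst|exact: powR_continuous_pos].
have eq0 : \forall s \near t, s `^ (beta - 1) * mittag_leffler b beta (- (z * s `^ b)) = EE b z beta s.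
  near=> s; rewrite /EE ifT//; near: s; exact: lt_nbhsr.
have e0 := nbhs_singleton eq0.
change (EE b z beta @ t --> EE b z beta t).
by rewrite -e0; apply: cvg_trans c; apply: near_eq_cvg; exact: eq0.
Unshelve. all: end_near. Qed.

(** Near 0 the Mittag-Leffler factor is close to its value [(Gamma b)^-1] at 0. *)
Lemma EE_pos_small : exists2 h : R, 0 < h & forall s, 0 < s <= h -> 0 < EE b z b s.
Proof.
have c := @continuous_ml _ b b0 b b0 0.
have g0 : 0 < mittag_leffler b b 0 by rewrite ml0// invr_gt0 Gamma_gt0.
have [e /= e0 he] := (nbhs_ballP _ _).1 (cvgr_gt _ c _ g0).
have ez : 0 < (e / 2) / (z + 1) by rewrite divr_gt0 ?divr_gt0// ltr_wpDl.
have [h h0 hh] := powR_small b0 ez; exists h => // s /andP[s0 sh].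
rewrite /EE s0 mulr_gt0 ?powR_gt0//; apply: he.
have z1 : 0 < z + 1 by rewrite ltr_wpDl.
have := hh s; rewrite (ltW s0) sh => /(_ isT); rewrite ler_pdivlMr// => h1.
rewrite /ball/= sub0r normrN normrN ger0_norm ?mulr_ge0 ?powR_ge0//.
apply: (@le_lt_trans _ _ (s `^ b * (z + 1))).
  by rewrite mulrC ler_wpM2l ?powR_ge0// lerDl.
by apply: le_lt_trans h1 _; rewrite ltr_pdivrMr// mulr_natr mulr2n ltrDl.
Qed.

(* At a first zero [t0], comparing the Volterra equations at [t0] and at a
   maximum point of [v] just before [t0] gives a contradiction. *)
Lemma EE_gt0 (t : R) : 0 < t -> 0 < EE b z b t.
Proof.
pose v := EE b z b; rewrite -/(v t) => t_gt0; rewrite ltNge; apply/negP => vt.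
pose S := [set s | 0 < s /\ v s <= 0].
have S0 : S !=set0 by exists t.
have lbS : has_lbound S by exists 0 => s [/ltW].
have hiS : has_inf S by split.
have [h0 h0p hh0] := EE_pos_small.
pose t0 := inf S.
have t0h : h0 <= t0.
  apply: lb_le_inf => // s [s0 vs]; rewrite leNgt; apply/negP => sh.
  by have := hh0 s; rewrite s0 (ltW sh) => /(_ isT); rewrite ltNge vs.
have t0_gt0 : 0 < t0 by rewrite (lt_le_trans h0p).
have vpos s : 0 < s < t0 -> 0 < v s.
  move=> /andP[s0 st0]; rewrite ltNge; apply/negP => vs.
  by have := ge_inf lbS (conj s0 vs); rewrite leNgt st0.
have vt0 : v t0 <= 0.
  rewrite leNgt; apply/negP => vt0.
  have c := @continuous_EE b t0 b0 t0_gt0.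
  have [e /= e0 he] := (nbhs_ballP _ _).1 (cvgr_gt _ c _ vt0).
  have [s [s0 vs] se] := inf_adherent e0 hiS.
  have : 0 < v s.
    apply: he; rewrite /ball/= distrC ger0_norm ?subr_ge0 ?ltrBlDl//.
    exact: (ge_inf lbS (conj s0 vs)).
  by rewrite ltNge vs.
have kt0 : 0 < kk b t0 by rewrite kkE// divr_gt0 ?powR_gt0 ?Gamma_gt0.
have b10 : 0 < b + 1 by rewrite addr_gt0.
have th2 : 0 < t0 / 2 by rewrite divr_gt0.
(* The maximum point [c] below satisfies [t0 / 2 <= c], so [D] bounds [z * kk b c / Gamma (b + 1)];
   [h] is then taken so small that [D (2 h) ^ b < kk b t0]. *)
pose D := z * kk b (t0 / 2) / Gamma (b + 1).
have D0 : 0 <= D by rewrite divr_ge0 ?mulr_ge0 ?kk_ge0// ltW// Gamma_gt0.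
have D10 : 0 < D + 1 by rewrite ltr_wpDl.
have kD : 0 < kk b t0 / (D + 1) by rewrite divr_gt0.
have [h1 h10 hh1] := powR_small b0 kD.
pose h := Num.min (h1 / 2) (t0 / 4).
have h_gt0 : 0 < h by rewrite lt_min !divr_gt0.
have hh2 : 2 * h <= h1.
  have : h <= h1 / 2 by rewrite ge_min lexx.
  by clear; lra.
have ht0 : 4 * h <= t0.
  have : h <= t0 / 4 by rewrite ge_min lexx orbT.
  by clear; lra.
(* As [t'] lies strictly before [t1], the factor [kk 1 (s - t')] is 1 on the whole of [[c, t0[],
   even if [c = t1]. *)
pose t1 := t0 - h; pose t' := t0 - 2 * h.
have t1_gt0 : t0 / 2 <= t1 by rewrite /t1; move: h_gt0 ht0; clear; lra.
have t1t0 : t1 < t0 by rewrite /t1 ltrBlDr ltrDl.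
have t't1 : t' < t1 by rewrite /t1 /t'; move: h_gt0; clear; lra.
have cv : {within `[t1, t0], continuous v}.
  apply: continuous_in_subspaceT => x; rewrite inE/= in_itv/= => /andP[x1 _].
  apply: continuous_EE => //; rewrite (lt_le_trans _ x1)// (lt_le_trans th2)//.
have [c] := EVT_max (ltW t1t0) cv; rewrite in_itv/= => /andP[t1c ct0] hc.
clear cv; have m0 : 0 < v c.
  apply: (@lt_le_trans _ _ (v t1)); last by apply: hc; rewrite in_itv/= lexx ltW.
  by apply: vpos; rewrite t1t0 andbT (lt_le_trans th2).
have ct : c < t0.
  by rewrite lt_neqAle ct0 andbT; apply/eqP => e; move: m0; rewrite e ltNge vt0.
have c0 : 0 < c by rewrite (lt_le_trans _ t1c)// (lt_le_trans th2).
have kc : 0 < kk b c by rewrite (kkE _ c0); exact: divr_gt0 (powR_gt0 _ c0) (Gamma_gt0 b0).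
have [L0 E0] := EE_volterra t0; have [Lc Ec] := EE_volterra c.
set I0 := \int[lam]_s _ in E0; set Ic := \int[lam]_s _ in Ec.
have [LJ EJ] := kk_conv_shift t0 t' b0 (@ltr01 R).
(* For [s < c] the integrand of the left-hand side is nonpositive by [kk_ratio]; for [c <= s < t0]
   only the first integral contributes, and [v s] is at most the maximum [v c]. *)
have main : kk b c * I0 - kk b t0 * Ic <= kk b c * v c * kk (b + 1) (t0 - t').
  clear E0 Ec; rewrite -EJ; clear EJ; rewrite -RIZ// /I0 /Ic -!RIZ// -RIB; [|exact: L1Z|exact: L1Z].
  apply: le_RI; [by apply: L1B; exact: L1Z|exact: L1Z|] => s.
  rewrite -/v kk1E.
  have RH : 0 <= kk b c * v c * (kk b (t0 - s) * (if 0 < s - t' then 1 else 0)).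
    by rewrite !mulr_ge0 ?kk_ge0// ?(ltW m0)//; case: ifP.
  have [s0|s0] := leP s 0.
    by rewrite /v (EE_le0 _ _ _ s0) !mulr0 subrr.
  have [sc|sc] := ltP s c.
    have vs0 : 0 <= v s by apply/ltW/vpos; rewrite s0 (lt_trans sc ct).
    apply: le_trans RH; rewrite subr_le0 [leLHS]mulrA [leRHS]mulrA.
    exact: (ler_wpM2r vs0 (kk_ratio b01 s0 sc (ltW ct))).
  rewrite (@kk_le0 _ b (c - s)) ?subr_le0// mul0r mulr0 subr0.
  have [st0|st0] := ltP s t0; last by rewrite (@kk_le0 _ b (t0 - s)) ?subr_le0// !mul0r !mulr0.
  rewrite ifT; last by rewrite subr_gt0 (lt_le_trans t't1)// (le_trans t1c).
  rewrite mulr1 [leRHS]mulrAC [leLHS]mulrA; apply: (ler_wpM2l (mulr_ge0 (ltW kc) (kk_ge0 _ b0))).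
  by apply: hc; rewrite in_itv/= (ltW st0) andbT (le_trans t1c).
have zI0 : kk b t0 <= z * I0 by move: vt0; rewrite /v E0 subr_le0.
(* The Volterra equation at [c] is multiplied by [kk b t0], and [v t0 <= 0] bounds the source term;
   the positive factor [v c] then cancels. *)
have key : kk b t0 * v c <= z * (kk b c * v c * kk (b + 1) (t0 - t')).
  have e : kk b t0 * v c = kk b t0 * kk b c - z * kk b t0 * Ic by rewrite /v Ec; clear; ring.
  rewrite e; apply: le_trans (ler_wpM2l z0 main).
  rewrite -subr_ge0 (_ : _ - _ = kk b c * (z * I0 - kk b t0)); last by clear; ring.
  by rewrite mulr_ge0 ?(ltW kc)// subr_ge0.
have J : kk (b + 1) (t0 - t') = (2 * h) `^ b / Gamma (b + 1).
  rewrite /t' (_ : t0 - (t0 - 2 * h) = 2 * h); last by clear; ring.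
  by rewrite kkE ?mulr_gt0// addrK.
have key2 : kk b t0 <= z * kk b c * kk (b + 1) (t0 - t').
  rewrite -(ler_pM2r m0); apply: le_trans key _.
  rewrite le_eqVlt; apply/orP; left; apply/eqP.
  by move: (kk b c) (kk (b + 1) _) (v c) => x y w; clear; ring.
have : kk b t0 < kk b t0.
  apply: (le_lt_trans key2); rewrite J.
  apply: (@le_lt_trans _ _ (D * (2 * h) `^ b)).
    rewrite (_ : D * _ = z * kk b (t0 / 2) * ((2 * h) `^ b / Gamma (b + 1))); last first.
      by rewrite /D; clear; ring.
    apply: ler_wpM2r; first by rewrite divr_ge0 ?powR_ge0// ltW// Gamma_gt0.
    by rewrite ler_wpM2l// kk_decr// (le_trans t1_gt0).
  apply: (@le_lt_trans _ _ (D * (kk b t0 / (D + 1)))).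
    by rewrite ler_wpM2l//; apply: hh1; rewrite mulr_ge0 ?(ltW h_gt0).
  by rewrite mulrA ltr_pdivrMr// mulrC ltr_pM2l// ltrDl.
by rewrite ltxx.
Qed.

Lemma EE_bound_le1 (t : R) : `|EE b z b t| <= kk b t.
Proof.
have [t0|t0] := leP t 0; first by rewrite EE_le0// kk_le0// normr0.
rewrite ger0_norm ?(ltW (EE_gt0 t0))//; have [L ->] := EE_volterra t.
rewrite gerBl mulr_ge0//; apply: RI_ge0 => s; rewrite mulr_ge0 ?kk_ge0//.
have [s0|s0] := leP s 0; first by rewrite EE_le0.
exact/ltW/EE_gt0.
Qed.

End EE_pos.

(** * Symmetric double integrals *)

Section square.
Context {R : realType}.
Implicit Types f k V : R -> R.

Lemma RI_del1 f (s : R) : measurable_fun setT f ->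
  \int[lam]_u (if s == u then 0 else f u) = \int[lam]_u f u.
Proof.
move=> mf; rewrite /Rintegral; congr fine; apply: ae_eq_integral => //.
- apply/measurable_EFinP; apply: measurable_fun_ifT => //.
  exact: measurable_fun_eqr.
- exact/measurable_EFinP.
exists [set s]; split => //.
  by have := @lam_itv R s s true false (lexx _); rewrite subrr set_itv1.
by move=> u /=; apply: contra_notP => us _; rewrite ifF//; apply/negbTE/eqP => e; apply: us.
Qed.

(** Exchanging the two variables identifies both halves; the symmetric form is the one that a Gram
    kernel can represent. *)
Lemma RI_symmetrize f k :
  L1 (lam \x lam)%E (fun w : R * R => f w.1 * (k (w.1 - w.2) * f w.2)) ->
  L1 (lam \x lam)%E (fun w : R * R => f w.1 * (k (w.2 - w.1) * f w.2)) ->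
  (forall s, L1 lam (fun u => k (s - u) * f u)) ->
  L1 (lam \x lam)%E (fun w : R * R => f w.1 * f w.2 * (k (w.1 - w.2) + k (w.2 - w.1))) /\
  \int[(lam \x lam)%E]_w (f w.1 * f w.2 * (k (w.1 - w.2) + k (w.2 - w.1))) =
    2 * \int[lam]_s (f s * \int[lam]_u (k (s - u) * f u)).
Proof.
move=> L1a L1b L.
have E : (fun w : R * R => f w.1 * f w.2 * (k (w.1 - w.2) + k (w.2 - w.1))) =
  fun w : R * R => f w.1 * (k (w.1 - w.2) * f w.2) + f w.1 * (k (w.2 - w.1) * f w.2).
  by apply/funext => w; clear; ring.
have IA : \int[(lam \x lam)%E]_w (f w.1 * (k (w.1 - w.2) * f w.2)) =
    \int[lam]_s (f s * \int[lam]_u (k (s - u) * f u)).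
  rewrite (RI_prod12 L1a) /=; apply: eq_RI => s; rewrite RIZ; [reflexivity|exact: L].
have IB : \int[(lam \x lam)%E]_w (f w.1 * (k (w.2 - w.1) * f w.2)) =
    \int[lam]_s (f s * \int[lam]_u (k (s - u) * f u)).
  rewrite (RI_prod21 L1b) /=; apply: eq_RI => s.
  rewrite -(RIZ _ (L s)); apply: eq_RI => u; clear; ring.
rewrite E; split; first exact: L1D.
rewrite (RID L1a L1b) IA IB mulr2n mulrDl mul1r; reflexivity.
Qed.

Lemma L1_kk1M f (s : R) : L1 lam f -> L1 lam (fun u => kk 1 (s - u) * f u).
Proof.
move=> hf; apply: L1_le (L1_norm hf).
  by apply: measurable_funM; [exact: measurable_kkB|exact: L1_measurable hf].
move=> u; rewrite normrM ler_piMl//.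
by have /andP[k0 k1] := kk1_01 (s - u); rewrite ger0_norm.
Qed.

(** The two triangles of the square contribute equally and the diagonal is null. This gives both the
    left-hand side of [energy] and the case [beta = 1] of [pos_type]. *)
Lemma RI_square f : L1 lam f ->
  \int[lam]_s (f s * \int[lam]_u (kk 1 (s - u) * f u)) = (\int[lam]_s f s) ^+ 2 / 2.
Proof.
move=> hf; have mf := L1_measurable hf.
have m1 : measurable_fun setT (fun w : R * R => f w.1) by exact: measurableT_comp.
have m2 : measurable_fun setT (fun w : R * R => f w.2) by exact: measurableT_comp.
have mk1 : measurable_fun setT (fun w : R * R => kk 1 (w.1 - w.2)).
  by apply: measurableT_comp; [exact: measurable_kk|exact: measurable_funB].
have mk2 : measurable_fun setT (fun w : R * R => kk 1 (w.2 - w.1)).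
  by apply: measurableT_comp; [exact: measurable_kk|exact: measurable_funB].
have hk (x y w : R) : `|x * (kk 1 w * y)| <= `|x| * `|y|.
  rewrite 2!normrM ler_wpM2l// ler_piMl//.
  by have /andP[k0 k1] := kk1_01 w; rewrite ger0_norm.
have [|||_] := @RI_symmetrize f (kk 1).
- apply: (L1_prod_le (g := fun s => `|f s|) (h := fun s => `|f s|)).
  + by apply: measurable_funM => //; exact: measurable_funM.
  + by move=> x y; exact: hk.
  + exact: L1_norm.
  + exact: L1_norm.
- apply: (L1_prod_le (g := fun s => `|f s|) (h := fun s => `|f s|)).
  + by apply: measurable_funM => //; exact: measurable_funM.
  + by move=> x y; exact: hk.
  + exact: L1_norm.
  + exact: L1_norm.
- by move=> s; exact: L1_kk1M.
set A := \int[lam]_s (f s * _) => E.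
have Lff : L1 (lam \x lam)%E (fun w : R * R => f w.1 * f w.2 * (kk 1 (w.1 - w.2) + kk 1 (w.2 - w.1))).
  apply: (L1_prod_le (g := fun s => `|f s|) (h := fun s => `|f s|)).
  + by apply: measurable_funM; [exact: measurable_funM|exact: measurable_funD].
  + move=> x y /=; rewrite 2!normrM ler_piMr ?mulr_ge0//.
    rewrite !kk1E !subr_gt0; case: ltgtP => _; rewrite ?addr0 ?add0r ?normr1 ?normr0 ?ler01//.
  + exact: L1_norm.
  + exact: L1_norm.
have : \int[(lam \x lam)%E]_w (f w.1 * f w.2 * (kk 1 (w.1 - w.2) + kk 1 (w.2 - w.1))) =
    (\int[lam]_s f s) ^+ 2.
  rewrite (RI_prod12 Lff) /= expr2 -(RIZr _ hf); apply: eq_RI => s.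
  rewrite -(RIZ _ hf) -(RI_del1 s (measurable_funM (measurable_cst (f s)) mf)).
  apply: eq_RI => u; rewrite !kk1E !subr_gt0; case: (ltgtP s u) => _; rewrite /= ?addr0 ?add0r ?mulr1 ?mulr0//.
rewrite E => <-; clear; field; exact: isT.
Qed.

End square.

(** * Fractional kernels as Gram kernels *)

Section half_kernel.
Context {R : realType}.
Variable beta : R.
Hypothesis beta01 : 0 < beta < 1.

Let p := beta / 2.
Let beta0 : 0 < beta. Proof. by case/andP : beta01. Qed.
Let beta1 : beta < 1. Proof. by case/andP : beta01. Qed.
Let p0 : 0 < p. Proof. by rewrite divr_gt0. Qed.
Let p_le1 : p <= 1. Proof. by rewrite /p ler_pdivrMr// mul1r (le_trans (ltW beta1))// ler1n. Qed.
Let p2 : p + p = beta. Proof. by rewrite /p -splitr. Qed.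

(** The Gram integral of [kk p] at distance 1; homogeneity gives the other distances, and only
    finiteness and positivity matter. *)
Definition half_cst : R := \int[lam]_x (kk p (1 + x) * kk p x).

Lemma measurable_half_cst : measurable_fun setT (fun x : R => kk p (1 + x) * kk p x).
Proof.
apply: measurable_funM; last exact: measurable_kk.
by apply: measurableT_comp; [exact: measurable_kk|exact: measurable_funD].
Qed.

(** The integrand is at most of order [x ^ (p - 1)] near 0 and [x ^ (beta - 2)] near infinity. The
    latter is integrable because [beta < 1], and this is why [beta = 1] is treated apart. *)
Lemma L1_half_cst : L1 lam (fun x => kk p (1 + x) * kk p x).
Proof.
have g0 : 0 < Gamma p by exact: Gamma_gt0.
have p1 : p - 1 <= 0 by rewrite subr_le0.
have b1 : beta - 1 < 0 by rewrite subr_lt0.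
apply: (L1_le (g := fun x => ((Gamma p)^-1 * (Gamma p)^-1) * (pw01 p x + pw1y (beta - 1) x))).
- exact: measurable_half_cst.
- move=> x; rewrite ger0_norm ?mulr_ge0 ?kk_ge0//.
  have GG : 0 <= (Gamma p)^-1 * (Gamma p)^-1 by rewrite mulr_ge0 ?invr_ge0 ?ltW.
  have P0 : 0 <= pw01 p x + pw1y (beta - 1) x.
    rewrite /pw01 /pw1y; apply: addr_ge0; case: ifP => // _; exact: powR_ge0.
  have [x0|x0] := leP x 0; first by rewrite (kk_le0 _ x0) mulr0 mulr_ge0.
  have x10 : 0 < 1 + x by rewrite addr_gt0.
  rewrite !kkE// mulrACA [X in _ <= X]mulrC ler_wpM2r//.
  have e1 : 1 `^ (p - 1) = 1 :> R by rewrite powR1.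
  have h1 : (1 + x) `^ (p - 1) <= 1 by rewrite -[X in _ <= X]e1 powR_decr// lerDl ltW.
  have h2 : (1 + x) `^ (p - 1) <= x `^ (p - 1) by rewrite powR_decr// lerDr.
  rewrite /pw01 /pw1y in_itv/= x0/=; have [x1|x1] := leP x 1.
    apply: ler_wpDr; first by case: ifP => // _; exact: powR_ge0.
    by rewrite ler_piMl ?powR_ge0.
  rewrite (ltW x1) add0r.
  apply: (@le_trans _ _ (x `^ (p - 1) * x `^ (p - 1))); first by rewrite ler_wpM2r ?powR_ge0.
  rewrite -powRD; last by rewrite (gt_eqF x0) implybT.
  by rewrite le_eqVlt; apply/orP; left; apply/eqP; congr (_ `^ _); rewrite -p2; ring.
- by apply: L1Z; apply: L1D; [exact: L1_pw01|exact: L1_pw1y].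
Qed.

Lemma half_cst_gt0 : 0 < half_cst.
Proof.
have g0 : 0 < Gamma p by exact: Gamma_gt0.
have p01 : 0 < p <= 1 by rewrite p0.
pose c : R := kk p 3 * kk p 2.
have c0 : 0 < c by rewrite /c !kkE// mulr_gt0// divr_gt0// powR_gt0.
have le1 : 1 <= 2 :> R by rewrite ler1n.
have If := integral_box c le1.
rewrite (_ : c * _ = c) in If; last by rewrite (_ : 2 - 1 = 1 :> R) ?mulr1//; ring.
have Lf := L1_box le1 (ltW c0).
apply: lt_le_trans c0 _; rewrite -lee_fin -If -(RI_EFin Lf) lee_fin.
apply: le_RI => //; first exact: L1_half_cst.
move=> s; case: ifPn => [|_]; last by rewrite mulr_ge0 ?kk_ge0.
rewrite in_itv/= => /andP[s1 s2]; rewrite /c ler_pM ?kk_ge0//.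
  apply: kk_decr => //; first by rewrite addr_gt0// (lt_le_trans _ s1).
  rewrite (_ : 3 = 1 + 2); last by ring.
  by rewrite lerD2l.
by apply: kk_decr => //; rewrite (lt_le_trans _ s1).
Qed.

(** Substitute [y = u - x] and scale by [s - u]; the exponents agree since
    [2 (p - 1) + 1 = beta - 1]. *)
Lemma half_kernel_lt (s u : R) : u < s ->
  L1 lam (fun y => kk p (s - y) * kk p (u - y)) /\
  \int[lam]_y (kk p (s - y) * kk p (u - y)) = half_cst * Gamma beta * kk beta (s - u).
Proof.
move=> us; have D0 : 0 < s - u by rewrite subr_gt0.
pose D := s - u; rewrite -/D in D0 *.
have mf : measurable_fun setT (fun y : R => kk p (s - y) * kk p (u - y)).
  by apply: measurable_funM; exact: measurable_kkB.
have f0 y : 0 <= kk p (s - y) * kk p (u - y) by rewrite mulr_ge0 ?kk_ge0.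
have mg : measurable_fun setT (fun x : R => kk p (D + x) * kk p x).
  apply: measurable_funM; last exact: measurable_kk.
  by apply: measurableT_comp; [exact: measurable_kk|exact: measurable_funD].
have g0 x : 0 <= kk p (D + x) * kk p x by rewrite mulr_ge0 ?kk_ge0.
have I : (\int[lam]_y (kk p (s - y) * kk p (u - y))%:E =
    (half_cst * Gamma beta * kk beta D)%:E)%E.
  transitivity (\int[lam]_x (kk p (D + x) * kk p x)%:E)%E.
    rewrite (mpres_ge0_integral (lam_reflection u)); last 2 first.
    - exact/measurable_EFinP.
    - by move=> x; rewrite lee_fin.
    apply: eq_integral => x _; congr EFin; congr (kk _ _ * kk _ _); rewrite /D; clear; ring.
  have mgE : measurable_fun setT (fun x : R => (kk p (D + x) * kk p x)%:E) by exact/measurable_EFinP.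
  have gE x : (0 <= (kk p (D + x) * kk p x)%:E)%E by rewrite lee_fin.
  have E := @lam_scaling R D D0 (fun x => (kk p (D + x) * kk p x)%:E) mgE gE.
  transitivity (D%:E * \int[lam]_x (kk p (D + D * x) * kk p (D * x))%:E)%E.
    by rewrite E muleA -EFinM divff ?gt_eqF// mul1e.
  clear E.
  rewrite (eq_integral (fun x : R => ((D `^ (p - 1) * D `^ (p - 1)) * (kk p (1 + x) * kk p x))%:E)); last first.
    move=> x _; rewrite -{1}[D]mulr1 -mulrDr !kk_scale//; congr EFin; clear; ring.
  rewrite ge0_integralZ; last 3 first.
  - by rewrite mulr_ge0 ?powR_ge0.
  - by move=> x; rewrite mulr_ge0 ?kk_ge0.
  - exact: measurable_half_cst.
  rewrite -(RI_EFin L1_half_cst) -/half_cst -!EFinM; congr EFin.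
  rewrite kkE// -powRD; last by rewrite (gt_eqF D0) implybT.
  rewrite -[X in X * _](powRr1 (ltW D0)) mulrA -powRD; last by rewrite (gt_eqF D0) implybT.
  rewrite [RHS]mulrACA -[LHS]mulrC; rewrite mulrAC mulrA.
  have gb : Gamma beta != 0 by rewrite gt_eqF// Gamma_gt0.
  rewrite (_ : beta - 1 = 1 + (p - 1 + (p - 1))); last by rewrite -p2; ring.
  by field.
split.
  apply/L1P => //; under eq_integral do rewrite (ger0_norm (f0 _)).
  by rewrite I ltry.
by rewrite /Rintegral I.
Qed.

Lemma half_kernel (s u : R) : s != u ->
  L1 lam (fun y => kk p (s - y) * kk p (u - y)) /\
  \int[lam]_y (kk p (s - y) * kk p (u - y)) =
    half_cst * Gamma beta * (kk beta (s - u) + kk beta (u - s)).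
Proof.
case: (ltgtP s u) => // su _.
  have [L I] := half_kernel_lt su.
  have E : (fun y => kk p (s - y) * kk p (u - y)) = fun y => kk p (u - y) * kk p (s - y).
    apply/funext => y; exact: mulrC.
  rewrite E; split; first exact: L.
  rewrite (@kk_le0 _ _ (s - u)); last by rewrite subr_le0 ltW.
  rewrite add0r; exact: I.
have [L I] := half_kernel_lt su; split; first exact: L.
rewrite (@kk_le0 _ _ (u - s)); last by rewrite subr_le0 ltW.
rewrite addr0; exact: I.
Qed.

End half_kernel.

(** * Positive type of the fractional kernels *)

Section positive_type.
Context {R : realType}.
Variables (beta T M : R) (V : R -> R).
Hypotheses (beta01 : 0 < beta <= 1) (M0 : 0 <= M) (mV : measurable_fun setT V).
Hypothesis hV : forall s, `|V s| <= M * (kk 1 s * kk 1 (T - s)).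

Let beta0 : 0 < beta. Proof. by case/andP : beta01. Qed.

Let hV1 s : `|V s| <= M * kk 1 s.
Proof.
apply: le_trans (hV s) _; rewrite ler_wpM2l// ler_piMr//.
  by have /andP[] := kk1_01 s.
by have /andP[] := kk1_01 (T - s).
Qed.

Let hV2 s : `|V s| <= M * kk 1 (T - s).
Proof.
apply: le_trans (hV s) _; rewrite ler_wpM2l// ler_piMl//.
  by have /andP[] := kk1_01 (T - s).
by have /andP[] := kk1_01 s.
Qed.

Lemma pos_type_L1a s : L1 lam (fun u => kk beta (s - u) * V u) /\
  \int[lam]_u `|kk beta (s - u) * V u| <= M * kk (beta + 1) s.
Proof.
have m : measurable_fun setT (fun u : R => kk beta (s - u) * V u).
  by apply: measurable_funM => //; exact: measurable_kkB.
have le u : `|kk beta (s - u) * V u| <= M * (kk beta (s - u) * kk 1 u).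
  by rewrite normrM (ger0_norm (kk_ge0 _ beta0)) [X in _ <= X]mulrCA ler_wpM2l ?kk_ge0.
have L := L1Z M (L1_kk_conv s beta0 (@ltr01 R)).
have L1f := L1_le m le L; split => //.
rewrite -(RI_kk_conv s beta0 (@ltr01 R)) -RIZ; last exact: L1_kk_conv.
by apply: le_RI => //; exact: L1_norm.
Qed.

Lemma pos_type_L1b s : L1 lam (fun u => kk beta (u - s) * V u) /\
  \int[lam]_u `|kk beta (u - s) * V u| <= M * kk (beta + 1) (T - s).
Proof.
have m : measurable_fun setT (fun u : R => kk beta (u - s) * V u).
  apply: measurable_funM => //.
  by apply: measurableT_comp; [exact: measurable_kk|exact: measurable_funB].
have le u : `|kk beta (u - s) * V u| <= M * (kk 1 (T - u) * kk beta (u - s)).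
  rewrite normrM (ger0_norm (kk_ge0 _ beta0)) [leLHS]mulrC [leRHS]mulrA.
  exact: (ler_wpM2r (kk_ge0 _ beta0) (hV2 u)).
have [L0 I] := kk_conv_shift T s (@ltr01 R) beta0.
have L1f := L1_le m le (L1Z M L0); split => //.
rewrite (addrC beta) -I -(RIZ M L0).
by apply: le_RI => //; [exact: L1_norm|exact: L1Z].
Qed.

Let mVk (k : R * R -> R) : measurable_fun setT k ->
  measurable_fun setT (fun w : R * R => V w.1 * (k w * V w.2)).
Proof.
move=> mk; apply: measurable_funM; first exact: measurableT_comp.
by apply: measurable_funM => //; exact: measurableT_comp.
Qed.

Lemma pos_type_prod1 :
  L1 (lam \x lam)%E (fun w : R * R => V w.1 * (kk beta (w.1 - w.2) * V w.2)).
Proof.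
apply: (@L1_prod_iter _ _ _ _ R lam lam (fun w : R * R => V w.1 * (kk beta (w.1 - w.2) * V w.2))
  (fun s => M * M * (kk 1 (T - s) * kk (beta + 1) s))).
- apply: mVk; apply: measurableT_comp; [exact: measurable_kk|exact: measurable_funB].
- by move=> s /=; apply: L1Z; exact: (pos_type_L1a s).1.
- move=> s /=; have [L I] := pos_type_L1a s.
  have -> : \int[lam]_u `|V s * (kk beta (s - u) * V u)| = \int[lam]_u (`|V s| * `|kk beta (s - u) * V u|).
    by apply: eq_RI => u; exact: normrM.
  rewrite (RIZ _ (L1_norm L)).
  apply: (@le_trans _ _ (`|V s| * (M * kk (beta + 1) s))); first by rewrite ler_wpM2l.
  apply: (@le_trans _ _ ((M * kk 1 (T - s)) * (M * kk (beta + 1) s))).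
    exact: (ler_wpM2r (mulr_ge0 M0 (kk_ge0 _ (addr_gt0 beta0 ltr01))) (hV2 s)).
  rewrite le_eqVlt; apply/orP; left; apply/eqP.
  by move: (kk 1 _) (kk (beta + 1) _) => x y; clear; ring.
- by apply: L1Z; apply: L1_kk_conv; rewrite ?addr_gt0.
Qed.

Lemma pos_type_prod2 :
  L1 (lam \x lam)%E (fun w : R * R => V w.1 * (kk beta (w.2 - w.1) * V w.2)).
Proof.
apply: (@L1_prod_iter _ _ _ _ R lam lam (fun w : R * R => V w.1 * (kk beta (w.2 - w.1) * V w.2))
  (fun s => M * M * (kk (beta + 1) (T - s) * kk 1 s))).
- apply: mVk; apply: measurableT_comp; [exact: measurable_kk|exact: measurable_funB].
- by move=> s /=; apply: L1Z; exact: (pos_type_L1b s).1.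
- move=> s /=; have [L I] := pos_type_L1b s.
  have -> : \int[lam]_u `|V s * (kk beta (u - s) * V u)| = \int[lam]_u (`|V s| * `|kk beta (u - s) * V u|).
    by apply: eq_RI => u; exact: normrM.
  rewrite (RIZ _ (L1_norm L)).
  apply: (@le_trans _ _ (`|V s| * (M * kk (beta + 1) (T - s)))); first by rewrite ler_wpM2l.
  apply: (@le_trans _ _ ((M * kk 1 s) * (M * kk (beta + 1) (T - s)))).
    exact: (ler_wpM2r (mulr_ge0 M0 (kk_ge0 _ (addr_gt0 beta0 ltr01))) (hV1 s)).
  rewrite le_eqVlt; apply/orP; left; apply/eqP.
  by move: (kk 1 _) (kk (beta + 1) _) => x y; clear; ring.
- by apply: L1Z; apply: L1_kk_conv; rewrite ?addr_gt0.
Qed.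

Lemma pos_type_L1 : L1 lam (fun s => V s * \int[lam]_u (kk beta (s - u) * V u)).
Proof.
have := L1_prod12 pos_type_prod1; apply: eq_integrable => // s _ /=; congr EFin.
by rewrite RIZ//; exact: (pos_type_L1a s).1.
Qed.

Let V_L1 : L1 lam V.
Proof.
apply: L1_le mV hV _; apply: L1Z.
by have := L1_kk_conv T (@ltr01 R) (@ltr01 R); apply: eq_integrable => // s _ /=; rewrite mulrC.
Qed.

(* [kk beta (s - u) + kk beta (u - s)] is a multiple of the Gram kernel
   [\int kk (beta/2) (s - y) kk (beta/2) (u - y) dy]. *)
Let pos_type_lt1 : beta < 1 -> 0 <= \int[lam]_s (V s * \int[lam]_u (kk beta (s - u) * V u)).
Proof.
move=> beta1; have b01 : 0 < beta < 1 by rewrite beta0.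
have p0 : 0 < beta / 2 by rewrite divr_gt0.
have [LF IF] := RI_symmetrize pos_type_prod1 pos_type_prod2 (fun s => (pos_type_L1a s).1).
set P := \int[lam]_s _ in IF *.
pose p := beta / 2; pose c := half_cst beta * Gamma beta.
have c0 : 0 < c by rewrite mulr_gt0 ?half_cst_gt0 ?Gamma_gt0.
(* On the diagonal the Gram integral diverges; the value 0 is put there, on a null set. *)
pose Phi (z : (R * R) * R) := if z.1.1 == z.1.2 then 0 else
  V z.1.1 * V z.1.2 * (kk p (z.1.1 - z.2) * kk p (z.1.2 - z.2)).
have mPhi : measurable_fun setT Phi.
  apply: measurable_fun_ifT => //.
    by apply: measurable_fun_eqr; exact: measurableT_comp.
  apply: measurable_funM; apply: measurable_funM.
  - by apply: measurableT_comp => //; exact: measurableT_comp.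
  - by apply: measurableT_comp => //; exact: measurableT_comp.
  - by apply: measurableT_comp; [exact: measurable_kk|apply: measurable_funB => //; exact: measurableT_comp].
  - by apply: measurableT_comp; [exact: measurable_kk|apply: measurable_funB => //; exact: measurableT_comp].
pose F (w : R * R) := V w.1 * V w.2 * (kk beta (w.1 - w.2) + kk beta (w.2 - w.1)).
have HP w : L1 lam (fun y => Phi (w, y)) /\ \int[lam]_y Phi (w, y) = c * F w /\
    \int[lam]_y `|Phi (w, y)| = c * `|F w|.
  rewrite /Phi /F /=; case: eqP => [->|/eqP ne].
    rewrite subrr (@kk_le0 _ _ 0)// addr0 !mulr0 normr0 mulr0; split; first exact: integrable0.
    by rewrite /Rintegral !integral0_eq// => x _; rewrite normr0.
  have [L I] := half_kernel b01 ne; split; first exact: L1Z.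
  split; first by rewrite (RIZ _ L) I -/c mulrCA; reflexivity.
  transitivity (\int[lam]_y (`|V w.1 * V w.2| * (kk p (w.1 - y) * kk p (w.2 - y)))).
    apply: eq_RI => y; rewrite normrM (ger0_norm (mulr_ge0 (kk_ge0 _ p0) (kk_ge0 _ p0))); reflexivity.
  have k0 : 0 <= kk beta (w.1 - w.2) + kk beta (w.2 - w.1) by rewrite addr_ge0 ?kk_ge0.
  rewrite (RIZ _ L) I -/c (normrM (V w.1 * V w.2)) (ger0_norm k0) mulrCA; reflexivity.
have LPhi : L1 (prod_measure lam lam \x lam)%E Phi.
  apply: (L1_prod_iter (G := fun w => c * `|F w|)) => //.
  - by move=> w; exact: (HP w).1.
  - by move=> w; rewrite (HP w).2.2.
  - by apply: L1Z; exact: L1_norm.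
have E := RI_fubini LPhi.
have E2 : \int[prod_measure lam lam]_w \int[lam]_y Phi (w, y) = c * (2 * P).
  rewrite -IF -(RIZ c LF); apply: eq_RI => w; exact: (HP w).2.1.
have : 0 <= c * (2 * P).
  (* For fixed [y] the double integral in the other variables is the square of the integral of
     [W]. *)
  rewrite -E2 E; apply: RI_ge0 => y.
  pose W s := V s * kk p (s - y).
  have mW : measurable_fun setT W.
    apply: measurable_funM => //; apply: measurableT_comp; [exact: measurable_kk|exact: measurable_funB].
  have LW : L1 lam W.
    have [L _] := kk_conv_shift T y (@ltr01 R) p0.
    apply: L1_le mW _ (L1Z M L) => s.
    by rewrite /W normrM (ger0_norm (kk_ge0 _ p0)) mulrA ler_wpM2r ?kk_ge0.
  have LWW : L1 (lam \x lam)%E (fun w => Phi (w, y)).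
    apply: (L1_prod_le (g := fun s => `|W s|) (h := fun s => `|W s|)).
    - exact: measurableT_comp.
    - move=> s u; rewrite /Phi /W /=; case: ifP => _; first by rewrite normr0 mulr_ge0.
      by rewrite -normrM mulrACA.
    - exact: L1_norm.
    - exact: L1_norm.
  have -> : \int[prod_measure lam lam]_w Phi (w, y) = (\int[lam]_s W s) ^+ 2.
    transitivity (\int[lam]_s \int[lam]_u Phi ((s, u), y)); first exact: (RI_prod12 LWW).
    rewrite expr2 -(RIZr _ LW); apply: eq_RI => s.
    rewrite -(RIZ _ LW) -(RI_del1 s (measurable_funM (measurable_cst (W s)) mW)).
    by apply: eq_RI => u; rewrite /Phi /W /=; case: ifP => // _; rewrite mulrACA.
  exact: sqr_ge0.
by rewrite (pmulr_rge0 _ c0) pmulr_rge0.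
Qed.

Lemma pos_type : 0 <= \int[lam]_s (V s * \int[lam]_u (kk beta (s - u) * V u)).
Proof.
have : beta <= 1 by case/andP : beta01.
rewrite le_eqVlt => /predU1P[->|]; last exact: pos_type_lt1.
by rewrite RI_square// divr_ge0// sqr_ge0.
Qed.

End positive_type.

(** * Energy estimate for orders above 1 *)

Section energy.
Context {R : realType}.
Variables b z : R.
Hypotheses (b12 : 1 < b <= 2) (z0 : 0 <= z).

Let b1 : 1 < b. Proof. by case/andP : b12. Qed.
Let b0 : 0 < b. Proof. by rewrite (lt_trans _ b1). Qed.
Let bm0 : 0 < b - 1. Proof. by rewrite subr_gt0. Qed.
Let v := EE b z b.

Let v_le T s : 0 <= T -> s <= T -> `|v s| <= ml_cst b (`|z| * T `^ b) * 2 * Gamma b * kk b T.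
Proof.
move=> T0 sT; apply: le_trans (EE_le b0 z b0 T0 sT) _.
rewrite ler_wpM2l ?kk_incr ?(ltW b1)//.
apply: mulr_ge0; last exact: ltW (Gamma_gt0 b0).
by apply: mulr_ge0 => //; apply: (ml_cst_ge0 b0); rewrite mulr_ge0 ?powR_ge0.
Qed.

(* With [q = EE b z (b - 1)] one has [v = kk 1 * q] and
   [q = kk (b - 1) - z (kk (b - 1) * v)] (convolutions), and [kk (b - 1)] is of positive
   type, whence [v T ^ 2 / 2 = \int q v <= \int kk (b - 1) v]. *)
Lemma energy (T S : R) : 0 < T -> (forall s, 0 < s < T -> `|v s| <= S) -> v T ^+ 2 <= 2 * S * kk b T.
Proof.
move=> T0 hS.
pose q s := kk 1 (T - s) * EE b z (b - 1) s.
have [Lq Iq] : L1 lam q /\ \int[lam]_s q s = v T.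
  have [L I] := EE_conv b0 z T (@ltr01 R) bm0; split; first exact: L.
  rewrite /q I subrK; reflexivity.
have mv : measurable_fun setT v by exact: measurable_EE.
pose V s := kk 1 (T - s) * v s.
have mV : measurable_fun setT V by apply: measurable_funM => //; exact: measurable_kkB.
pose M := ml_cst b (`|z| * T `^ b) * 2 * Gamma b * kk b T.
have M0 : 0 <= M by apply: le_trans (v_le (ltW T0) (lexx T)).
have hV s : `|V s| <= M * (kk 1 s * kk 1 (T - s)).
  rewrite /V normrM (ger0_norm (kk_ge0 _ ltr01)) [X in _ <= X]mulrA mulrC.
  have [sT|sT] := leP (T - s) 0; first by rewrite (@kk_le0 _ _ (T - s))// !mulr0.
  apply: (ler_wpM2r (kk_ge0 _ ltr01)); rewrite kk1E; case: ifPn => [s0|].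
    by rewrite mulr1; apply: v_le; [exact: ltW|rewrite ltW// -subr_gt0].
  by rewrite -leNgt => s0; rewrite /v EE_le0// normr0 mulr0.
have SV s : V s <= S * kk 1 (T - s).
  rewrite /V mulrC; have [sT|sT] := leP (T - s) 0; first by rewrite (@kk_le0 _ _ (T - s))// !mulr0.
  rewrite ler_wpM2r ?kk_ge0//; have [s0|s0] := ltP 0 s.
    by apply: le_trans (ler_norm _) _; apply: hS; rewrite s0 -subr_gt0.
  rewrite /v EE_le0//; apply: le_trans (hS (T / 2) _); first exact: normr_ge0.
  by rewrite divr_gt0// ltr_pdivrMr// mulr_natr mulr2n ltrDl.
have bm1 : 0 < b - 1 <= 1 by rewrite bm0 lerBlDr; case/andP : b12.
have Lpos := pos_type_L1 bm1 M0 mV hV.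
have pos := pos_type bm1 M0 mV hV.
have LSk := L1Z S (L1_kk_conv T (@ltr01 R) bm0).
have LVk2 : L1 lam (fun s => V s * kk (b - 1) s).
  have := L1_kk_conv T (@ltr01 R) bm0 => L.
  have mVk : measurable_fun setT (fun s => V s * kk (b - 1) s).
    by apply: measurable_funM => //; exact: measurable_kk.
  have leVk s : `|V s * kk (b - 1) s| <= M * (kk 1 (T - s) * kk (b - 1) s).
    rewrite normrM (ger0_norm (kk_ge0 _ bm0)) [leRHS]mulrA; apply: (ler_wpM2r (kk_ge0 _ bm0)).
    apply: le_trans (hV s) _; rewrite ler_wpM2l// ler_piMl ?kk_ge0//.
    by have /andP[] := kk1_01 s.
  exact: L1_le mVk leVk (L1Z M L).
pose Q s := \int[lam]_u (kk (b - 1) (s - u) * V u).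
(* The cut-offs at [T] are invisible to the inner convolutions, which read [u < s < T] only; beyond
   [T] both sides vanish. *)
have point s : q s * \int[lam]_u (kk 1 (s - u) * q u) = V s * kk (b - 1) s - z * (V s * Q s).
  clear Iq; have [sT|sT] := leP (T - s) 0.
    have q0 : q s = 0 by rewrite /q (@kk_le0 _ _ (T - s) sT) mul0r.
    have V0 : V s = 0 by rewrite /V (@kk_le0 _ _ (T - s) sT) mul0r.
    have gen (x y w : R) : 0 * x = 0 * y - z * (0 * w) by clear; ring.
    rewrite q0 V0; exact: gen.
  have sT' : s < T by rewrite -subr_gt0.
  have E1 : \int[lam]_u (kk 1 (s - u) * q u) = v s.
    have [_ I] := EE_conv b0 z s (@ltr01 R) bm0; rewrite subrK in I; rewrite /v -I.
    clear I; apply: eq_RI => u; rewrite /q; have [us|us] := ltP u s; last first.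
      by rewrite (@kk_le0 _ _ (s - u)) ?subr_le0// !mul0r.
    by rewrite (kk1E (T - u)) subr_gt0 (lt_trans us sT') mul1r.
  have E2 : Q s = EE b z (b - 1 + b) s.
    have [_ I] := EE_conv b0 z s bm0 b0; rewrite (addrC (b - 1)) -I /Q.
    clear I; apply: eq_RI => u; rewrite /V; have [us|us] := ltP u s; last first.
      by rewrite (@kk_le0 _ _ (s - u)) ?subr_le0// !mul0r.
    by rewrite (kk1E (T - u)) subr_gt0 (lt_trans us sT') mul1r.
  rewrite E1 E2 /q /V (EE_rec b0 z s bm0).
  move: (kk 1 _) (kk (b - 1) _) (EE b z (b - 1 + b) s) (v s) => x y w u; clear; ring.
have := RI_square Lq; rewrite (eq_RI _ point) (RIB LVk2 (L1Z z Lpos)) (RIZ z Lpos) Iq => sq.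
have le1 : \int[lam]_s (V s * kk (b - 1) s) <= S * kk b T.
  have := RI_kk_conv T (@ltr01 R) bm0; rewrite (addrC 1) subrK => <-.
  rewrite -(RIZ S (L1_kk_conv T (@ltr01 R) bm0)); clear Iq sq.
  apply: le_RI; [exact: LVk2|exact: LSk|move=> s; rewrite [leRHS]mulrA].
  exact: (ler_wpM2r (kk_ge0 _ bm0) (SV s)).
have le2 : v T ^+ 2 / 2 <= S * kk b T.
  by rewrite -sq; apply: le_trans le1; rewrite gerBl mulr_ge0.
by move: le2; rewrite ler_pdivrMr// => le2; apply: le_trans le2 _; rewrite le_eqVlt; apply/orP; left; apply/eqP; clear; ring.
Qed.

(** With [S] the supremum of the modulus of [v] on []0, T]], finite by [v_le], the energy estimate
    gives [S ^ 2 <= 2 S kk b T], and [S] cancels. *)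
Lemma EE_bound_gt1 (T : R) : `|v T| <= 2 * kk b T.
Proof.
have [T0|T0] := leP T 0; first by rewrite /v EE_le0// kk_le0// normr0 mulr0.
pose E := [set `|v s| | s in [set s | 0 < s <= T]].
have E0 : E !=set0 by exists `|v T|, T => //=; rewrite T0 lexx.
have ubE : has_ubound E.
  exists (ml_cst b (`|z| * T `^ b) * 2 * Gamma b * kk b T) => _ [s /andP[_ sT] <-].
  exact: v_le (ltW T0) sT.
have hE s : 0 < s <= T -> `|v s| <= sup E by move=> sT; apply: ub_le_sup => //; exists s.
have kT : 0 < kk b T by rewrite kkE// divr_gt0 ?powR_gt0 ?Gamma_gt0.
have S0 : 0 <= sup E by apply: le_trans (hE T _); rewrite ?T0 ?lexx.
apply: le_trans (hE T _) _; first by rewrite T0 lexx.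
have sq : sup E <= Num.sqrt (2 * sup E * kk b T).
  apply: ge_sup => // _ [s /= /andP[s0 sT] <-].
  rewrite -sqrtr_sqr ler_wsqrtr//; apply: (@le_trans _ _ (2 * sup E * kk b s)).
    apply: energy => // u /andP[u0 us]; apply: hE; rewrite u0 (le_trans (ltW us))//.
  by rewrite ler_wpM2l ?mulr_ge0// kk_incr// ltW.
have : sup E ^+ 2 <= 2 * sup E * kk b T.
  rewrite -[X in _ <= X]sqr_sqrtr ?mulr_ge0// ?(ltW kT)//.
  by rewrite lerXn2r ?nnegrE// sqrtr_ge0.
have [S1 _|S1] := leP (sup E) 0; first by rewrite (le_trans S1)// mulr_ge0// ltW.
by rewrite expr2 mulrAC ler_pM2r.
Qed.

End energy.

(** The case [beta = b] comes from positivity or from the energy estimate; convolution with the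
    nonnegative kernel [kk (beta - b)] transports it to larger [beta]. The point is uniformity in
    [z]. *)
Lemma EE_bound (R : realType) (b z beta t : R) : 0 < b <= 2 -> 0 <= z -> b <= beta ->
  `|EE b z beta t| <= 2 * kk beta t.
Proof.
move=> /andP[b0 b2] z0.
have base s : `|EE b z b s| <= 2 * kk b s.
  have [b1|b1] := leP b 1; last by apply: EE_bound_gt1 => //; rewrite b1.
  apply: le_trans (EE_bound_le1 _ z0 s) _; first by rewrite b0.
  by rewrite ler_peMl ?kk_ge0// ler1n.
rewrite le_eqVlt => /orP[/eqP <-//|bb].
have p0 : 0 < beta - b by rewrite subr_gt0.
have [L I] := EE_conv b0 z t p0 b0; rewrite (addrC b) subrK in I; rewrite -I.
have := RI_kk_conv t p0 b0; rewrite subrK => <-.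
rewrite -RIZ; last exact: L1_kk_conv.
apply: norm_RI_le; first exact: L1_measurable L.
  move=> s; rewrite normrM (ger0_norm (kk_ge0 _ p0)) [X in _ <= X]mulrCA.
  by rewrite ler_wpM2l ?kk_ge0.
by apply: L1Z; exact: L1_kk_conv.
Qed.

#[local] Opaque kk EE mittag_leffler.

(** * Decay in the spectral parameter *)

Section asymptotics.
Context {R : realType}.
Variables b : R.
Hypothesis b02 : 0 < b <= 2.

Let b0 : 0 < b. Proof. by case/andP : b02. Qed.

Lemma EE_z0 (beta s : R) : 0 < beta -> EE b 0 beta s = kk beta s.
Proof. by move=> beta0; rewrite EE_rec// mul0r subr0. Qed.

Lemma kk1_diff_ge0 (s t u : R) : s <= t -> 0 <= kk 1 (t - u) - kk 1 (s - u).
Proof.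
move=> st; rewrite !kk1E !subr_gt0; case: ifPn => [ut|].
  by case: ifP => _; rewrite ?subrr ?subr0.
by rewrite -leNgt => tu; rewrite ifF ?subrr//; apply/negbTE; rewrite -leNgt (le_trans st).
Qed.

(** Both increments are integrals against the nonnegative weight [kk 1 (t - u) - kk 1 (s - u)],
    through which [EE_bound] passes. *)
Lemma EE_increment (z rho s t : R) : 0 <= z -> b <= rho -> s <= t ->
  `|EE b z (rho + 1) t - EE b z (rho + 1) s| <= 2 * (kk (rho + 1) t - kk (rho + 1) s).
Proof.
move=> z0 brho st; have rho0 : 0 < rho by rewrite (lt_le_trans b0).
have [Lt It] := EE_conv b0 z t (@ltr01 R) rho0.
have [Ls Is] := EE_conv b0 z s (@ltr01 R) rho0.
have Kt := L1_kk_conv t (@ltr01 R) rho0; have Ks := L1_kk_conv s (@ltr01 R) rho0.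
rewrite -It -Is -(RIB Lt Ls) (addrC rho) -(RI_kk_conv t (@ltr01 R) rho0).
rewrite -(RI_kk_conv s (@ltr01 R) rho0) -(RIB Kt Ks) -(RIZ 2 (L1B Kt Ks)).
clear It Is; apply: norm_RI_le; first exact: L1_measurable (L1B Lt Ls).
  move=> u; rewrite -!mulrBl normrM (ger0_norm (kk1_diff_ge0 u st)) mulrCA.
  by apply: (ler_wpM2l (kk1_diff_ge0 u st)); exact: EE_bound.
exact: L1Z (L1B Kt Ks).
Qed.

(** On [[s, T]] the function of parameter [rho + 1] stays above its value at [T] minus the variation
    allowed by [EE_increment]; integrate over this interval, whose length within the positive
    half-line is [kk 2 T - kk 2 s]. *)
Lemma EE_antideriv_le (z rho s T : R) : 0 <= z -> b <= rho -> s < T ->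
  (kk 2 T - kk 2 s) * (EE b z (rho + 1) T - 2 * (kk (rho + 1) T - kk (rho + 1) s)) <=
  EE b z (rho + 1 + 1) T - EE b z (rho + 1 + 1) s.
Proof.
move=> z0 brho sT; have rho0 : 0 < rho by rewrite (lt_le_trans b0).
have rho1 : 0 < rho + 1 by rewrite addr_gt0.
have [Lt It] := EE_conv b0 z T (@ltr01 R) rho1.
have [Ls Is] := EE_conv b0 z s (@ltr01 R) rho1.
have Kt := L1_kk_conv T (@ltr01 R) (@ltr01 R); have Ks := L1_kk_conv s (@ltr01 R) (@ltr01 R).
set C := 2 * _.
rewrite (_ : 2 = 1 + 1); last by ring.
rewrite -It -Is -(RIB Lt Ls) -(RI_kk_conv T (@ltr01 R) (@ltr01 R)).
rewrite -(RI_kk_conv s (@ltr01 R) (@ltr01 R)) -(RIB Kt Ks) -(RIZr _ (L1B Kt Ks)).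
clear It Is; apply: le_RI; [exact: L1Zr (L1B Kt Ks)|exact: L1B Lt Ls|].
move=> u; rewrite -2!mulrBl -mulrA; have [u0|u0] := leP u 0.
  by rewrite (kk_le0 _ u0) (EE_le0 _ _ _ u0) mul0r.
rewrite (kk1E u) u0 mul1r; have [us|us] := ltP u s.
  by rewrite !kk1E !subr_gt0 us (lt_trans us sT) subrr !mul0r.
rewrite (@kk_le0 _ _ (s - u)) ?subr_le0// subr0.
have [uT|uT] := ltP u T; last by rewrite (@kk_le0 _ _ (T - u)) ?subr_le0// !mul0r.
rewrite ler_wpM2l ?kk_ge0// lerBlDl -lerBlDr.
apply: le_trans (ler_norm _) _; apply: le_trans (EE_increment z0 brho (ltW uT)) _.
rewrite /C ler_wpM2l// lerD2l lerN2; apply: kk_incr => //.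
by rewrite lerDr ltW.
Qed.

(** In the application [x - y] is an increment of the function of parameter [rho + 2], [w] the
    length of the interval, [A] the value to bound and [D] its fluctuation. As [z (x - y) <= 6 k2],
    the threshold [24 k2 / (w k)] gives [A - D <= k / 4], hence [A <= k / 2]. *)
Lemma increment_absorb (z w k k2 A D x y : R) : 0 < w -> 0 < k -> 0 <= k2 ->
  24 * k2 / (w * k) + 1 <= z -> D <= k / 4 -> w * (A - D) <= x - y ->
  `|z * x| <= 3 * k2 -> `|z * y| <= 3 * k2 -> k / 2 <= k - A.
Proof.
move=> w0 k0 k20 Kz Dk h hx hy.
have wk : 0 < w * k by rewrite mulr_gt0.
have z0 : 0 < z by rewrite (lt_le_trans _ Kz)// ltr_wpDl// divr_ge0 ?mulr_ge0// ltW.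
have zh : z * (w * (A - D)) <= 6 * k2.
  apply: le_trans (ler_wpM2l (ltW z0) h) _; rewrite mulrBr.
  have := ler_norm (z * x); have := ler_norm (- (z * y)); rewrite normrN.
  by move: hx hy; clear; lra.
have zw : 24 * k2 <= z * (w * k).
  by rewrite -ler_pdivrMr//; apply: le_trans Kz; rewrite lerDl.
have : z * w * (A - D) <= z * w * (k / 4).
  rewrite -mulrA; apply: le_trans zh _; move: zw; clear; lra.
rewrite ler_pM2l ?mulr_gt0// => h2; move: h2 Dk; clear; lra.
Qed.

(* [z EE (rho + b) = kk rho - EE rho] and [EE rho -> 0] as [z -> oo], because
   [EE (rho + 1) = O(1/z)] and [EE rho] has bounded increments. *)
Lemma EE_lower (r T : R) : 0 <= r -> 0 < T -> exists c K : R,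
  [/\ 0 < c, 0 < K & forall z, K <= z -> c <= z * EE b z (2 * (b + r) + 1) T].
Proof.
move=> r0 T0.
have b2 : b <= 2 by case/andP : b02.
(* Chosen so that [rho + 1 + b] is the parameter of the statement. *)
pose rho := b + 2 * r; have brho : b <= rho by rewrite lerDl mulr_ge0.
have rho0 : 0 < rho by rewrite (lt_le_trans b0).
have rho1 : 0 < rho + 1 by rewrite addr_gt0.
pose k := kk (rho + 1) T.
have k0 : 0 < k by rewrite /k kkE// divr_gt0 ?powR_gt0 ?Gamma_gt0.
have [s s0 [sT ks]] : exists2 s, 0 < s & s < T /\ 2 * (k - kk (rho + 1) s) <= k / 4.
  have c : {for T, continuous (fun s => s `^ rho / Gamma (rho + 1))}.
    by apply: cvgM; [exact: powR_continuous_pos|exact: cvg_cst].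
  (* [7 / 8] because [2 (k - 7 k / 8) = k / 4]. *)
  have lt : k * (7 / 8) < T `^ rho / Gamma (rho + 1).
    rewrite /k kkE// addrK gtr_pMr ?divr_gt0 ?powR_gt0 ?Gamma_gt0//.
    by rewrite ltr_pdivrMr// mul1r ltr_nat.
  have [e /= e0 he] := (nbhs_ballP _ _).1 (cvgr_gt _ c _ lt).
  pose s := T - Num.min (e / 2) (T / 2).
  have m0 : 0 < Num.min (e / 2) (T / 2) by rewrite lt_min !divr_gt0.
  have m1 : Num.min (e / 2) (T / 2) < e.
    by rewrite gt_min ltr_pdivrMr// mulr_natr mulr2n ltrDl e0.
  have m2 : Num.min (e / 2) (T / 2) < T.
    by rewrite gt_min (ltr_pdivrMr T T)// mulr_natr mulr2n ltrDl T0 orbT.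
  have s0 : 0 < s by rewrite subr_gt0.
  exists s => //; split; first by rewrite /s ltrBlDr ltrDl.
  have : k * (7 / 8) < kk (rho + 1) s.
    rewrite kkE// addrK; apply: he; rewrite /ball/= /s opprB addrC subrK.
    by rewrite ger0_norm// ltW.
  by clear; lra.
pose w := kk 2 T - kk 2 s.
have w0 : 0 < w.
  rewrite /w !kkE// -mulrBl divr_gt0 ?Gamma_gt0// subr_gt0 (_ : 2 - 1 = 1 :> R); last by ring.
  by rewrite !powRr1// ltW.
have be : b <= 2 * r + 2 by rewrite (le_trans b2)// lerDr mulr_ge0.
have be0 : 0 < 2 * r + 2 by rewrite (lt_le_trans b0).
pose k2 := kk (2 * r + 2) T.
have k20 : 0 <= k2 by exact: kk_ge0.
(* [b <= 2] makes [EE_bound] available at parameter [2 r + 2]; the constant 3 is 1 for [kk] plus 2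
   for [EE]. *)
have hb z t : 0 < z -> t <= T -> `|z * EE b z (rho + 1 + 1) t| <= 3 * k2.
  move=> z0 tT; have -> : z * EE b z (rho + 1 + 1) t = kk (2 * r + 2) t - EE b z (2 * r + 2) t.
    rewrite (EE_rec b0 z t be0) (_ : 2 * r + 2 + b = rho + 1 + 1) /rho; [|by ring]; by ring.
  apply: le_trans (ler_normB _ _) _.
  have h1 := EE_bound t b02 (ltW z0) be; have h2 : kk (2 * r + 2) t <= k2.
    by apply: kk_incr tT; rewrite (@le_trans _ _ 2) ?ler1n// lerDr mulr_ge0.
  rewrite (ger0_norm (kk_ge0 _ be0)).
  by move: h1 h2; clear; lra.
have K0 : 0 < 24 * k2 / (w * k) + 1.
  apply: ltr_wpDl ltr01; apply: divr_ge0; last exact: ltW (mulr_gt0 w0 k0).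
  exact: mulr_ge0 (ler0n _ _) k20.
exists (k / 2), (24 * k2 / (w * k) + 1); split; [exact: (divr_gt0 k0 (ltr0Sn _ 1))|exact: K0|move=> z Kz].
have z0 : 0 < z := lt_le_trans K0 Kz.
have E : z * EE b z (2 * (b + r) + 1) T = k - EE b z (rho + 1) T.
  by rewrite (EE_rec b0 z T rho1) (_ : rho + 1 + b = 2 * (b + r) + 1) /rho /k; [|ring]; rewrite /rho; ring.
rewrite E; exact: (increment_absorb w0 k0 k20 Kz ks (EE_antideriv_le (ltW z0) brho sT)
  (hb z T z0 (lexx T)) (hb z s z0 (ltW sT))).
Qed.

End asymptotics.

(** * Covariance of the mollified noise *)

Section sigma_finite_pack.
Context d (T : measurableType d) (R : realType) (mu : {measure set T -> \bar R}).
Hypothesis sf : sigma_finite setT mu.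

(** [mu] under another name, to which the sigma-finiteness required by Fubini's theorem is
    attached. *)
Definition sfun : set T -> \bar R := mu.

HB.instance Definition _ := Measure.copy sfun mu.
HB.instance Definition _ := Measure_isSigmaFinite.Build _ _ _ sfun sf.

Definition smeas : {sigma_finite_measure set T -> \bar R} := sfun.

End sigma_finite_pack.

Lemma measurable_cos_dot (R : realType) n d' (T : measurableType d') (f g : T -> 'rV[R]_n) :
  measurable_fun setT f -> measurable_fun setT g ->
  measurable_fun setT (fun t => cos (dot (f t) (g t))).
Proof.
move=> mf mg; have := measurable_cosdot (measurable_cst (0 : R)) mf mg.
by congr measurable_fun; apply/funext => t; rewrite add0r.
Qed.

(** * Continuity with respect to the Euclidean norm *)

Section econt.
Context {R : realType} {d : nat}.
Implicit Types (f g : 'rV[R]_d -> R).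

Definition econt f := forall z eps, 0 < eps -> exists2 eta, 0 < eta &
  forall y, enorm (z - y) < eta -> `|f y - f z| <= eps.

Lemma econtD f g : econt f -> econt g -> econt (fun x => f x + g x).
Proof.
move=> cf cg z e e0; have e20 : 0 < e / 2 by rewrite divr_gt0.
have [n1 n10 h1] := cf z _ e20; have [n2 n20 h2] := cg z _ e20.
exists (Num.min n1 n2) => [|y]; rewrite lt_min ?n10// => /andP[/h1 y1 /h2 y2].
rewrite (_ : _ - _ = (f y - f z) + (g y - g z)); last by ring.
by apply: le_trans (ler_normD _ _) _; rewrite [e]splitr lerD.
Qed.

Lemma econtZ (c : R) f : econt f -> econt (fun x => c * f x).
Proof.
move=> cf z e e0; have c0 : 0 < `|c| + 1 by rewrite ltr_wpDl.
have ec : 0 < e / (`|c| + 1) by rewrite divr_gt0.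
have [n n0 h] := cf z _ ec; exists n => // y /h yz.
rewrite -mulrBr normrM; apply: (@le_trans _ _ ((`|c| + 1) * `|f y - f z|)).
  by rewrite ler_wpM2r// lerDl.
by rewrite mulrC -ler_pdivlMr.
Qed.

Lemma econtB f g : econt f -> econt g -> econt (fun x => f x - g x).
Proof.
move=> cf /(econtZ (-1)) cg; have := econtD cf cg.
by congr econt; apply/funext => x; rewrite mulN1r.
Qed.

Lemma econt_norm f : econt f -> econt (fun x => `|f x|).
Proof.
move=> cf z e e0; have [n n0 h] := cf z e e0; exists n => // y /h.
exact: le_trans (ler_dist_dist _ _).
Qed.

Lemma mxnorm_le_enorm (x : 'rV[R]_d) : `|x| <= enorm x.
Proof.
have -> : `|x| = (\big[Order.max/0%:nng]_i `|x i.1 i.2|%:nng)%:num by rewrite -mx_normE.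
apply: (big_ind (fun a : {nonneg R} => a%:num <= enorm x)) => //=.
- exact: enorm_ge0.
- by move=> a b ha hb; rewrite num_max ge_max ha.
- by move=> [i j] _ /=; rewrite ord1; exact: coord_le_enorm.
Qed.

Lemma continuous_econt f : continuous f -> econt f.
Proof.
move=> cf z e e0; have /cvgrPdist_le/(_ e e0) := cf z.
move=> /nbhs_ballP[n /= n0 h]; exists n => // y zy.
rewrite distrC; apply: h; rewrite -ball_normE /=.
exact: le_lt_trans (mxnorm_le_enorm _) zy.
Qed.

(* [f] is the limit of [f] at the points of finer and finer grids. *)
Lemma continuous_measurable_row f : continuous f -> measurable_fun setT f.
Proof.
move=> cf.
pose g n (x : 'rV[R]_d) : 'rV[int]_d := \row_i Num.floor (x ord0 i * n.+1%:R).
pose h n (k : 'rV[int]_d) : 'rV[R]_d := \row_i ((k ord0 i)%:~R / n.+1%:R).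
have mg n k : measurable [set x | g n x = k].
  have -> : [set x | g n x = k] = \bigcap_(i in [set: 'I_d]) (setT `&`
      (fun x : 'rV[R]_d => x ord0 i) @^-1` `[(k ord0 i)%:~R / n.+1%:R, (k ord0 i + 1)%:~R / n.+1%:R[%classic).
    apply/seteqP; split=> x /=.
      move=> <- i _ /=; split=> //; rewrite in_itv/= !mxE ler_pdivrMr// ltr_pdivlMr//.
      exact: floor_itv.
    move=> H; apply/rowP => i; rewrite mxE; apply/floor_def.
    by have [_] := H i I; rewrite /= in_itv/= ler_pdivrMr// ltr_pdivlMr.
  apply: fin_bigcap_measurable => [|i _]; first exact: finite_finset.
  by apply: measurable_coord => //; exact: measurable_itv.
have mgh n : measurable_fun setT (fun x => f (h n (g n x))).
  move=> _ A mA; rewrite setTI.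
  have -> : (fun x => f (h n (g n x))) @^-1` A =
      \bigcup_k ([set x | g n x = k] `&` [set _ | A (f (h n k))]).
    by apply/seteqP; split => [x Ax|x [k _ [/= <-]]]//; exists (g n x).
  apply: countable_bigcupT_measurable => [|k]; first exact: countableP.
  have [Ak|Ak] := pselect (A (f (h n k))).
    rewrite (_ : _ `&` _ = [set x | g n x = k]); first exact: mg.
    by apply/seteqP; split => [x []|x gx].
  by rewrite (_ : _ `&` _ = set0)//; apply/seteqP; split => x [].
apply: (measurable_fun_cvg (h := fun n x => f (h n (g n x)))) => // x _.
have c : h n (g n x) @[n --> \oo] --> x.
  apply/cvg_ballP => e e0; near=> n; split=> // i j; rewrite ord1 /ball/= !mxE.
  have n0 : 0 < n.+1%:R :> R by [].
  have /andP[h1 h2] := floor_itv (x ord0 j * n.+1%:R).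
  rewrite ger0_norm; last by rewrite subr_ge0 ler_pdivrMr.
  apply: (@le_lt_trans _ _ n.+1%:R^-1).
    rewrite -[x ord0 j](mulfK (lt0r_neq0 n0)) -mulrBl -[X in _ <= X]mul1r ler_wpM2r//.
    by rewrite mulfK ?lt0r_neq0// lerBlDl ltW// -[1]/(1%:~R) -intrD.
  near: n; exact: (near_infty_natSinv_lt (PosNum e0)).
exact: (continuous_cvg _ (cf x) c).
Unshelve. all: end_near. Qed.

End econt.

Section gdom.
Context {R : realType} {d : nat}.
Implicit Types (f g psi : 'rV[R]_d -> R).

(** Domination by a Gaussian makes [cov] absolutely convergent; it holds for test functions and heat
    kernels, and is stable under differences and moduli. *)
Definition gdom psi := measurable_fun setT psi /\
  exists C k : R, [/\ 0 < k, 0 <= C & forall x, `|psi x| <= C * heat k x].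

End gdom.

Lemma ghat_expR {R : realType} {d : nat} (e : R) (xi : 'rV[R]_d) :
  ghat e xi * expR (e / 2 * dot xi xi) = 1.
Proof.
#[local] Transparent ghat.
by rewrite /ghat -expRD (_ : _ + _ = 0) ?expR0//; ring.
Qed.

#[local] Opaque ghat.

(** * The covariance in terms of the spectral measure *)

Section covariance_kernel.
Context {R : realType} {d : nat}.
Variables (gamma : 'rV[R]_d -> R) (mu : {measure set 'rV[R]_d -> \bar R}).
Hypothesis hn : noise_covariance gamma mu.
Implicit Types (x y z w xi : 'rV[R]_d) (psi f g : 'rV[R]_d -> R) (e : R).

Let mgamma : measurable_fun setT gamma. Proof. by case: hn. Qed.
Let gamma_ge0 x : 0 <= gamma x. Proof. by case: hn. Qed.
Let hspec : spectral_measure gamma mu. Proof. by case: hn. Qed.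

Lemma L1_mu_ghat e : 0 < e -> L1 mu (ghat e).
Proof.
move=> e0; have [[k hk] _ _] := hspec.
have e20 : 0 < e / 2 by rewrite divr_gt0.
have [C hC] := poly_expR_bound k e20.
have m1 : measurable_fun setT (fun xi : 'rV[R]_d => ((1 + enorm xi) ^+ k)^-1).
  have -> : (fun xi : 'rV[R]_d => ((1 + enorm xi) ^+ k)^-1) = (fun xi => ((1 + enorm xi) ^+ k) `^ (-1)).
    by apply/funext => xi; rewrite powR_inv1// exprn_ge0// addr_ge0// enorm_ge0.
  apply: (measurableT_comp (measurable_powR (-1))); apply: measurable_funX.
  by apply: measurable_funD => //; exact: measurable_enorm.
have p0 xi : 0 < (1 + enorm xi) ^+ k by rewrite exprn_gt0// ltr_pwDl// enorm_ge0.
have L : L1 mu (fun xi => ((1 + enorm xi) ^+ k)^-1).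
  apply/L1P => //; apply: le_lt_trans hk.
  by under eq_integral do rewrite ger0_norm ?invr_ge0 ?(ltW (p0 _))//.
apply: (L1_le (g := fun xi => C * ((1 + enorm xi) ^+ k)^-1)).
- exact: measurable_ghat.
- move=> xi; rewrite (ger0_norm (ghat_ge0 e xi)) ler_pdivlMr//.
  have := hC _ (enorm_ge0 xi); rewrite enorm_sqr => h.
  have := ler_wpM2l (ghat_ge0 e xi) h; rewrite mulrCA ghat_expR mulr1; exact.
- exact: L1Z.
Qed.

(** The sets where [ghat 1] is at least [1 / (n + 1)] exhaust the space and have finite mass, as
    [ghat 1] is integrable. *)
Lemma mu_sigma_finite : sigma_finite setT mu.
Proof.
pose F (n : nat) := setT `&` (@ghat R d 1) @^-1` `[n.+1%:R^-1, +oo[%classic.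
exists F => [|n].
  apply/seteqP; split => // xi _.
  have g0 : 0 < ghat 1 xi by exact: expR_gt0.
  have [n /= _ hn0] := near_infty_natSinv_lt (PosNum g0).
  by exists n => //; split => //=; rewrite in_itv/= andbT ltW//; apply: hn0 => /=.
have mF : measurable (F n) by apply: measurable_ghat => //; exact: measurable_itv.
split => //.
have L := L1_mu_ghat (@ltr01 R).
have : (\int[mu]_(xi in F n) (n.+1%:R^-1)%:E < +oo)%E.
  apply: (@le_lt_trans _ _ (\int[mu]_xi (`|ghat 1 xi|)%:E)%E); last first.
    by apply/L1P => //; exact: measurable_ghat.
  apply: (@le_trans _ _ (\int[mu]_(xi in F n) (`|ghat 1 xi|)%:E)%E); last first.
    apply: ge0_subset_integral => //.
      by apply/measurable_EFinP; apply: measurableT_comp => //; exact: measurable_ghat.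
  apply: ge0_le_integral => //.
  - apply/measurable_EFinP; apply: measurable_funTS.
    by apply: measurableT_comp => //; exact: measurable_ghat.
  - move=> xi [_ /=]; rewrite in_itv/= andbT lee_fin => h.
    by apply: le_trans h (ler_norm _).
rewrite integral_cst//; case: (mu (F n)) (measure_ge0 mu (F n)) => [r _ _|_|//]; first exact: ltry.
by rewrite gt0_muley ?ltxx// lte_fin.
Qed.

Let smu := smeas mu_sigma_finite.

(** By [gamma_heat] this is [gamma] convolved with [heat e]; it will be the covariance of two
    mollified noises whose variances add up to [e]. *)
Definition cov_kernel e z : R := \int[mu]_xi (cos (dot z xi) * ghat e xi).

Lemma measurable_cosM_ghat e z : measurable_fun setT (fun xi => cos (dot z xi) * ghat e xi).
Proof.
apply: measurable_funM; last exact: measurable_ghat.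
exact: (measurable_cos_dot (measurable_cst z) (@measurable_id _ _ setT)).
Qed.

Lemma L1_cos_ghat e z : 0 < e -> L1 mu (fun xi => cos (dot z xi) * ghat e xi).
Proof.
move=> e0; apply: L1_le (measurable_cosM_ghat e z) _ (L1_mu_ghat e0).
by move=> xi; exact: norm_cosM_le (ghat_ge0 e xi).
Qed.

Lemma cov_kernelN e z : cov_kernel e (- z) = cov_kernel e z.
Proof. by apply: eq_RI => xi; rewrite dotNl cosN. Qed.

Lemma cov_kernel_le e z : 0 < e -> `|cov_kernel e z| <= cov_kernel e 0.
Proof.
move=> e0; have -> : cov_kernel e 0 = \int[mu]_xi ghat e xi.
  by apply: eq_RI => xi; rewrite dot0l cos0 mul1r.
apply: norm_RI_le; first exact: measurable_cosM_ghat; last exact: L1_mu_ghat.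
by move=> xi; exact: norm_cosM_le (ghat_ge0 e xi).
Qed.

(** The spectral identity tested on a translated heat kernel, whose transform is [ghat e] times a
    wave. *)
Lemma gamma_heat e z : 0 < e -> L1 leb (fun x => gamma x * heat e (z - x)) /\
  \int[leb]_x (gamma x * heat e (z - x)) = cov_kernel e z.
Proof.
move=> e0; have [_ _ h] := hspec; have [L E _] := h _ (schwartz_heatB z e0).
split; [exact: L|rewrite E; apply: eq_RI => xi; rewrite /ft_cos].
have m : measurable_fun setT (fun y => cos (dot xi z + dot (- xi) y) * heat e y).
  apply: measurable_funM; last exact: measurable_heat.
  exact: (@measurable_cosdot R d _ _ (cst (dot xi z)) (cst (- xi)) id).
transitivity (\int[leb]_y (cos (dot xi z + dot (- xi) (z - y)) * heat e (z - y))).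
  by apply: eq_RI => y; congr (cos _ * _); rewrite dotNl dotBr opprB addrC subrK.
rewrite (RI_leb_subl z m) heat_fourier// ghatN (dotC xi); reflexivity.
Qed.

Lemma L1_gamma_heat e x z : 0 < e -> L1 leb (fun y => gamma (x - y) * heat e (z - y)) /\
  \int[leb]_y (gamma (x - y) * heat e (z - y)) = cov_kernel e (x - z).
Proof.
move=> e0.
have m : measurable_fun setT (fun w => gamma w * heat e (x - z - w)).
  apply: measurable_funM => //; apply: measurableT_comp; first exact: measurable_heat.
  by apply: measurable_rowB => //; exact: measurable_cst.
have [L I] := gamma_heat (x - z) e0.
have E : (fun y => gamma (x - y) * heat e (z - y)) =
    (fun w => gamma w * heat e (x - z - w)) \o (fun y => x - y).
  by apply/funext => y /=; congr (_ * _); rewrite -heatN; congr heat; apply/rowP => i; rewrite !mxE; ring.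
split; first by rewrite E; apply/(mpres_L1 (leb_reflection x) m).
rewrite -I (mpres_RI (leb_reflection x) m) E; reflexivity.
Qed.

(** The second variable is integrated first: [L1_gamma_heat] bounds the result by a multiple of
    [cov_kernel mu k2 0], uniformly in the first one. *)
Lemma L1_cov f g : gdom f -> gdom g ->
  L1 (leb \x leb)%E (fun w : 'rV[R]_d * 'rV[R]_d => f w.1 * gamma (w.1 - w.2) * g w.2).
Proof.
move=> [mf [C1 [k1 [k10 C10 hf]]]] [mg [C2 [k2 [k20 C20 hg]]]].
have mF : measurable_fun setT (fun w : 'rV[R]_d * 'rV[R]_d => f w.1 * gamma (w.1 - w.2) * g w.2).
  apply: measurable_funM; last exact: measurableT_comp.
  apply: measurable_funM; first exact: measurableT_comp.
  by apply: measurableT_comp => //; exact: measurable_rowB.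
have Hx x : L1 leb (fun y => f x * gamma (x - y) * g y) /\
    \int[leb]_y `|f x * gamma (x - y) * g y| <= C1 * heat k1 x * (C2 * cov_kernel k2 0).
  have [L I] := L1_gamma_heat x 0 k20.
  have m : measurable_fun setT (fun y => f x * gamma (x - y) * g y).
    apply: measurable_funM => //; apply: measurable_funM => //.
    by apply: measurableT_comp => //; apply: measurable_rowB => //; exact: measurable_cst.
  have le y : `|f x * gamma (x - y) * g y| <= (C1 * heat k1 x * C2) * (gamma (x - y) * heat k2 (0 - y)).
    rewrite sub0r heatN 2!normrM (ger0_norm (gamma_ge0 _)).
    apply: (@le_trans _ _ ((C1 * heat k1 x * gamma (x - y)) * (C2 * heat k2 y))).
      apply: ler_pM (hg y) => //; first by rewrite mulr_ge0.
      exact: ler_wpM2r.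
    by rewrite le_eqVlt; apply/orP; left; apply/eqP; clear; ring.
  have Lf := L1_le m le (L1Z _ L).
  split => //; apply: le_trans (le_RI (L1_norm Lf) (L1Z _ L) le) _.
  rewrite (RIZ _ L) I -[X in _ <= X]mulrA mulrA.
  rewrite mulrA; apply: ler_wpM2l; first by rewrite mulr_ge0// mulr_ge0// heat_ge0.
  apply: le_trans (ler_norm _) _; exact: cov_kernel_le.
apply: (@L1_prod_iter _ _ _ _ R leb leb _ (fun x => C1 * heat k1 x * (C2 * cov_kernel k2 0)) mF).
- by move=> x; exact: (Hx x).1.
- by move=> x; exact: (Hx x).2.
- by apply: L1Zr; apply: L1Z; exact: L1_heat.
Qed.

End covariance_kernel.

Section gauss_dominated.
Context {R : realType} {d : nat}.
Implicit Types (x y z : 'rV[R]_d) (f g psi : 'rV[R]_d -> R) (e k : R).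

#[local] Transparent heat.

Lemma heat_mono (k1 k2 : R) x : 0 < k1 -> k1 <= k2 ->
  heat k1 x <= (k2 / k1) `^ (d%:R / 2) * heat k2 x.
Proof.
move=> k10 k12; have k20 : 0 < k2 by rewrite (lt_le_trans k10).
have pi0 : 0 < 2 * pi :> R by rewrite mulr_gt0// pi_gt0.
rewrite /heat mulrA; apply: ler_pM; rewrite ?powR_ge0 ?expR_ge0//.
  rewrite !powRN le_eqVlt; apply/orP; left; apply/eqP.
  have -> : (2 * pi * k2) `^ (d%:R / 2) = (k2 / k1) `^ (d%:R / 2) * (2 * pi * k1) `^ (d%:R / 2).
    rewrite -powRM ?divr_ge0 ?mulr_ge0 ?(ltW k10) ?(ltW k20) ?pi_ge0//; congr (_ `^ _).
    by field; rewrite gt_eqF.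
  have h1 : (k2 / k1) `^ (d%:R / 2) != 0 by rewrite gt_eqF// powR_gt0// divr_gt0.
  have h2 : (2 * pi * k1) `^ (d%:R / 2) != 0 by rewrite gt_eqF// powR_gt0// mulr_gt0.
  by move: h1 h2; clear; set a := _ `^ _; set b := _ `^ _ => h1 h2; field; rewrite h1 h2.
rewrite ler_expR lerN2 ler_wpM2l ?dot_ge0// lef_pV2 ?posrE ?mulr_gt0//.
by rewrite ler_pM2l.
Qed.

Lemma gdom_common f g : gdom f -> gdom g -> exists C k : R, [/\ 0 < k, 0 <= C,
  forall x, `|f x| <= C * heat k x & forall x, `|g x| <= C * heat k x].
Proof.
move=> [mf [C1 [k1 [k10 C10 hf]]]] [mg [C2 [k2 [k20 C20 hg]]]].
pose k := Num.max k1 k2; have h1 : k1 <= k by rewrite le_max lexx.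
have h2 : k2 <= k by rewrite le_max lexx orbT.
pose A1 := (k / k1) `^ (d%:R / 2); pose A2 := (k / k2) `^ (d%:R / 2).
have A10 : 0 <= A1 by exact: powR_ge0.
have A20 : 0 <= A2 by exact: powR_ge0.
exists (C1 * A1 + C2 * A2), k; split.
- by rewrite (lt_le_trans k10).
- by rewrite addr_ge0// mulr_ge0.
- move=> x; apply: le_trans (hf x) _.
  apply: (@le_trans _ _ (C1 * A1 * heat k x)).
    by rewrite -mulrA ler_wpM2l//; exact: heat_mono.
  by rewrite ler_wpM2r ?heat_ge0// lerDl mulr_ge0.
- move=> x; apply: le_trans (hg x) _.
  apply: (@le_trans _ _ (C2 * A2 * heat k x)).
    by rewrite -mulrA ler_wpM2l//; exact: heat_mono.
  by rewrite ler_wpM2r ?heat_ge0// lerDr mulr_ge0.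
Qed.

Lemma gdomD f g : gdom f -> gdom g -> gdom (fun x => f x + g x).
Proof.
move=> df dg; have [C [k [k0 C0 hf hg]]] := gdom_common df dg.
split; first exact: measurable_funD df.1 dg.1.
exists (C + C), k; split=> //; first exact: addr_ge0.
by move=> x; rewrite mulrDl; apply: le_trans (ler_normD _ _) _; exact: lerD.
Qed.

Lemma gdomZ (c : R) f : gdom f -> gdom (fun x => c * f x).
Proof.
move=> [mf [C [k [k0 C0 hf]]]]; split; first exact: measurable_funM.
exists (`|c| * C), k; split=> //; first exact: mulr_ge0.
by move=> x; rewrite normrM -mulrA ler_wpM2l.
Qed.

Lemma gdomB f g : gdom f -> gdom g -> gdom (fun x => f x - g x).
Proof.
move=> df /(gdomZ (-1)) dg; have := gdomD df dg.
by congr gdom; apply/funext => x; rewrite mulN1r.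
Qed.

Lemma gdom_norm f : gdom f -> gdom (fun x => `|f x|).
Proof.
move=> [mf [C [k [k0 C0 hf]]]]; split; first exact: measurableT_comp.
by exists C, k; split=> // x; rewrite normr_id.
Qed.

(** Recentring at 0 costs a factor 2 in the variance, by [dotD_le]. *)
Lemma gdom_heat e z : 0 < e -> gdom (fun y => heat e (z - y)).
Proof.
move=> e0; split.
  apply: measurableT_comp; first exact: measurable_heat.
  by apply: measurable_rowB => //; exact: measurable_cst.
have pi0 : 0 < 2 * pi :> R by rewrite mulr_gt0// pi_gt0.
pose c1 := (2 * pi * e) `^ (- (d%:R / 2)).
pose c2 := (2 * pi * (2 * e)) `^ (- (d%:R / 2)).
have c10 : 0 < c1 by rewrite powR_gt0// mulr_gt0.
have ee : 0 < 2 * e by rewrite mulr_gt0.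
have c20 : 0 < c2 by rewrite powR_gt0// mulr_gt0.
exists (c1 / c2 * expR (dot z z / (2 * e))), (2 * e); split=> //.
  by rewrite mulr_ge0 ?expR_ge0// divr_ge0 ?ltW.
move=> y; rewrite (ger0_norm (heat_ge0 e (z - y))) /heat -/c1 -/c2.
have -> : c1 / c2 * expR (dot z z / (2 * e)) * (c2 * expR (- (dot y y / (2 * (2 * e))))) =
    c1 * expR (dot z z / (2 * e) - dot y y / (2 * (2 * e))).
  rewrite expRD; have : c2 != 0 by rewrite gt_eqF.
  by clear; move=> h; field.
rewrite ler_wpM2l ?(ltW c10)// ler_expR.
have := dotD_le z (y - z); rewrite [z + _]addrC subrK.
rewrite (_ : dot (y - z) (y - z) = dot (z - y) (z - y)); last by rewrite -[z - y]opprB dotNN.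
move=> h; rewrite -subr_ge0.
rewrite (_ : _ - _ = (2 * dot z z + 2 * dot (z - y) (z - y) - dot y y) / (4 * e)); last first.
  by clear h; field; rewrite gt_eqF.
by rewrite divr_ge0 ?subr_ge0// mulr_ge0// ltW.
Qed.

Lemma heat_ball_ge (M : R) : exists2 c, 0 < c & forall x : 'rV[R]_d, enorm x <= M -> c <= heat 1 x.
Proof.
exists ((2 * pi * 1 : R) `^ (- (d%:R / 2)) * expR (- (M ^+ 2 / (2 * 1)))).
  by rewrite mulr_gt0 ?expR_gt0// powR_gt0// mulr1 mulr_gt0// pi_gt0.
move=> x xM; rewrite /heat ler_wpM2l ?powR_ge0// ler_expR lerN2 ler_wpM2r ?invr_ge0 ?mulr1//.
rewrite -enorm_sqr expr2; apply: ler_pM => //; exact: enorm_ge0.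
Qed.

#[local] Opaque heat.

Lemma econt_heat e z : 0 < e -> econt (fun y => heat e (z - y)).
Proof.
move=> e0; apply: continuous_econt => x; apply: differentiable_continuous.
by have [hs _] := schwartz_heatB z e0; exact: (hs [::] x).
Qed.

End gauss_dominated.

#[local] Opaque heat.

Section test_functions.
Context {R : realType} {d : nat}.
Implicit Types (f g : 'rV[R]_d -> R).

Lemma test_fun_continuous f : test_fun f -> continuous f.
Proof.
by move=> [hs _] x; apply: differentiable_continuous; exact: (hs [::] x).
Qed.

Lemma test_fun_gdom f : test_fun f -> gdom f.
Proof.
move=> tf; have cf := test_fun_continuous tf; have [_ [M hM]] := tf.
split; first exact: continuous_measurable_row.
(* A ball of the sup norm, which is at most [enorm]; the modulus of [M] is taken because [M] may be
   negative. *)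
pose K := [set x : 'rV[R]_d | `|x| <= `|M|].
have cK : compact K.
  apply: bounded_closed_compact.
    by exists `|M|; split; rewrite ?num_real// => r Mr x /= h; exact: le_trans h (ltW Mr).
  apply: (closed_comp (f := fun x : 'rV[R]_d => `|x|) (D := [set x | x <= `|M|])) => [x _|].
    exact: norm_continuous.
  exact: closed_le.
have [B [_ hB]] := compact_bounded (continuous_compact (continuous_subspaceT cf) cK).
have hB' x : `|f x| <= `|B| + 1.
  have [xM|xM] := leP `|x| `|M|.
    have := hB (`|B| + 1); rewrite ltr_pwDr ?ler_norm// => /(_ isT); apply; exists x => //.
  rewrite hM ?normr0 ?addr_ge0//; apply: le_lt_trans (ler_norm M) (lt_le_trans xM _).
  exact: mxnorm_le_enorm.
have [c c0 hc] := @heat_ball_ge R d M.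
have Bc : 0 <= (`|B| + 1) / c by rewrite divr_ge0 ?(ltW c0)// addr_ge0.
exists ((`|B| + 1) / c), 1; split=> //.
move=> x; have [xM|xM] := leP (enorm x) M; last first.
  by rewrite hM// normr0 mulr_ge0 ?heat_ge0.
apply: le_trans (hB' x) _; rewrite mulrAC ler_pdivlMr// ler_wpM2l ?addr_ge0//.
exact: hc.
Qed.

Lemma test_funD (c : R) f g : test_fun f -> test_fun g -> test_fun (fun x => c * f x + g x).
Proof.
move=> [sf [M hM]] [sg [N hN]]; split.
  have E l : partials l (fun x => c * f x + g x) = fun x => c * partials l f x + partials l g x.
    elim: l => [//|i l IH]; apply/funext => x; rewrite /= IH.
    have df : derivable (partials l f) x (delta_mx ord0 i) by apply: diff_derivable; exact: sf.
    have dg : derivable (partials l g) x (delta_mx ord0 i) by apply: diff_derivable; exact: sg.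
    rewrite (_ : (fun y => _) = c \*: partials l f + partials l g)//.
    have dcf : derivable (c \*: partials l f) x (delta_mx ord0 i) by exact: derivableZ.
    rewrite (deriveD dcf dg) (deriveZ c df); reflexivity.
  move=> l x; rewrite E (_ : (fun y => _) = c \*: partials l f + partials l g)//.
  by apply: differentiableD; [apply: differentiableZ; exact: sf|exact: sg].
exists (Num.max M N) => x; rewrite gt_max => /andP[/hM -> /hN ->].
by rewrite mulr0 addr0.
Qed.

End test_functions.

(** * Nonnegativity of the covariance on dominated functions *)

Section positive_definite.
Context {R : realType} {d : nat}.
Variables (gamma : 'rV[R]_d -> R) (mu : {measure set 'rV[R]_d -> \bar R}).
Hypothesis hn : noise_covariance gamma mu.
Implicit Types (x y z w xi : 'rV[R]_d) (psi f g : 'rV[R]_d -> R) (e : R).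

Let mgamma : measurable_fun setT gamma. Proof. by case: hn. Qed.
Let gamma_ge0 x : 0 <= gamma x. Proof. by case: hn. Qed.
Let smu := smeas (mu_sigma_finite hn).
Let V := 'rV[R]_d.

Lemma measurable_cov_kernel e : measurable_fun setT (cov_kernel mu e : V -> R).
Proof.
apply: (@measurable_RI _ _ _ _ R smu
  (fun w : V * V => cos (dot w.1 w.2) * ghat e w.2)).
apply: measurable_funM; last by apply: measurableT_comp => //; exact: measurable_ghat.
exact: measurable_cos_dot measurable_fst measurable_snd.
Qed.

(* By Fubini, the [mu]-integral of [ghat e] times the squared modulus of the Fourier
   transform of [psi]. *)
Lemma cov_kernel_pos psi e : 0 < e -> L1 leb psi ->
  L1 (leb \x leb)%E (fun w : V * V => psi w.1 * psi w.2 * cov_kernel mu e (w.1 - w.2)) /\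
  0 <= \int[(leb \x leb)%E]_w (psi w.1 * psi w.2 * cov_kernel mu e (w.1 - w.2)).
Proof.
move=> e0 L; have mpsi := L1_measurable L.
have mpsi1 : measurable_fun setT (fun w : V * V => psi w.1) by exact: measurableT_comp.
have mpsi2 : measurable_fun setT (fun w : V * V => psi w.2) by exact: measurableT_comp.
have Lpp : L1 (leb \x leb)%E (fun w : V * V => `|psi w.1 * psi w.2|).
  apply: L1_norm; apply: (L1_prod_le (g := fun x => `|psi x|) (h := fun x => `|psi x|)).
  - exact: measurable_funM.
  - by move=> x y /=; rewrite normrM.
  - exact: L1_norm.
  - exact: L1_norm.
have Lk : L1 (leb \x leb)%E (fun w : V * V => psi w.1 * psi w.2 * cov_kernel mu e (w.1 - w.2)).
  apply: (L1_le (g := fun w : V * V => `|psi w.1 * psi w.2| * cov_kernel mu e 0)).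
  - apply: measurable_funM; first exact: measurable_funM.
    by apply: measurableT_comp; [exact: measurable_cov_kernel|exact: measurable_rowB].
  - by move=> w; rewrite normrM ler_wpM2l// (cov_kernel_le hn).
  - exact: L1Zr.
split => //.
pose T (z : (V * V) * V) := psi z.1.1 * psi z.1.2 * (cos (dot (z.1.1 - z.1.2) z.2) * ghat e z.2).
have mT : measurable_fun setT T.
  apply: measurable_funM; first by apply: measurable_funM; apply: measurableT_comp => //; exact: measurableT_comp.
  apply: measurable_funM; last by apply: measurableT_comp => //; exact: measurable_ghat.
  by apply: measurable_cos_dot => //; apply: measurable_rowB; exact: measurableT_comp.
have LT : L1 (prod_measure leb leb \x smu)%E T.
  have le (w : V * V) (xi : V) : `|T (w, xi)| <= `|psi w.1 * psi w.2| * ghat e xi.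
    rewrite /T /= normrM ler_wpM2l//; exact: norm_cosM_le (ghat_ge0 e xi).
  exact: (@L1_prod_le _ _ _ _ R (prod_measure leb leb) smu T (fun w : V * V => `|psi w.1 * psi w.2|)
    (ghat e) mT le Lpp (L1_mu_ghat hn e0)).
have E1 : \int[(leb \x leb)%E]_w (psi w.1 * psi w.2 * cov_kernel mu e (w.1 - w.2)) =
    \int[prod_measure leb leb]_w \int[smu]_xi T (w, xi).
  apply: eq_RI => w; rewrite /T /=; symmetry; apply: (RIZ _ (L1_cos_ghat hn (w.1 - w.2) e0)).
rewrite E1 (RI_fubini LT); clear E1; apply: RI_ge0 => xi.
have mc : measurable_fun setT (fun x : V => cos (dot x xi)).
  exact: (measurable_cos_dot (@measurable_id _ _ setT) (measurable_cst xi)).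
have ms : measurable_fun setT (fun x : V => sin (dot x xi)).
  have h := @measurable_cosdot R d _ _ (cst (- (pi / 2))) id (cst xi) (measurable_cst _) (@measurable_id _ _ setT) (measurable_cst xi).
  rewrite (_ : (fun x => _) = fun x => cos (- (pi / 2) + dot x xi)); first exact: h.
  by apply/funext => x; rewrite addrC cosBpihalf.
have Lc : L1 leb (fun x => cos (dot x xi) * psi x).
  apply: L1_le (L1_norm L); first exact: measurable_funM.
  by move=> x; rewrite normrM ler_piMl// cos_max.
have Ls : L1 leb (fun x => sin (dot x xi) * psi x).
  apply: L1_le (L1_norm L); first exact: measurable_funM.
  by move=> x; rewrite normrM ler_piMl// sin_max.
have prodL (h : V -> R) : L1 leb h -> L1 (leb \x leb)%E (fun w : V * V => h w.1 * h w.2) /\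
    \int[(leb \x leb)%E]_w (h w.1 * h w.2) = (\int[leb]_x h x) ^+ 2.
  move=> Lh; have mh := L1_measurable Lh.
  have Lhh : L1 (leb \x leb)%E (fun w : V * V => h w.1 * h w.2).
    apply: (L1_prod_le (g := fun x => `|h x|) (h := fun x => `|h x|)).
    - by apply: measurable_funM; exact: measurableT_comp.
    - by move=> x y /=; rewrite normrM.
    - exact: L1_norm.
    - exact: L1_norm.
  split => //; rewrite (RI_prod12 Lhh) /= expr2 -(RIZr _ Lh); apply: eq_RI => x.
  exact: RIZ.
have [Lcc Ic] := prodL _ Lc; have [Lss Is] := prodL _ Ls.
have -> : \int[prod_measure leb leb]_w T (w, xi) = ghat e xi *
    ((\int[leb]_x (cos (dot x xi) * psi x)) ^+ 2 + (\int[leb]_x (sin (dot x xi) * psi x)) ^+ 2).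
  rewrite -Ic -Is -(RID Lcc Lss) -(RIZ _ (L1D Lcc Lss)); clear Ic Is.
  apply: eq_RI => w; rewrite /T /= dotBl cosB; clear; ring.
by rewrite mulr_ge0 ?ghat_ge0// addr_ge0// sqr_ge0.
Qed.

Lemma cov_prod f g : gdom f -> gdom g ->
  cov gamma f g = \int[(leb \x leb)%E]_w (f w.1 * gamma (w.1 - w.2) * g w.2).
Proof. by move=> df dg; rewrite (RI_prod12 (L1_cov hn df dg)). Qed.

Section limit.
Variables (psi : V -> R) (C k : R).
Hypotheses (mpsi : measurable_fun setT psi) (cpsi : econt psi) (k0 : 0 < k) (C0 : 0 <= C).
Hypothesis hpsi : forall x, `|psi x| <= C * heat k x.

Let Lpsi : L1 leb psi.
Proof. by apply: L1_le mpsi hpsi _; apply: L1Z; exact: L1_heat. Qed.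

Let moll e z := \int[leb]_x (psi x * heat e (z - x)).

Let measurable_moll e : measurable_fun setT (moll e).
Proof.
apply: (@measurable_RI _ _ _ _ R leb (fun w : V * V => psi w.2 * heat e (w.1 - w.2))).
apply: measurable_funM; first exact: measurableT_comp.
by apply: measurableT_comp; [exact: measurable_heat|exact: measurable_rowB].
Qed.

Let C' := C * 2 `^ (d%:R / 2).

Let C'0 : 0 <= C'. Proof. by rewrite mulr_ge0// powR_ge0. Qed.

(** By the semigroup law the bound becomes a Gaussian of variance [e + k], at most [2 k]; the factor
    in [C'] is the price of [heat_mono]. *)
Let moll_le e z : 0 < e <= k -> L1 leb (fun x => psi x * heat e (z - x)) /\
  \int[leb]_x `|psi x * heat e (z - x)| <= C' * heat (2 * k) z.
Proof.
move=> /andP[e0 ek].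
have m : measurable_fun setT (fun x => psi x * heat e (z - x)).
  by apply: measurable_funM => //; exact: L1_measurable (L1_heatB z e0).
have Lhh : L1 leb (fun x => heat e (z - x) * heat k x).
  have B := @heat_le R d k; apply: L1_le (L1Zr ((2 * pi * k) `^ (- (d%:R / 2))) (L1_heatB z e0)).
    by apply: measurable_funM; [exact: L1_measurable (L1_heatB z e0)|exact: measurable_heat].
  move=> x; rewrite (ger0_norm (mulr_ge0 (heat_ge0 e (z - x)) (heat_ge0 k x))).
  by apply: ler_wpM2l; [exact: heat_ge0|exact: heat_le].
have le x : `|psi x * heat e (z - x)| <= C * (heat e (z - x) * heat k x).
  rewrite normrM (ger0_norm (heat_ge0 e (z - x))) [leRHS]mulrCA [leLHS]mulrC.
  by apply: ler_wpM2l; [exact: heat_ge0|exact: hpsi].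
have L := L1_le m le (L1Z C Lhh); split => //.
apply: le_trans (le_RI (L1_norm L) (L1Z C Lhh) le) _.
rewrite (RIZ C Lhh) (heat_semigroup z e0 k0) /C' -mulrA ler_wpM2l//.
have ek0 : 0 < e + k by rewrite addr_gt0.
apply: le_trans (heat_mono z ek0 (_ : e + k <= 2 * k)) _.
  by rewrite mulr2n mulrDl mul1r lerD2r.
apply: ler_wpM2r; first exact: heat_ge0.
apply: ge0_ler_powR; rewrite ?nnegrE.
- exact: divr_ge0.
- by apply: divr_ge0; [apply: mulr_ge0 => //; exact: ltW|exact: ltW].
- by [].
- by rewrite ler_pdivrMr// ler_pM2l// lerDr ltW.
Qed.

(** A majorant common to all [e <= k], so that [e] may tend to 0. *)
Let G (w : V * V) := C * heat k w.1 * (C' * (gamma w.2 * heat (2 * k) (- w.1 - w.2))).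

Let LG : L1 (leb \x leb)%E G.
Proof.
have k20 : 0 < 2 * k by rewrite mulr_gt0.
have mG : measurable_fun setT G.
  apply: measurable_funM.
    by apply: measurable_funM => //; apply: measurableT_comp => //; exact: measurable_heat.
  apply: measurable_funM => //; apply: measurable_funM; first exact: measurableT_comp.
  apply: measurableT_comp; first exact: measurable_heat.
  by apply: measurable_rowB => //; apply: measurable_rowN; exact: measurable_fst.
apply: (@L1_prod_iter _ _ _ _ R leb leb G (fun y => C * heat k y * (C' * cov_kernel mu (2 * k) 0)) mG).
- move=> y; rewrite /G /=; apply: L1Z; apply: L1Z; exact: (gamma_heat hn (- y) k20).1.
- move=> y; rewrite /G /=.
  have [L I] := gamma_heat hn (- y) k20.
  have p0 : 0 <= C * heat k y by rewrite mulr_ge0 ?heat_ge0.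
  rewrite (@eq_RI _ _ R leb _ (fun w : V => C * heat k y * (C' * (gamma w * heat (2 * k) (- y - w))))); last first.
    move=> w; apply: ger0_norm; apply: mulr_ge0 p0 _; apply: mulr_ge0 C'0 _.
    exact: mulr_ge0 (gamma_ge0 w) (heat_ge0 _ _).
  rewrite (RIZ _ (L1Z C' L)) (RIZ C' L) I; apply: (ler_wpM2l p0); apply: (ler_wpM2l C'0).
  exact: le_trans (ler_norm _) (cov_kernel_le hn (- y) k20).
- by apply: L1Zr; apply: L1Z; exact: L1_heat.
Qed.

Let T e (z : (V * V) * V) :=
  psi z.2 * psi z.1.1 * (gamma z.1.2 * heat e (z.2 - z.1.1 - z.1.2)).

Let mT e : measurable_fun setT (T e).
Proof.
apply: measurable_funM.
  by apply: measurable_funM; apply: measurableT_comp => //; exact: measurableT_comp.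
apply: measurable_funM; first by apply: measurableT_comp => //; exact: measurableT_comp.
apply: measurableT_comp; first exact: measurable_heat.
by apply: measurable_rowB; [apply: measurable_rowB => //|]; exact: measurableT_comp.
Qed.

Let inner e (w : V * V) : 0 < e <= k ->
  [/\ L1 leb (fun x => T e (w, x)), \int[leb]_x `|T e (w, x)| <= G w
    & \int[leb]_x T e (w, x) = psi w.1 * (gamma w.2 * moll e (w.1 + w.2))].
Proof.
move=> ek; have [L I] := moll_le (w.1 + w.2) ek.
have E x : T e (w, x) = psi w.1 * gamma w.2 * (psi x * heat e (w.1 + w.2 - x)).
  rewrite /T /= -(heatN e (w.1 + w.2 - x)) opprB (_ : x - (w.1 + w.2) = x - w.1 - w.2); last first.
    by rewrite opprD addrA.
  by clear; ring.
split.
- by rewrite (_ : (fun x => _) = fun x => psi w.1 * gamma w.2 * (psi x * heat e (w.1 + w.2 - x))); [exact: L1Z|apply/funext].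
- rewrite (@eq_RI _ _ R leb _ (fun x : V => `|psi w.1 * gamma w.2| * `|psi x * heat e (w.1 + w.2 - x)|)); last first.
    by move=> x; rewrite E normrM.
  rewrite (RIZ _ (L1_norm L)) normrM (ger0_norm (gamma_ge0 _)) /G -opprD heatN.
  rewrite -[leLHS]mulrA; apply: ler_pM.
  + exact: normr_ge0.
  + by apply: mulr_ge0 => //; apply: RI_ge0.
  + exact: hpsi.
  + by rewrite mulrCA; apply: ler_wpM2l.
- by rewrite (eq_RI _ E) (RIZ _ L) -mulrA.
Qed.

(** In the integral of [T e], integrating [z.2] first yields [moll e], while integrating [z.1.2],
    the variable of [gamma], first yields the quadratic form of [cov_kernel_pos]. *)
Let approx_pos e : 0 < e <= k ->
  0 <= \int[(leb \x leb)%E]_w (psi w.1 * (gamma w.2 * moll e (w.1 + w.2))).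
Proof.
move=> ek; have /andP[e0 _] := ek.
have LT : L1 (prod_measure leb leb \x leb)%E (T e).
  apply: (@L1_prod_iter _ _ _ _ R (prod_measure leb leb) leb (T e) G (mT e)).
  - by move=> w; have [] := inner w ek.
  - by move=> w; have [] := inner w ek.
  - exact: LG.
have -> : \int[(leb \x leb)%E]_w (psi w.1 * (gamma w.2 * moll e (w.1 + w.2))) =
    \int[prod_measure leb leb]_w \int[leb]_x T e (w, x).
  by apply: eq_RI => w; have [_ _ ->] := inner w ek.
rewrite (RI_fubini LT).
have [Lk pos] := cov_kernel_pos e0 Lpsi.
rewrite (RI_prod12 Lk) /= in pos; apply: le_trans pos _.
rewrite le_eqVlt; apply/orP; left; apply/eqP; apply: eq_RI => x.
have Hy y : L1 leb (fun w => T e ((y, w), x)) /\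
   \int[leb]_w T e ((y, w), x) = psi x * psi y * cov_kernel mu e (x - y) /\
   \int[leb]_w `|T e ((y, w), x)| <= `|psi x| * `|psi y| * cov_kernel mu e 0.
  have [L I] := gamma_heat hn (x - y) e0.
  split; first exact: (L1Z (psi x * psi y) L).
  split; first by rewrite /T /= (RIZ _ L) I; reflexivity.
  rewrite (@eq_RI _ _ R leb _ (fun w : V => (`|psi x| * `|psi y|) * (gamma w * heat e (x - y - w)))); last first.
    by move=> w; rewrite /T /= 2!normrM (@ger0_norm _ (gamma w * _))// mulr_ge0 ?heat_ge0.
  rewrite (RIZ _ L) I; apply: ler_wpM2l; first exact: mulr_ge0.
  exact: le_trans (ler_norm _) (cov_kernel_le hn (x - y) e0).
have LTx : L1 (leb \x leb)%E (fun w : V * V => T e (w, x)).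
  apply: (@L1_prod_iter _ _ _ _ R leb leb (fun w : V * V => T e (w, x))
    (fun y => `|psi x| * `|psi y| * cov_kernel mu e 0)).
  - exact: measurableT_comp.
  - by move=> y; exact: (Hy y).1.
  - by move=> y; exact: (Hy y).2.2.
  - by apply: L1Zr; apply: L1Z; exact: L1_norm.
transitivity (\int[leb]_y \int[leb]_w T e ((y, w), x)).
  by apply: eq_RI => y; have [_ [-> _]] := Hy y.
by symmetry; exact: (RI_prod12 LTx).
Qed.

Let dpsi : gdom psi. Proof. by split => //; exists C, k. Qed.

Lemma cov_ge0_lim : 0 <= cov gamma psi psi.
Proof.
pose e_ (n : nat) := k / n.+1%:R.
have e_k n : 0 < e_ n <= k.
  by rewrite divr_gt0//= ler_pdivrMr// ler_peMr ?(ltW k0)// ler1n.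
have e_0 : e_ @ \oo --> 0.
  rewrite -(mulr0 k); apply: cvgM; first exact: cvg_cst.
  exact: cvg_harmonic.
have [|||LL c] := @RI_dct _ _ R (leb \x leb)%E
  (fun n (w : V * V) => psi w.1 * (gamma w.2 * moll (e_ n) (w.1 + w.2)))
  (fun w : V * V => psi w.1 * (gamma w.2 * psi (w.1 + w.2))) G _ _ _ LG.
- move=> n; apply: measurable_funM; first exact: measurableT_comp.
  apply: measurable_funM; first exact: measurableT_comp.
  by apply: (measurableT_comp (measurable_moll (e_ n))); exact: measurable_rowD.
- move=> w; apply: cvgM; first exact: cvg_cst.
  apply: cvgM; first exact: cvg_cst.
  apply: (@heat_approx R d e_ psi (C * (2 * pi * k) `^ (- (d%:R / 2)))) => //.
  + by move=> n; case/andP : (e_k n).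
  + by move=> y; apply: le_trans (hpsi y) _; apply: (ler_wpM2l C0); exact: heat_le.
  + exact: cpsi.
- move=> n w; have [_ h <-] := inner w (e_k n).
  have [L _ _] := inner w (e_k n); exact: le_trans (norm_RI L) h.
have pos : 0 <= \int[(leb \x leb)%E]_w (psi w.1 * (gamma w.2 * psi (w.1 + w.2))).
  rewrite -(cvg_lim _ c)//; apply: limr_ge; first by apply/cvg_ex; eexists; exact: c.
  by apply: nearW => n; exact: approx_pos.
apply: le_trans pos _; rewrite (RI_prod12 LL) /=.
rewrite (cov_prod dpsi dpsi) (RI_prod21 (L1_cov hn dpsi dpsi)) /=.
rewrite le_eqVlt; apply/orP; left; apply/eqP; apply: eq_RI => y.
have m : measurable_fun setT (fun x => psi x * gamma (x - y) * psi y).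
  apply: measurable_funM => //; apply: measurable_funM => //.
  by apply: measurableT_comp => //; apply: measurable_rowB => //; exact: measurable_cst.
rewrite -(RI_leb_addl y m); apply: eq_RI => w.
rewrite (addrC y w) addrK; clear; ring.
Qed.

End limit.

(** [noise_covariance] provides this for test functions; [covs_le] applies it to combinations of
    moduli, which are not smooth. *)
Lemma cov_ge0 psi : gdom psi -> econt psi -> 0 <= cov gamma psi psi.
Proof. by move=> [m [C [k [k0 C0 h]]]] c; exact: (cov_ge0_lim m c k0 C0 h). Qed.

End positive_definite.

(** * Covariance of the mollified noise *)

Section covariance_limit.
Context {R : realType} {d : nat}.
Variables (gamma : 'rV[R]_d -> R) (mu : {measure set 'rV[R]_d -> \bar R}).
Hypothesis hn : noise_covariance gamma mu.
Implicit Types (f g h psi : 'rV[R]_d -> R) (e : R).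
Let V := 'rV[R]_d.
Let mgamma : measurable_fun setT gamma. Proof. by case: hn. Qed.
Let gamma_ge0 x : 0 <= gamma x. Proof. by case: hn. Qed.
Let smu := smeas (mu_sigma_finite hn).

Lemma covDl (c : R) f g h : gdom f -> gdom g -> gdom h ->
  cov gamma (fun x => c * f x + g x) h = c * cov gamma f h + cov gamma g h.
Proof.
move=> df dg dh; have dfg := gdomD (gdomZ c df) dg.
rewrite !(cov_prod hn)//; have L1f := L1_cov hn df dh; have L1g := L1_cov hn dg dh.
rewrite -(RIZ c L1f) -(RID (L1Z c L1f) L1g); apply: eq_RI => w; clear; ring.
Qed.

Lemma covDr (c : R) f g h : gdom f -> gdom g -> gdom h ->
  cov gamma h (fun x => c * f x + g x) = c * cov gamma h f + cov gamma h g.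
Proof.
move=> df dg dh; have dfg := gdomD (gdomZ c df) dg.
rewrite !(cov_prod hn)//; have L1f := L1_cov hn dh df; have L1g := L1_cov hn dh dg.
rewrite -(RIZ c L1f) -(RID (L1Z c L1f) L1g); apply: eq_RI => w; clear; ring.
Qed.

Lemma cov_le_norm f g : gdom f -> gdom g ->
  `|cov gamma f g| <= cov gamma (fun x => `|f x|) (fun x => `|g x|).
Proof.
move=> df dg; rewrite !(cov_prod hn)//; [|exact: gdom_norm|exact: gdom_norm].
apply: norm_RI_le; first exact: L1_measurable (L1_cov hn df dg).
  by move=> w; rewrite 2!normrM (ger0_norm (gamma_ge0 _)).
exact: (L1_cov hn (gdom_norm df) (gdom_norm dg)).
Qed.

(* [gamma] is not assumed to be even, hence [cov gamma] need not be symmetric. *)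
Definition covs f g := cov gamma f g + cov gamma g f.

Lemma covs_expand (c : R) f g : gdom f -> gdom g ->
  cov gamma (fun x => c * f x + g x) (fun x => c * f x + g x) =
  c * c * cov gamma f f + c * covs f g + cov gamma g g.
Proof.
move=> df dg; have dfg := gdomD (gdomZ c df) dg.
rewrite (covDl c df dg dfg) (covDr c df dg df) (covDr c df dg dg) /covs.
move: (cov gamma f f) (cov gamma f g) (cov gamma g f) (cov gamma g g) => a1 a2 a3 a4.
by clear; ring.
Qed.

(** Nonnegativity of the covariance at [|g| - c |f|]: a Cauchy-Schwarz inequality in which the free
    weight [c] replaces square roots. *)
Lemma covs_le (c : R) f g : gdom f -> econt f -> gdom g -> econt g -> 0 < c ->
  `|covs f g| <= c * cov gamma (fun x => `|f x|) (fun x => `|f x|) +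
    c^-1 * cov gamma (fun x => `|g x|) (fun x => `|g x|).
Proof.
move=> df cf dg cg c0.
have df' := gdom_norm df; have dg' := gdom_norm dg.
have cf' := econt_norm cf; have cg' := econt_norm cg.
apply: (@le_trans _ _ (covs (fun x => `|f x|) (fun x => `|g x|))).
  by apply: le_trans (ler_normD _ _) _; apply: lerD; exact: cov_le_norm.
have dd := gdomD (gdomZ (- c) df') dg'.
have := cov_ge0 hn dd (econtD (econtZ (- c) cf') cg').
rewrite (covs_expand (- c) df' dg') => h.
set S := covs _ _ in h *; set Qf := cov _ _ _ in h *; set Qg := cov _ _ _ in h *.
have h2 : c * S <= c * (c * Qf + c^-1 * Qg).
  rewrite -subr_ge0 (_ : _ - _ = - c * - c * Qf + - c * S + Qg)//.
  by clear h; field; rewrite gt_eqF.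
by rewrite ler_pM2l in h2.
Qed.

Lemma covs_cvg f1 f2 (p1 p2 : nat -> V -> R) :
  gdom f1 -> econt f1 -> gdom f2 -> econt f2 ->
  (forall n, gdom (p1 n) /\ econt (p1 n)) -> (forall n, gdom (p2 n) /\ econt (p2 n)) ->
  cov gamma (fun x => `|p1 n x - f1 x|) (fun x => `|p1 n x - f1 x|) @[n --> \oo] --> 0 ->
  cov gamma (fun x => `|p2 n x - f2 x|) (fun x => `|p2 n x - f2 x|) @[n --> \oo] --> 0 ->
  covs (p1 n) (p2 n) @[n --> \oo] --> covs f1 f2.
Proof.
move=> df1 cf1 df2 cf2 hp1 hp2.
set q1 := fun n => cov _ _ _; set q2 := fun n => cov _ _ _ => cq1 cq2.
pose Q1 := cov gamma (fun x => `|f1 x|) (fun x => `|f1 x|).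
pose Q2 := cov gamma (fun x => `|f2 x|) (fun x => `|f2 x|).
have Q10 : 0 <= Q1 by apply: (cov_ge0 hn); [exact: gdom_norm|exact: econt_norm].
have Q20 : 0 <= Q2 by apply: (cov_ge0 hn); [exact: gdom_norm|exact: econt_norm].
(* Bilinear expansion around [f1] and [f2], with the weights distributed so that the fixed
   quantities [Q1] and [Q2] carry the factor [c^-1]. *)
have bound (c : R) n : 0 < c -> `|covs f1 f2 - covs (p1 n) (p2 n)| <=
    (c + 1) * (q1 n + q2 n) + c^-1 * (Q1 + Q2).
  move=> c0; have [dp1 cp1] := hp1 n; have [dp2 cp2] := hp2 n.
  pose u x := p1 n x - f1 x; pose v x := p2 n x - f2 x.
  have du : gdom u by exact: gdomB. have dv : gdom v by exact: gdomB.
  have cu : econt u by exact: econtB. have cv : econt v by exact: econtB.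
  have E1 : p1 n = fun x => 1 * u x + f1 x by apply/funext => x; rewrite mul1r subrK.
  have E2 : p2 n = fun x => 1 * v x + f2 x by apply/funext => x; rewrite mul1r subrK.
  have dp1' : gdom (fun x => 1 * u x + f1 x) by rewrite -E1.
  have dp2' : gdom (fun x => 1 * v x + f2 x) by rewrite -E2.
  have -> : covs f1 f2 - covs (p1 n) (p2 n) = - (covs u f2 + covs f1 v + covs u v).
    rewrite E1 E2 /covs (covDl 1 du df1 dp2') (covDr 1 dv df2 du) (covDr 1 dv df2 df1).
    rewrite (covDl 1 dv df2 dp1') (covDr 1 du df1 dv) (covDr 1 du df1 df2).
    move: (cov gamma u v) (cov gamma v u) (cov gamma u f2) (cov gamma f2 u)
      (cov gamma f1 v) (cov gamma v f1) (cov gamma f1 f2) (cov gamma f2 f1).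
    by clear; move=> a1 a2 a3 a4 a5 a6 a7 a8; ring.
  rewrite normrN; apply: le_trans (ler_normD _ _) _.
  have h1 := covs_le du cu df2 cf2 c0.
  have ci0 : 0 < c^-1 by rewrite invr_gt0.
  have h2 := covs_le df1 cf1 dv cv ci0; rewrite invrK in h2.
  have h3 := covs_le du cu dv cv ltr01; rewrite invr1 !mul1r in h3.
  have h12 := ler_normD (covs u f2) (covs f1 v).
  rewrite -/Q1 -/Q2 -/(q1 n) -/(q2 n) in h1 h2 h3.
  apply: le_trans (lerD (le_trans h12 (lerD h1 h2)) h3) _.
  rewrite le_eqVlt; apply/orP; left; apply/eqP; clear; ring.
apply/cvgrPdist_le => eps eps0.
(* Makes [c^-1 (Q1 + Q2)] at most [eps / 2]; the term 1 keeps [c] positive when [Q1] and [Q2]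
   vanish. *)
pose c := 2 * (Q1 + Q2 + 1) / eps.
have c0 : 0 < c by rewrite divr_gt0// mulr_gt0// ltr_wpDl// addr_ge0.
have c10 : 0 < c + 1 by rewrite addr_gt0.
have cq : c^-1 * (Q1 + Q2) <= eps / 2.
  have e2 : eps / 2 * c = Q1 + Q2 + 1 by rewrite /c; field; rewrite gt_eqF.
  by rewrite mulrC ler_pdivrMr// e2 lerDl.
have q12 := cvgD cq1 cq2; rewrite addr0 in q12.
have ec : 0 < eps / 2 / (c + 1) by rewrite !divr_gt0.
near=> n; apply: le_trans (bound c n c0) _.
rewrite [eps]splitr; apply: lerD; last exact: cq.
rewrite mulrC -ler_pdivlMr//; apply: le_trans (ler_norm _) _; near: n.
apply: filterS ((cvgrPdist_le _ _).1 (q12 _) _ ec) => n.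
by rewrite sub0r normrN.
Unshelve. all: end_near. Qed.

Lemma cov_EFin f g : gdom f -> gdom g ->
  (\int[leb]_x \int[leb]_y (f x * gamma (x - y) * g y)%:E)%E = (cov gamma f g)%:E.
Proof.
move=> df dg; have L := L1_cov hn df dg; rewrite (cov_prod hn df dg) (RI_EFin L).
by rewrite (integral12_prod_meas1 L).
Qed.

Section completion.
Variables (H : completeNormedModType R) (iota : (V -> R) -> H).
Hypothesis hi : is_completion gamma iota.

(** Both elements are approximated by test functions and polarized; norms only see [cov f f], hence
    the symmetrized form, halved. *)
Lemma hdot_represents f1 f2 (h1 h2 : H) : gdom f1 -> econt f1 -> gdom f2 -> econt f2 ->
  represents gamma iota f1 h1 -> represents gamma iota f2 h2 ->
  hdot h1 h2 = covs f1 f2 / 2.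
Proof.
move=> df1 cf1 df2 cf2 [_ [p1 [tp1 q1 c1]]] [_ [p2 [tp2 q2 c2]]].
have [lin nrm _] := hi.
have gp n (p : nat -> V -> R) : (forall n, test_fun (p n)) -> gdom (p n) /\ econt (p n).
  move=> tp; split; first exact: test_fun_gdom.
  by apply: continuous_econt; exact: test_fun_continuous.
have qE (p : nat -> V -> R) f : (forall n, test_fun (p n)) -> gdom f ->
    (\int[leb]_x \int[leb]_y (`|p n x - f x| * gamma (x - y) * `|p n y - f y|)%:E)%E
      @[n --> \oo] --> 0%E ->
    cov gamma (fun x => `|p n x - f x|) (fun x => `|p n x - f x|) @[n --> \oo] --> 0.
  move=> tp df /fine_cvg; apply: cvg_trans; apply: near_eq_cvg; apply: nearW => n.
  have dpf : gdom (fun x => `|p n x - f x|) by apply: gdom_norm; apply: gdomB => //; exact: (gp n p tp).1.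
  by rewrite /= (cov_EFin dpf dpf).
have lim := covs_cvg df1 cf1 df2 cf2 (fun n => gp n p1 tp1) (fun n => gp n p2 tp2)
  (qE _ _ tp1 df1 q1) (qE _ _ tp2 df2 q2).
have key n : (`|iota (p1 n) + iota (p2 n)| ^+ 2 - `|iota (p1 n) - iota (p2 n)| ^+ 2) / 4 =
    covs (p1 n) (p2 n) / 2.
  have e1 : iota (p1 n) + iota (p2 n) = iota (fun x => 1 * p1 n x + p2 n x).
    by rewrite lin// scale1r.
  have e2 : iota (p1 n) - iota (p2 n) = - iota (fun x => -1 * p1 n x + p2 n x).
    by rewrite lin// scaleN1r opprD opprK.
  rewrite e1 e2 normrN !nrm; [|exact: test_funD|exact: test_funD].
  rewrite !covs_expand; [|exact: (gp n p1 tp1).1|exact: (gp n p2 tp2).1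
    |exact: (gp n p1 tp1).1|exact: (gp n p2 tp2).1].
  by field.
have cp : (`|iota (p1 n) + iota (p2 n)| ^+ 2 - `|iota (p1 n) - iota (p2 n)| ^+ 2) / 4
    @[n --> \oo] --> hdot h1 h2.
  apply: cvgM; last exact: cvg_cst.
  by apply: cvgB; rewrite !expr2; apply: cvgM; apply: cvg_norm; [exact: cvgD|exact: cvgD|exact: cvgB|exact: cvgB].
have cs : (`|iota (p1 n) + iota (p2 n)| ^+ 2 - `|iota (p1 n) - iota (p2 n)| ^+ 2) / 4
    @[n --> \oo] --> covs f1 f2 / 2.
  under eq_fun do rewrite key.
  by apply: cvgM; [exact: lim|exact: cvg_cst].
by have := cvg_unique _ cp cs; apply; exact: Rhausdorff.
Qed.

End completion.

(** Each heat kernel contributes one factor [ghat], and [ghatD] adds the variances. *)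
Lemma cov_heat e1 e2 (x1 x2 : V) : 0 < e1 -> 0 < e2 ->
  cov gamma (fun y => heat e1 (x1 - y)) (fun y => heat e2 (x2 - y)) =
  cov_kernel mu (e1 + e2) (x1 - x2).
Proof.
move=> e10 e20.
have inner x : \int[leb]_y (heat e1 (x1 - x) * gamma (x - y) * heat e2 (x2 - y)) =
    heat e1 (x1 - x) * cov_kernel mu e2 (x - x2).
  have [L I] := L1_gamma_heat hn x x2 e20; rewrite -I -(RIZ _ L).
  by clear I; apply: eq_RI => y; rewrite mulrA.
rewrite /cov (eq_RI _ inner); clear inner.
pose T (w : V * V) := heat e1 (x1 - w.1) * (cos (dot (w.1 - x2) w.2) * ghat e2 w.2).
have mT : measurable_fun setT T.
  apply: measurable_funM.
    apply: measurableT_comp; first exact: measurable_heat.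
    by apply: measurable_rowB => //; exact: measurable_cst.
  apply: measurable_funM; last by apply: measurableT_comp => //; exact: measurable_ghat.
  by apply: measurable_cos_dot => //; apply: measurable_rowB => //; exact: measurable_cst.
have le (x xi : V) : `|T (x, xi)| <= heat e1 (x1 - x) * ghat e2 xi.
  rewrite /T /= normrM (ger0_norm (heat_ge0 e1 (x1 - x))).
  by apply: (ler_wpM2l (heat_ge0 e1 (x1 - x))); exact: norm_cosM_le (ghat_ge0 e2 xi).
have LT : L1 (leb \x smu)%E T.
  exact: (@L1_prod_le _ _ _ _ R leb smu T (fun x => heat e1 (x1 - x)) (ghat e2) mT le
    (L1_heatB x1 e10) (L1_mu_ghat hn e20)).
transitivity (\int[leb]_x \int[smu]_xi T (x, xi)).
  apply: eq_RI => x; rewrite /T /=; symmetry; apply: (RIZ _ (L1_cos_ghat hn (x - x2) e20)).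
rewrite (RI_fubini LT); apply: eq_RI => xi; rewrite /T /=.
have m : measurable_fun setT (fun y : V => cos (dot xi (x1 - x2) + dot (- xi) y) * heat e1 y * ghat e2 xi).
  apply: measurable_funM => //; apply: measurable_funM; last exact: measurable_heat.
  exact: (@measurable_cosdot R d _ _ (cst (dot xi (x1 - x2))) (cst (- xi)) id).
transitivity (\int[leb]_x (cos (dot xi (x1 - x2) + dot (- xi) (x1 - x)) * heat e1 (x1 - x) * ghat e2 xi)).
  apply: eq_RI => x; rewrite mulrA (mulrC (heat _ _)); congr (cos _ * _ * _).
  by rewrite dotNl -dotBr dotC; congr dot; apply/rowP => i; rewrite !mxE; ring.
rewrite (RI_leb_subl x1 m) RIZr.
  rewrite heat_fourier// ghatN ghatD (dotC xi) mulrA; reflexivity.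
have mm : measurable_fun setT (fun y : V => cos (dot xi (x1 - x2) + dot (- xi) y) * heat e1 y).
  apply: measurable_funM; last exact: measurable_heat.
  exact: (@measurable_cosdot R d _ _ (cst (dot xi (x1 - x2))) (cst (- xi)) id).
by apply: L1_le mm _ (L1_heat e10) => y; exact: norm_cosM_le (heat_ge0 e1 y).
Qed.

Section noise_covariance.
Context (dO : measure_display) (Omega : measurableType dO) (P : probability Omega R).
Variables (H : completeNormedModType R) (iota : (V -> R) -> H).
Variables (W : H -> Omega -> R) (dW : R -> V -> Omega -> R).
Hypotheses (hi : is_completion gamma iota) (hW : isonormal P W).
Hypothesis hdW : mollified_noise P gamma iota W dW.

Lemma isonormal_gaussian (h : H) : centered_gaussian P (W h).
Proof.
have [hg _] := hW; have := hg 1%N (fun=> 1) (fun=> h).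
by congr centered_gaussian; apply/funext => w; rewrite big_ord1 mul1r.
Qed.

Lemma measurable_dW e x : 0 < e -> measurable_fun setT (dW e x).
Proof.
move=> e0; have [m _] := hdW e0.
exact: (measurableT_comp m (pair1_measurable x)).
Qed.

(** [cov_kernel] is even, so the two halves of [covs] agree. *)
Lemma dW_covariance e1 e2 x1 x2 : 0 < e1 -> 0 < e2 ->
  (\int[P]_w (dW e1 x1 w * dW e2 x2 w)%:E = (cov_kernel mu (e1 + e2) (x1 - x2))%:E)%E.
Proof.
move=> e10 e20.
have [h1 r1 a1] := (hdW e10).2 x1; have [h2 r2 a2] := (hdW e20).2 x2.
have [_ hE] := hW; have := hE h1 h2.
rewrite (hdot_represents hi (gdom_heat x1 e10) (econt_heat x1 e10) (gdom_heat x2 e20)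
  (econt_heat x2 e20) r1 r2) /covs !cov_heat// (addrC e2) -[x2 - x1]opprB cov_kernelN.
rewrite mulrDl -splitr => <-; rewrite unlock; apply: ae_eq_integral => //.
- apply/measurable_EFinP; apply: measurable_funM; exact: measurable_dW.
- apply/measurable_EFinP; apply: measurable_funM.
    by have [] := isonormal_gaussian h1.
  by have [] := isonormal_gaussian h2.
by apply: filterS2 a1 a2 => w e1' e2' _; rewrite /= e1' e2'.
Qed.

End noise_covariance.

End covariance_limit.

(** * The mollified fundamental solution *)

Section econt_comp.
Context {R : realType} {d : nat}.
Implicit Types (x y z : 'rV[R]_d).

Lemma econt_comp (g : R -> R) (h : 'rV[R]_d -> R) : continuous g -> econt h ->
  econt (fun x => g (h x)).
Proof.
move=> cg ch z e e0; have /cvgrPdist_le/(_ e e0) := cg (h z).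
move=> /nbhs_ballP[n /= n0 hg]; have n20 : 0 < n / 2 by rewrite divr_gt0.
have [eta eta0 he] := ch z _ n20; exists eta => // y /he yz.
rewrite distrC; apply: hg; rewrite /ball/= distrC; apply: le_lt_trans yz _.
by rewrite ltr_pdivrMr// mulr_natr mulr2n ltrDl.
Qed.

Lemma enorm_dist_le x y : `|enorm y - enorm x| <= enorm (x - y).
Proof.
have h1 := enormD_le (x - y) y; have h2 := enormD_le (y - x) x.
rewrite !subrK in h1 h2; rewrite -[y - x]opprB enormN in h2.
by rewrite ler_norml lerBlDr h2 andbT lerNl opprB lerBlDr.
Qed.

Lemma econt_enorm_powR (a : R) : 0 < a -> econt (fun x => enorm x `^ a).
Proof.
move=> a0 z e e0; have [z0|z0] := ltP 0 (enorm z).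
  have [n /= n0 h] := (nbhs_ballP _ _).1 ((cvgrPdist_le _ _).1 (powR_continuous_pos z0 (p := a)) e e0).
  exists n => // y yz; rewrite distrC; apply: h; rewrite /ball/= distrC.
  exact: le_lt_trans (enorm_dist_le z y) yz.
have {}z0 : enorm z = 0 by apply/eqP; rewrite eq_le z0 enorm_ge0.
have [h h0 hh] := powR_small a0 e0; exists h => // y yz.
rewrite z0 powR0 ?gt_eqF// subr0 ger0_norm ?powR_ge0//; apply: hh; rewrite enorm_ge0/=.
have := le_lt_trans (enorm_dist_le z y) yz; rewrite z0 subr0 ger0_norm ?enorm_ge0//.
exact: ltW.
Qed.

End econt_comp.

(** * Fourier representation of the mollified solution *)

Section mollified_solution.
Context {R : realType} {d : nat}.
Variables a b r nu : R.
Hypotheses (ha : 0 < a <= 2) (hb : 0 < b <= 2) (hr : 0 <= r) (hnu : 0 < nu).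
Implicit Types (x y xi : 'rV[R]_d) (s t e : R).

Let b0 : 0 < b. Proof. by case/andP : hb. Qed.
Let a0 : 0 < a. Proof. by case/andP : ha. Qed.
Let br0 : 0 < b + r. Proof. by rewrite ltr_pwDl. Qed.

Definition freq xi : R := nu / 2 * enorm xi `^ a.

(** [symbol] extended by 0 to [t <= 0]; [freq xi] is the spectral parameter [z] of the previous
    estimates. *)
Definition msym t xi : R := EE b (freq xi) (b + r) t.

Lemma freq_ge0 xi : 0 <= freq xi.
Proof. by rewrite mulr_ge0 ?powR_ge0// divr_ge0// ltW. Qed.

Lemma freqN xi : freq (- xi) = freq xi.
Proof. by rewrite /freq enormN. Qed.

Lemma msymN t xi : msym t (- xi) = msym t xi.
Proof. by rewrite /msym freqN. Qed.

Lemma freq0 : freq 0 = 0.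
Proof.
rewrite /freq (_ : enorm 0 = 0) ?powR0 ?mulr0 ?gt_eqF//.
by rewrite /enorm dot0l sqrtr0.
Qed.

Lemma msym0 t : msym t 0 = kk (b + r) t.
Proof. by rewrite /msym freq0 EE_z0. Qed.

Lemma symbol_msym t xi : 0 < t -> symbol a b r nu t xi = msym t xi.
Proof.
Transparent EE.
move=> t0; rewrite /symbol /msym /EE t0 /freq; congr (_ * mittag_leffler _ _ (- _)).
by rewrite mulrAC.
Opaque EE.
Qed.

Lemma measurable_freq : measurable_fun setT freq.
Proof.
apply: measurable_funM => //.
exact: (measurableT_comp (measurable_powR a) measurable_enorm).
Qed.

Lemma measurable_msym d' (T : measurableType d') (s : T -> R) (f : T -> 'rV[R]_d) :
  measurable_fun setT s -> measurable_fun setT f ->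
  measurable_fun setT (fun w => msym (s w) (f w)).
Proof.
move=> ms mf; apply: (measurable_EE2 b0 br0) => //.
exact: measurableT_comp measurable_freq mf.
Qed.

Lemma msym_le t xi : `|msym t xi| <= 2 * kk (b + r) t.
Proof. by apply: EE_bound => //; [exact: freq_ge0|rewrite lerDl]. Qed.

Lemma msym_le0 t xi : t <= 0 -> msym t xi = 0.
Proof. exact: EE_le0. Qed.

Lemma econt_msym t : econt (msym t).
Proof.
have [t0|t0] := leP t 0.
  by move=> z e e0; exists 1 => // y _; rewrite !msym_le0// subrr normr0 ltW.
have cg : continuous (fun w : R => t `^ (b + r - 1) * mittag_leffler b (b + r) (- (nu / 2 * w * t `^ b))).
  move=> w; apply: cvgM; first exact: cvg_cst.
  apply: (continuous_comp (f := fun w : R => - (nu / 2 * w * t `^ b)) (g := mittag_leffler b (b + r))).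
    apply: cvgN; apply: cvgM; last exact: cvg_cst.
    by apply: cvgM; [exact: cvg_cst|exact: cvg_id].
  exact: continuous_ml.
have := econt_comp cg (econt_enorm_powR a0 (d := d)).
congr econt; apply/funext => xi.
Transparent EE.
by rewrite /msym /EE t0.
Opaque EE.
Qed.

Section fourier.
Variables (G : R -> ('rV[R]_d -> R) -> R).
Hypothesis hG : fundamental_solution a b r nu G.

Lemma ghat_wave del x al : (fun xi : 'rV[R]_d => cos (al + dot x xi) * ghat del xi) =
  fun xi => 1 * gwave (del / 2) 0 x al xi.
Proof.
Transparent ghat.
apply/funext => xi; rewrite mul1r /gwave /ghat subr0 mulrC.
by congr (expR (- _) * _); ring.
Opaque ghat.
Qed.

Lemma schwartz_cos_ghat del x al : 0 < del ->
  schwartz (fun xi => cos (al + dot x xi) * ghat del xi).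
Proof. by move=> e0; rewrite ghat_wave; apply: schwartz_gwave; rewrite divr_gt0. Qed.

Let C0 := (2 * pi : R) `^ d%:R.

Lemma L1_leb_cos_ghat del (y : 'rV[R]_d) al : 0 < del ->
  L1 leb (fun xi => cos (al + dot y xi) * ghat del xi).
Proof.
move=> e0; apply: L1_le (L1_ghat e0).
  apply: measurable_funM; last exact: measurable_ghat.
  exact: (@measurable_cosdot R d _ _ (cst al) (cst y) id).
by move=> xi; exact: norm_cosM_le (ghat_ge0 del xi).
Qed.

Lemma ft_cos_ghat del x y : 0 < del ->
  ft_cos (fun xi => cos (0 + dot x xi) * ghat del xi) y =
  C0 / 2 * (heat del (x - y) + heat del (- x - y)).
Proof.
move=> e0.
have L1' := L1_leb_cos_ghat (y - x) 0 e0; have L2' := L1_leb_cos_ghat (y + x) 0 e0.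
transitivity (\int[leb]_xi (2^-1 * (cos (0 + dot (y - x) xi) * ghat del xi + cos (0 + dot (y + x) xi) * ghat del xi))).
  by apply: eq_RI => xi; rewrite !add0r dotBl dotDl cosB cosD; field.
rewrite (RIZ _ (L1D L1' L2')) (RID L1' L2') !heat_inversion// cos0 !mul1r.
rewrite -(heatN _ (y - x)) opprB -(heatN _ (y + x)) opprD -/C0 (addrC (- y)).
by clear; ring.
Qed.

Lemma ft_sin_ghat del x y : 0 < del ->
  ft_sin (fun xi => cos (- (pi / 2) + dot x xi) * ghat del xi) y =
  C0 / 2 * (heat del (x - y) - heat del (- x - y)).
Proof.
move=> e0.
have L1' := L1_leb_cos_ghat (y - x) 0 e0; have L2' := L1_leb_cos_ghat (y + x) 0 e0.
transitivity (\int[leb]_xi (2^-1 * (cos (0 + dot (y - x) xi) * ghat del xi - cos (0 + dot (y + x) xi) * ghat del xi))).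
  by apply: eq_RI => xi; rewrite (addrC (- _)) cosBpihalf !add0r dotBl dotDl cosB cosD; field.
rewrite (RIZ _ (L1B L1' L2')) (RIB L1' L2') !heat_inversion// cos0 !mul1r.
rewrite -(heatN _ (y - x)) opprB -(heatN _ (y + x)) opprD -/C0 (addrC (- y)).
by clear; ring.
Qed.

Lemma schwartz_heatZ (A : R) del x : 0 < del -> schwartz (fun y : 'rV[R]_d => A * heat del (x - y)).
Proof.
Transparent heat.
move=> e0; have c0 : 0 < (2 * del)^-1 by rewrite invr_gt0 mulr_gt0.
rewrite (_ : (fun y => _) =
    fun y => (A * (2 * pi * del) `^ (- (d%:R / 2))) * gwave (2 * del)^-1 x 0 0 y).
  exact: schwartz_gwave.
apply/funext => y; rewrite /heat /gwave dot0l addr0 cos0 mulr1 -dotNN opprB mulrA.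
by rewrite [_ / (2 * del)]mulrC.
Opaque heat.
Qed.

(** Cosine and sine waves times a Gaussian transform into the sum and the difference of heat kernels
    at [x] and [- x]; the sine identity says that [G t] takes equal values on both, and the cosine
    identity gives this value. *)
Lemma Gmol_fourier del t x : 0 < del -> 0 < t ->
  C0 * Gmol G del t x = \int[leb]_xi (msym t xi * (cos (dot x xi) * ghat del xi)).
Proof.
move=> e0 t0; have [[lin _] hF] := hG t0.
have [F1 _] := hF _ (schwartz_cos_ghat x 0 e0).
have [_ F2] := hF _ (schwartz_cos_ghat x (- (pi / 2)) e0).
rewrite (_ : ft_cos _ = fun y => C0 / 2 * heat del (x - y) + C0 / 2 * heat del (- x - y)) in F1; last first.
  by apply/funext => y; rewrite ft_cos_ghat// mulrDr.
rewrite (_ : ft_sin _ = fun y => C0 / 2 * heat del (x - y) + (- (C0 / 2)) * heat del (- x - y)) in F2; last first.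
  by apply/funext => y; rewrite ft_sin_ghat// mulrBr mulNr.
rewrite lin in F1; [|exact: schwartz_heatB|exact: schwartz_heatZ].
rewrite lin in F2; [|exact: schwartz_heatB|exact: schwartz_heatZ].
(* Linearity is stated for [c f + g]; homogeneity is the case [(c - 1) f + f]. *)
have scal (c : R) : G t (fun y => c * heat del (- x - y)) = c * G t (fun y => heat del (- x - y)).
  have := lin (c - 1) _ _ (schwartz_heatB (- x) e0) (schwartz_heatB (- x) e0).
  rewrite (_ : (fun y => _) = fun y => c * heat del (- x - y)); last first.
    by apply/funext => y; ring.
  by move=> ->; ring.
rewrite !scal in F1 F2; rewrite /Gmol.
set u := G t _ in F1 F2 *; set v := G t _ in F1 F2.
transitivity (\int[leb]_xi (symbol a b r nu t xi * (cos (0 + dot x xi) * ghat del xi))).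
  have F3 : C0 / 2 * u = C0 / 2 * v by apply/eqP; rewrite -subr_eq0 -mulNr F2.
  rewrite -F1 -F3 -mulrDl -splitr; reflexivity.
apply: eq_RI => xi; rewrite symbol_msym// add0r; reflexivity.
Qed.

End fourier.

(** [Gmol] for [t > 0], in a jointly measurable form that vanishes for [t <= 0]; the ordering of the
    times is thereby built into products of [gm]. *)
Definition gm del t x : R :=
  ((2 * pi) `^ d%:R)^-1 * \int[leb]_xi (msym t xi * (cos (dot x xi) * ghat del xi)).

Lemma Gmol_gm G del t x : fundamental_solution a b r nu G -> 0 < del -> 0 < t ->
  Gmol G del t x = gm del t x.
Proof.
move=> hG e0 t0; rewrite /gm -(Gmol_fourier hG x e0 t0) mulrA mulVf ?mul1r//.
by rewrite gt_eqF// powR_gt0// mulr_gt0// pi_gt0.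
Qed.

Lemma L1_msym_ghat del t (g : 'rV[R]_d -> R) : 0 < del -> measurable_fun setT g ->
  (forall xi, `|g xi| <= 1) -> L1 leb (fun xi => msym t xi * (g xi * ghat del xi)).
Proof.
move=> e0 mg hg; apply: L1_le (L1Z (2 * kk (b + r) t) (L1_ghat e0)).
  apply: measurable_funM; last by apply: measurable_funM => //; exact: measurable_ghat.
  by apply: measurable_msym => //; exact: measurable_cst.
move=> xi; rewrite normrM; apply: ler_pM => //; first exact: msym_le.
by rewrite normrM (ger0_norm (ghat_ge0 del xi)) ler_piMl ?ghat_ge0.
Qed.

Lemma gm_le0 del t x : t <= 0 -> gm del t x = 0.
Proof.
move=> t0; rewrite /gm (@eq_RI _ _ R leb _ (fun=> 0)); last by move=> xi; rewrite msym_le0// mul0r.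
by rewrite /Rintegral integral0 mulr0.
Qed.

Definition gm_cst del : R := ((2 * pi) `^ d%:R)^-1 * (2 * \int[leb]_xi @ghat R d del xi).

(** Uniform in [x] but without decay, which is why the integrability of kernels has to come from
    elsewhere. *)
Lemma gm_le del t x : 0 < del -> `|gm del t x| <= gm_cst del * kk (b + r) t.
Proof.
move=> e0; have C0 : 0 <= ((2 * pi : R) `^ d%:R)^-1 by rewrite invr_ge0 powR_ge0.
rewrite /gm normrM (ger0_norm C0) /gm_cst -mulrA; apply: (ler_wpM2l C0).
have L := L1_ghat e0 (d := d).
have -> : 2 * (\int[leb]_xi @ghat R d del xi) * kk (b + r) t = \int[leb]_xi (2 * kk (b + r) t * @ghat R d del xi).
  by rewrite (RIZ _ L); clear; ring.
have mc : measurable_fun setT (fun xi : 'rV[R]_d => cos (dot x xi)).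
  exact: measurable_cos_dot (measurable_cst x) (@measurable_id _ _ setT).
apply: norm_RI_le; last exact: L1Z.
  apply: measurable_funM; first by apply: measurable_msym => //; exact: measurable_cst.
  by apply: measurable_funM => //; exact: measurable_ghat.
move=> xi; rewrite normrM; apply: ler_pM => //; first exact: msym_le.
exact: norm_cosM_le (ghat_ge0 del xi).
Qed.

Lemma measurable_gm del d' (T : measurableType d') (s : T -> R) (f : T -> 'rV[R]_d) :
  measurable_fun setT s -> measurable_fun setT f ->
  measurable_fun setT (fun w => gm del (s w) (f w)).
Proof.
move=> ms mf; apply: measurable_funM => //.
have m : measurable_fun setT (fun z : T * 'rV[R]_d => msym (s z.1) z.2 * (cos (dot (f z.1) z.2) * ghat del z.2)).
  apply: measurable_funM; first by apply: measurable_msym => //; exact: measurableT_comp.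
  apply: measurable_funM; last by apply: measurableT_comp => //; exact: measurable_ghat.
  by apply: measurable_cos_dot => //; exact: measurableT_comp.
exact: (@measurable_RI _ _ _ _ R leb _ m).
Qed.

End mollified_solution.

(** * Integrability against random fields *)

Section random_integrability.
Context d1 (T : measurableType d1) (R : realType).
Variable m : {sigma_finite_measure set T -> \bar R}.
Context d2 (Omega : measurableType d2) (P : probability Omega R).
Variables (f : T -> R) (X : T -> Omega -> R) (c : R).
Hypotheses (mf : measurable_fun setT f) (c0 : 0 < c).
Hypothesis mX : measurable_fun setT (fun z : T * Omega => X z.1 z.2).
Hypothesis small : forall t, (P [set w | `|X t w| < c]%R <= (4^-1)%:E)%E.
Hypothesis int : {ae P, forall w, L1 m (fun t => f t * X t w)}.

Let Y w := (\int[m]_t (`|f t * X t w|)%:E)%E.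

Let mXt t : measurable_fun setT (X t).
Proof. exact: (measurableT_comp mX (pair1_measurable t)). Qed.

Let mfX : measurable_fun setT (fun z : T * Omega => f z.1 * X z.1 z.2).
Proof. by apply: measurable_funM => //; exact: measurableT_comp. Qed.

Let mY : measurable_fun setT Y.
Proof.
apply: (measurable_fun_fubini_tonelli_G (m1 := m) (fun z : T * Omega => (`|f z.1 * X z.1 z.2|)%:E)) => //.
by apply/measurable_EFinP; apply: measurableT_comp.
Qed.

Let D (n : nat) := [set w | (Y w <= n%:R%:E)%E].

Let mD n : measurable (D n).
Proof.
rewrite (_ : D n = setT `&` Y @^-1` `]-oo, n%:R%:E]).
  by apply: mY => //; exact: emeasurable_itv.
by rewrite setTI; apply/seteqP; split => w /=; rewrite in_itv.
Qed.

(** [Y] is almost surely finite, so the increasing events [D n] have probabilities tending to 1. *)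
Let bounded_half : exists n, (2^-1%:E <= P (D n))%E.
Proof.
have ndD : nondecreasing_seq D.
  move=> n k nk; apply/subsetPset => w; rewrite /D /= => h; apply: le_trans h _.
  by rewrite lee_fin ler_nat.
have mU : measurable (\bigcup_n D n) by exact: bigcup_measurable.
have cvP := nondecreasing_cvg_mu (mu := P) mD mU ndD.
have PU : P (\bigcup_n D n) = 1%E.
  rewrite -(@probability_setT _ _ _ P).
  case: int => N [mN PN hN].
  apply/eqP; rewrite eq_le; apply/andP; split; first by apply: le_measure; rewrite ?inE.
  have -> : P setT = P (~` N) by rewrite probability_setC// PN sube0 probability_setT.
  apply: le_measure; rewrite ?inE//; first exact: measurableC.
  move=> w Nw; have : L1 m (fun t => f t * X t w) by apply: contrapT => h; apply: Nw; exact: hN.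
  move=> /[dup] /L1_measurable mw /(L1P _ mw); rewrite -/(Y w) => Yoo.
  have Y0 : (0 <= Y w)%E by apply: integral_ge0.
  exists (Num.truncn (fine (Y w))).+1 => //; rewrite /D /=.
  rewrite -(@fineK _ (Y w)) ?ge0_fin_numE// lee_fin ltW//; exact: truncnS_gt.
have {}cvP : P (D n) @[n --> \oo] --> 1%E by rewrite -PU; exact: cvP.
apply: contrapT => /forallNP h.
have : (1%E <= 2^-1%:E :> \bar R)%E.
  rewrite -(cvg_lim _ cvP)//; apply: lime_le; first by apply/cvg_ex; eexists; exact: cvP.
  by apply: nearW => n; have /negP := h n; rewrite -ltNge => /ltW.
by rewrite lee_fin leNgt invf_lt1// ltr1n.
Qed.

(* The random integral is at most some [n] on an event of probability at least 1/2;
   intersected with [c <= |X t|], this event keeps probability at least 1/4. *)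
Lemma L1_random : L1 m f.
Proof.
have [n hD] := bounded_half.
(* Two estimates of the double integral of [F]: at most [n], as [Y <= n] on [D n], and at least
   [c / 4] times the integral of the modulus of [f]. *)
pose F (z : T * Omega) := (`|f z.1 * X z.1 z.2| * \1_(D n) z.2)%:E.
have mF : measurable_fun setT F.
  apply/measurable_EFinP; apply: measurable_funM; first exact: measurableT_comp.
  by apply: measurableT_comp => //; exact: measurable_indic.
have F0 z : (0 <= F z)%E by rewrite lee_fin mulr_ge0.
have E := @fubini_tonelli _ _ _ _ _ m P _ mF F0.
have up : (\int[P]_w \int[m]_t F (t, w) <= n%:R%:E)%E.
  apply: (@le_trans _ _ (\int[P]_w n%:R%:E)%E); last first.
    by rewrite (integral_cst _ measurableT) [X in (_ * X)%E]probability_setT mule1.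
  apply: ge0_le_integral => //.
  - by move=> w _; apply: integral_ge0.
  - exact: (measurable_fun_fubini_tonelli_G F).
  move=> w _; rewrite /F /=; have [wD|wD] := pselect (D n w).
    rewrite (eq_integral (fun t => (`|f t * X t w|)%:E)); first exact: wD.
    by move=> t _; rewrite indicE mem_set// mulr1.
  rewrite integral0_eq ?lee_fin// => t _.
  by rewrite indicE memNset// mulr0.
have low t : ((`|f t| * (c / 4))%:E <= \int[P]_w F (t, w))%E.
  pose A := D n `&` [set w | c <= `|X t w|].
  have mc : measurable [set w | c <= `|X t w|].
    rewrite (_ : [set w | _] = setT `&` (fun w => `|X t w|) @^-1` `[c, +oo[).
      by apply: (measurableT_comp (@normr_measurable R _) (mXt t)) => //; exact: measurable_itv.
    by rewrite setTI; apply/seteqP; split => w /=; rewrite in_itv/= andbT.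
  have mA : measurable A by exact: measurableI.
  have PA : (4^-1%:E <= P A)%E.
    have sub : (P (D n) <= P A + P [set w | `|X t w| < c]%R)%E.
      have mlt : measurable [set w | `|X t w| < c].
        rewrite (_ : [set w | _] = ~` [set w | c <= `|X t w|]); first exact: measurableC.
        by apply/seteqP; split => w /=; rewrite leNgt; [move=> ->|move=> /negP; rewrite negbK].
      apply: (@le_trans _ _ (P (A `|` [set w | `|X t w| < c]))); last exact: measureU2.
      apply: le_measure; rewrite ?inE//; first exact: measurableU.
      by move=> w Dw; have [h|h] := leP c `|X t w|; [left|right].
    have h4 := small t; have := le_trans hD (le_trans sub (leeD2l (P A) h4)).
    have fA : P A \is a fin_num by exact: fin_num_measure.
    rewrite -(fineK fA) -EFinD !lee_fin; lra.
  apply: (@le_trans _ _ (\int[P]_w (`|f t| * c * \1_A w)%:E)%E).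
    under eq_integral do rewrite EFinM.
    rewrite integralZl//; last first.
      by apply/integrableP; split; [apply/measurable_EFinP; exact: measurable_indic|
        under eq_integral do rewrite /= ger0_norm//; rewrite integral_indic// setIT (le_lt_trans (probability_le1 _ _))// ltry].
    rewrite integral_indic// setIT mulrA EFinM; apply: lee_pmul => //.
      by rewrite lee_fin mulr_ge0// ltW.
  apply: ge0_le_integral => //.
  - by move=> w _; rewrite lee_fin !mulr_ge0// ltW.
  - by apply/measurable_EFinP; apply: measurable_funM => //; exact: measurable_indic.
  - exact: (measurableT_comp mF (pair1_measurable t)).
  move=> w _; rewrite lee_fin /F /=.
  have [wA|wA] := pselect (A w); last by rewrite [\1_A w]indicE memNset// mulr0 mulr_ge0.
  have [wD wc] := wA.
  by rewrite !indicE !mem_set// !mulr1 normrM ler_wpM2l.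
apply/L1P => //.
have c40 : 0 < c / 4 by rewrite divr_gt0.
have : ((c / 4)%:E * \int[m]_t (`|f t|)%:E <= n%:R%:E)%E.
  apply: le_trans up; rewrite -E -ge0_integralZl//; last 2 first.
  - by apply/measurable_EFinP; exact: measurableT_comp.
  - by rewrite lee_fin ltW.
  apply: ge0_le_integral => //.
  - by move=> t _; rewrite -EFinM lee_fin mulr_ge0// ltW.
  - by apply/measurable_EFinP; apply: measurable_funM => //; exact: measurableT_comp.
  - exact: (measurable_fun_fubini_tonelli_F F).
  by move=> t _; rewrite -EFinM mulrC.
set I := (\int[m]_t _)%E; have : (0 <= I)%E by apply: integral_ge0.
case: I => [x _ _|_|//]; first exact: ltry.
by rewrite gt0_muley ?lte_fin.
Qed.

End random_integrability.

(** * Small ball estimate for Gaussian variables *)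

Section gaussian_small_ball.
Context {R : realType} d2 (Omega : measurableType d2) (P : probability Omega R).
Variables (X : Omega -> R) (v : R).
Hypotheses (hX : centered_gaussian P X) (v0 : 0 < v).
Hypothesis hv : (\int[P]_w (X w * X w)%:E = v%:E)%E.

Let mX : measurable_fun setT X. Proof. by case: hX. Qed.

(** Positive variance excludes the degenerate alternative. The parameter [e] is compared with [v] in
    [variance_le]; equality is not sought. *)
Let law : exists2 e : R, 0 < e & forall A : set R, measurable A ->
  P (X @^-1` A) = (\int[lam]_x (if x \in A then gauss1 e x else 0)%:E)%E.
Proof.
have [_ [h|[s s0 h]]] := hX.
  exfalso; have : (\int[P]_w (X w * X w)%:E = 0)%E.
    rewrite (ae_eq_integral (cst 0%E)) ?integral0//.
    - by apply/measurable_EFinP; exact: measurable_funM.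
    - by apply: filterS h => w e _; rewrite /= e mulr0.
  by rewrite hv => -[] v00; move: v0; rewrite v00 ltxx.
have s20 : 0 < s ^+ 2 by rewrite exprn_even_gt0.
exists (s ^+ 2) => // A mA; rewrite h// /normal_prob.
have E : gauss1 (s ^+ 2) = normal_pdf 0 s.
  rewrite gauss1E// sqrtr_sqr; apply/funext => x.
  rewrite !normal_pdfE ?normr_eq0//; congr (_ * _); rewrite /normal_peak /normal_fun.
    by rewrite real_normK// num_real.
  by rewrite real_normK// num_real.
rewrite -E integral_mkcond.
rewrite (eq_integral (fun x : measurableTypeR R => (if x \in A then gauss1 (s ^+ 2) x else 0)%:E)); last first.
  by move=> x _; rewrite patchE; case: ifP.
apply: integral_lam; apply/measurable_EFinP.
rewrite (_ : (fun x => _) = (gauss1 (s ^+ 2)) \_ A); last first.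
  by apply/funext => x; rewrite patchE.
by apply/(measurable_restrict _ mA) => //; apply: measurable_funTS; exact: measurable_gauss1.
Qed.

(** The law is known on sets, and the layer-cake formula [sq] carries it to second moments. Then
    [gauss1_split] and [y exp(- y) <= 1] bound [x ^ 2] times the density by [4 e sqrt 2] times
    another density; [sqrt 2 <= 2] gives 8. *)
Let variance_le (e : R) : 0 < e ->
  (forall A : set R, measurable A ->
    P (X @^-1` A) = (\int[lam]_x (if x \in A then gauss1 e x else 0)%:E)%E) ->
  v <= 8 * e.
Proof.
move=> e0 h; rewrite -lee_fin -hv.
pose I (u x : R) : R := if (0 < u) && (u < x * x) then 1 else 0.
have mI d' (S : measurableType d') (U Z : S -> R) : measurable_fun setT U -> measurable_fun setT Z ->
    measurable_fun setT (fun s => I (U s) (Z s)).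
  move=> mU mZ; apply: measurable_fun_ifT => //.
  apply: measurable_and; first exact: measurable_fun_ltr.
  by apply: measurable_fun_ltr => //; exact: measurable_funM.
have I0 (u x : R) : 0 <= I u x by rewrite /I; case: ifP.
have sq (x : R) : (x * x)%:E = (\int[lam]_u (I u x)%:E)%E.
  have x0 : 0 <= x * x by rewrite -expr2 sqr_ge0.
  have := @lam_itv R 0 (x * x) false true x0; rewrite subr0 => <-.
  rewrite -[in LHS](setIT [set` _]) -integral_indic//.
  apply: eq_integral => u _; rewrite indicE /I; congr (_%:E).
  by rewrite mem_setE in_itv/=; case: ifP.
have mg : measurable_fun setT (gauss1 e) by exact: measurable_gauss1.
have mF : measurable_fun setT (fun z : R * R => (I z.1 z.2 * gauss1 e z.2)%:E).
  by apply/measurable_EFinP; apply: measurable_funM; [exact: mI|exact: measurableT_comp].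
have mXX : measurable_fun setT (fun z : Omega * R => (I z.2 (X z.1))%:E).
  by apply/measurable_EFinP; apply: mI => //; exact: measurableT_comp.
have s1 : (\int[P]_w (X w * X w)%:E = \int[lam]_u \int[P]_w (I u (X w))%:E)%E.
  under eq_integral do rewrite sq.
  by apply: (@fubini_tonelli _ _ _ _ _ P lam _ mXX) => z; rewrite lee_fin.
have s2 (u : R) : (\int[P]_w (I u (X w))%:E = \int[lam]_x (I u x * gauss1 e x)%:E)%E.
  pose A := [set x : R | (0 < u) && (u < x * x)].
  have mA : measurable A.
    rewrite (_ : A = setT `&` (fun x : R => I u x) @^-1` [set 1]).
      by apply: mI => //.
    rewrite setTI; apply/seteqP; split => x; rewrite /A /I /=; case: ifP => // _ /eqP.
    by rewrite eq_sym oner_eq0.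
  have := h _ mA; rewrite -[X @^-1` A](setIT) -integral_indic//; last first.
    by rewrite -[X @^-1` A](setTI); exact: mX.
  move=> E; transitivity (\int[P]_w (\1_(X @^-1` A) w)%:E)%E.
    apply: eq_integral => w _; rewrite indicE /I; congr (_%:E).
    have [Iw|/negP Iw] := boolP ((0 < u) && (u < X w * X w)); first by rewrite mem_set.
    by rewrite memNset.
  rewrite E; apply: eq_integral => x _; congr (_%:E); rewrite /I.
  have [Ix|/negP Ix] := boolP ((0 < u) && (u < x * x)); first by rewrite mem_set ?mul1r.
  by rewrite memNset ?mul0r.
rewrite s1; under eq_integral do rewrite s2.
rewrite (@fubini_tonelli _ _ _ _ _ lam lam _ mF); last first.
  by move=> z; rewrite lee_fin mulr_ge0 ?gauss1_ge0.
have e20 : 0 < 2 * e by rewrite mulr_gt0.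
have B x : (\int[lam]_u (I u x * gauss1 e x)%:E <= (Num.sqrt 2 * (4 * e) * gauss1 (2 * e) x)%:E)%E.
  under eq_integral do rewrite mulrC EFinM.
  rewrite ge0_integralZl//; last 3 first.
  - by apply/measurable_EFinP; apply: mI.
  - by move=> u _; rewrite lee_fin.
  - by rewrite lee_fin gauss1_ge0.
  rewrite -sq -EFinM lee_fin gauss1_split//.
  set g := gauss1 _ _; have g0 : 0 <= g by exact: gauss1_ge0.
  have : x * x * expR (- (x * x / (4 * e))) <= 4 * e.
    set y := x * x / (4 * e); have -> : x * x = 4 * e * y by rewrite /y; field; rewrite gt_eqF.
    rewrite -mulrA ler_piMr ?mulr_ge0 ?(ltW e0)//.
    rewrite expRN ler_pdivrMr ?expR_gt0// mul1r.
    by apply: le_trans (expR_ge1Dx y); rewrite lerDr.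
  set q := expR _ => hq; rewrite [leLHS](_ : _ = (Num.sqrt 2 * g) * (x * x * q)); last by ring.
  rewrite [leRHS](_ : _ = (Num.sqrt 2 * g) * (4 * e)); last by clear; ring.
  by apply: ler_wpM2l hq; rewrite mulr_ge0 ?sqrtr_ge0.
apply: (@le_trans _ _ (\int[lam]_x (Num.sqrt 2 * (4 * e) * gauss1 (2 * e) x)%:E)%E).
  apply: ge0_le_integral => //.
  - by move=> x _; apply: integral_ge0 => u _; rewrite lee_fin mulr_ge0 ?gauss1_ge0.
  - apply: (measurable_fun_fubini_tonelli_G (m1 := lam) (fun z : R * R => (I z.1 z.2 * gauss1 e z.2)%:E)) => //.
    by move=> z; rewrite lee_fin mulr_ge0 ?gauss1_ge0.
  - apply/measurable_EFinP; apply: measurable_funM => //; exact: measurable_gauss1.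
  - by move=> x _; exact: B.
have L := L1Z (Num.sqrt 2 * (4 * e)) (L1_gauss1 e20).
rewrite -(RI_EFin L) (RIZ _ (L1_gauss1 e20)) RI_gauss1// mulr1 lee_fin.
have : Num.sqrt 2 <= 2 :> R.
  by rewrite -[leRHS](ger0_norm (ler0n R 2)) -sqrtr_sqr ler_sqrt// expr2 -natrM ler_nat.
by move=> s22; rewrite mulrA ler_wpM2r// ?(ltW e0)//; lra.
Qed.

(** The density is at most [1 / sqrt e], and [v <= 8 e] gives [sqrt v <= 3 sqrt e]; an interval of
    length [2 sqrt v / 48] then has probability at most 6/48. *)
Lemma gaussian_small_ball : (P [set w | `|X w| < Num.sqrt v / 48]%R <= (8^-1)%:E)%E.
Proof.
have [e e0 h] := law; have ve := variance_le e0 h.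
pose c := Num.sqrt v / 48; have c0 : 0 < c by rewrite divr_gt0 ?sqrtr_gt0.
have se0 : 0 < Num.sqrt e by rewrite sqrtr_gt0.
have mA : measurable (`]- c, c[%classic : set R) by exact: measurable_itv.
have -> : [set w | `|X w| < Num.sqrt v / 48] = X @^-1` `]- c, c[%classic.
  by apply/seteqP; split => w; rewrite /= in_itv/= ltr_norml.
have g (x : R) : gauss1 e x <= (Num.sqrt e)^-1.
  Transparent gauss1.
  have p0 : 0 < 2 * pi * e by rewrite !mulr_gt0// pi_gt0.
  rewrite /gauss1 (_ : - (1 / 2) = - 2^-1); last by rewrite mul1r.
  rewrite powRN powR12_sqrt ?(ltW p0)//; apply: (@le_trans _ _ (Num.sqrt (2 * pi * e))^-1).
    rewrite ler_piMr ?invr_ge0 ?sqrtr_ge0// -[leRHS]expR0 ler_expR oppr_le0.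
    apply: divr_ge0; first by rewrite -expr2 sqr_ge0.
    by rewrite mulr_ge0 ?(ltW e0).
  rewrite lef_pV2 ?posrE ?sqrtr_gt0//; apply: ler_wsqrtr.
  by apply: ler_peMl (ltW e0) _; have := @pi_ge2 R; lra.
  Opaque gauss1.
rewrite (h _ mA).
apply: (@le_trans _ _ (\int[lam]_x ((Num.sqrt e)^-1 * \1_(`]- c, c[%classic) x)%:E)%E).
  apply: ge0_le_integral => //.
  - by move=> x _; rewrite lee_fin; case: ifP => // _; exact: gauss1_ge0.
  - apply/measurable_EFinP; rewrite (_ : (fun x => _) = (gauss1 e) \_ (`]- c, c[%classic)); last first.
      by apply/funext => x; rewrite patchE.
    by apply/(measurable_restrict _ mA) => //; apply: measurable_funTS; exact: measurable_gauss1.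
  - by apply/measurable_EFinP; apply: measurable_funM => //; exact: measurable_indic.
  - by move=> x _; rewrite lee_fin indicE; case: ifP => _; rewrite ?mulr1 ?mulr0.
under eq_integral do rewrite EFinM.
rewrite ge0_integralZl//; last by apply/measurable_EFinP; exact: measurable_indic.
have cc : - c <= c by rewrite ge0_cp// ltW.
rewrite integral_indic// setIT [X in (_ * X)%E](@lam_itv R (- c) c false true cc).
rewrite -EFinM lee_fin opprK.
rewrite mulrC ler_pdivrMr// /c.
have : Num.sqrt v <= 3 * Num.sqrt e.
  rewrite -(@ler_pXn2r _ 2) ?nnegrE ?mulr_ge0 ?sqrtr_ge0// exprMn (sqr_sqrtr (ltW v0)) (sqr_sqrtr (ltW e0)).
  by apply: le_trans ve _; rewrite ler_wpM2r ?(ltW e0)// expr2 -natrM ler_nat.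
by move=> hh; lra.
Qed.

End gaussian_small_ball.

(** * The second moment on the Fourier side *)

Section cutoff_transform.
Context {R : realType} {d : nat}.
Variables a b r nu : R.
Hypotheses (ha : 0 < a <= 2) (hb : 0 < b <= 2) (hr : 0 <= r) (hnu : 0 < nu).
Implicit Types (x y xi eta : 'rV[R]_d) (s t e del kap : R).

Let b0 : 0 < b. Proof. by case/andP : hb. Qed.
Let br0 : 0 < b + r. Proof. by rewrite ltr_pwDl. Qed.
Let V := 'rV[R]_d.
Let ms := @msym R d a b r nu.
Let gmd := @gm R d a b r nu.
Let C0 : R := (2 * pi) `^ d%:R.

(** Polarization reduces products to squares, which [econt_comp] covers. *)
Lemma econtM (f g : V -> R) : econt f -> econt g -> econt (fun x => f x * g x).
Proof.
move=> cf cg; have csq : continuous (fun u : R => u ^+ 2) by exact: exprn_continuous.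
have := econtZ 2^-1 (econtB (econtB (econt_comp csq (econtD cf cg)) (econt_comp csq cf)) (econt_comp csq cg)).
by congr econt; apply/funext => x; field.
Qed.

Lemma econt_ghat del : 0 < del -> econt (@ghat R d del).
Proof.
move=> e0; have e0' : 0 < del^-1 by rewrite invr_gt0.
have := econtZ ((2 * pi / del) `^ (d%:R / 2)) (econt_heat (0 : V) e0').
by congr econt; apply/funext => x; rewrite sub0r heatN ghatE.
Qed.

(** Without the cut-off [ghat kap] this integral might diverge. In frequency the cut-off is a
    convolution with [heat kap], which disappears as [kap] tends to 0. *)
Definition cutoff_transform kap del t eta : R :=
  \int[leb]_y (gmd del t y * (cos (dot y eta) * ghat kap y)).

Lemma cutoff_transform_def kap del t eta : cutoff_transform kap del t eta =
  \int[leb]_y (gmd del t y * (cos (dot y eta) * ghat kap y)).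
Proof. reflexivity. Qed.

Let psi del t xi := ms t xi * ghat del xi.

Let psiN del t xi : psi del t (- xi) = psi del t xi.
Proof. by rewrite /psi ghatN /ms msymN. Qed.

Let psi_le del t xi : 0 < del -> `|psi del t xi| <= 2 * kk (b + r) t.
Proof.
move=> e0; rewrite /psi normrM (ger0_norm (ghat_ge0 del xi)).
have h : `|ms t xi| <= 2 * kk (b + r) t by exact: (msym_le a hb hr hnu t xi).
by apply: le_trans h; rewrite ler_piMr// ghat_le1// ltW.
Qed.

Let measurable_psi del t : measurable_fun setT (psi del t).
Proof.
apply: measurable_funM; last exact: measurable_ghat.
by apply: measurable_msym => //; exact: measurable_cst.
Qed.

(** Cosines symmetrize the convolution kernel: equal masses sit around [eta] and [- eta], which is
    harmless by [psiN]. *)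
Let heat2 kap eta xi := heat kap (eta - xi) + heat kap (- eta - xi).

Let L1_heat2 kap eta : 0 < kap -> L1 leb (heat2 kap eta).
Proof. by move=> k0; apply: L1D; exact: L1_heatB. Qed.

Let RI_heat2 kap eta : 0 < kap -> \int[leb]_xi heat2 kap eta xi = 2.
Proof.
move=> k0; rewrite (RID (L1_heatB eta k0) (L1_heatB (- eta) k0)) !RI_heatB//.
Qed.

(** The Gaussian factors in [y] and in [xi] allow Fubini's theorem; the integral in space is then
    [ft_cos_ghat]. *)
Lemma cutoff_transformE kap del t eta : 0 < kap -> 0 < del ->
  cutoff_transform kap del t eta = \int[leb]_xi (2^-1 * (psi del t xi * heat2 kap eta xi)).
Proof.
move=> k0 e0; rewrite /cutoff_transform.
pose F (w : V * V) := ms t w.2 * (cos (dot w.1 w.2) * ghat del w.2) * (cos (dot w.1 eta) * ghat kap w.1).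
have mF : measurable_fun setT F.
  apply: measurable_funM.
    apply: measurable_funM; first by apply: measurable_msym => //; exact: measurable_cst.
    apply: measurable_funM; first exact: measurable_cos_dot measurable_fst measurable_snd.
    by apply: measurableT_comp => //; exact: measurable_ghat.
  apply: measurable_funM; last by apply: measurableT_comp => //; exact: measurable_ghat.
  by apply: measurable_cos_dot => //; exact: measurable_cst.
have le y xi : `|F (y, xi)| <= ghat kap y * (2 * kk (b + r) t * ghat del xi).
  rewrite /F /= mulrC normrM; apply: ler_pM => //; first exact: norm_cosM_le (ghat_ge0 kap y).
  rewrite normrM; apply: ler_pM => //; first exact: (msym_le a hb hr hnu t xi).
  exact: norm_cosM_le (ghat_ge0 del xi).
have LF : L1 (leb \x leb)%E F.
  exact: (@L1_prod_le _ _ _ _ R leb leb F _ _ mF le (L1_ghat k0) (L1Z _ (L1_ghat e0))).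
have Lc y : L1 leb (fun xi => ms t xi * (cos (dot y xi) * ghat del xi)).
  apply: (@L1_msym_ghat R d a b r nu hb hr hnu del t (fun xi => cos (dot y xi)) e0).
    exact: measurable_cos_dot (measurable_cst y) (@measurable_id _ _ setT).
  by move=> xi; exact: cos_max.
transitivity (\int[leb]_y (C0^-1 * \int[leb]_xi F (y, xi))).
  apply: eq_RI => y; rewrite /gmd /gm -/C0 /F /= (RIZr _ (Lc y)) -mulrA; reflexivity.
rewrite (RIZ _ (L1_prod12 LF)) (RI_fubini LF).
have c0 : C0 != 0 by rewrite gt_eqF// powR_gt0// mulr_gt0// pi_gt0.
have inner xi : \int[leb]_y F (y, xi) = C0 * (2^-1 * (psi del t xi * heat2 kap eta xi)).
  have := ft_cos_ghat eta xi k0; rewrite /ft_cos => h.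
  have L : L1 leb (fun y => cos (dot xi y) * (cos (0 + dot eta y) * ghat kap y)).
    apply: L1_le (L1_ghat k0).
      apply: measurable_funM.
        exact: measurable_cos_dot (measurable_cst xi) (@measurable_id _ _ setT).
      exact: L1_measurable (L1_leb_cos_ghat eta 0 k0).
    move=> y; rewrite normrM; apply: (@le_trans _ _ (1 * ghat kap y)); last by rewrite mul1r.
    by apply: ler_pM => //; [exact: cos_max|exact: norm_cosM_le (ghat_ge0 kap y)].
  transitivity (\int[leb]_y (psi del t xi * (cos (dot xi y) * (cos (0 + dot eta y) * ghat kap y)))).
    apply: eq_RI => y; rewrite /F /= add0r (dotC xi y) (dotC eta y) /psi; clear; ring.
  rewrite (RIZ _ L) h -/C0 /heat2; clear; ring.
rewrite (eq_RI _ inner).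
have LH : L1 leb (fun xi => 2^-1 * (psi del t xi * heat2 kap eta xi)).
  apply: L1Z; apply: L1_le (L1Z (2 * kk (b + r) t) (L1_heat2 eta k0)).
    by apply: measurable_funM => //; exact: L1_measurable (L1_heat2 eta k0).
  move=> xi; rewrite normrM; apply: ler_pM => //; first exact: psi_le.
  by rewrite ger0_norm// addr_ge0 ?heat_ge0.
by rewrite (RIZ _ LH) mulrA mulVf// mul1r.
Qed.

(** Half of [heat2] has mass 1, so the bound on the symbol persists. *)
Lemma cutoff_transform_le kap del t eta : 0 < kap -> 0 < del ->
  `|cutoff_transform kap del t eta| <= 2 * kk (b + r) t.
Proof.
move=> k0 e0; rewrite cutoff_transformE//.
have L := L1Z (kk (b + r) t) (L1_heat2 eta k0).
have <- : \int[leb]_xi (kk (b + r) t * heat2 kap eta xi) = 2 * kk (b + r) t.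
  by rewrite (RIZ _ (L1_heat2 eta k0)) RI_heat2// mulrC.
apply: norm_RI_le L.
  apply: measurable_funM => //; apply: measurable_funM => //.
  exact: L1_measurable (L1_heat2 eta k0).
move=> xi; have h0 : 0 <= heat2 kap eta xi by rewrite addr_ge0 ?heat_ge0.
rewrite normrM (ger0_norm (_ : 0 <= 2^-1 :> R))//.
rewrite normrM (ger0_norm h0) mulrA; apply: (ler_wpM2r h0).
by have := psi_le t xi e0; lra.
Qed.

Lemma cutoff_transform_cvg (k_ : nat -> R) del t eta : (forall n, 0 < k_ n) ->
  k_ @ \oo --> 0 -> 0 < del ->
  cutoff_transform (k_ n) del t eta @[n --> \oo] --> ms t eta * ghat del eta.
Proof.
move=> k0 kc e0; have cp : econt (psi del t).
  by apply: econtM; [exact: (econt_msym nu ha hb hr t)|exact: econt_ghat].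
have h z := @heat_approx R d k_ (psi del t) (2 * kk (b + r) t) z k0 kc
  (measurable_psi del t) (fun y => psi_le t y e0) (cp z).
have cv : 2^-1 * (\int[leb]_y (psi del t y * heat (k_ n) (eta - y)) +
    \int[leb]_y (psi del t y * heat (k_ n) (- eta - y))) @[n --> \oo] -->
    2^-1 * (psi del t eta + psi del t (- eta)).
  by apply: cvgM; [exact: cvg_cst|apply: cvgD; exact: h].
have half2 (u : R) : 2^-1 * (u + u) = u by rewrite mulrDr ![2^-1 * u]mulrC -splitr.
rewrite psiN half2 in cv.
apply: cvg_trans cv; apply: near_eq_cvg; apply: nearW => n /=.
have L z : L1 leb (fun xi => psi del t xi * heat (k_ n) (z - xi)).
  apply: L1_le (L1Z (2 * kk (b + r) t) (L1_heatB z (k0 n))).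
    by apply: measurable_funM => //; exact: L1_measurable (L1_heatB z (k0 n)).
  move=> xi; rewrite normrM; apply: ler_pM => //; first exact: psi_le.
  by rewrite ger0_norm// heat_ge0.
rewrite cutoff_transformE// /= -(RID (L eta) (L (- eta))) -(RIZ _ (L1D (L eta) (L (- eta)))).
by clear; apply: eq_RI => xi; rewrite /heat2 -mulrDr.
Qed.

Lemma measurable_cutoff_transform kap del d' (T : measurableType d') (s : T -> R) (f : T -> V) :
  measurable_fun setT s -> measurable_fun setT f ->
  measurable_fun setT (fun w => cutoff_transform kap del (s w) (f w)).
Proof.
move=> m1 m2.
have m : measurable_fun setT (fun z : T * V => gmd del (s z.1) z.2 * (cos (dot z.2 (f z.1)) * ghat kap z.2)).
  apply: measurable_funM; first by apply: measurable_gm => //; exact: measurableT_comp.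
  apply: measurable_funM; last by apply: measurableT_comp => //; exact: measurable_ghat.
  by apply: measurable_cos_dot => //; exact: measurableT_comp.
exact: (@measurable_RI _ _ _ _ R leb _ m).
Qed.

End cutoff_transform.

Lemma cov_kernelE {R : realType} {d : nat} (mu : {measure set 'rV[R]_d -> \bar R}) e z :
  cov_kernel mu e z = \int[mu]_xi (cos (dot z xi) * ghat e xi).
Proof. reflexivity. Qed.

Lemma cov_kernel0 {R : realType} {d : nat} (mu : {measure set 'rV[R]_d -> \bar R}) e :
  cov_kernel mu e 0 = \int[mu]_xi ghat e xi.
Proof. by rewrite cov_kernelE; apply: eq_RI => xi; rewrite dot0l cos0 mul1r. Qed.

#[local] Opaque gm cov_kernel cutoff_transform.

(** * The second moment with cut-offs in space *)

Section second_moment.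
Context {R : realType} {d : nat}.
Variables (gamma : 'rV[R]_d -> R) (mu : {measure set 'rV[R]_d -> \bar R}).
Hypothesis hn : noise_covariance gamma mu.
Variables a b r nu : R.
Hypotheses (ha : 0 < a <= 2) (hb : 0 < b <= 2) (hr : 0 <= r) (hnu : 0 < nu).
Implicit Types (x y xi eta : 'rV[R]_d) (t : R) (s : R * R).

Let b0 : 0 < b. Proof. by case/andP : hb. Qed.
Let br0 : 0 < b + r. Proof. by rewrite ltr_pwDl. Qed.
Let V := 'rV[R]_d.
Let smu := smeas (mu_sigma_finite hn).

Variables (T del e : R).
Hypotheses (e0 : 0 < e) (del0 : 0 < del).

Let g := @gm R d a b r nu del.
Let cov := cov_kernel mu e : V -> R.
Let k := kk (b + r) : R -> R.
Let c0 := cov 0.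
Let cg : R := @gm_cst R d del.

Let k_ge0 t : 0 <= k t. Proof. exact: kk_ge0. Qed.

Let c0_ge0 : 0 <= c0.
Proof. exact: le_trans (normr_ge0 _) (cov_kernel_le hn 0 e0). Qed.

Let g_le t x : `|g t x| <= cg * k t. Proof. exact: (gm_le a hb hr hnu t x del0). Qed.

Let mcov : measurable_fun setT cov. Proof. exact: (measurable_cov_kernel hn e). Qed.

(** Up to constants, the majorant of all the time integrands. *)
Let simplex_kernel (s : R * R) : R := kk 1 (T - s.2) * (k s.1 * k (s.2 - s.1)).

Let simplex_kernel_ge0 (s : R * R) : 0 <= simplex_kernel s.
Proof.
by apply: mulr_ge0; [exact: kk_ge0|apply: mulr_ge0].
Qed.

Let measurable_time (f h : R -> R) : measurable_fun setT f -> measurable_fun setT h ->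
  measurable_fun setT (fun s : R * R => kk 1 (T - s.2) * (f s.1 * h (s.2 - s.1))).
Proof.
move=> mf mh; apply: measurable_funM.
  by apply: measurableT_comp; [exact: measurable_kk|exact: measurable_funB].
apply: measurable_funM; first exact: measurableT_comp.
by apply: measurableT_comp => //; exact: measurable_funB.
Qed.

Let L1_simplex_kernel : L1 (lam \x lam)%E simplex_kernel.
Proof.
have mk : measurable_fun setT simplex_kernel.
  by apply: measurable_time; exact: measurable_kk.
have E (s1 s2 : R) : simplex_kernel (s1, s2) = k s1 * (kk 1 (T - s2) * k (s2 - s1)).
  by rewrite /simplex_kernel /= mulrCA.
have h (s1 : R) := kk_conv_shift T s1 (@ltr01 R) br0.
apply: (@L1_prod_iter _ _ _ _ R lam lam simplex_kernel (fun s1 : R => kk (1 + (b + r)) (T - s1) * k s1) mk).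
- move=> s1; rewrite (_ : (fun s2 : R => simplex_kernel (s1, s2)) = fun s2 : R => k s1 * (kk 1 (T - s2) * k (s2 - s1))).
    by apply: L1Z; exact: (h s1).1.
  by apply/funext => s2; exact: E.
- move=> s1; rewrite -(h s1).2 mulrC -(RIZ _ (h s1).1) le_eqVlt; apply/orP; left; apply/eqP.
  apply: eq_RI => s2; rewrite ger0_norm ?simplex_kernel_ge0// E; reflexivity.
by apply: L1_kk_conv => //; rewrite addr_gt0.
Qed.

(* The kernel [g_2] at time [T] and position [0], for [G] mollified; the factor
   [kk 1 (T - s_2)] is the indicator of [s_2 < T], those of [0 < s_1] and [s_1 < s_2]
   are built into [gm]. *)
Definition kernel2 (p : V * V) : R :=
  \int[(lam \x lam)%E]_s (kk 1 (T - s.2) * (g s.1 p.1 * g (s.2 - s.1) (p.2 - p.1))).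

Let mF : measurable_fun setT (fun z : (V * V) * (R * R) =>
  kk 1 (T - z.2.2) * (g z.2.1 z.1.1 * g (z.2.2 - z.2.1) (z.1.2 - z.1.1))).
Proof.
have m11 : measurable_fun setT (fun z : (V * V) * (R * R) => z.1.1) by exact: measurableT_comp.
have m12 : measurable_fun setT (fun z : (V * V) * (R * R) => z.1.2) by exact: measurableT_comp.
have m21 : measurable_fun setT (fun z : (V * V) * (R * R) => z.2.1) by exact: measurableT_comp.
have m22 : measurable_fun setT (fun z : (V * V) * (R * R) => z.2.2) by exact: measurableT_comp.
apply: measurable_funM.
  by apply: measurableT_comp; [exact: measurable_kk|exact: measurable_funB].
apply: measurable_funM; apply: measurable_gm => //; first exact: measurable_funB.
exact: measurable_rowB.
Qed.

Lemma measurable_kernel2 : measurable_fun setT kernel2.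
Proof. exact: (@measurable_RI _ _ _ _ R (prod_measure lam lam) _ mF). Qed.

Let F_le (x1 x2 : V) (s : R * R) :
  `|kk 1 (T - s.2) * (g s.1 x1 * g (s.2 - s.1) x2)| <= cg ^+ 2 * simplex_kernel s.
Proof.
rewrite normrM (ger0_norm (kk_ge0 _ (@ltr01 R))) /simplex_kernel [leRHS]mulrCA.
apply: (ler_wpM2l (kk_ge0 _ (@ltr01 R))); rewrite normrM.
rewrite [leRHS](_ : _ = (cg * k s.1) * (cg * k (s.2 - s.1))); last by clear; ring.
by apply: ler_pM => //; exact: g_le.
Qed.

Let L1_F (x1 x2 : V) : L1 (lam \x lam)%E (fun s : R * R => kk 1 (T - s.2) * (g s.1 x1 * g (s.2 - s.1) x2)).
Proof.
apply: L1_le (L1Z (cg ^+ 2) L1_simplex_kernel); last by move=> s; exact: F_le.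
apply: (measurable_time (f := fun t => g t x1) (h := fun t => g t x2)).
  by apply: measurable_gm => //; exact: measurable_cst.
by apply: measurable_gm => //; exact: measurable_cst.
Qed.

Section cutoff.
Variables (kap : R) (kap0 : 0 < kap).

Let gh := @ghat R d kap.
Let A t := cutoff_transform a b r nu kap del t (0 : V).
(** The integral over the second increment, the only one that meets the covariance. *)
Definition cutoff_cov t : R := \int[leb]_y (g t y * (cov y * gh y)).
Let D := cutoff_cov.

Let mgh : measurable_fun setT gh. Proof. exact: measurable_ghat. Qed.

Let L1_D t : L1 leb (fun y => g t y * (cov y * gh y)).
Proof.
apply: L1_le (L1Z (cg * k t) (L1Z c0 (L1_ghat kap0))).
  apply: measurable_funM; first by apply: measurable_gm => //; exact: measurable_cst.
  exact: measurable_funM.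
move=> y; rewrite normrM; apply: ler_pM => //.
rewrite normrM; apply: ler_pM => //; first exact: (cov_kernel_le hn y e0).
by rewrite ger0_norm// ghat_ge0.
Qed.

Lemma cutoff_cov_spectral t :
  D t = \int[mu]_eta (cutoff_transform a b r nu kap del t eta * ghat e eta).
Proof.
pose F (w : V * V) := g t w.1 * ((cos (dot w.1 w.2) * ghat e w.2) * gh w.1).
have mF' : measurable_fun setT F.
  apply: measurable_funM; first by apply: measurable_gm => //; exact: measurable_cst.
  apply: measurable_funM; last exact: measurableT_comp.
  apply: measurable_funM; first exact: measurable_cos_dot measurable_fst measurable_snd.
  by apply: measurableT_comp => //; exact: measurable_ghat.
have le y eta : `|F (y, eta)| <= cg * k t * gh y * ghat e eta.
  rewrite /F /= [leRHS](_ : _ = (cg * k t) * (gh y * ghat e eta)); last by rewrite mulrA.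
  rewrite normrM; apply: ler_pM => //.
  have gh0 : 0 <= gh y := ghat_ge0 kap y.
  rewrite normrM [leLHS]mulrC (ger0_norm gh0); apply: (ler_wpM2l gh0).
  exact: norm_cosM_le (ghat_ge0 e eta).
have LF : L1 (leb \x smu)%E F.
  exact: (@L1_prod_le _ _ _ _ R leb smu F _ _ mF' le (L1Z _ (L1_ghat kap0)) (L1_mu_ghat hn e0)).
transitivity (\int[leb]_y \int[smu]_eta F (y, eta)).
  apply: eq_RI => y; rewrite /F /= /cov cov_kernelE.
  have L : L1 smu (fun eta => cos (dot y eta) * ghat e eta) := L1_cos_ghat hn y e0.
  transitivity (g t y * \int[smu]_eta (cos (dot y eta) * ghat e eta * gh y)).
    rewrite (RIZr _ L); reflexivity.
  by symmetry; apply: (RIZ _ (L1Zr (gh y) L)).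
rewrite (RI_fubini LF); apply: eq_RI => eta.
have L : L1 leb (fun y => g t y * (cos (dot y eta) * gh y)).
  apply: L1_le (L1Z (cg * k t) (L1_ghat kap0)).
    apply: measurable_funM; first by apply: measurable_gm => //; exact: measurable_cst.
    apply: measurable_funM => //.
    exact: measurable_cos_dot (@measurable_id _ _ setT) (measurable_cst eta).
  move=> y; rewrite normrM; apply: ler_pM => //.
  exact: norm_cosM_le (ghat_ge0 kap y).
rewrite cutoff_transform_def -(RIZr _ L); apply: eq_RI => y; rewrite /F /= /gh; clear; ring.
Qed.

(** The cut-offs act on the increments [x_1] and [x_2 - x_1], so that the integral in space still
    factors. *)
Let cut (p : V * V) := gh p.1 * (cov (p.1 - p.2) * gh (p.2 - p.1)).

Let mcut : measurable_fun setT cut.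
Proof.
apply: measurable_funM; first exact: measurableT_comp.
by apply: measurable_funM; apply: measurableT_comp => //; exact: measurable_rowB.
Qed.

Let cut_le p : `|cut p| <= c0 * (gh p.1 * gh (p.2 - p.1)).
Proof.
rewrite /cut normrM mulrCA (ger0_norm (ghat_ge0 kap p.1)).
apply: (ler_wpM2l (ghat_ge0 kap p.1)); rewrite normrM; apply: ler_pM => //.
  exact: (cov_kernel_le hn _ e0).
by rewrite ger0_norm// ghat_ge0.
Qed.

Let L1_leb_shift x (f : V -> R) : L1 leb f -> L1 leb (fun y => f (y - x)).
Proof.
move=> L; have := (mpres_L1 (leb_translation (- x)) (L1_measurable L)).1 L.
by congr L1; apply/funext => y; rewrite /= addrC.
Qed.

Let RI_leb_shift x (f : V -> R) : measurable_fun setT f ->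
  \int[leb]_y f (y - x) = \int[leb]_y f y.
Proof.
move=> m; rewrite -[RHS](RI_leb_addl (- x) m); apply: eq_RI => y; rewrite addrC; reflexivity.
Qed.

Let L1_gh2 : L1 (leb \x leb)%E (fun p : V * V => gh p.1 * gh (p.2 - p.1)).
Proof.
have m : measurable_fun setT (fun p : V * V => gh p.1 * gh (p.2 - p.1)).
  apply: measurable_funM; first exact: measurableT_comp.
  by apply: measurableT_comp => //; exact: measurable_rowB.
apply: (@L1_prod_iter _ _ _ _ R leb leb _ (fun x1 => gh x1 * \int[leb]_y gh y) m).
- by move=> x1 /=; apply: L1Z; apply: L1_leb_shift; exact: L1_ghat.
- move=> x1 /=; rewrite -(RI_leb_shift x1 mgh) -(RIZ _ (L1_leb_shift x1 (L1_ghat kap0))).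
  rewrite le_eqVlt; apply/orP; left; apply/eqP; apply: eq_RI => x2.
  by rewrite ger0_norm// mulr_ge0 ?ghat_ge0.
by apply: L1Zr; exact: L1_ghat.
Qed.

Let H (z : (V * V) * (R * R)) :=
  kk 1 (T - z.2.2) * (g z.2.1 z.1.1 * g (z.2.2 - z.2.1) (z.1.2 - z.1.1)) * cut z.1.

Let mH : measurable_fun setT H.
Proof. by apply: measurable_funM; [exact: mF|exact: measurableT_comp]. Qed.

Let H_le (p : V * V) (s : R * R) : `|H (p, s)| <= c0 * (gh p.1 * gh (p.2 - p.1)) * (cg ^+ 2 * simplex_kernel s).
Proof.
rewrite /H /= normrM [leLHS]mulrC; exact: ler_pM.
Qed.

(** For fixed times, taking [x_2 - x_1] as a variable separates the integrals: the first increment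
    meets its cut-off only, the second one the covariance as well. *)
Lemma cutoff_second_moment :
  \int[(leb \x leb)%E]_p (kernel2 p * cut p) =
  \int[(lam \x lam)%E]_s (kk 1 (T - s.2) * (A s.1 * D (s.2 - s.1))).
Proof.
have LH : L1 (prod_measure leb leb \x prod_measure lam lam)%E H.
  apply: (@L1_prod_le _ _ _ _ R (prod_measure leb leb) (prod_measure lam lam) H _ _ mH H_le).
    by apply: L1Z; exact: L1_gh2.
  by apply: L1Z; exact: L1_simplex_kernel.
transitivity (\int[prod_measure leb leb]_p \int[prod_measure lam lam]_s H (p, s)).
  by apply: eq_RI => p; symmetry; apply: (RIZr (cut p) (L1_F p.1 (p.2 - p.1))).
rewrite (RI_fubini LH); apply: eq_RI => s.
have Ls : L1 (leb \x leb)%E (fun p => H (p, s)).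
  apply: L1_le (L1Zr (cg ^+ 2 * simplex_kernel s) (L1Z c0 L1_gh2)); last by move=> p; exact: H_le.
  exact: (measurableT_comp mH (pair2_measurable s)).
transitivity (\int[(leb \x leb)%E]_p H (p, s)); first reflexivity.
rewrite (RI_prod12 Ls).
have inner x1 : \int[leb]_x2 H ((x1, x2), s) =
    kk 1 (T - s.2) * D (s.2 - s.1) * (g s.1 x1 * (cos (dot x1 0) * gh x1)).
  pose c := kk 1 (T - s.2) * (g s.1 x1 * gh x1).
  transitivity (\int[leb]_x2 (c * (g (s.2 - s.1) (x2 - x1) * (cov (x2 - x1) * gh (x2 - x1))))).
    apply: eq_RI => x2; rewrite /H /cut /= /cov -[x1 - x2]opprB cov_kernelN /c; clear; ring.
  have L := L1_D (s.2 - s.1).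
  rewrite (RIZ _ (L1_leb_shift x1 L)) (RI_leb_shift x1 (L1_measurable L)) dot0r cos0 /c /D /cutoff_cov.
  clear; ring.
rewrite (eq_RI _ inner).
have LA : L1 leb (fun y => g s.1 y * (cos (dot y 0) * gh y)).
  apply: L1_le (L1Z (cg * k s.1) (L1_ghat kap0)).
    apply: measurable_funM; first by apply: measurable_gm => //; exact: measurable_cst.
    apply: measurable_funM => //.
    by apply: measurable_cos_dot => //; exact: measurable_cst.
  move=> y; rewrite normrM; apply: ler_pM => //.
  exact: norm_cosM_le (ghat_ge0 kap y).
rewrite (RIZ _ LA) /A cutoff_transform_def -/g -/gh; clear; ring.
Qed.

Lemma cutoff_cov_le t : `|D t| <= 2 * k t * c0.
Proof.
rewrite cutoff_cov_spectral.
have L := L1_mu_ghat hn e0.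
have <- : \int[mu]_eta (2 * k t * ghat e eta) = 2 * k t * c0.
  by rewrite (RIZ _ L) /c0 /cov cov_kernel0.
apply: norm_RI_le (L1Z _ L).
  apply: measurable_funM; last exact: measurable_ghat.
  by apply: (measurable_cutoff_transform a nu hb hr) => //; exact: measurable_cst.
move=> eta; rewrite normrM; apply: ler_pM => //; last by rewrite ger0_norm ?ghat_ge0.
exact: cutoff_transform_le.
Qed.

End cutoff.

Let kap_ (n : nat) : R := n.+1%:R^-1.

Let kap_gt0 n : 0 < kap_ n. Proof. by rewrite invr_gt0 ltr0n. Qed.

Let kap_cvg0 : kap_ @ \oo --> 0. Proof. exact: cvg_harmonic. Qed.

Let limit_cov t : R := \int[mu]_eta (msym a b r nu t eta * ghat del eta * ghat e eta).

Lemma cutoff_cov_cvg t : cutoff_cov (kap_ n) t @[n --> \oo] --> limit_cov t.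
Proof.
under eq_fun do rewrite cutoff_cov_spectral//.
have h n eta : `|cutoff_transform a b r nu (kap_ n) del t eta * ghat e eta| <= 2 * k t * ghat e eta.
  rewrite normrM (ger0_norm (ghat_ge0 e eta)); apply: (ler_wpM2r (ghat_ge0 e eta)).
  exact: cutoff_transform_le.
apply: (RI_dct (m := mu) _ _ h (L1Z _ (L1_mu_ghat hn e0))).2.
  move=> n; apply: measurable_funM; last exact: measurable_ghat.
  by apply: (measurable_cutoff_transform a nu hb hr) => //; exact: measurable_cst.
move=> eta; apply: cvgM; last exact: cvg_cst.
exact: (cutoff_transform_cvg ha hb hr hnu).
Qed.

Lemma ghat_cvg (e_ : nat -> R) (l : R) x : e_ @ \oo --> l ->
  ghat (e_ n) x @[n --> \oo] --> ghat l x.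
Proof.
Transparent ghat.
move=> h; rewrite /ghat.
have h2 : - (e_ n * dot x x / 2) @[n --> \oo] --> - (l * dot x x / 2).
  by apply: cvgN; apply: cvgM; [apply: cvgM => //|]; exact: cvg_cst.
by apply: continuous_cvg h2; exact: continuous_expR.
Opaque ghat.
Qed.

Lemma ghat0e x : ghat 0 x = 1.
Proof.
Transparent ghat.
by rewrite /ghat mul0r mul0r oppr0 expR0.
Opaque ghat.
Qed.

Hypothesis L1_kernel2 : L1 (leb \x leb)%E kernel2.

(** The integrability of the kernel itself is what allows the cut-offs to be removed. *)
Lemma kernel2_cutoff_cvg : \int[(leb \x leb)%E]_p (kernel2 p *
    (ghat (kap_ n) p.1 * (cov (p.1 - p.2) * ghat (kap_ n) (p.2 - p.1)))) @[n --> \oo] -->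
  \int[(leb \x leb)%E]_p (kernel2 p * cov (p.1 - p.2)).
Proof.
have h n (p : V * V) : `|kernel2 p * (ghat (kap_ n) p.1 * (cov (p.1 - p.2) * ghat (kap_ n) (p.2 - p.1)))| <=
    `|kernel2 p| * c0.
  rewrite normrM; apply: ler_wpM2l => //; rewrite -[leRHS]mul1r normrM.
  apply: ler_pM => //; first by rewrite ger0_norm ?ghat_ge0// ghat_le1// ltW.
  rewrite -[leRHS]mulr1 normrM; apply: ler_pM => //; first exact: (cov_kernel_le hn _ e0).
  by rewrite ger0_norm ?ghat_ge0// ghat_le1// ltW.
apply: (RI_dct _ _ h (L1Zr c0 (L1_norm L1_kernel2))).2.
  move=> n; apply: measurable_funM; first exact: measurable_kernel2.
  apply: measurable_funM; first by apply: measurableT_comp => //; exact: measurable_ghat.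
  apply: measurable_funM; apply: measurableT_comp => //; try exact: measurable_rowB.
  exact: measurable_ghat.
move=> p; apply: cvgM; first exact: cvg_cst.
have g1 x : ghat (kap_ n) x @[n --> \oo] --> (1 : R) by rewrite -(ghat0e x); exact: ghat_cvg.
rewrite -[X in _ --> X]mul1r; apply: cvgM; first exact: g1.
by rewrite -[X in _ --> X]mulr1; apply: cvgM; [exact: cvg_cst|exact: g1].
Qed.

Lemma time_cutoff_cvg : \int[(lam \x lam)%E]_s (kk 1 (T - s.2) *
    (cutoff_transform a b r nu (kap_ n) del s.1 (0 : V) * cutoff_cov (kap_ n) (s.2 - s.1))) @[n --> \oo] -->
  \int[(lam \x lam)%E]_s (kk 1 (T - s.2) * (k s.1 * limit_cov (s.2 - s.1))).
Proof.
have h n s : `|kk 1 (T - s.2) * (cutoff_transform a b r nu (kap_ n) del s.1 (0 : V) * cutoff_cov (kap_ n) (s.2 - s.1))| <=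
    4 * c0 * simplex_kernel s.
  rewrite normrM (ger0_norm (kk_ge0 _ (@ltr01 R))) /simplex_kernel [leRHS]mulrCA.
  apply: (ler_wpM2l (kk_ge0 _ (@ltr01 R))); rewrite normrM.
  rewrite [leRHS](_ : _ = (2 * k s.1) * (2 * k (s.2 - s.1) * c0)); last by clear; ring.
  by apply: ler_pM => //; [exact: cutoff_transform_le|exact: cutoff_cov_le].
apply: (RI_dct _ _ h (L1Z (4 * c0) L1_simplex_kernel)).2.
  move=> n; apply: (measurable_time (f := fun t => cutoff_transform a b r nu (kap_ n) del t (0 : V))
      (h := cutoff_cov (kap_ n))).
    by apply: (measurable_cutoff_transform a nu hb hr) => //; exact: measurable_cst.
  have m : measurable_fun setT (fun z : R * V => g z.1 z.2 * (cov z.2 * ghat (kap_ n) z.2)).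
    apply: measurable_funM; first exact: measurable_gm.
    by apply: measurable_funM; apply: measurableT_comp => //; exact: measurable_ghat.
  exact: (@measurable_RI _ _ _ _ R leb _ m).
move=> s; apply: cvgM; first exact: cvg_cst.
apply: cvgM; last exact: cutoff_cov_cvg.
have := @cutoff_transform_cvg R d a b r nu ha hb hr hnu kap_ del s.1 0 kap_gt0 kap_cvg0 del0.
by rewrite ghat0 mulr1 (msym0 nu ha hb hr).
Qed.

(** Two convolutions: over [s_1] with [kk (b + r)], then over [s_2] with the Heaviside function. *)
Lemma simplex_EE (z : R) : 0 <= z ->
  \int[(lam \x lam)%E]_s (kk 1 (T - s.2) * (k s.1 * EE b z (b + r) (s.2 - s.1))) =
  EE b z (2 * (b + r) + 1) T.
Proof.
move=> z0; have mE : measurable_fun setT (EE b z (b + r)) by exact: measurable_EE.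
have L : L1 (lam \x lam)%E (fun s : R * R => kk 1 (T - s.2) * (k s.1 * EE b z (b + r) (s.2 - s.1))).
  apply: L1_le (L1Z 2 L1_simplex_kernel); first by apply: measurable_time => //; exact: measurable_kk.
  move=> s; rewrite normrM (ger0_norm (kk_ge0 _ (@ltr01 R))) /simplex_kernel [leRHS]mulrCA.
  apply: (ler_wpM2l (kk_ge0 _ (@ltr01 R))); rewrite normrM (ger0_norm (k_ge0 _)) [leRHS]mulrCA.
  by apply: ler_wpM2l => //; apply: EE_bound => //; rewrite lerDl.
rewrite (RI_prod21 L).
have inner (s2 : R) : \int[lam]_s1 (kk 1 (T - s2) * (k s1 * EE b z (b + r) (s2 - s1))) =
    kk 1 (T - s2) * EE b z (b + r + (b + r)) s2.
  have [L' I'] := EE_conv b0 z s2 br0 br0.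
  have mk : measurable_fun setT (fun u : R => kk (b + r) (s2 - u) * EE b z (b + r) u).
    by apply: measurable_funM => //; exact: measurable_kkB.
  have Eu : (fun u : R => k u * EE b z (b + r) (s2 - u)) =
      (fun u : R => kk (b + r) (s2 - u) * EE b z (b + r) u) \o (fun u => s2 - u).
    by apply/funext => u /=; rewrite subKr.
  have L2 : L1 lam (fun u : R => k u * EE b z (b + r) (s2 - u)).
    by rewrite Eu; apply: (mpres_L1 (lam_reflection s2) mk).1.
  have I2 : \int[lam]_u (k u * EE b z (b + r) (s2 - u)) = EE b z (b + r + (b + r)) s2.
    rewrite -I' [RHS](mpres_RI (lam_reflection s2) mk) Eu; reflexivity.
  rewrite -I2; exact: (RIZ _ L2).
transitivity (\int[lam]_s2 (kk 1 (T - s2) * EE b z (b + r + (b + r)) s2)).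
  by apply: eq_RI => s2; exact: inner.
rewrite (_ : 2 * (b + r) = b + r + (b + r)); last by rewrite mulr_natl mulr2n.
have [_ I1] := EE_conv b0 z T (@ltr01 R) (addr_gt0 br0 br0); exact: I1.
Qed.

(** Both sides of [cutoff_second_moment] converge as the cut-offs disappear; in the limit Fubini's
    theorem brings the times inside, where [simplex_EE] applies. *)
Lemma second_moment_spectral :
  \int[(leb \x leb)%E]_p (kernel2 p * cov (p.1 - p.2)) =
  \int[mu]_eta (ghat del eta * ghat e eta * EE b (freq a nu eta) (2 * (b + r) + 1) T).
Proof.
have c1 := kernel2_cutoff_cvg; have c2 := time_cutoff_cvg.
rewrite (_ : (fun n => _) = fun n => \int[(lam \x lam)%E]_s (kk 1 (T - s.2) *
    (cutoff_transform a b r nu (kap_ n) del s.1 (0 : V) * cutoff_cov (kap_ n) (s.2 - s.1)))) in c1; last first.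
  by apply/funext => n; exact: cutoff_second_moment.
have -> : \int[(leb \x leb)%E]_p (kernel2 p * cov (p.1 - p.2)) =
    \int[(lam \x lam)%E]_s (kk 1 (T - s.2) * (k s.1 * limit_cov (s.2 - s.1))).
  by have := cvg_unique _ c1 c2; apply; exact: Rhausdorff.
clear c1 c2.
pose F (z : (R * R) * V) := kk 1 (T - z.1.2) * (k z.1.1 * (msym a b r nu (z.1.2 - z.1.1) z.2 *
  ghat del z.2 * ghat e z.2)).
have m11 : measurable_fun setT (fun z : (R * R) * V => z.1.1) by exact: measurableT_comp.
have m12 : measurable_fun setT (fun z : (R * R) * V => z.1.2) by exact: measurableT_comp.
have mF' : measurable_fun setT F.
  apply: measurable_funM.
    by apply: measurableT_comp; [exact: measurable_kk|exact: measurable_funB].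
  apply: measurable_funM; first by apply: measurableT_comp => //; exact: measurable_kk.
  apply: measurable_funM; last by apply: measurableT_comp => //; exact: measurable_ghat.
  apply: measurable_funM; last by apply: measurableT_comp => //; exact: measurable_ghat.
  by apply: measurable_msym => //; exact: measurable_funB.
have le s eta : `|F (s, eta)| <= 2 * simplex_kernel s * ghat e eta.
  rewrite /F /= normrM (ger0_norm (kk_ge0 _ (@ltr01 R))) normrM (ger0_norm (k_ge0 _)).
  rewrite [leRHS](_ : _ = kk 1 (T - s.2) * (k s.1 * (2 * k (s.2 - s.1) * ghat e eta))); last first.
    by rewrite /simplex_kernel; clear; ring.
  apply: (ler_wpM2l (kk_ge0 _ (@ltr01 R))); apply: (ler_wpM2l (k_ge0 _)).
  rewrite normrM (ger0_norm (ghat_ge0 e eta)); apply: (ler_wpM2r (ghat_ge0 e eta)).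
  rewrite normrM (ger0_norm (ghat_ge0 del eta)) -[leRHS]mulr1.
  by apply: ler_pM => //; [exact: ghat_ge0|exact: msym_le|apply: ghat_le1; exact: ltW].
have LF : L1 (prod_measure lam lam \x smu)%E F.
  exact: (@L1_prod_le _ _ _ _ R (prod_measure lam lam) smu F _ _ mF' le
    (L1Z 2 L1_simplex_kernel) (L1_mu_ghat hn e0)).
transitivity (\int[prod_measure lam lam]_s \int[smu]_eta F (s, eta)).
  apply: eq_RI => s; rewrite /F /limit_cov.
  have L : L1 smu (fun eta => msym a b r nu (s.2 - s.1) eta * ghat del eta * ghat e eta).
    apply: L1_le (L1Z (2 * k (s.2 - s.1)) (L1_mu_ghat hn e0)).
      apply: measurable_funM; last exact: measurable_ghat.
      apply: measurable_funM; last exact: measurable_ghat.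
      by apply: measurable_msym => //; exact: measurable_cst.
    move=> eta; rewrite normrM (ger0_norm (ghat_ge0 e eta)); apply: (ler_wpM2r (ghat_ge0 e eta)).
    rewrite normrM (ger0_norm (ghat_ge0 del eta)) -[leRHS]mulr1.
    by apply: ler_pM => //; [exact: ghat_ge0|exact: msym_le|apply: ghat_le1; exact: ltW].
  transitivity (kk 1 (T - s.2) * \int[smu]_eta (k s.1 *
      (msym a b r nu (s.2 - s.1) eta * ghat del eta * ghat e eta))).
    by congr (_ * _); symmetry; exact: (RIZ (k s.1) L).
  by symmetry; exact: (RIZ (kk 1 (T - s.2)) (L1Z (k s.1) L)).
rewrite (RI_fubini LF); apply: eq_RI => eta.
have fe := freq_ge0 a hnu eta.
have Ls : L1 (lam \x lam)%E (fun s : R * R => kk 1 (T - s.2) * (k s.1 * EE b (freq a nu eta) (b + r) (s.2 - s.1))).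
  apply: L1_le (L1Z 2 L1_simplex_kernel).
    by apply: measurable_time; [exact: measurable_kk|exact: measurable_EE].
  move=> s; rewrite normrM (ger0_norm (kk_ge0 _ (@ltr01 R))) /simplex_kernel [leRHS]mulrCA.
  apply: (ler_wpM2l (kk_ge0 _ (@ltr01 R))); rewrite normrM (ger0_norm (k_ge0 _)) [leRHS]mulrCA.
  by apply: ler_wpM2l => //; apply: EE_bound => //; rewrite lerDl.
rewrite -(simplex_EE fe) -(RIZ _ Ls); apply: eq_RI => s; rewrite /F /msym /=; clear; ring.
Qed.

End second_moment.

(** * Mean of the second chaos *)

Section kernel_of_tuples.
Context {R : realType} {d : nat}.
Variables a b r nu : R.
Hypotheses (hb : 0 < b <= 2) (hr : 0 <= r).
Variables (G : R -> ('rV[R]_d -> R) -> R) (T del : R).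
Hypotheses (hG : fundamental_solution a b r nu G) (del0 : 0 < del).

Let V := 'rV[R]_d.
Let g := @gm R d a b r nu del.

Lemma kernel_mol2 (xs : 2.-tuple V) : @kernel_mol R d G 2 T 0 del xs =
  kernel2 a b r nu T del (tnth xs ord0, tnth xs ord_max).
Proof.
set x1 := tnth xs ord0; set x2 := tnth xs ord_max.
pose K (s : R * R) := kk 1 (T - s.2) * (g s.1 x1 * g (s.2 - s.1) (x2 - x1)).
have mK : measurable_fun setT K.
  apply: measurable_funM.
    by apply: measurableT_comp; [exact: measurable_kk|exact: measurable_funB].
  by apply: measurable_funM; apply: measurable_gm => //; exact: measurable_funB.
pose st (s : 2.-tuple (measurableTypeR R)) : R * R := (tnth s ord0, tnth s ord_max).
have E : @kernel_mol R d G 2 T 0 del xs = \int[tuple_measure lebesgue_measure 2]_s K (st s).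
  rewrite /kernel_mol /Rintegral integral_mkcond; congr fine; apply: eq_integral => s _.
  rewrite patchE.
  have st1 : nth 0 s 0 = (st s).1 :> R by rewrite /st/= (tnth_nth 0).
  have st2 : nth 0 s 1 = (st s).2 :> R by rewrite /st/= (tnth_nth 0).
  have xs1 : nth 0 xs 0 = x1 by rewrite /x1 (tnth_nth 0).
  have xs2 : nth 0 xs 1 = x2 by rewrite /x2 (tnth_nth 0).
  have sE : (s : seq R) = [:: (st s).1; (st s).2].
    by rewrite -st1 -st2; case: s {st1 st2} => -[|s1 [|s2 []]].
  have mem : (s \in simplex T) = (0 < (st s).1) && ((st s).1 < (st s).2) && ((st s).2 < T).
    apply/idP/idP => [/set_mem|h]; [|apply/mem_set]; rewrite /simplex /= sE /= andbT ?andbA//.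
  rewrite mem; case: ifP => [/andP[/andP[s1 s12] s2T]|h]; congr (_%:E).
    rewrite !big_ord_recl big_ord0 mulr1 /bump /=.
    rewrite (_ : nth 0 _ 0 = (st s).1)// ?st1// st2 xs1 xs2 !subr0 /K kk1E subr_gt0 s2T mul1r.
    by rewrite !(Gmol_gm _ hG del0)// subr_gt0.
  (* Off the simplex one of the three factors of [K] vanishes. *)
  rewrite /K; have [s1|s1] := leP (st s).1 0; first by rewrite /g gm_le0// mul0r mulr0.
  have [s12|s12] := leP (st s).2 (st s).1.
    by rewrite [g (_ - _) _]gm_le0 ?mulr0// subr_le0.
  have [s2T|s2T] := leP T (st s).2; first by rewrite kk_le0 ?mul0r// subr_le0.
  by rewrite s1 s12 s2T in h.
(* The identity on coordinates, from pairs measured by [lam] to tuples measured by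
   [lebesgue_measure]. *)
pose phi (p : R * R) : 2.-tuple (measurableTypeR R) :=
  [tuple (idfun : R -> R) (tnth [tuple p.1; p.2] i) | i < 2].
have hphi : mpres (lam \x lam)%E (tuple_measure (@lebesgue_measure R) 2) phi.
  exact: (mpres_comp (mpres_tuple2 lam) (mpres_tuple 2 (fun=> @mpres_lamV R))).
have stphi p : st (phi p) = p by rewrite /st /phi !tnth_mktuple; case: p.
rewrite E (mpres_RI hphi); last first.
  apply: measurableT_comp => //; apply: measurable_fun_pair; exact: measurable_tnth.
by apply: eq_RI => p; rewrite stphi.
Qed.

End kernel_of_tuples.

(** * Products of two mollified noises *)

Section noise_products.
Context {R : realType} {d : nat}.
Variables (gamma : 'rV[R]_d -> R) (mu : {measure set 'rV[R]_d -> \bar R}).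
Hypothesis hn : noise_covariance gamma mu.
Context (dO : measure_display) (Omega : measurableType dO) (P : probability Omega R).
Variables (H : completeNormedModType R) (iota : ('rV[R]_d -> R) -> H).
Variables (W : H -> Omega -> R) (dW : R -> 'rV[R]_d -> Omega -> R).
Hypotheses (hi : is_completion gamma iota) (hW : isonormal P W).
Hypothesis hdW : mollified_noise P gamma iota W dW.

Let V := 'rV[R]_d.

Lemma centered_gaussian_ae (X Y : Omega -> R) : measurable_fun setT X ->
  {ae P, forall w, X w = Y w} -> centered_gaussian P Y -> centered_gaussian P X.
Proof.
move=> mX XY [mY h]; split=> //; case: h => [h|[s s0 h]].
  by left; apply: filterS2 XY h => w -> ->.
right; exists s => // A mA; rewrite -h//.
have mXA : measurable (X @^-1` A) by rewrite -[X in measurable X]setTI; exact: mX.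
have mYA : measurable (Y @^-1` A) by rewrite -[X in measurable X]setTI; exact: mY.
rewrite -[X @^-1` A]setIT -[Y @^-1` A]setIT -!integral_indic//.
apply: ae_eq_integral => //.
- by apply/measurable_EFinP; exact: measurable_indic.
- by apply/measurable_EFinP; exact: measurable_indic.
apply: filterS XY => w XY _.
have E : (w \in X @^-1` A) = (w \in Y @^-1` A) by rewrite -[LHS]/(X w \in A) XY.
by rewrite !indicE E.
Qed.

Lemma measurable_norm_lt (X : Omega -> R) (u : R) : measurable_fun setT X ->
  measurable [set w | `|X w| < u].
Proof.
move=> mX; have m : measurable_fun setT (fun w => `|X w|) by exact: measurableT_comp.
have := m measurableT _ (measurable_itv `]-oo, u[).
by rewrite setTI (_ : _ @^-1` _ = [set w | `|X w| < u]).
Qed.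

Lemma gaussian_dW e x : 0 < e -> centered_gaussian P (dW e x).
Proof.
move=> e0; have [h _ ae] := (hdW e0).2 x.
exact: centered_gaussian_ae (measurable_dW hdW x e0) ae (isonormal_gaussian hW h).
Qed.

Section fixed_scale.
Variables (e : R) (e0 : 0 < e).
Let v := cov_kernel mu (e + e) 0.
Hypothesis v0 : 0 < v.
Let X (p : V * V) w := dW e p.1 w * dW e p.2 w.
Let c := (Num.sqrt v / 48) ^+ 2.

Let mdW x : measurable_fun setT (dW e x). Proof. exact: (measurable_dW hdW x e0). Qed.

Lemma variance_dW x : (\int[P]_w (dW e x w * dW e x w)%:E = v%:E)%E.
Proof. by rewrite (dW_covariance hn hi hW hdW x x e0 e0) subrr. Qed.

(** A small product has a small factor, and each factor is small with probability at most 1/8,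
    wherever it is taken, since [v] does not depend on the position. *)
Lemma product_dW_small (p : V * V) : (P [set w | `|X p w| < c]%R <= (4^-1)%:E)%E.
Proof.
have m x : measurable [set w | `|dW e x w| < Num.sqrt v / 48] by exact: measurable_norm_lt.
apply: (@le_trans _ _ (P ([set w | `|dW e p.1 w| < Num.sqrt v / 48] `|`
    [set w | `|dW e p.2 w| < Num.sqrt v / 48]))).
  apply: le_measure; rewrite ?inE.
  - by apply: measurable_norm_lt; exact: measurable_funM.
  - by apply: measurableU; exact: m.
  move=> w /=; have [h1|h1] := ltP `|dW e p.1 w| (Num.sqrt v / 48); first by left.
  have [h2|h2] := ltP `|dW e p.2 w| (Num.sqrt v / 48); first by right.
  rewrite ltNge /X normrM /c expr2 ler_pM//; by rewrite divr_ge0 ?sqrtr_ge0.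
apply: le_trans (measureU2 _ (m _) (m _)) _.
rewrite (_ : 4^-1 = 8^-1 + 8^-1 :> R); last by field.
rewrite EFinD; apply: leeD.
  exact: (gaussian_small_ball (gaussian_dW p.1 e0) v0 (variance_dW p.1)).
exact: (gaussian_small_ball (gaussian_dW p.2 e0) v0 (variance_dW p.2)).
Qed.

Lemma measurable_product_dW : measurable_fun setT (fun z : (V * V) * Omega => X z.1 z.2).
Proof.
have m := (hdW e0).1.
have mm (f : V * V -> V) : measurable_fun setT f ->
    measurable_fun setT (fun z : (V * V) * Omega => dW e (f z.1) z.2).
  move=> mf; apply: (measurableT_comp (f := fun z : V * Omega => dW e z.1 z.2) m
    (g := fun z : (V * V) * Omega => (f z.1, z.2))).
  by apply: measurable_fun_pair => //; exact: measurableT_comp.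
by apply: measurable_funM; apply: mm.
Qed.

Lemma L1_sqr_dW x : L1 P (fun w => dW e x w * dW e x w).
Proof.
apply/L1P; first exact: measurable_funM.
rewrite (eq_integral (fun w => (dW e x w * dW e x w)%:E)); first by rewrite variance_dW ltry.
by move=> w _; rewrite ger0_norm// -expr2 sqr_ge0.
Qed.

Lemma RI_sqr_dW x : \int[P]_w (dW e x w * dW e x w) = v.
Proof. by rewrite /Rintegral variance_dW. Qed.

Lemma L1_product_dW p : L1 P (X p) /\ \int[P]_w `|X p w| <= v.
Proof.
have mX : measurable_fun setT (X p) by exact: measurable_funM.
have S := L1Z 2^-1 (L1D (L1_sqr_dW p.1) (L1_sqr_dW p.2)).
have le w : `|X p w| <= 2^-1 * (dW e p.1 w * dW e p.1 w + dW e p.2 w * dW e p.2 w).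
  rewrite /X normrM; set x := dW _ _ _; set y := dW _ _ _.
  have := sqr_ge0 (`|x| - `|y|).
  have -> : x * x = `|x| ^+ 2 by rewrite real_normK ?num_real.
  have -> : y * y = `|y| ^+ 2 by rewrite real_normK ?num_real.
  by nra.
have LX : L1 P (X p) by exact: L1_le mX le S.
split=> //; apply: (le_trans (le_RI (L1_norm LX) S le)).
rewrite (RIZ _ (L1D (L1_sqr_dW p.1) (L1_sqr_dW p.2))) (RID (L1_sqr_dW p.1) (L1_sqr_dW p.2)).
by rewrite !RI_sqr_dW; lra.
Qed.

Lemma RI_product_dW p : \int[P]_w X p w = cov_kernel mu (e + e) (p.1 - p.2).
Proof. by rewrite /Rintegral /X (dW_covariance hn hi hW hdW p.1 p.2 e0 e0). Qed.

(** [L1_random] makes [f] integrable; as the mean of the modulus of [X p] is at most [v] for every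
    [p], Fubini's theorem then applies. *)
Lemma chaos_mean (f : V * V -> R) : measurable_fun setT f ->
  {ae P, forall w, L1 (leb \x leb)%E (fun p => f p * X p w)} ->
  L1 (leb \x leb)%E f /\
  \int[P]_w \int[(leb \x leb)%E]_p (f p * X p w) =
  \int[(leb \x leb)%E]_p (f p * cov_kernel mu (e + e) (p.1 - p.2)).
Proof.
move=> mf ae; have c0 : 0 < c by rewrite exprn_gt0// divr_gt0 ?sqrtr_gt0.
have L : L1 (leb \x leb)%E f.
  exact: (@L1_random _ _ R (prod_measure leb leb) _ _ P f X c mf c0 measurable_product_dW
    product_dW_small ae).
split=> //.
pose F (z : (V * V) * Omega) := f z.1 * X z.1 z.2.
have mF : measurable_fun setT F.
  by apply: measurable_funM; [exact: measurableT_comp|exact: measurable_product_dW].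
have LF : L1 (prod_measure leb leb \x P)%E F.
  apply: (@L1_prod_iter _ _ _ _ R (prod_measure leb leb) P F (fun p => `|f p| * v) mF).
  - by move=> p; exact: (L1Z (f p) (L1_product_dW p).1).
  - move=> p; have [LX hX] := L1_product_dW p.
    apply: (@le_trans _ _ (\int[P]_w (`|f p| * `|X p w|))).
      by rewrite le_eqVlt; apply/orP; left; apply/eqP; apply: eq_RI => w; rewrite normrM.
    by rewrite (RIZ _ (L1_norm LX)) ler_wpM2l.
  by apply: L1Zr; exact: L1_norm.
transitivity (\int[P]_w \int[prod_measure leb leb]_p F (p, w)); first reflexivity.
rewrite -(RI_fubini LF); apply: eq_RI => p.
by rewrite -RI_product_dW -(RIZ _ (L1_product_dW p).1).
Qed.

End fixed_scale.

End noise_products.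

(** * Means of limits in L^2 *)

Section mean_convergence.
Context {R : realType} (dO : measure_display) (Omega : measurableType dO).
Variable P : probability Omega R.

Lemma in_L2_L1 (X : Omega -> R) : in_L2 P X -> L1 P X.
Proof.
move=> [mX hX]; have L2 : L1 P (fun w => X w ^+ 2).
  apply/L1P; first exact: measurable_funX.
  by rewrite (eq_integral (fun w => (X w ^+ 2)%:E))// => w _; rewrite ger0_norm ?sqr_ge0.
have L1c : L1 P (fun=> 1).
  apply/L1P => //; rewrite (eq_integral (cst 1%E)); last by move=> w _; rewrite normr1.
  by rewrite integral_cst// mul1e (le_lt_trans (probability_le1 _ _))// ltry.
apply: L1_le mX _ (L1D L1c L2) => w.
have := sqr_ge0 (`|X w| - 1); rewrite -(real_normK (num_real (X w))).
by have := normr_ge0 (X w); nra.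
Qed.

(** As [|z| <= eps / 2 + z ^ 2 / (eps / 2)] for every [z], a second moment of the difference below
    [(eps / 2) ^ 2] suffices. *)
Lemma cvg_L2_mean (I : Type) (F : set_system I) (X : I -> Omega -> R) (Y : Omega -> R) :
  Filter F -> cvg_L2 P F X Y -> \int[P]_w X i w @[i --> F] --> \int[P]_w Y w.
Proof.
move=> FF [hY hX hXY]; apply/cvgrPdist_le => eps eps0.
have e20 : 0 < eps / 2 by rewrite divr_gt0.
have /= h2 : \forall i \near F, (\int[P]_w ((X i w - Y w) ^+ 2)%:E < ((eps / 2) ^+ 2)%:E)%E.
  have : (0%E < ((eps / 2) ^+ 2)%:E)%E by rewrite lte_fin exprn_gt0.
  by move=> h0; exact: (hXY _ (open_ereal_lt' h0)).
near=> i.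
have LX : L1 P (X i) by apply: in_L2_L1; near: i.
have LY := in_L2_L1 hY.
have hi : (\int[P]_w ((X i w - Y w) ^+ 2)%:E < ((eps / 2) ^+ 2)%:E)%E by near: i.
have LD := L1B LY LX.
have L2 : L1 P (fun w => (X i w - Y w) ^+ 2).
  apply/L1P.
    by apply: measurable_funX; apply: measurable_funB; [exact: L1_measurable LX|exact: L1_measurable LY].
  rewrite (eq_integral (fun w => ((X i w - Y w) ^+ 2)%:E)); first by rewrite (lt_trans hi)// ltry.
  by move=> w _; rewrite ger0_norm ?sqr_ge0.
have L1c : L1 P (fun=> eps / 2).
  apply/L1P => //; rewrite (eq_integral (cst (eps / 2)%:E)); last by move=> w _; rewrite ger0_norm// ltW.
  by rewrite integral_cst// [X in (_ * X)%E]probability_setT mule1 ltry.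
have Lb := L1D L1c (L1Z (eps / 2)^-1 L2).
rewrite -(RIB LY LX).
have le w : `|Y w - X i w| <= eps / 2 + (eps / 2)^-1 * (X i w - Y w) ^+ 2.
  rewrite distrC; set z := X i w - Y w; rewrite -(real_normK (num_real z)).
  have [hz|hz] := leP `|z| (eps / 2).
    by apply: (le_trans hz); rewrite lerDl mulr_ge0 ?sqr_ge0// invr_ge0 ltW.
  apply: (@le_trans _ _ ((eps / 2)^-1 * `|z| ^+ 2)); last by rewrite lerDr ltW.
  by rewrite mulrC ler_pdivlMr// expr2 ler_wpM2l// ltW.
apply: le_trans (norm_RI_le (L1_measurable LD) le Lb) _.
rewrite (RID L1c (L1Z _ L2)) (RIZ _ L2).
have -> : \int[P]_w (eps / 2) = eps / 2.
  by rewrite /Rintegral integral_cst// [X in (_ * X)%E]probability_setT mule1.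
have : \int[P]_w ((X i w - Y w) ^+ 2) <= (eps / 2) ^+ 2.
  by rewrite -lee_fin (RI_EFin L2) ltW.
rewrite -(ler_pM2l (_ : 0 < (eps / 2)^-1)) ?invr_gt0//.
rewrite [X in _ <= X -> _](_ : _ = eps / 2); last by field; rewrite gt_eqF.
by move=> h; rewrite [leRHS](splitr eps) lerD.
Unshelve. all: by end_near. Qed.

End mean_convergence.

(** * From the second chaos to Dalang's condition *)

Section dalang.
Context {R : realType} {d : nat}.
Variables (gamma : 'rV[R]_d -> R) (mu : {measure set 'rV[R]_d -> \bar R}).
Hypothesis hn : noise_covariance gamma mu.
Variables a b r nu : R.
Hypotheses (ha : 0 < a <= 2) (hb : 0 < b <= 2) (hr : 0 <= r) (hnu : 0 < nu).
Variables (T : R) (T0 : 0 < T).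

Let b0 : 0 < b. Proof. by case/andP : hb. Qed.
Let a0 : 0 < a. Proof. by case/andP : ha. Qed.
Let br0 : 0 < b + r. Proof. by rewrite ltr_pwDl. Qed.
Let q0 : 0 < 2 * (b + r) + 1. Proof. by rewrite addr_gt0// mulr_gt0. Qed.
Let V := 'rV[R]_d.

Let F (eta : V) : R := EE b (freq a nu eta) (2 * (b + r) + 1) T.
Let B : R := 2 * kk (2 * (b + r) + 1) T.

Let F_le eta : `|F eta| <= B.
Proof.
apply: EE_bound => //; first exact: freq_ge0.
by apply: ltW; move: hr b0; lra.
Qed.

Let mF : measurable_fun setT F.
Proof. by apply: (measurable_EE2 b0 q0); [exact: measurable_freq|exact: measurable_cst]. Qed.

Let kap (n : nat) : R := n.+1%:R^-1.

Let kap_gt0 n : 0 < kap n. Proof. by rewrite invr_gt0 ltr0n. Qed.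

Let kap_cvg0 : kap @ \oo --> 0. Proof. exact: cvg_harmonic. Qed.

Let kap_at_right : kap @ \oo --> 0^'+.
Proof.
move=> A [u /= u0 hA]; have hu : \forall n \near \oo, `|0 - kap n| < u.
    by apply: (cvgrPdist_lt _ _).1 kap_cvg0 u u0.
by apply: filterS hu => n hu; apply: hA => //=; exact: kap_gt0.
Qed.

Let L1_spectral e : 0 < e -> L1 mu (fun eta => ghat e eta * F eta).
Proof.
move=> e0; apply: L1_le (L1Z B (L1_mu_ghat hn e0)).
  by apply: measurable_funM => //; exact: measurable_ghat.
by move=> eta; rewrite normrM (ger0_norm (ghat_ge0 e eta)) mulrC; exact: (ler_wpM2r (ghat_ge0 e eta)).
Qed.

Lemma measurable_dalang : measurable_fun setT (fun eta : V => (1 + enorm eta `^ a)^-1).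
Proof.
have m : measurable_fun setT (fun eta : V => 1 + enorm eta `^ a).
  apply: measurable_funD => //.
  exact: (measurableT_comp (measurable_powR a) (@measurable_enorm R d)).
have := measurableT_comp (measurable_powR (-1)) m.
congr measurable_fun; apply/funext => eta /=.
by rewrite powR_inv1// addr_ge0 ?powR_ge0.
Qed.

Section noise.
Context (dO : measure_display) (Omega : measurableType dO) (P : probability Omega R).
Variables (H : completeNormedModType R) (iota : ('rV[R]_d -> R) -> H).
Variables (W : H -> Omega -> R) (dW : R -> 'rV[R]_d -> Omega -> R).
Hypotheses (hi : is_completion gamma iota) (hW : isonormal P W).
Hypothesis hdW : mollified_noise P gamma iota W dW.
Variable G : R -> ('rV[R]_d -> R) -> R.
Hypothesis hG : fundamental_solution a b r nu G.
Hypothesis cov_gt0 : forall e, 0 < e -> 0 < cov_kernel mu (e + e) 0.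

Let chaos e del w (xs : 2.-tuple V) : R :=
  @kernel_mol R d G 2 T 0 del xs * \prod_(k < 2) dW ((const_mx e : 'rV[R]_2) ord0 k) (tnth xs k) w.

Let chaosE e del w (x1 x2 : V) : 0 < del -> chaos e del w [tuple x1; x2] =
  kernel2 a b r nu T del (x1, x2) * (dW e x1 w * dW e x2 w).
Proof.
move=> del0; rewrite /chaos (kernel_mol2 hb hr T hG del0).
by rewrite !big_ord_recl big_ord0 mulr1 !mxE.
Qed.

Let measurable_chaos e del w : 0 < e -> 0 < del -> measurable_fun setT (chaos e del w).
Proof.
move=> e0 del0.
have mdW : measurable_fun setT (fun x : V => dW e x w).
  exact: (measurableT_comp (hdW e0).1 (pair2_measurable w)).
rewrite (_ : chaos e del w = fun xs => kernel2 a b r nu T del (tnth xs ord0, tnth xs ord_max) *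
    \prod_(k < 2) dW e (tnth xs k) w); last first.
  apply/funext => xs; rewrite /chaos (kernel_mol2 hb hr T hG del0); congr (_ * _).
  by apply: eq_bigr => k _; rewrite mxE.
apply: measurable_funM.
  apply: (measurableT_comp (measurable_kernel2 a nu hb hr T del)).
  by apply: measurable_fun_pair; exact: measurable_tnth.
apply: measurable_prod => k _.
exact: (measurableT_comp (f := fun x : V => dW e x w) mdW (measurable_tnth k)).
Qed.

Lemma chaos_expectation e del : 0 < e -> 0 < del ->
  {ae P, forall w, L1 (tuple_measure leb 2) (chaos e del w)} ->
  \int[P]_w \int[tuple_measure leb 2]_xs chaos e del w xs =
  \int[mu]_eta (ghat del eta * ghat (e + e) eta * F eta).
Proof.
move=> e0 del0 ae.
have hm := mpres_tuple2 (leb : {sigma_finite_measure set V -> \bar R}).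
have ae2 : {ae P, forall w, L1 (leb \x leb)%E (fun p : V * V =>
    kernel2 a b r nu T del p * (dW e p.1 w * dW e p.2 w))}.
  apply: filterS ae => w /(mpres_L1 hm (measurable_chaos w e0 del0)).1.
  by congr L1; apply/funext => -[x1 x2]; rewrite /= chaosE.
have [L E] := chaos_mean hn hi hW hdW e0 (cov_gt0 e0) (measurable_kernel2 a nu hb hr T del) ae2.
have ee0 : 0 < e + e by rewrite addr_gt0.
rewrite -(second_moment_spectral hn ha hb hr hnu ee0 del0 L) -E.
apply: eq_RI => w; rewrite (mpres_RI hm (measurable_chaos w e0 del0)).
by apply: eq_RI => -[x1 x2]; rewrite chaosE.
Qed.

(** The limits are iterated: [del] tends to 0 at fixed scales, then both scales tend to 0 together
    along [1 / (n + 1)]. The variances of the two noises add up, hence [kap n + kap n]. *)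
Lemma stratonovich2_mean Z :
  multiple_stratonovich_integral P dW (@kernel_mol R d G 2 T 0) Z ->
  \int[mu]_eta (ghat (kap n + kap n) eta * F eta) @[n --> \oo] --> \int[P]_w Z w.
Proof.
move=> [I [hI cI]].
pose ep (e : R) : 'rV[R]_2 := const_mx e.
have ep0 e : 0 < e -> forall k, 0 < ep e ord0 k by move=> e0 k; rewrite mxE.
have mean e : 0 < e -> \int[P]_w I (ep e) w = \int[mu]_eta (ghat (e + e) eta * F eta).
  move=> e0; have [hae hc] := hI (ep e) (ep0 e e0).
  have c1 := cvg_comp _ _ kap_at_right (cvg_L2_mean _ hc).
  have ee0 : 0 < e + e by rewrite addr_gt0.
  have c2 : \int[mu]_eta (ghat (kap n) eta * ghat (e + e) eta * F eta) @[n --> \oo] -->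
      \int[mu]_eta (ghat (e + e) eta * F eta).
    have h n eta : `|ghat (kap n) eta * ghat (e + e) eta * F eta| <= B * ghat (e + e) eta.
      rewrite normrM [leLHS]mulrC; apply: ler_pM => //.
      rewrite ger0_norm ?mulr_ge0 ?ghat_ge0// ler_piMl ?ghat_ge0// ghat_le1// ltW//.
    apply: (RI_dct (m := mu) _ _ h (L1Z B (L1_mu_ghat hn ee0))).2.
      by move=> n; do 2 (apply: measurable_funM => //; try exact: measurable_ghat).
    move=> eta; apply: cvgM; last exact: cvg_cst.
    rewrite -[X in _ --> X]mul1r; apply: cvgM; last exact: cvg_cst.
    by rewrite -(ghat0e eta); exact: ghat_cvg.
  have E n : \int[P]_w \int[tuple_measure leb 2]_xs chaos e (kap n) w xs =
      \int[mu]_eta (ghat (kap n) eta * ghat (e + e) eta * F eta).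
    by apply: chaos_expectation => //; exact: hae.
  have c3 : \int[mu]_eta (ghat (kap n) eta * ghat (e + e) eta * F eta) @[n --> \oo] -->
      \int[P]_w I (ep e) w.
    by under eq_fun do rewrite -E; exact: c1.
  by have := cvg_unique _ c3 c2; apply; exact: Rhausdorff.
have cep : (ep \o kap) @ \oo --> within [set eps : 'rV[R]_2 | forall k, 0 < eps ord0 k]
    (nbhs (0 : 'rV[R]_2)).
  move=> A /nbhs_ballP[u /= u0 hA]; have hu : \forall n \near \oo, `|0 - kap n| < u.
    by apply: (cvgrPdist_lt _ _).1 kap_cvg0 u u0.
  apply: filterS hu => n hu; apply: hA => /=; last exact: ep0.
  by split => // i j; rewrite !mxE; exact: hu.
have cZ : \int[P]_w I (ep (kap n)) w @[n --> \oo] --> \int[P]_w Z w.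
  exact: (cvg_comp _ _ cep (cvg_L2_mean _ cI)).
by apply: cvg_trans cZ; apply: near_eq_cvg; apply: nearW => n /=; rewrite mean.
Qed.

End noise.

(** A positive function with integral 0 forces [mu] to vanish. *)
Lemma cov_kernel0_dalang e : 0 < e -> cov_kernel mu e 0 = 0 -> dalang_condition a mu.
Proof.
move=> e0 c0; have L := L1_mu_ghat hn e0.
have ae : ae_eq mu setT (EFin \o @ghat R d e) (cst 0%E).
  apply: (ae_eq_integral_abs mu measurableT _).1.
    by apply/measurable_EFinP; exact: measurable_ghat.
  rewrite (eq_integral (fun eta => (ghat e eta)%:E)); last first.
    by move=> eta _; rewrite /= ger0_norm ?ghat_ge0.
  by rewrite -(RI_EFin L) -cov_kernel0 c0.
rewrite /dalang_condition (ae_eq_integral (cst 0%E)) ?integral0//.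
  apply/measurable_EFinP; apply: measurable_funTS; exact: measurable_dalang.
apply: filterS ae => eta /(_ Logic.I) [] /eqP; rewrite gt_eqF//.
Transparent ghat.
exact: expR_gt0.
Opaque ghat.
Qed.

(** Compares low frequencies, on which [EE_lower] is silent, with an integrable Gaussian. *)
Lemma enorm_powR_bound (K : R) : 0 < K -> exists2 C : R, 0 < C &
  forall eta : V, enorm eta `^ a < K -> 1 <= C * ghat 1 eta.
Proof.
move=> K0; pose M := K `^ a^-1.
have Ma : M `^ a = K by rewrite -powRrM mulVf ?gt_eqF// powRr1// ltW.
exists (expR (M * M / 2)) => [|eta he]; first exact: expR_gt0.
Transparent ghat.
rewrite /ghat -expRD -[leLHS]expR0 ler_expR mul1r subr_ge0.
Opaque ghat.
have hM : enorm eta <= M.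
  rewrite leNgt; apply/negP => hM; move: he; rewrite -Ma ltNge; apply/negP; rewrite negbK.
  by apply: ge0_ler_powR; rewrite ?nnegrE ?enorm_ge0 ?powR_ge0// ltW.
by rewrite ler_wpM2r// -enorm_sqr; apply: ler_pM => //; exact: enorm_ge0.
Qed.

Lemma bounded_means_dalang (l : R) :
  \int[mu]_eta (ghat (kap n + kap n) eta * F eta) @[n --> \oo] --> l ->
  dalang_condition a mu.
Proof.
move=> cl; have [c [K [c0 K0 hF]]] := EE_lower hb hr T0.
(* [K' <= |eta|^a] amounts to [K <= freq a nu eta], the range of [EE_lower]. *)
pose K' := 2 * K / nu; have K'0 : 0 < K' by rewrite divr_gt0 ?mulr_gt0.
have [C C0 hC] := enorm_powR_bound K'0.
pose hi (eta : V) : bool := K' <= enorm eta `^ a.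
have hiF eta : hi eta -> c <= freq a nu eta * F eta.
  rewrite /hi /K' => h; apply: hF; move: h; rewrite ler_pdivrMr// /freq => h.
  by rewrite mulrAC ler_pdivlMr// mulrC (mulrC nu).
have f0 eta : hi eta -> 0 < freq a nu eta.
  by move=> h; rewrite mulr_gt0 ?divr_gt0//; exact: lt_le_trans h.
have hiF0 eta : hi eta -> 0 <= F eta.
  by move=> h; rewrite -(pmulr_rge0 _ (f0 _ h)) (le_trans (ltW c0))// hiF.
have mhi : measurable_fun setT hi.
  by apply: measurable_fun_ler => //; exact: (measurableT_comp (measurable_powR a) measurable_enorm).
have B0 : 0 <= B by rewrite mulr_ge0// kk_ge0.
have L1g : L1 mu (fun eta => C * ghat 1 eta) by exact: L1Z (L1_mu_ghat hn ltr01).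
(* Fatou's lemma asks for nonnegative functions, and the sign of [F] is known at high frequencies
   only. *)
pose f n eta := if hi eta then ghat (kap n + kap n) eta * F eta else 0.
have kk0 n : 0 < kap n + kap n by rewrite addr_gt0.
have mf n : measurable_fun setT (f n).
  apply: measurable_fun_ifT => //; apply: measurable_funM => //; exact: measurable_ghat.
(* Discarding a low frequency costs at most [B], which the integrable Gaussian term covers. *)
have f_le n eta : f n eta <= ghat (kap n + kap n) eta * F eta + B * (C * ghat 1 eta).
  have D0 : 0 <= B * (C * ghat 1 eta) by apply: mulr_ge0 => //; apply: mulr_ge0; [exact: ltW|exact: ghat_ge0].
  rewrite /f; case: ifPn => h; first by rewrite lerDl.
  have h1 : 1 <= C * ghat 1 eta by apply: hC; rewrite ltNge.
  have : `|ghat (kap n + kap n) eta * F eta| <= B.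
    rewrite normrM -[leRHS]mul1r; apply: ler_pM => //.
    by rewrite ger0_norm ?ghat_ge0// ghat_le1// ltW.
  move=> /ler_normlP[h2 _]; have : B <= B * (C * ghat 1 eta) by rewrite ler_peMr.
  by lra.
have [M hM] : exists M, forall n, \int[mu]_eta (ghat (kap n + kap n) eta * F eta) <= M.
  have /cvg_seq_bounded [M [Mr hM]] : cvgn (fun n => \int[mu]_eta (ghat (kap n + kap n) eta * F eta)).
    by apply/cvg_ex; exists l.
  by exists (M + 1) => n; apply: le_trans (ler_norm _) _; apply: hM => //; rewrite ltrDl.
have Lf := L1_fatou (f := fun eta => if hi eta then F eta else 0)
  (C := M + B * \int[mu]_eta (C * ghat 1 eta)) mf.
have [Lfoo _] : L1 mu (fun eta => if hi eta then F eta else 0) /\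
    (\int[mu]_eta (if hi eta then F eta else 0)%:E <= (M + B * \int[mu]_eta (C * ghat 1 eta))%:E)%E.
  apply: Lf => [n eta|eta|n].
  - by rewrite /f; case: ifPn => // h; rewrite mulr_ge0 ?ghat_ge0// hiF0.
  - rewrite /f; case: (hi eta); last exact: cvg_cst.
    rewrite -[X in _ --> X]mul1r; apply: cvgM; last exact: cvg_cst.
    rewrite -(ghat0e eta); apply: ghat_cvg; rewrite -[X in _ --> X]addr0.
    by apply: cvgD.
  have Ls := L1_spectral (kk0 n); have LD := L1D Ls (L1Z B L1g).
  have Lfn : L1 mu (f n).
    apply: L1_le (mf n) _ (L1D (L1_norm Ls) (L1Z B L1g)) => eta.
    rewrite ger0_norm; last by rewrite /f; case: ifPn => // h; rewrite mulr_ge0 ?ghat_ge0// hiF0.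
    by apply: le_trans (f_le n eta) _; rewrite lerD2r ler_norm.
  rewrite -(RI_EFin Lfn) lee_fin; apply: le_trans (le_RI Lfn LD (f_le n)) _.
  by rewrite (RID Ls (L1Z B L1g)) (RIZ _ L1g) lerD2r.
(* From [c <= (nu / 2) |eta|^a F], the integrand of Dalang's condition is at most [D F] at high
   frequencies. *)
pose D := nu / (2 * c).
have LB := L1D (L1Z D Lfoo) L1g.
rewrite /dalang_condition.
have D0 : 0 <= D by rewrite divr_ge0 ?mulr_ge0 ?ltW.
have dal_ge0 eta : 0 <= (1 + enorm eta `^ a)^-1 :> R by rewrite invr_ge0 addr_ge0 ?powR_ge0.
have Ld : L1 mu (fun eta : V => (1 + enorm eta `^ a)^-1).
  apply: L1_le measurable_dalang _ LB => eta; rewrite ger0_norm//.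
  have p0 : 0 <= enorm eta `^ a by exact: powR_ge0.
  have p1 : 0 < 1 + enorm eta `^ a by rewrite ltr_pwDl.
  case: ifPn => h; last first.
    have h1 : 1 <= C * ghat 1 eta by apply: hC; rewrite ltNge.
    by rewrite mulr0 add0r (le_trans _ h1)// invf_le1// lerDl.
  apply: (@le_trans _ _ (D * F eta)); last by rewrite lerDl mulr_ge0 ?ghat_ge0 ?ltW.
  have := hiF _ h; rewrite /freq; set p := enorm eta `^ a; rewrite -/p in p0 p1 *.
  have Fe := hiF0 _ h; move: (F eta) Fe => y y0 hy.
  rewrite -[leLHS]mul1r ler_pdivrMr// /D.
  rewrite [leRHS](_ : _ = nu * y * (1 + p) / (2 * c)); last by ring.
  rewrite ler_pdivlMr ?mulr_gt0// mul1r; have : 0 <= nu * y := mulr_ge0 (ltW hnu) y0.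
  by move: hy; nra.
have := (L1P _ measurable_dalang).1 Ld.
by rewrite (eq_integral (fun eta : V => ((1 + enorm eta `^ a)^-1)%:E))// => eta _; rewrite ger0_norm.
Qed.

End dalang.

Theorem theorem1p6 (R : realType) (d : nat) (a b r theta nu : R)
  (gamma : 'rV[R]_d -> R) (mu : {measure set 'rV[R]_d -> \bar R})
  (dO : measure_display) (Omega : measurableType dO) (P : probability Omega R)
  (H : completeNormedModType R) (iota : ('rV[R]_d -> R) -> H)
  (W : H -> Omega -> R) (dW : R -> 'rV[R]_d -> Omega -> R)
  (G : R -> ('rV[R]_d -> R) -> R) :
  (1 <= d)%N ->
  0 < a <= 2 -> 0 < b <= 2 -> 0 <= r -> 0 < theta -> 0 < nu ->
  noise_covariance gamma mu ->
  is_completion gamma iota ->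
  isonormal P W ->
  mollified_noise P gamma iota W dW ->
  fundamental_solution a b r nu G ->
  assumption_G a b r G ->
  (exists (T : R) (u : R -> 'rV[R]_d -> Omega -> R),
    [/\ 0 < T,
        square_integrable_field P T u,
        mild_stratonovich_solution P dW G theta T u
      & has_stratonovich_expansion P dW G theta T u]) ->
  dalang_condition a mu.
Proof.
move=> _ ha hb hr _ nu0 hn hi hW hdW hG _ [T [u [T0 _ _ hu]]].
(* The small ball estimate needs a positive variance; if the variance vanishes at some scale, then
   so does [mu]. *)
have [[e [e0 c0]]|h] := pselect (exists e, 0 < e /\ cov_kernel mu (e + e) 0 = 0).
  by apply: (cov_kernel0_dalang hn _ _ c0); rewrite addr_gt0.
have cov_gt0 e : 0 < e -> 0 < cov_kernel mu (e + e) 0.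
  move=> e0; rewrite lt_neqAle; apply/andP; split.
    by apply/eqP => c0; apply: h; exists e.
  by rewrite cov_kernel0; apply: RI_ge0 => xi; exact: ghat_ge0.
have T0T : 0 < T <= T by rewrite T0 lexx.
have [S [_ hS _]] := hu T 0 T0T.
apply: (bounded_means_dalang (l := \int[P]_w S 2%N w) hn ha hb hr nu0 T0).
exact: (stratonovich2_mean hn ha hb hr nu0 hi hW hdW hG cov_gt0 (hS 2 isT)).
Qed.
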